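(* Let $\Lambda=\sqrt{\frac{\pi}{2}}(\mathbb{Z}+i\mathbb{Z})$, let $\sigma$ be the Weierstrass $\sigma$-function associated to $\Lambda$, and let $c=(c_\lambda)_{\lambda\in\Lambda}$ be a sequence of complex numbers. (1) There exists $f\in\mathcal{F}^1$ satisfying $f|\Lambda=c$ if and only if - $\sum_{\lambda\in\Lambda}|c_\lambda| e^{-|\lambda|^2}<+\infty$, - $\sum_{\lambda'\in\Lambda}\Bigl|\sum_{\lambda\in\Lambda_{\lambda'}}\frac{c_\lambda}{\sigma'(\lambda)(\lambda-\lambda')}\Bigr|<+\infty$, and - $\sum_{\lambda'\in\Lambda}\Bigl|\sum_{\lambda\in\Lambda_{\lambda'}}\frac{c_\lambda}{\sigma'(\lambda)(\lambda-\lambda')^2}\Bigr|<+\infty$. (2) Let $1<p<\infty$. There exists $f\in\mathcal{F}^p$ satisfying $f|\Lambda=c$ if and only if - $\sum_{\lambda\in\Lambda}|c_\lambda|^p e^{-p|\lambda|^2}<+\infty$, and - $\sum_{\lambda'\in\Lambda}\Bigl|\mathrm{p.v.}\sum_{\lambda\in\Lambda_{\lambda'}}\frac{c_\lambda}{\sigma'(\lambda)(\lambda-\lambda')}\Bigr|^p<+\infty$. (3) There exists $f\in\mathcal{F}^\infty$ satisfying $f|\Lambda=c$ if and only if - $\sup_{\lambda\in\Lambda}|c_\lambda| e^{-|\lambda|^2}<+\infty$, - $\sup_{\lambda'\in\Lambda_0}\Bigl|-\frac{c_0}{\sigma'(0)\lambda'}+\mathrm{p.v.}\sum_{\lambda\in\Lambda_{\lambda'}\setminus\{0\}}\frac{c_\lambda}{\sigma'(\lambda)}\Bigl(\frac{1}{\lambda-\lambda'}-\frac{1}{\lambda}\Bigr)\Bigr|<+\infty$,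 and - $\sup_{\lambda'\in\Lambda}\Bigl|\mathrm{p.v.}\sum_{\lambda\in\Lambda_{\lambda'}}\frac{c_\lambda}{\sigma'(\lambda)(\lambda-\lambda')^2}\Bigr|<+\infty$.
   Context: $H(\mathbb{C})$ denotes the entire functions and $m$ is Lebesgue measure on the plane. The classical Bargmann-Fock spaces are $$\mathcal{F}^p=\Bigl\{f\in H(\mathbb{C}):\int_{\mathbb{C}}|f(z)|^pe^{-p|z|^2}\,dm(z)<+\infty\Bigr\}\quad(1\le p<\infty),$$ $$\mathcal{F}^\infty=\Bigl\{f\in H(\mathbb{C}):\sup_{z\in\mathbb{C}}|f(z)|e^{-|z|^2}<+\infty\Bigr\}.$$ $f|\Lambda=c$ means $f(\lambda)=c_\lambda$ for all $\lambda\in\Lambda$. For $\lambda\in\Lambda$, $\Lambda_\lambda=\Lambda\setminus\{\lambda\}$; in particular $\Lambda_0=\Lambda\setminus\{0\}$. The Weierstrass $\sigma$-function associated to $\Lambda$ is $$\sigma(z)=z\prod_{\lambda\in\Lambda_0}\Bigl(1-\frac{z}{\lambda}\Bigr)e^{\frac{z}{\lambda}+\frac12\frac{z^2}{\lambda^2}},$$ whose zero set is $\Lambda$. The principal value of a sum over a subset $S\subseteq\Lambda$ is $\mathrm{p.v.}\sum_{\lambda\in S}a_\lambda=\lim_{R\to\infty}\sum_{\lambda\in S,\,|\lambda|<R}a_\lambda$; a condition involving such principal values is understood to include the existence of these limits. *)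

(* Defs.v *)
From mathcomp Require Import all_boot all_order all_algebra.
From mathcomp Require Import finmap complex.
From mathcomp Require Import all_classical all_reals all_analysis.
From mathcomp Require showcase.summability.

Set Implicit Arguments.
Unset Strict Implicit.
Unset Printing Implicit Defensive.

Import Order.TTheory GRing.Theory Num.Theory.
Import numFieldNormedType.Exports.

Local Open Scope classical_set_scope.
Local Open Scope ring_scope.
Local Open Scope complex_scope.

(* The plane, as a normed space over itself: [R[i]] alone carries no topology,
   its regular module [R[i]^o] does.  Consequently [derivable f z 1] and
   [derive1 f z] are complex differentiability and the complex derivative. *)
Notation Cplx R := (R[i]^o) (only parsing).

(* Real-valued modulus; the generic norm [`|z|] takes its values in [R[i]]. *)
Definition cabs (R : realType) (z : Cplx R) : R := ComplexField.Normc.normc z.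

Definition cexp (R : realType) (z : Cplx R) : Cplx R :=
  (expR (complex.Re z))%:C
    * (cos (complex.Im z) +i* sin (complex.Im z)).

Definition entire (R : realType) (f : Cplx R -> Cplx R) : Prop :=
  forall z : Cplx R, derivable f z 1.

Definition fock (R : realType) (p : R) (f : Cplx R -> Cplx R) : Prop :=
  entire f /\
  (\int[@lebesgue_measure R \x @lebesgue_measure R]_(w in [set: R * R])
     (cabs (f (w.1 +i* w.2)) `^ p
        * expR (- (p * cabs (w.1 +i* w.2) ^+ 2)))%:E < +oo)%E.

Definition fock_infty (R : realType) (f : Cplx R -> Cplx R) : Prop :=
  entire f /\
  (ereal_sup [set (cabs (f z) * expR (- cabs z ^+ 2))%:E | z in [set: Cplx R]]
     < +oo)%E.

(* Unordered sums and products over a set of complex numbers: limits along the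
   net of finite sets [F], ordered by inclusion, of the operation over
   [F `&` S]. *)
Definition usum_partial (R : realType) (S : set (Cplx R))
    (a : Cplx R -> Cplx R) (F : {fset (Cplx R)}) : Cplx R :=
  \sum_(l <- F | l \in S) a l.

Definition usum_cvg (R : realType) (S : set (Cplx R)) (a : Cplx R -> Cplx R) :=
  cvg (usum_partial S a F @[F --> summability.totally]).

Definition usum (R : realType) (S : set (Cplx R)) (a : Cplx R -> Cplx R) :
    Cplx R :=
  lim (usum_partial S a F @[F --> summability.totally]).

Definition uprod_partial (R : realType) (S : set (Cplx R))
    (a : Cplx R -> Cplx R) (F : {fset (Cplx R)}) : Cplx R :=
  \prod_(l <- F | l \in S) a l.

Definition uprod (R : realType) (S : set (Cplx R)) (a : Cplx R -> Cplx R) :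
    Cplx R :=
  lim (uprod_partial S a F @[F --> summability.totally]).

(* [\sum_(l \in A)] is a genuine finite sum when [A] is finite, which is the
   case here as soon as [S] is locally finite. *)
Definition pv_partial (R : realType) (S : set (Cplx R))
    (a : Cplx R -> Cplx R) (r : R) : Cplx R :=
  \sum_(l \in S `&` [set l | cabs l < r]) a l.

Definition pv_cvg (R : realType) (S : set (Cplx R)) (a : Cplx R -> Cplx R) :=
  cvg (pv_partial S a r @[r --> +oo]).

Definition pvsum (R : realType) (S : set (Cplx R)) (a : Cplx R -> Cplx R) :
    Cplx R :=
  lim (pv_partial S a r @[r --> +oo]).

Definition Lambda (R : realType) : set (Cplx R) :=
  [set l | exists m n : int,
     l = (Num.sqrt (pi / 2))%:C * (m%:~R +i* n%:~R)].

Definition LambdaD (R : realType) (l' : Cplx R) : set (Cplx R) :=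
  @Lambda R `\ l'.

Definition weierstrass_sigma (R : realType) (L : set (Cplx R)) (z : Cplx R) :
    Cplx R :=
  z * uprod (L `\ 0)
        (fun l => (1 - z / l) * cexp (z / l + 2^-1 * (z ^+ 2 / l ^+ 2))).

Definition sigma (R : realType) : Cplx R -> Cplx R :=
  weierstrass_sigma (@Lambda R).

(* Main.v *)
Require Import Defs.
From mathcomp Require Import all_boot all_order all_algebra.
From mathcomp Require Import finmap complex ring lra zify.
From mathcomp Require Import all_classical all_reals all_analysis measurable_realfun.

Set Implicit Arguments.
Unset Strict Implicit.
Unset Printing Implicit Defensive.

Import Order.TTheory GRing.Theory Num.Theory.
Import numFieldNormedType.Exports.

Local Open Scope classical_set_scope.
Local Open Scope ring_scope.
Local Open Scope complex_scope.

(** * The real-valued modulus *)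

Section Modulus.
Variable R : realType.
Local Notation C := (R[i]^o).
Implicit Types (x y z : C) (t : R).

(** Put [a l = c l / sigma'(l)]. The function |sigma(z)| exp(-|z|^2) is periodic under the lattice,
    so |sigma'(l)| = exp(|l|^2), and the size condition on [c] says that [a] lies in l^p. Both
    directions compare f / sigma with the Cauchy sums of [a], truncated to discs.

    Sufficiency. The function is the Lagrange series: f(z) = -sigma(z) times the limit of the
    truncated sums of a_l / (l - z), from which the sums of a_l / l are subtracted when p is
    infinite. In the cell of l' write z = l' + w and x = l - l', and expand 1/(x - w) = 1/x + w/x^2
    + w^2/(x^2 (x - w)). The first term sums to the discrete Hilbert transform [Lm l'] of the
    hypothesis. Up to O(|x|^-3), 1/x^2 is a central difference of 1/x with a lattice step, so the
    second (Beurling) sum is a combination of [Lm] at two neighbours of l' and an absolutely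
    convergent sum ([beurling_cvg]). Everything in the cell is then dominated by the convolution of
    |a| + |Lm| with the summable kernel |x|^-3 ([interpolation]). This convolution preserves l^p
    ([kern_convolution]) and boundedness, and cellwise bounds integrate to a Fock norm
    ([fock_of_bound]).

    Necessity. [fock_bound] turns membership in F^p into an l^p sequence [b] that bounds |f|
    exp(-|z|^2) on each cell; the tool is Cauchy's formula on rectangles whose sides are chosen by
    Tonelli's theorem to carry small line integrals ([local_mean]). Next, integrate k f / sigma
    around all cells centred in a disc: interior edges cancel, the decay of k kills the rim, and the
    residues give the sum of a_l k(l) over the cells free of poles of k as a contour integral around
    the remaining cells ([contour_limit]). With k(w) = 1/(w - l') the Hilbert transform at l'
    becomes one local integral, bounded by a multiple of [b l'] ([pv_cauchy]); for p infinite, k(w)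
    = 1/(w - l') - 1/w ([pv_cauchy_diff]). The Beurling sums are again bounded through
    [beurling_cvg].

    Facts on sigma. Grouping the factors in orbits of quarter turns gives sigma(z) = z times the
    product of 1 - z^4 / l^4 over a quarter of the lattice. Shifting a finite box product by one
    lattice step exchanges one column for another, and the quotient of these columns tends to an
    exponential by a Riemann sum for arctan ([column_limit]). The lattice side sqrt(pi/2) yields
    exactly sigma(z + l) = e exp(2 conj(l) z + |l|^2) sigma(z) with |e| = 1. *)

Lemma normcE' z : `|z| = (cabs z)%:C.
Proof. by []. Qed.

Lemma cabsE (a b : R) : cabs (a +i* b : C) = Num.sqrt (a ^+ 2 + b ^+ 2).
Proof. by []. Qed.

Lemma cabs0 : cabs (0 : C) = 0.
Proof. exact: ComplexField.Normc.normc0. Qed.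

Lemma cabs1 : cabs (1 : C) = 1.
Proof. exact: ComplexField.Normc.normc1. Qed.

Lemma cabs_ge0 z : 0 <= cabs z.
Proof. by case: z => a b; exact: sqrtr_ge0. Qed.

Lemma cabs_eq0 z : (cabs z == 0) = (z == 0).
Proof.
apply/eqP/eqP => [|->]; [exact: ComplexField.Normc.eq0_normc|exact: cabs0].
Qed.

Lemma cabs_gt0 z : (0 < cabs z) = (z != 0).
Proof. by rewrite lt_def cabs_ge0 cabs_eq0 andbT. Qed.

Lemma cabsM x y : cabs (x * y) = cabs x * cabs y.
Proof. exact: ComplexField.Normc.normcM. Qed.

Lemma cabsV x : cabs x^-1 = (cabs x)^-1.
Proof. exact: ComplexField.Normc.normcV. Qed.

Lemma cabsX x n : cabs (x ^+ n) = cabs x ^+ n.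
Proof. by elim: n => [|n IH]; rewrite ?expr0 ?cabs1// !exprS cabsM IH. Qed.

Lemma cabsN x : cabs (- x) = cabs x.
Proof. exact: normcN. Qed.

Lemma cabsC x y : cabs (x - y) = cabs (y - x).
Proof. by rewrite -cabsN opprB. Qed.

Lemma cabsD x y : cabs (x + y) <= cabs x + cabs y.
Proof. exact: le_normcD. Qed.

Lemma cabsB x y : cabs (x - y) <= cabs x + cabs y.
Proof. by rewrite -[cabs y]cabsN; exact: cabsD. Qed.

Lemma cabs_ge_sub x y : cabs x - cabs y <= cabs (x - y).
Proof. by rewrite lerBlDr; have := cabsD (x - y) y; rewrite subrK. Qed.

Lemma cabs_sum (I : Type) (r : seq I) (P : pred I) (F : I -> C) :
  cabs (\sum_(i <- r | P i) F i) <= \sum_(i <- r | P i) cabs (F i).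
Proof.
elim/big_ind2: _ => [|x1 x2 y1 y2 h1 h2|i _]; rewrite ?cabs0//.
by apply: (le_trans (cabsD _ _)); exact: lerD.
Qed.

Lemma cabs_prod (I : Type) (r : seq I) (P : pred I) (F : I -> C) :
  cabs (\prod_(i <- r | P i) F i) = \prod_(i <- r | P i) cabs (F i).
Proof.
by elim/big_ind2: _ => [|x1 x2 y1 y2 <- <-|i _]; rewrite ?cabs1 ?cabsM.
Qed.

Lemma cabs_sqr z : cabs z ^+ 2 = complex.Re z ^+ 2 + complex.Im z ^+ 2.
Proof. by case: z => a b; rewrite cabsE sqr_sqrtr// addr_ge0// sqr_ge0. Qed.

Lemma cabs_real t : cabs (t%:C : C) = `|t|.
Proof. by rewrite cabsE expr0n addr0 sqrtr_sqr. Qed.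

Lemma cabs_i : cabs ('i : C) = 1.
Proof. by rewrite cabsE expr0n add0r expr1n sqrtr1. Qed.

Lemma ler_Re z : `|complex.Re z| <= cabs z.
Proof.
by rewrite -(@ler_pXn2r _ 2) ?nnegrE ?cabs_ge0// cabs_sqr real_normK ?num_real// lerDl sqr_ge0.
Qed.

Lemma ler_Im z : `|complex.Im z| <= cabs z.
Proof.
by rewrite -(@ler_pXn2r _ 2) ?nnegrE ?cabs_ge0// cabs_sqr real_normK ?num_real// lerDr sqr_ge0.
Qed.

Lemma cabs_le_ReIm z : cabs z <= `|complex.Re z| + `|complex.Im z|.
Proof.
rewrite -(@ler_pXn2r _ 2) ?nnegrE ?cabs_ge0 ?addr_ge0//.
rewrite cabs_sqr -[X in X + _]real_normK ?num_real// -[X in _ + X]real_normK ?num_real//.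
by rewrite sqrrD addrAC lerDl mulrn_wge0// mulr_ge0.
Qed.

Lemma cabs_conj z : cabs (z^*%C : C) = cabs z.
Proof. by case: z => a b; rewrite /cabs /= sqrrN. Qed.

Lemma ReD x y : complex.Re (x + y) = complex.Re x + complex.Re y.
Proof. by case: x => ? ?; case: y. Qed.

Lemma ImD x y : complex.Im (x + y) = complex.Im x + complex.Im y.
Proof. by case: x => ? ?; case: y. Qed.

Lemma ReN x : complex.Re (- x) = - complex.Re x.
Proof. by case: x. Qed.

Lemma ImN x : complex.Im (- x) = - complex.Im x.
Proof. by case: x. Qed.

Lemma ReM x y : complex.Re (x * y)
  = complex.Re x * complex.Re y - complex.Im x * complex.Im y.
Proof. by case: x => ? ?; case: y. Qed.

Lemma ImM x y : complex.Im (x * y)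
  = complex.Re x * complex.Im y + complex.Im x * complex.Re y.
Proof. by case: x => ? ?; case: y. Qed.

Lemma Re_sum (I : Type) (r : seq I) (P : pred I) (F : I -> C) :
  complex.Re (\sum_(i <- r | P i) F i) = \sum_(i <- r | P i) complex.Re (F i).
Proof. by elim/big_ind2: _ => // x1 x2 y1 y2 <- <-; rewrite ReD. Qed.

Lemma Im_sum (I : Type) (r : seq I) (P : pred I) (F : I -> C) :
  complex.Im (\sum_(i <- r | P i) F i) = \sum_(i <- r | P i) complex.Im (F i).
Proof. by elim/big_ind2: _ => // x1 x2 y1 y2 <- <-; rewrite ImD. Qed.

Lemma eq_complexP x y :
  complex.Re x = complex.Re y -> complex.Im x = complex.Im y -> x = y.
Proof. by case: x => ? ?; case: y => ? ? /= -> ->. Qed.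

End Modulus.

(** * Limits in the plane *)

Section Limits.
Variable R : realType.
Local Notation C := (R[i]^o).

(** The generic norm and its epsilons live in [R[i]], where being positive means being a positive
    real. All later limit arguments go through this form with a real [e]. *)
Lemma cvgCP (T : Type) (F : set_system T) {FF : Filter F} (f : T -> C) (l : C) :
  f @ F --> l <-> forall e : R, 0 < e -> \forall x \near F, cabs (f x - l) < e.
Proof.
split.
- move=> /cvgrPdist_lt H e e0.
  have e0' : 0 < (e%:C : R[i]) by rewrite ltcR.
  move: (H _ e0'); apply: filterS => x.
  by rewrite distrC normcE' ltcR.
- move=> H; apply/cvgrPdist_lt => e.
  rewrite ltcE /= => /andP[/eqP e0 e1].
  move: (H _ e1); apply: filterS => x.
  by rewrite distrC normcE' ltcE /= e0 eqxx.
Qed.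

Lemma nbhsCP (a : C) (P : set C) : (\forall z \near a, P z) <->
  exists2 d : R, 0 < d & forall z, cabs (z - a) < d -> P z.
Proof.
split.
- move=> /nbhs_normP [d /=]. rewrite ltcE /= => /andP[/eqP e0 e1] H.
  exists (complex.Re d) => // z zd; apply: H => /=.
  by rewrite distrC normcE' ltcE /= e0 eqxx.
- move=> [d d0 H]. apply/nbhs_normP; exists d%:C; rewrite /= ?ltcR // => z /=.
  by rewrite distrC normcE' ltcR; exact: H.
Qed.

Lemma dnbhsCP (a : C) (P : set C) : (\forall z \near a^', P z) <->
  exists2 d : R, 0 < d & forall z, z != a -> cabs (z - a) < d -> P z.
Proof.
rewrite /dnbhs/within /=; split.
  by move=> /nbhsCP [d d0 H]; exists d => // z za zd; apply: H.
by move=> [d d0 H]; apply/nbhsCP; exists d => // z /[swap] za; apply: H.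
Qed.

Lemma cvg_Re (T : Type) (F : set_system T) {FF : Filter F} (f : T -> C) (l : C) :
  f @ F --> l -> (fun x => complex.Re (f x)) @ F --> complex.Re l.
Proof.
move=> /cvgCP H; apply/cvgrPdist_lt => e /H; apply: filterS => x.
rewrite distrC; apply: le_lt_trans.
by rewrite -ReN -ReD; exact: ler_Re.
Qed.

Lemma cvg_Im (T : Type) (F : set_system T) {FF : Filter F} (f : T -> C) (l : C) :
  f @ F --> l -> (fun x => complex.Im (f x)) @ F --> complex.Im l.
Proof.
move=> /cvgCP H; apply/cvgrPdist_lt => e /H; apply: filterS => x.
rewrite distrC; apply: le_lt_trans.
by rewrite -ImN -ImD; exact: ler_Im.
Qed.

Lemma cvg_ReIm (T : Type) (F : set_system T) {FF : Filter F} (u v : T -> R) (a b : R) :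
  u @ F --> a -> v @ F --> b -> (fun x => (u x +i* v x : C)) @ F --> (a +i* b : C).
Proof.
move=> /cvgrPdist_lt Hu /cvgrPdist_lt Hv; apply/cvgCP => e e0.
have e2 : 0 < e / 2 by rewrite divr_gt0.
near=> x.
apply: (le_lt_trans (cabs_le_ReIm _)) => /=.
rewrite [e]splitr ltrD//; rewrite distrC; near: x; [exact: Hu|exact: Hv].
Unshelve. all: by end_near. Qed.

Lemma cvg_cabs (T : Type) (F : set_system T) {FF : Filter F} (f : T -> C) (l : C) :
  f @ F --> l -> (fun x => cabs (f x)) @ F --> cabs l.
Proof.
move=> /cvgCP H; apply/cvgrPdist_lt => e /H; apply: filterS => x.
apply: le_lt_trans.
rewrite ler_norml; apply/andP; split; last by rewrite cabsC cabs_ge_sub.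
by rewrite lerNl opprB cabs_ge_sub.
Qed.

Lemma cvgC_le (T : Type) (F : set_system T) {FF : ProperFilter F} (f : T -> C)
    (l : C) (K : R) :
  f @ F --> l -> (\forall x \near F, cabs (f x) <= K) -> cabs l <= K.
Proof.
move=> /cvg_cabs fl H.
exact: (cvgr_to_le fl H).
Qed.

Lemma cvgCD (T : Type) (F : set_system T) {FF : Filter F} (f g : T -> C) (a b : C) :
  f @ F --> a -> g @ F --> b -> (fun x => f x + g x) @ F --> a + b.
Proof. by move=> fa gb; exact: (cvgD fa gb). Qed.

Lemma cvgCB (T : Type) (F : set_system T) {FF : Filter F} (f g : T -> C) (a b : C) :
  f @ F --> a -> g @ F --> b -> (fun x => f x - g x) @ F --> a - b.
Proof. by move=> fa gb; exact: (cvgB fa gb). Qed.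

Lemma cvgCM (T : Type) (F : set_system T) {FF : Filter F} (f g : T -> C) (a b : C) :
  f @ F --> a -> g @ F --> b -> (fun x => f x * g x) @ F --> a * b.
Proof. by move=> fa gb; exact: (cvgM fa gb). Qed.

Lemma cvgCMl (T : Type) (F : set_system T) {FF : Filter F} (f : T -> C) (a b : C) :
  f @ F --> a -> (fun x => b * f x) @ F --> b * a.
Proof. by move=> fa; exact: (cvgCM (cvg_cst b) fa). Qed.

(* Completeness of the plane, stated along a filter. *)
Lemma cauchy_cvgC (T : Type) (F : set_system T) {FF : ProperFilter F} (f : T -> C) :
  (forall e : R, 0 < e -> exists l : C, \forall x \near F, cabs (f x - l) < e) ->
  exists l : C, f @ F --> l.
Proof.
move=> H.
have cR : cvg ((fun x => complex.Re (f x)) @ F).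
  apply: cauchy_cvg; apply: cauchy_exP => _/posnumP[e].
  have [l Hl] := H e%:num (gt0 _).
  exists (complex.Re l); move: Hl; apply: filterS => x xl /=.
  rewrite /ball/= distrC; apply: le_lt_trans xl.
  by rewrite -ReN -ReD; exact: ler_Re.
have cI : cvg ((fun x => complex.Im (f x)) @ F).
  apply: cauchy_cvg; apply: cauchy_exP => _/posnumP[e].
  have [l Hl] := H e%:num (gt0 _).
  exists (complex.Im l); move: Hl; apply: filterS => x xl /=.
  rewrite /ball/= distrC; apply: le_lt_trans xl.
  by rewrite -ImN -ImD; exact: ler_Im.
move: cR cI => /cvg_ex[a Ha] /cvg_ex[b Hb]; exists (a +i* b).
have E : (fun x => complex.Re (f x) +i* complex.Im (f x) : C) = f.
  by apply/funext => x; case: (f x).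
by rewrite -[f]E; exact: cvg_ReIm.
Qed.

End Limits.

Notation cder f z d := (is_derive (z : _[i]^o) (1 : _[i]^o) (f : _[i]^o -> _[i]^o) (d : _[i]^o)).

(** * Complex differentiability and its calculus *)

Section ComplexDerivative.
Variable R : realType.
Local Notation C := (R[i]^o).
Implicit Types (f g : C -> C) (z d : C).

(** Multiplying the difference quotient through by [h] removes the exclusion of [h = 0] and leaves
    an inequality between real numbers. *)
Lemma cderP f z d : cder f z d <->
  forall e : R, 0 < e -> exists2 del : R, 0 < del &
    forall h : C, cabs h < del -> cabs (f (z + h) - f z - d * h) <= e * cabs h.
Proof.
split.
  move=> [/cvg_ex [l H] E].
  have {}E : l = d by rewrite -E; apply/esym/cvg_lim.
  subst l => e e0. move/cvgCP: H => /(_ _ e0) /dnbhsCP [r r0 H].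
  exists r => // h hr.
  have [->|h0] := eqVneq h 0; first by rewrite addr0 mulr0 subrr subr0 cabs0 mulr0.
  have := H h h0; rewrite subr0 => /(_ hr) /ltW.
  rewrite -(@ler_pM2r _ (cabs h)) ?cabs_gt0// -cabsM.
  suff -> : (h^-1 *: ((f \o shift z) (h *: (1:C)) - f z) - d) * h = f (z + h) - f z - d * h by [].
  rewrite /= /GRing.scale /= mulr1 (addrC h z) mulrBl mulrAC mulVf// mul1r.
  by [].
move=> H.
have L : (fun h : C => h^-1 *: ((f \o shift z) (h *: (1:C)) - f z)) @ 0^' --> d.
  apply/cvgCP => e e0; apply/dnbhsCP.
  have e2 : 0 < e / 2 by rewrite divr_gt0.
  have [r r0 {}H] := H _ e2; exists r => // h h0; rewrite subr0 => hr.
  rewrite -(@ltr_pM2r _ (cabs h)) ?cabs_gt0// -cabsM.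
  suff -> : (h^-1 *: ((f \o shift z) (h *: (1:C)) - f z) - d) * h = f (z + h) - f z - d * h.
    apply: (le_lt_trans (H h hr)); rewrite ltr_pM2r ?cabs_gt0//.
    by rewrite ltr_pdivrMr// ltr_pMr// ltr1n.
  by rewrite /= /GRing.scale /= mulr1 (addrC h z) mulrBl mulrAC mulVf// mul1r.
by split; [apply/cvg_ex; exists d|exact/cvg_lim].
Qed.

Lemma cder_derivable f z d : cder f z d -> derivable f z 1.
Proof. by case. Qed.

Lemma derivable_cder f z : derivable f z 1 -> exists d, cder f z d.
Proof. by move=> fz; exists ('D_1 f z); apply: derivableP. Qed.

Lemma cder_derive1 f z d : cder f z d -> derive1 f z = d.
Proof. by move=> H; rewrite derive1E; apply: derive_val. Qed.

Lemma cder_near f g z d (r : R) : 0 < r ->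
  (forall w : C, cabs (w - z) < r -> f w = g w) -> cder g z d -> cder f z d.
Proof.
move=> r0 E /cderP H; apply/cderP => e /H [s s0 {}H].
exists (Num.min r s); first by rewrite lt_min r0.
move=> h; rewrite lt_min => /andP[hr hs].
rewrite !E ?subrr ?cabs0//; first exact: H.
by rewrite addrC addKr.
Qed.

Lemma cder_quadratic f z d (r K : R) : 0 < r -> 0 <= K ->
  (forall h, cabs h < r -> cabs (f (z + h) - f z - d * h) <= K * cabs h ^+ 2) ->
  cder f z d.
Proof.
move=> r0 K0 H; apply/cderP => e e0.
have K1 : 0 < K + 1 by rewrite ltr_wpDl.
exists (Num.min r (e / (K + 1))); first by rewrite lt_min r0 divr_gt0.
move=> h; rewrite lt_min => /andP[hr he].
apply: (le_trans (H _ hr)); rewrite expr2 mulrA ler_wpM2r ?cabs_ge0//.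
move: he; rewrite ltr_pdivlMr// => /ltW; apply: le_trans.
by rewrite mulrC ler_wpM2l ?cabs_ge0// lerDl.
Qed.

Lemma cder_continuous f z d : cder f z d -> {for z, continuous f}.
Proof.
move=> /cderP H; apply/(cvgCP (F := nbhs z)) => e e0; apply/nbhsCP.
have [r r0 {}H] := H 1 ltr01.
have K1 : 0 < cabs d + 1 by rewrite ltr_wpDl// cabs_ge0.
exists (Num.min r (e / (cabs d + 1))); first by rewrite lt_min r0 divr_gt0.
move=> w; rewrite lt_min => /andP[wr we].
have := H _ wr; rewrite (addrC z) subrK mul1r => {}H.
have -> : f w - f z = (f w - f z - d * (w - z)) + d * (w - z) by rewrite subrK.
apply: (le_lt_trans (cabsD _ _)); rewrite cabsM.
move: we; rewrite ltr_pdivlMr//; apply: le_lt_trans.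
by rewrite [leRHS]mulrDr mulr1 [leRHS]addrC lerD// mulrC.
Qed.

Lemma cder_cst (a : C) z : cder (fun=> a) z 0.
Proof. exact: is_derive_cst. Qed.

Lemma cder_id z : cder (fun w => w) z 1.
Proof. exact: is_derive_id. Qed.

Lemma cderD f g z df dg : cder f z df -> cder g z dg ->
  cder (fun w => f w + g w) z (df + dg).
Proof. by move=> ? ?; apply: is_deriveD. Qed.

Lemma cderN f z df : cder f z df -> cder (fun w => - f w) z (- df).
Proof. by move=> ?; apply: is_deriveN. Qed.

Lemma cderB f g z df dg : cder f z df -> cder g z dg ->
  cder (fun w => f w - g w) z (df - dg).
Proof. by move=> ? ?; apply: is_deriveB. Qed.

Lemma cderM f g z df dg : cder f z df -> cder g z dg ->
  cder (fun w => f w * g w) z (f z * dg + g z * df).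
Proof. by move=> ? ?; apply: is_deriveM. Qed.

Lemma cderMl (a : C) g z dg : cder g z dg -> cder (fun w => a * g w) z (a * dg).
Proof. by move=> H; have := cderM (cder_cst a z) H; rewrite mulr0 addr0. Qed.

Lemma cderX f z df n : cder f z df ->
  cder (fun w => f w ^+ n) z (n%:R * f z ^+ n.-1 * df).
Proof.
move=> H; elim: n => [|n IH]; first by rewrite mul0r mul0r; exact: cder_cst.
have -> : (fun w => f w ^+ n.+1) = (fun w => f w * f w ^+ n).
  by apply/funext => w; rewrite exprS.
suff -> : n.+1%:R * f z ^+ n.+1.-1 * df
  = f z * (n%:R * f z ^+ n.-1 * df) + f z ^+ n * df :> C by exact: cderM.
case: n {IH} => [|n] /=; first by rewrite !expr0; ring.
by rewrite -[n.+2%:R]natr1 exprS; ring.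
Qed.

Lemma cder_inv z : z != 0 -> cder (fun w => w^-1) z (- z ^- 2).
Proof.
move=> z0; have a0 : 0 < cabs z by rewrite cabs_gt0.
have r0 : 0 < cabs z / 2 by rewrite divr_gt0.
have K0 : 0 <= 2 / cabs z ^+ 3 by rewrite divr_ge0// exprn_ge0// ltW.
apply: (cder_quadratic r0 K0) => h hr.
have zh : cabs z / 2 <= cabs (z + h).
  have := cabs_ge_sub z (- h); rewrite opprK cabsN; lra.
have zh0 : z + h != 0 by rewrite -cabs_gt0; lra.
have -> : (z + h)^-1 - z^-1 - - z ^- 2 * h = h ^+ 2 * (z ^- 2 * (z + h)^-1).
  by field; rewrite zh0.
rewrite cabsM cabsX mulrC ler_wpM2r ?sqr_ge0// cabsM !cabsV cabsX.
have -> : 2 / cabs z ^+ 3 = cabs z ^- 2 * (cabs z / 2)^-1 by field; rewrite gt_eqF.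
by rewrite ler_wpM2l ?invr_ge0 ?sqr_ge0// lef_pV2// posrE; lra.
Qed.

Lemma cder_comp f g z df dg : cder g z dg -> cder f (g z) df ->
  cder (fun w => f (g w)) z (df * dg).
Proof.
move=> Hg /cderP Hf; have Cg := cder_continuous Hg; move/cderP: Hg => Hg.
apply/cderP => e e0.
(* The outer remainder costs [e1] times |g'| + 1, the inner one [e1] times |f'|; [e1 <= 1] keeps the
   increment of [g] below (|g'| + 1) |h|. *)
pose K := cabs dg + 1 + cabs df.
have K0 : 0 < K by rewrite ltr_wpDr ?cabs_ge0// ltr_wpDl// cabs_ge0.
pose e1 := Num.min 1 (e / K).
have e10 : 0 < e1 by rewrite lt_min ltr01 divr_gt0.
have [r1 r10 {}Hf] := Hf _ e10.
have [r2 r20 {}Hg] := Hg _ e10.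
have /nbhsCP[r3 r30 Cg'] : \forall w \near z, cabs (g w - g z) < r1.
  by move/(cvgCP (F := nbhs z)) : Cg; exact.
exists (Num.min r2 r3); first by rewrite lt_min r20.
move=> h; rewrite lt_min => /andP[h2 h3].
have E3 : cabs (g (z + h) - g z) < r1 by apply: Cg'; rewrite addrC addKr.
have {}Hf := Hf _ E3; rewrite (addrC (g z)) subrK in Hf.
have {}Hg := Hg _ h2.
have E4 : cabs (g (z + h) - g z) <= (cabs dg + 1) * cabs h.
  have -> : g (z + h) - g z = (g (z + h) - g z - dg * h) + dg * h by rewrite subrK.
  apply: (le_trans (cabsD _ _)); rewrite cabsM mulrDl mul1r addrC lerD//.
  apply: (le_trans Hg); rewrite ler_piMl ?cabs_ge0//.
  by rewrite /e1 ge_min lexx.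
have -> : f (g (z + h)) - f (g z) - df * dg * h
  = (f (g (z + h)) - f (g z) - df * (g (z + h) - g z))
    + df * (g (z + h) - g z - dg * h) by ring.
apply: (le_trans (cabsD _ _)); rewrite cabsM.
apply: (@le_trans _ _ (e1 * K * cabs h)).
  have -> : e1 * K * cabs h = e1 * ((cabs dg + 1) * cabs h) + cabs df * (e1 * cabs h).
    by rewrite /K; ring.
  rewrite lerD//; last by rewrite ler_wpM2l ?cabs_ge0.
  by apply: (le_trans Hf); rewrite ler_wpM2l// ltW.
rewrite ler_wpM2r ?cabs_ge0// -ler_pdivlMr//.
by rewrite /e1 ge_min lexx orbT.
Qed.

Lemma cderV g z dg : g z != 0 -> cder g z dg ->
  cder (fun w => (g w)^-1) z (- (g z) ^- 2 * dg).
Proof. by move=> gz Hg; apply: (cder_comp Hg (cder_inv gz)). Qed.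

Lemma cder_sub_cst (a z : C) : cder (fun w => w - a) z 1.
Proof. by have := cderB (cder_id z) (cder_cst a z); rewrite subr0. Qed.

Lemma cderV_sub (a z : C) : z != a -> cder (fun w => (w - a)^-1) z (- (z - a) ^- 2).
Proof.
rewrite -subr_eq0 => za.
by have := @cderV (fun w => w - a) z 1 za (cder_sub_cst a z); rewrite mulr1.
Qed.

(* Derivability survives pointwise limits as soon as the second order
   remainders are bounded uniformly: this replaces the Weierstrass theorem. *)
Lemma cder_limit (T : Type) (F : set_system T) {FF : ProperFilter F}
    (f : T -> C -> C) (D : T -> C) (g : C -> C) z (r K : R) :
  0 < r -> 0 <= K ->
  (forall h, cabs h < r -> (fun t => f t (z + h)) @ F --> g (z + h)) ->
  (forall h, cabs h < r -> \forall t \near F,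
    cabs (f t (z + h) - f t z - D t * h) <= K * cabs h ^+ 2) ->
  exists d, cder g z d.
Proof.
move=> r0 K0 fg H.
have fgz : (fun t => f t z) @ F --> g z.
  by have := fg 0; rewrite cabs0 addr0; exact.
have [d Dd] : exists d, D @ F --> d.
  apply: cauchy_cvgC => e e0.
  (* A single small step [h] is fixed: the quotient of the limit function with this step
     approximates [D t] within e for all late [t], which gives the Cauchy property. *)
  have [h [h0 hr hK]] : exists h : C, [/\ cabs h != 0, cabs h < r & K * cabs h <= e / 2].
    have K1 : 0 < K + 1 by rewrite ltr_wpDl.
    pose t := Num.min (r / 2) (e / 2 / (K + 1)).
    have t0 : 0 < t by rewrite lt_min !divr_gt0.
    have E : cabs (t%:C : C) = t by rewrite cabs_real gtr0_norm.
    exists (t%:C); rewrite E; split; first by rewrite gt_eqF.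
      by rewrite /t gt_min ltr_pdivrMr// ltr_pMr// ltr1n.
    apply: (@le_trans _ _ ((K + 1) * t)); first by rewrite ler_wpM2r ?(ltW t0)// lerDl.
    by rewrite mulrC -ler_pdivlMr// /t ge_min lexx orbT.
  have hh : 0 < cabs h by rewrite lt_def h0 cabs_ge0.
  exists ((g (z + h) - g z) / h).
  have e4 : 0 < e / 4 * cabs h by rewrite mulr_gt0// divr_gt0.
  near=> t.
  have A : cabs (f t (z + h) - g (z + h)) < e / 4 * cabs h.
    by near: t; move/cvgCP: (fg h hr); exact.
  have B : cabs (f t z - g z) < e / 4 * cabs h by near: t; move/cvgCP: fgz; exact.
  have E : cabs (f t (z + h) - f t z - D t * h) <= K * cabs h ^+ 2.
    by near: t; exact: H.
  rewrite -(@ltr_pM2r _ (cabs h))// -cabsM mulrBl divfK -?cabs_eq0//.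
  have -> : D t * h - (g (z + h) - g z) = (f t (z + h) - g (z + h)) - (f t z - g z)
     - (f t (z + h) - f t z - D t * h) by ring.
  apply: (le_lt_trans (cabsB _ _)).
  have E' : cabs (f t (z + h) - f t z - D t * h) <= e / 2 * cabs h.
    by apply: (le_trans E); rewrite expr2 mulrA ler_wpM2r// ltW.
  have := cabsB (f t (z + h) - g (z + h)) (f t z - g z).
  have : e * cabs h = 2 * (e / 4 * cabs h) + e / 2 * cabs h by field.
  lra.
exists d; apply: (cder_quadratic r0 K0) => h hr.
apply: (@cvgC_le _ _ F _ (fun t => f t (z + h) - f t z - D t * h)); last exact: H.
exact: (cvgCB (cvgCB (fg _ hr) fgz) (cvgCM Dd (cvg_cst h))).
Unshelve. all: by end_near. Qed.

End ComplexDerivative.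

#[global] Arguments cabs : simpl never.

(** * Derivatives along segments and the mean value inequality *)

Section RealDerivative.
Variable R : realType.
Local Notation C := (R[i]^o).
Implicit Types (f : R -> R) (x d : R).

Lemma rderP f x d : is_derive x (1 : R) f d <->
  forall e : R, 0 < e -> exists2 r : R, 0 < r &
    forall h : R, `|h| < r -> `|f (x + h) - f x - d * h| <= e * `|h|.
Proof.
split.
  move=> [/cvg_ex [l H] E].
  have {}E : l = d by rewrite -E; apply/esym/cvg_lim.
  subst l => e e0. move/cvgrPdist_lt: H => /(_ _ e0).
  move=> /nbhs_normP[r /= r0 H]; exists r => // h hr.
  have [->|h0] := eqVneq h 0; first by rewrite addr0 mulr0 subrr subr0 normr0 mulr0.
  have := H h; rewrite /= sub0r normrN => /(_ hr h0) /ltW.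
  rewrite distrC -(@ler_pM2r _ `|h|) ?normr_gt0// -normrM.
  by rewrite /GRing.scale /= mulr1 (addrC h x) mulrBl mulrAC mulVf// mul1r.
move=> H.
have L : (fun h : R => h^-1 *: ((f \o shift x) (h *: (1:R)) - f x)) @ 0^' --> d.
  apply/cvgrPdist_lt => e e0; apply/nbhs_normP.
  have e2 : 0 < e / 2 by rewrite divr_gt0.
  have [r r0 {}H] := H _ e2; exists r => // h; rewrite /= sub0r normrN => hr h0.
  rewrite -(@ltr_pM2r _ `|h|) ?normr_gt0// distrC -normrM.
  have -> : (h^-1 *: (f (h *: 1 + x) - f x) - d) * h = f (x + h) - f x - d * h.
    by rewrite /GRing.scale /= mulr1 (addrC h x) mulrBl mulrAC mulVf// mul1r.
  apply: (le_lt_trans (H h hr)); rewrite ltr_pM2r ?normr_gt0//.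
  by rewrite ltr_pdivrMr// ltr_pMr// ltr1n.
by split; [apply/cvg_ex; exists d|exact/cvg_lim].
Qed.

Lemma rder_continuous f x d : is_derive x (1 : R) f d -> {for x, continuous f}.
Proof. by move=> [fx _]; apply/differentiable_continuous/derivable1_diffP. Qed.

Lemma cder_Re_line (F : C -> C) (a dl d : C) (t : R) :
  cder F (a + t%:C * dl) d ->
  is_derive t (1 : R) (fun t => complex.Re (F (a + t%:C * dl))) (complex.Re (d * dl)).
Proof.
move=> H.
have H1 : cder (fun w : C => a + w * dl) (t%:C) dl.
  have := cderD (cder_cst a t%:C) (cderM (cder_id (t%:C : C)) (cder_cst dl t%:C)).
  by rewrite mulr0 add0r mulr1 add0r.
have /cderP {}H := cder_comp H1 H.
apply/rderP => e /H [r r0 {}H]; exists r => // h hr.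
have := H (h%:C); rewrite cabs_real => /(_ hr); apply: le_trans.
apply: le_trans (ler_Re _).
rewrite !ReD !ReN (_ : (t + h)%:C = t%:C + h%:C) ?rmorphD//.
by rewrite [complex.Re (d * dl * _)]ReM /= mulr0 subr0.
Qed.

Lemma cder_Im_line (F : C -> C) (a dl d : C) (t : R) :
  cder F (a + t%:C * dl) d ->
  is_derive t (1 : R) (fun t => complex.Im (F (a + t%:C * dl))) (complex.Im (d * dl)).
Proof.
move=> H.
have := @cder_Re_line (fun w => - 'i * F w) a dl _ t (cderMl (- 'i) H).
have E w : complex.Re (- 'i * w : C) = complex.Im w.
  by case: w => u v; rewrite ReM /=; ring.
by rewrite -mulrA E; under eq_fun do rewrite E.
Qed.

(** The mean value theorem is applied separately to the real and imaginary parts along the segment;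
    each contributes K |b - a|, whence the factor 2. *)
Lemma cder_dist_le (F dF : C -> C) (a b : C) (K : R) :
  (forall t : R, 0 <= t <= 1 -> cder F (a + t%:C * (b - a)) (dF (a + t%:C * (b - a)))) ->
  (forall t : R, 0 <= t <= 1 -> cabs (dF (a + t%:C * (b - a))) <= K) ->
  cabs (F b - F a) <= 2 * K * cabs (b - a).
Proof.
move=> H HK.
have aux (G : C -> R) (D : C -> R) :
    (forall t : R, 0 <= t <= 1 -> is_derive t (1 : R) (fun t => G (a + t%:C * (b - a)))
       (D (dF (a + t%:C * (b - a)) * (b - a)))) ->
    (forall w, `|D w| <= cabs w) -> `|G b - G a| <= K * cabs (b - a).
  move=> HG HD.
  have := @MVT R (fun t => G (a + t%:C * (b - a)))
     (fun t => D (dF (a + t%:C * (b - a)) * (b - a))) 0 1 ltr01.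
  case.
  - by move=> x; rewrite in_itv /= => /andP[x0 x1]; apply: HG; rewrite !ltW.
  - apply: continuous_in_subspaceT => x; rewrite inE /= in_itv /= => xI.
    exact: (rder_continuous (HG x xI)).
  move=> t; rewrite in_itv /= => /andP[t0 t1].
  have -> : a + 1%:C * (b - a) = b by rewrite rmorph1 mul1r addrC subrK.
  have -> : a + 0%:C * (b - a) = a by rewrite rmorph0 mul0r addr0.
  rewrite subr0 mulr1 => ->.
  apply: (le_trans (HD _)); rewrite cabsM ler_wpM2r ?cabs_ge0// HK// !ltW//.
have A := aux (fun w => complex.Re w) (fun w => complex.Re w).
have {}A := aux (fun w => complex.Re (F w)) (fun w => complex.Re w)
  (fun t tI => cder_Re_line (H t tI)) (@ler_Re R).
have B := aux (fun w => complex.Im (F w)) (fun w => complex.Im w)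
  (fun t tI => cder_Im_line (H t tI)) (@ler_Im R).
apply: (le_trans (cabs_le_ReIm _)).
rewrite ReD ImD ReN ImN; lra.
Qed.

End RealDerivative.

(** * The complex exponential and the primary factors of order two *)

Section ComplexExponential.
Variable R : realType.
Local Notation C := (R[i]^o).
Implicit Types (z w : C).

Lemma cexpD z w : cexp (z + w) = cexp z * cexp w.
Proof.
case: z => a b; case: w => c d; apply: eq_complexP;
rewrite /cexp !(ReM, ImM) /= expRD ?cosD ?sinD; ring.
Qed.

Lemma cabs_cexp z : cabs (cexp z) = expR (complex.Re z).
Proof.
rewrite cabsM cabs_real gtr0_norm ?expR_gt0//.
by rewrite cabsE cos2Dsin2 sqrtr1 mulr1.
Qed.

Lemma cexp0 : cexp (0 : C) = 1.
Proof. by rewrite /cexp /= expR0 cos0 sin0 mul1r. Qed.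

Lemma cexp_neq0 z : cexp z != 0.
Proof. by rewrite -cabs_gt0 cabs_cexp expR_gt0. Qed.

Lemma cexpN z : cexp (- z) = (cexp z)^-1.
Proof.
apply: (mulIf (cexp_neq0 z)).
by rewrite -cexpD addNr cexp0 mulVf// cexp_neq0.
Qed.

Lemma cexp_sum (I : Type) (r : seq I) (F : I -> C) :
  cexp (\sum_(i <- r) F i) = \prod_(i <- r) cexp (F i).
Proof. by elim/big_rec2: _ => [|i x y _ <-]; rewrite ?cexp0 ?cexpD. Qed.

Lemma cabs_cexp_le z : cabs (cexp z) <= expR (cabs z).
Proof. by rewrite cabs_cexp ler_expR (le_trans (ler_norm _))// ler_Re. Qed.

Let cder_cexp0 : cder (@cexp R) 0 1.
Proof.
have HE := is_derive_expR (0 : R); rewrite expR0 in HE.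
have HC := is_derive_cos (0 : R); rewrite sin0 oppr0 in HC.
have HS := is_derive_sin (0 : R); rewrite cos0 in HS.
apply/cderP => e e0.
(* So e = 12 d. With exp x <= 3 near 0 the four error terms below add up to 8 d |h|. *)
pose d := e / 4 / 3.
have d0 : 0 < d by rewrite !divr_gt0.
have [r1 r10 {}HE] := (rderP _ _ _).1 HE _ d0.
have [r2 r20 {}HC] := (rderP _ _ _).1 HC _ d0.
have [r3 r30 {}HS] := (rderP _ _ _).1 HS _ d0.
pose r := Num.min (Num.min r1 r2) (Num.min r3 (Num.min (2^-1) (e / 12 / (1 + d)))).
have dd : 0 < 1 + d by rewrite addr_gt0.
exists r; first by rewrite !lt_min r10 r20 r30 invr_gt0 ltr0n !divr_gt0.
move=> h; rewrite !lt_min => /andP[/andP[h1 h2] /andP[h3 /andP[h4 h5]]].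
case: h h1 h2 h3 h4 h5 => x y h1 h2 h3 h4 h5.
have hx : `|x| <= cabs (x +i* y : C) := ler_Re (x +i* y : C).
have hy : `|y| <= cabs (x +i* y : C) := ler_Im (x +i* y : C).
have {}HE := HE _ (le_lt_trans hx h1); rewrite add0r expR0 mul1r in HE.
have {}HC := HC _ (le_lt_trans hy h2); rewrite add0r cos0 mul0r subr0 in HC.
have {}HS := HS _ (le_lt_trans hy h3); rewrite add0r sin0 mul1r subr0 in HS.
set A := cabs (x +i* y) in hx hy h1 h2 h3 h4 h5 *.
have A0 : 0 <= A by exact: cabs_ge0.
have HE' : `|expR x - 1| <= (1 + d) * A.
  have -> : expR x - 1 = (expR x - 1 - x) + x by rewrite subrK.
  apply: (le_trans (ler_normD _ _)); rewrite mulrDl mul1r addrC lerD//.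
  by apply: (le_trans HE); rewrite ler_wpM2l// ltW.
have HE3 : expR x <= 3.
  have x2 : x <= 2^-1 by rewrite (le_trans (ler_norm x))// (le_trans hx)// ltW.
  have := expR_ge1Dx (- x); rewrite expRN => H.
  have H2 : 2^-1 <= (expR x)^-1 by apply: le_trans H; lra.
  by rewrite lef_pV2 ?posrE ?expR_gt0// in H2; lra.
have E0 := expR_ge0 x.
have hAA : (1 + d) * A <= e / 12 by rewrite mulrC -ler_pdivlMr// ltW.
apply: (le_trans (cabs_le_ReIm _)).
rewrite add0r cexp0 mul1r /cexp /= !mul0r subr0 addr0 oppr0 addr0.
have -> : expR x * cos y - 1 - x = expR x * (cos y - 1) + (expR x - 1 - x) by ring.
have -> : expR x * sin y - y = expR x * (sin y - y) + (expR x - 1) * y by ring.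
have P1 := ler_normD (expR x * (cos y - 1)) (expR x - 1 - x).
have P2 := ler_normD (expR x * (sin y - y)) ((expR x - 1) * y).
have Q1 : `|expR x * (cos y - 1)| <= 3 * (d * A).
  rewrite normrM ger0_norm//; apply: ler_pM => //.
  by apply: (le_trans HC); rewrite ler_wpM2l// ltW.
have Q2 : `|expR x * (sin y - y)| <= 3 * (d * A).
  rewrite normrM ger0_norm//; apply: ler_pM => //.
  by apply: (le_trans HS); rewrite ler_wpM2l// ltW.
have Q3 : `|(expR x - 1) * y| <= e / 12 * A.
  rewrite normrM; apply: ler_pM => //; exact: le_trans hAA.
have Q4 : `|expR x - 1 - x| <= d * A.
  by apply: (le_trans HE); rewrite ler_wpM2l// ltW.
have -> : e * A = 12 * (d * A) by rewrite /d; field.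
have EQ : e / 12 * A = d * A by rewrite /d; field.
rewrite EQ in Q3.
have dA : 0 <= d * A by rewrite mulr_ge0// ltW.
lra.
Qed.

Lemma cder_cexp z : cder (@cexp R) z (cexp z).
Proof.
have H1 : cder (fun w : C => w - z) z 1.
  by have := cderB (cder_id z) (cder_cst z z); rewrite subr0.
have H2 : cder (@cexp R) (z - z) 1 by rewrite subrr.
have := cderMl (cexp z) (cder_comp H1 H2); rewrite !mulr1.
suff -> : (fun w => cexp z * cexp (w - z)) = @cexp R by [].
by apply/funext => w; rewrite -cexpD addrC subrK.
Qed.

Lemma cder_cexp_comp (g : C -> C) z dg : cder g z dg ->
  cder (fun w => cexp (g w)) z (cexp (g z) * dg).
Proof. by move=> Hg; apply: (cder_comp Hg (cder_cexp _)). Qed.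

(* With [phi t = (1 - t x) e^(t x + (t x)^2 / 2)], [phi' t = - t^2 x^3 e^(...)]. *)
Lemma cabs_weierstrass_factor (x : C) :
  cabs ((1 - x) * cexp (x + 2^-1 * x ^+ 2) - 1)
  <= 2 * (cabs x ^+ 2 * expR (cabs x + 2^-1 * cabs x ^+ 2)) * cabs x.
Proof.
pose phi (w : C) : C := (1 - w) * cexp (w + 2^-1 * w ^+ 2).
pose dphi (w : C) : C := - (w ^+ 2 : C) * cexp (w + 2^-1 * w ^+ 2).
have -> : (1 - x) * cexp (x + 2^-1 * x ^+ 2) - 1 = phi x - phi 0.
  by rewrite /phi subr0 expr0n mulr0 addr0 cexp0 mulr1.
rewrite -{5}(subr0 x); apply: (@cder_dist_le R phi dphi) => t tI.
- set w := 0 + _.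
  have H1 : cder (fun w : C => 1 - w) w (-1).
    by have := cderB (cder_cst 1 w) (cder_id w); rewrite sub0r.
  have H2 : cder (fun w : C => w + 2^-1 * w ^+ 2) w (1 + w).
    have := cderD (cder_id w) (cderMl 2^-1 (cderX 2 (cder_id w))).
    by rewrite /= expr1 mulr1 mulrA mulVf ?mul1r// pnatr_eq0.
  have := cderM H1 (cder_cexp_comp H2).
  suff -> : (1 - w) * (cexp (w + 2^-1 * w ^+ 2) * (1 + w)) +
    cexp (w + 2^-1 * w ^+ 2) * -1 = dphi w by [].
  by rewrite /dphi; ring.
- rewrite add0r subr0 /dphi cabsM cabsN cabsX cabsM cabs_real.
  have tx : `|t| * cabs x <= cabs x.
    by rewrite ler_piMl ?cabs_ge0//; case/andP: tI => t0 t1; rewrite ger0_norm.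
  have tx0 : 0 <= `|t| * cabs x by rewrite mulr_ge0 ?cabs_ge0.
  apply: ler_pM; rewrite ?exprn_ge0 ?cabs_ge0//; first by rewrite lerXn2r// nnegrE ?cabs_ge0.
  apply: (le_trans (cabs_cexp_le _)); rewrite ler_expR.
  apply: (le_trans (cabsD _ _)).
  rewrite [cabs (2^-1 * _)]cabsM cabsX [cabs (t%:C * x)]cabsM cabs_real lerD//.
  rewrite cabsV (_ : cabs (2 : C) = 2); last first.
    have -> : (2 : C) = (2 : R)%:C by rewrite rmorph_nat.
    by rewrite cabs_real ger0_norm.
  by rewrite ler_wpM2l// lerXn2r// nnegrE ?cabs_ge0.
Qed.

End ComplexExponential.

(** * Complex-valued integrals over real intervals *)

Section PathIntegral.
Variable R : realType.
Local Notation C := (R[i]^o).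
Local Notation mu := (@lebesgue_measure R).
Implicit Types (phi psi : R -> C) (a b c : R).

Definition cont_on phi a b := forall x, a <= x <= b -> {for x, continuous phi}.

Definition cint phi a b : C :=
  (\int[mu]_(x in `[a, b]) complex.Re (phi x))
  +i* (\int[mu]_(x in `[a, b]) complex.Im (phi x)).

Lemma cont_on_sub phi a b a' b' : a <= a' -> b' <= b -> cont_on phi a b ->
  cont_on phi a' b'.
Proof.
by move=> aa bb H x /andP[ax xb]; apply: H; rewrite (le_trans aa)// (le_trans xb).
Qed.

Lemma integrable_cont (f : R -> R) a b :
  (forall x, a <= x <= b -> {for x, continuous f}) ->
  mu.-integrable `[a, b] (EFin \o f).
Proof.
move=> H; apply: continuous_compact_integrable; first exact: segment_compact.
by apply: continuous_in_subspaceT => x; rewrite inE /= in_itv /=; exact: H.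
Qed.

Lemma cont_on_Re phi a b : cont_on phi a b ->
  forall x, a <= x <= b -> {for x, continuous (fun x => complex.Re (phi x))}.
Proof. by move=> H x /H; exact: cvg_Re. Qed.

Lemma cont_on_Im phi a b : cont_on phi a b ->
  forall x, a <= x <= b -> {for x, continuous (fun x => complex.Im (phi x))}.
Proof. by move=> H x /H; exact: cvg_Im. Qed.

Lemma cont_on_cabs phi a b : cont_on phi a b ->
  forall x, a <= x <= b -> {for x, continuous (fun x => cabs (phi x))}.
Proof. by move=> H x /H; exact: cvg_cabs. Qed.

Lemma Rint_split (f : R -> R) a b c : a <= c -> c <= b ->
  (forall x, a <= x <= b -> {for x, continuous f}) ->
  \int[mu]_(x in `[a, b]) f x
  = \int[mu]_(x in `[a, c]) f x + \int[mu]_(x in `[c, b]) f x.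
Proof.
move=> ac cb H.
have I := integrable_cont H.
have I' : mu.-integrable `]c, b] (EFin \o f).
  by apply: integrableS I => //; apply: subset_itvr; rewrite bnd_simp.
rewrite -(Rintegral_itv_obnd_cbnd I') -(@Rintegral_itvB _ _ _ _ c I) ?bnd_simp//.
by rewrite addrC subrK.
Qed.

Lemma cint_split phi a b c : a <= c -> c <= b -> cont_on phi a b ->
  cint phi a b = cint phi a c + cint phi c b.
Proof.
move=> ac cb H; apply: eq_complexP; rewrite ?ReD ?ImD /=.
- exact: (Rint_split ac cb (cont_on_Re H)).
- exact: (Rint_split ac cb (cont_on_Im H)).
Qed.

Lemma eq_cint phi psi a b : (forall x, a <= x <= b -> phi x = psi x) ->
  cint phi a b = cint psi a b.
Proof.
move=> H; rewrite /cint.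
by congr (_ +i* _); apply: eq_Rintegral => x; rewrite inE /= in_itv /= => /H ->.
Qed.

Lemma cintD phi psi a b : cont_on phi a b -> cont_on psi a b ->
  cint (fun x => phi x + psi x) a b = cint phi a b + cint psi a b.
Proof.
move=> H1 H2; apply: eq_complexP; rewrite ?ReD ?ImD /=.
- under eq_Rintegral do rewrite ReD.
  by rewrite RintegralD//; [exact: integrable_cont (cont_on_Re H1)|exact: integrable_cont (cont_on_Re H2)].
- under eq_Rintegral do rewrite ImD.
  by rewrite RintegralD//; [exact: integrable_cont (cont_on_Im H1)|exact: integrable_cont (cont_on_Im H2)].
Qed.

Lemma cintZ phi (k : C) a b : cont_on phi a b ->
  cint (fun x => k * phi x) a b = k * cint phi a b.
Proof.
move=> H; have IR := integrable_cont (cont_on_Re H).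
have II := integrable_cont (cont_on_Im H).
case: k => k l; apply: eq_complexP; rewrite ?(ReM, ImM) /=.
- under eq_Rintegral do rewrite ReM /=.
  rewrite RintegralB// ?RintegralZl//.
  + apply: integrable_cont => x xI; exact: (cvgM (cvg_cst k) (cont_on_Re H xI)).
  + apply: integrable_cont => x xI; exact: (cvgM (cvg_cst l) (cont_on_Im H xI)).
- under eq_Rintegral do rewrite ImM /=.
  rewrite RintegralD// ?RintegralZl//.
  + apply: integrable_cont => x xI; exact: (cvgM (cvg_cst k) (cont_on_Im H xI)).
  + apply: integrable_cont => x xI; exact: (cvgM (cvg_cst l) (cont_on_Re H xI)).
Qed.

(** Real and imaginary parts are estimated one by one. The constant 2 is not sharp but suffices,
    since only orders of magnitude matter later. *)
Lemma cabs_cint phi a b : cont_on phi a b ->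
  cabs (cint phi a b) <= 2 * \int[mu]_(x in `[a, b]) cabs (phi x).
Proof.
move=> H; have IR := integrable_cont (cont_on_Re H).
have II := integrable_cont (cont_on_Im H).
have IA := integrable_cont (cont_on_cabs H).
apply: (le_trans (cabs_le_ReIm _)) => /=.
rewrite mulrDl mul1r lerD//.
- apply: (le_trans (le_normr_Rintegral _ IR)) => //.
  apply: le_Rintegral => //; last by move=> x _; exact: ler_Re.
  exact: (integrable_norm IR).
- apply: (le_trans (le_normr_Rintegral _ II)) => //.
  apply: le_Rintegral => //; last by move=> x _; exact: ler_Im.
  exact: (integrable_norm II).
Qed.

Lemma Rint_cst (K : R) a b : a <= b -> \int[mu]_(x in `[a, b]) K = K * (b - a).
Proof.
move=> ab; rewrite Rintegral_cst//= lebesgue_measure_itv/= lte_fin.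
by case: ltgtP ab => //= -> _; rewrite subrr.
Qed.

Lemma cabs_cint_le phi a b (K : R) : a <= b -> cont_on phi a b ->
  (forall x, a <= x <= b -> cabs (phi x) <= K) ->
  cabs (cint phi a b) <= 2 * K * (b - a).
Proof.
move=> ab H HK; apply: (le_trans (cabs_cint H)); rewrite -mulrA ler_wpM2l//.
rewrite -Rint_cst//; apply: le_Rintegral => //.
- exact: integrable_cont (cont_on_cabs H).
- by apply: integrable_cont => x _; exact: cst_continuous.
Qed.

Lemma Rint_FTC (F f : R -> R) a b : a < b ->
  (forall x, is_derive x (1 : R) F (f x)) -> (forall x, {for x, continuous f}) ->
  \int[mu]_(x in `[a, b]) f x = F b - F a.
Proof.
move=> ab HF Hf.
have Cf : {within `[a, b], continuous f} by apply: continuous_subspaceT => x; exact: Hf.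
have DF : derivable_oo_LRcontinuous F a b.
  split.
  - by move=> x _; case: (HF x).
  - by apply: cvg_at_right_filter; apply: rder_continuous (HF _).
  - by apply: cvg_at_left_filter; apply: rder_continuous (HF _).
have EF : {in `]a, b[, derive1 F =1 f}.
  by move=> x _; have HFx := HF x; rewrite derive1E derive_val.
by rewrite /Rintegral (continuous_FTC2 ab Cf DF EF).
Qed.

Lemma rder_quadratic (f : R -> R) (x d K : R) : 0 <= K ->
  (forall h, `|f (x + h) - f x - d * h| <= K * h ^+ 2) -> is_derive x (1 : R) f d.
Proof.
move=> K0 H; apply/rderP => e e0.
have K1 : 0 < K + 1 by rewrite ltr_wpDl.
exists (e / (K + 1)); first by rewrite divr_gt0.
move=> h he; apply: (le_trans (H h)).
rewrite -[h ^+ 2]real_normK ?num_real// expr2 mulrA ler_wpM2r//.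
move: he; rewrite ltr_pdivlMr// => /ltW; apply: le_trans.
by rewrite mulrC ler_wpM2l// lerDl.
Qed.

Lemma Rint_affine (p q : R) a b : a < b ->
  \int[mu]_(x in `[a, b]) (p + q * x) = p * (b - a) + q * ((b ^+ 2 - a ^+ 2) / 2).
Proof.
move=> ab.
have HD x : is_derive x (1 : R) (fun x => p * x + q / 2 * x ^+ 2) (p + q * x).
  apply: (@rder_quadratic _ _ _ `|q / 2|) => // h.
  have -> : p * (x + h) + q / 2 * (x + h) ^+ 2 - (p * x + q / 2 * x ^+ 2) - (p + q * x) * h
    = q / 2 * h ^+ 2 by field.
  by rewrite normrM [X in _ * X <= _]ger0_norm// sqr_ge0.
have HC x : {for x, continuous (fun x => p + q * x)}.
  exact: (cvgD (cvg_cst p) (cvgM (cvg_cst q) cvg_id)).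
rewrite (Rint_FTC ab HD HC).
by field.
Qed.

Lemma cint_affine (p q : C) a b : a < b ->
  cint (fun x => p + q * x%:C) a b = p * (b - a)%:C + q * ((b ^+ 2 - a ^+ 2) / 2)%:C.
Proof.
move=> ab; apply: eq_complexP; rewrite ?(ReD, ImD, ReM, ImM) /=.
- under eq_Rintegral do rewrite ReD ReM /= mulr0 subr0.
  by rewrite Rint_affine// !mulr0 !subr0.
- under eq_Rintegral do rewrite ImD ImM /= mulr0 add0r.
  by rewrite Rint_affine// !mulr0 !add0r.
Qed.

End PathIntegral.

(** * Contour integrals around rectangles *)

Section Rectangle.
Variable R : realType.
Local Notation C := (R[i]^o).
Implicit Types (f g : C -> C).

Definition holo_on f (x0 x1 y0 y1 : R) :=
  forall x y, x0 <= x <= x1 -> y0 <= y <= y1 -> exists d, cder f (x +i* y) d.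

Definition cont_rect f (x0 x1 y0 y1 : R) :=
  forall x y, x0 <= x <= x1 -> y0 <= y <= y1 -> {for (x +i* y : C), continuous f}.

Definition on_bd (P : C -> Prop) (x0 x1 y0 y1 : R) :=
  forall x y, x0 <= x <= x1 -> y0 <= y <= y1 ->
    (x == x0) || (x == x1) || (y == y0) || (y == y1) -> P (x +i* y).

Definition cont_bd f (x0 x1 y0 y1 : R) :=
  on_bd (fun z => {for z, continuous f}) x0 x1 y0 y1.

Definition hint f (y x0 x1 : R) : C := cint (fun x => f (x +i* y)) x0 x1.
Definition vint f (x y0 y1 : R) : C := cint (fun y => f (x +i* y)) y0 y1.

(** The contour runs counterclockwise; the factor ['i] is dz along the vertical sides. *)
Definition rect f x0 x1 y0 y1 : C :=
  hint f y0 x0 x1 - hint f y1 x0 x1 + 'i * (vint f x1 y0 y1 - vint f x0 y0 y1).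

Lemma holo_cont f x0 x1 y0 y1 : holo_on f x0 x1 y0 y1 -> cont_rect f x0 x1 y0 y1.
Proof. by move=> H x y hx hy; have [d /cder_continuous] := H x y hx hy. Qed.

Lemma cont_h f (x y : R) : {for (x +i* y : C), continuous f} ->
  {for x, continuous (fun x => f (x +i* y))}.
Proof.
move=> Hf; apply: (@continuous_comp _ _ _ (fun x => x +i* y : C) f); last exact: Hf.
exact: (cvg_ReIm cvg_id (cvg_cst y)).
Qed.

Lemma cont_v f (x y : R) : {for (x +i* y : C), continuous f} ->
  {for y, continuous (fun y => f (x +i* y))}.
Proof.
move=> Hf; apply: (@continuous_comp _ _ _ (fun y => x +i* y : C) f); last exact: Hf.
exact: (cvg_ReIm (cvg_cst x) cvg_id).
Qed.

Lemma cont_rect_h f x0 x1 y0 y1 y : cont_rect f x0 x1 y0 y1 -> y0 <= y <= y1 ->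
  cont_on (fun x => f (x +i* y)) x0 x1.
Proof. by move=> H hy x hx; apply: cont_h; apply: H. Qed.

Lemma cont_rect_v f x0 x1 y0 y1 x : cont_rect f x0 x1 y0 y1 -> x0 <= x <= x1 ->
  cont_on (fun y => f (x +i* y)) y0 y1.
Proof. by move=> H hx y hy; apply: cont_v; apply: H. Qed.

Lemma cont_rect_bd f x0 x1 y0 y1 : cont_rect f x0 x1 y0 y1 -> cont_bd f x0 x1 y0 y1.
Proof. by move=> H x y hx hy _; apply: H. Qed.

Lemma cont_bd_h f x0 x1 y0 y1 y : cont_bd f x0 x1 y0 y1 -> y0 <= y <= y1 ->
  (y == y0) || (y == y1) -> cont_on (fun x => f (x +i* y)) x0 x1.
Proof. by move=> H hy E x hx; apply: cont_h; apply: H; rewrite // -orbA E !orbT. Qed.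

Lemma cont_bd_v f x0 x1 y0 y1 x : cont_bd f x0 x1 y0 y1 -> x0 <= x <= x1 ->
  (x == x0) || (x == x1) -> cont_on (fun y => f (x +i* y)) y0 y1.
Proof. by move=> H hx E y hy; apply: cont_v; apply: H; rewrite // E. Qed.

Lemma rect_splitx f x0 x1 y0 y1 x : x0 <= x -> x <= x1 -> y0 <= y1 ->
  cont_rect f x0 x1 y0 y1 ->
  rect f x0 x1 y0 y1 = rect f x0 x y0 y1 + rect f x x1 y0 y1.
Proof.
move=> h0 h1 hy H; rewrite /rect /hint.
rewrite (cint_split h0 h1 (cont_rect_h H _)) ?lexx//.
rewrite (cint_split h0 h1 (cont_rect_h H _)) ?lexx ?hy//.
ring.
Qed.

Lemma rect_splity f x0 x1 y0 y1 y : y0 <= y -> y <= y1 -> x0 <= x1 ->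
  cont_rect f x0 x1 y0 y1 ->
  rect f x0 x1 y0 y1 = rect f x0 x1 y0 y + rect f x0 x1 y y1.
Proof.
move=> h0 h1 hx H; rewrite /rect /vint.
rewrite (cint_split h0 h1 (cont_rect_v H _)) ?lexx ?hx//.
rewrite (cint_split h0 h1 (cont_rect_v H _)) ?lexx ?hx//.
ring.
Qed.

Lemma rect_affine (p q : C) x0 x1 y0 y1 : x0 < x1 -> y0 < y1 ->
  rect (fun w => p + q * w) x0 x1 y0 y1 = 0.
Proof.
move=> hx hy; rewrite /rect /hint /vint.
have Ex y : (fun x => p + q * (x +i* y)) = (fun x => (p + q * 'i * y%:C) + q * x%:C).
  apply/funext => x; have -> : (x +i* y : C) = x%:C + 'i * y%:C by simpc.
  by ring.
have Ey x : (fun y => p + q * (x +i* y)) = (fun y => (p + q * x%:C) + q * 'i * y%:C).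
  apply/funext => y; have -> : (x +i* y : C) = x%:C + 'i * y%:C by simpc.
  by ring.
rewrite !Ex !Ey !cint_affine//.
have ii : 'i * 'i = -1 :> C by rewrite -expr2 sqr_i.
rewrite !rmorphB /=.
set X0 := x0%:C; set X1 := x1%:C; set Y0 := y0%:C; set Y1 := y1%:C.
transitivity (q * (X1 - X0) * (Y1 - Y0) * (- 'i + 'i) : C); last by rewrite addNr mulr0.
ring.
Qed.

Lemma rectD f g x0 x1 y0 y1 : x0 <= x1 -> y0 <= y1 ->
  cont_bd f x0 x1 y0 y1 -> cont_bd g x0 x1 y0 y1 ->
  rect (fun w => f w + g w) x0 x1 y0 y1 = rect f x0 x1 y0 y1 + rect g x0 x1 y0 y1.
Proof.
move=> hx hy Hf Hg; rewrite /rect /hint /vint.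
have h0 : y0 <= y0 <= y1 by rewrite lexx. have h1 : y0 <= y1 <= y1 by rewrite lexx andbT.
have v0 : x0 <= x0 <= x1 by rewrite lexx. have v1 : x0 <= x1 <= x1 by rewrite lexx andbT.
have e0 (t t' : R) : (t == t) || (t == t') by rewrite eqxx.
have e1 (t t' : R) : (t' == t) || (t' == t') by rewrite eqxx orbT.
rewrite (cintD (cont_bd_h Hf h0 (e0 _ _)) (cont_bd_h Hg h0 (e0 _ _))).
rewrite (cintD (cont_bd_h Hf h1 (e1 _ _)) (cont_bd_h Hg h1 (e1 _ _))).
rewrite (cintD (cont_bd_v Hf v0 (e0 _ _)) (cont_bd_v Hg v0 (e0 _ _))).
rewrite (cintD (cont_bd_v Hf v1 (e1 _ _)) (cont_bd_v Hg v1 (e1 _ _))).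
ring.
Qed.

Lemma rectZ (k : C) f x0 x1 y0 y1 : x0 <= x1 -> y0 <= y1 ->
  cont_bd f x0 x1 y0 y1 ->
  rect (fun w => k * f w) x0 x1 y0 y1 = k * rect f x0 x1 y0 y1.
Proof.
move=> hx hy Hf; rewrite /rect /hint /vint.
have h0 : y0 <= y0 <= y1 by rewrite lexx. have h1 : y0 <= y1 <= y1 by rewrite lexx andbT.
have v0 : x0 <= x0 <= x1 by rewrite lexx. have v1 : x0 <= x1 <= x1 by rewrite lexx andbT.
have e0 (t t' : R) : (t == t) || (t == t') by rewrite eqxx.
have e1 (t t' : R) : (t' == t) || (t' == t') by rewrite eqxx orbT.
rewrite (cintZ k (cont_bd_h Hf h0 (e0 _ _))) (cintZ k (cont_bd_h Hf h1 (e1 _ _))).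
rewrite (cintZ k (cont_bd_v Hf v0 (e0 _ _))) (cintZ k (cont_bd_v Hf v1 (e1 _ _))).
ring.
Qed.

Lemma eq_rect f g x0 x1 y0 y1 : x0 <= x1 -> y0 <= y1 ->
  on_bd (fun z => f z = g z) x0 x1 y0 y1 ->
  rect f x0 x1 y0 y1 = rect g x0 x1 y0 y1.
Proof.
move=> hx hy H; rewrite /rect /hint /vint.
by congr (_ - _ + _ * (_ - _)); apply: eq_cint => t tI; apply: H; rewrite ?lexx ?eqxx ?hx ?hy ?orbT.
Qed.

Lemma cabs_rect_le f x0 x1 y0 y1 (K : R) : x0 <= x1 -> y0 <= y1 ->
  cont_bd f x0 x1 y0 y1 -> on_bd (fun z => cabs (f z) <= K) x0 x1 y0 y1 ->
  cabs (rect f x0 x1 y0 y1) <= 4 * K * ((x1 - x0) + (y1 - y0)).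
Proof.
move=> hx hy Hf HK.
have A y : y0 <= y <= y1 -> (y == y0) || (y == y1) ->
    cabs (hint f y x0 x1) <= 2 * K * (x1 - x0).
  move=> yI E; apply: cabs_cint_le => //; first exact: cont_bd_h Hf yI E.
  by move=> x xI; apply: HK; rewrite // -orbA E !orbT.
have B x : x0 <= x <= x1 -> (x == x0) || (x == x1) ->
    cabs (vint f x y0 y1) <= 2 * K * (y1 - y0).
  move=> xI E; apply: cabs_cint_le => //; first exact: cont_bd_v Hf xI E.
  by move=> y yI; apply: HK; rewrite // E.
have h0 : y0 <= y0 <= y1 by rewrite lexx. have h1 : y0 <= y1 <= y1 by rewrite lexx andbT.
have v0 : x0 <= x0 <= x1 by rewrite lexx. have v1 : x0 <= x1 <= x1 by rewrite lexx andbT.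
have e0 (t t' : R) : (t == t) || (t == t') by rewrite eqxx.
have e1 (t t' : R) : (t' == t) || (t' == t') by rewrite eqxx orbT.
have A0 := A _ h0 (e0 _ _); have A1 := A _ h1 (e1 _ _).
have B0 := B _ v0 (e0 _ _); have B1 := B _ v1 (e1 _ _).
apply: (le_trans (cabsD _ _)); rewrite cabsM cabs_i mul1r.
have := cabsB (hint f y0 x0 x1) (hint f y1 x0 x1).
have := cabsB (vint f x1 y0 y1) (vint f x0 y0 y1).
lra.
Qed.

End Rectangle.

(** * Goursat's theorem *)

Section Goursat.
Variable R : realType.
Local Notation C := (R[i]^o).
Implicit Types (f g H : C -> C).

Lemma quarter_ge (a b c d : C) (e : R) : e <= cabs (a + b + c + d) ->
  [\/ e / 4 <= cabs a, e / 4 <= cabs b, e / 4 <= cabs c | e / 4 <= cabs d].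
Proof.
move=> H.
have := cabsD (a + b + c) d; have := cabsD (a + b) c; have := cabsD a b.
case: (leP (e / 4) (cabs a)) => [|ha]; first by constructor 1.
case: (leP (e / 4) (cabs b)) => [|hb]; first by constructor 2.
case: (leP (e / 4) (cabs c)) => [|hc]; first by constructor 3.
case: (leP (e / 4) (cabs d)) => [|hd]; first by constructor 4.
lra.
Qed.

Lemma holo_on_sub f x0 x1 y0 y1 a0 a1 b0 b1 : x0 <= a0 -> a1 <= x1 -> y0 <= b0 ->
  b1 <= y1 -> holo_on f x0 x1 y0 y1 -> holo_on f a0 a1 b0 b1.
Proof.
move=> h1 h2 h3 h4 Hf x y /andP[hx hx'] /andP[hy hy'].
by apply: Hf; rewrite ?(le_trans h1 hx) ?(le_trans hx' h2) ?(le_trans h3 hy) ?(le_trans hy' h4).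
Qed.

Section Bisection.
Variables (f : C -> C) (x0 x1 y0 y1 : R).
Hypotheses (hx : x0 < x1) (hy : y0 < y1) (hf : holo_on f x0 x1 y0 y1).

Let w n : R := (x1 - x0) / 2 ^+ n.
Let h n : R := (y1 - y0) / 2 ^+ n.
Let e0 : R := cabs (rect f x0 x1 y0 y1).

(** [p] is the lower left corner of a rectangle of generation [n] that still carries its share
    [e0 / 4 ^+ n] of the integral. *)
Let good (n : nat) (p : R * R) :=
  [/\ e0 / 4 ^+ n <= cabs (rect f p.1 (p.1 + w n) p.2 (p.2 + h n)),
      x0 <= p.1, p.1 + w n <= x1, y0 <= p.2 & p.2 + h n <= y1].

Let inside (n : nat) (p q : R * R) :=
  [/\ p.1 <= q.1, q.1 + w n.+1 <= p.1 + w n, p.2 <= q.2 & q.2 + h n.+1 <= p.2 + h n].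

Let wE n : w n = w n.+1 + w n.+1.
Proof. by rewrite /w exprS; field; rewrite expf_neq0. Qed.

Let hE n : h n = h n.+1 + h n.+1.
Proof. by rewrite /h exprS; field; rewrite expf_neq0. Qed.

Let w_gt0 n : 0 < w n.
Proof. by rewrite divr_gt0 ?exprn_gt0// subr_gt0. Qed.

Let h_gt0 n : 0 < h n.
Proof. by rewrite divr_gt0 ?exprn_gt0// subr_gt0. Qed.

Let step n p : good n p -> exists q, good n.+1 q /\ inside n p q.
Proof.
case: p => a b [/= G1 G2 G3 G4 G5].
have W := w_gt0 n.+1; have H := h_gt0 n.+1; have EW := wE n; have EH := hE n.
have Hc : cont_rect f a (a + w n) b (b + h n).
  by apply: holo_cont; apply: holo_on_sub hf.
have Hsub a0 a1 : a <= a0 -> a1 <= a + w n -> cont_rect f a0 a1 b (b + h n).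
  move=> h1 h2; apply: holo_cont; apply: holo_on_sub hf; lra.
move: G1; rewrite (@rect_splitx _ f a (a + w n) b (b + h n) (a + w n.+1)); try lra; last exact: Hc.
rewrite (@rect_splity _ f a (a + w n.+1) b (b + h n) (b + h n.+1)); try lra; last by apply: Hsub; lra.
rewrite (@rect_splity _ f (a + w n.+1) (a + w n) b (b + h n) (b + h n.+1)); try lra; last by apply: Hsub; lra.
rewrite addrA => /quarter_ge.
have -> : e0 / 4 ^+ n / 4 = e0 / 4 ^+ n.+1 by rewrite exprSr invfM mulrA.
have EA : a + w n = a + w n.+1 + w n.+1 by rewrite EW addrA.
have EB : b + h n = b + h n.+1 + h n.+1 by rewrite EH addrA.
case => G1.
- exists (a, b); split; split => //=; lra.
- exists (a, b + h n.+1); split; split => //=; [rewrite -EB//|lra..].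
- exists (a + w n.+1, b); split; split => //=; [rewrite -EA//|lra..].
- exists (a + w n.+1, b + h n.+1); split; split => //=; [rewrite -EA -EB//|lra..].
Qed.

(** Bisection. Some quarter of a good rectangle is good, and the nested sequence shrinks to a point
    where f is affine up to o(|h|). Affine functions integrate to 0 and the remainder is too small
    for the share [e0 / 4 ^+ n]. *)
Lemma goursat : rect f x0 x1 y0 y1 = 0.
Proof.
apply/eqP; rewrite -cabs_eq0; apply/negP => /negP E0.
have e00 : 0 < e0 by rewrite lt_def E0 cabs_ge0.
have /choice[g Hg] : forall np : nat * (R * R), exists q,
    good np.1 np.2 -> good np.1.+1 q /\ inside np.1 np.2 q.
  move=> [n p] /=; have [G|G] := pselect (good n p); last by exists p.
  by have [q Hq] := step G; exists q.
pose u := fix u n := if n is m.+1 then g (m, u m) else (x0, y0).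
have G n : good n (u n).
  elim: n => [|n IH]; last by have [] := Hg (n, u n) IH.
  split => //=; rewrite /w /h expr0 ?divr1; try lra.
  by rewrite (addrC x0) subrK (addrC y0) subrK.
have I n : inside n (u n) (u n.+1) by have [] := Hg (n, u n) (G n).
have M n m : [/\ (u n).1 <= (u (n + m)%N).1, (u (n + m)%N).1 + w (n + m)%N <= (u n).1 + w n,
    (u n).2 <= (u (n + m)%N).2 & (u (n + m)%N).2 + h (n + m)%N <= (u n).2 + h n].
  elim: m => [|m IH]; first (by rewrite addn0; split; rewrite lexx).
  rewrite addnS; case: IH => h1 h2 h3 h4; move: (I (n + m)%N); rewrite /inside => -[h5 h6 h7 h8].
  by split; lra.
have Mle n m : (u m).1 <= (u n).1 + w n /\ (u m).2 <= (u n).2 + h n.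
  have [nm|/ltnW nm] := leqP n m.
    have := M n (m - n)%N; rewrite subnKC// => -[h1 h2 h3 h4].
    by have := w_gt0 m; have := h_gt0 m; split; lra.
  have := M m (n - m)%N; rewrite subnKC// => -[h1 h2 h3 h4].
  by have := w_gt0 n; have := h_gt0 n; split; lra.
have [X X1] : exists X : R, forall n, (u n).1 <= X <= (u n).1 + w n.
  exists (sup (range (fun n => (u n).1))) => n; apply/andP; split.
    by apply: ub_le_sup; [exists ((u 0%N).1 + w 0) => _ [m _ <-]; case: (Mle 0%N m)|exists n].
  by apply: ge_sup; [exists (u 0%N).1; exists 0%N|move=> _ [m _ <-]; case: (Mle n m)].
have [Y Y1] : exists Y : R, forall n, (u n).2 <= Y <= (u n).2 + h n.
  exists (sup (range (fun n => (u n).2))) => n; apply/andP; split.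
    by apply: ub_le_sup; [exists ((u 0%N).2 + h 0) => _ [m _ <-]; case: (Mle 0%N m)|exists n].
  by apply: ge_sup; [exists (u 0%N).2; exists 0%N|move=> _ [m _ <-]; case: (Mle n m)].
have [d /cderP D] : exists d, cder f (X +i* Y) d.
  have := X1 0%N; have := Y1 0%N; rewrite /w /h expr0 !divr1 /= => /andP[k1 k2] /andP[k3 k4].
  rewrite (addrC x0) subrK in k4; rewrite (addrC y0) subrK in k2.
  by apply: hf; apply/andP; split; assumption.
pose L := (x1 - x0) + (y1 - y0).
have L0 : 0 < L by rewrite addr_gt0 ?subr_gt0.
(* The contour bound at generation n is then 4 e (L / 2^n)^2, that is half of e0 / 4^n. *)
pose e := e0 / (8 * L ^+ 2).
have e_gt0 : 0 < e by rewrite divr_gt0// mulr_gt0// exprn_gt0.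
have [r r0 {}D] := D _ e_gt0.
have [n Ln] : exists n, L / 2 ^+ n < r.
  have [n Hn] : exists n : nat, L / r < n%:R.
    by exists (Num.truncn (L / r)).+1; have := @truncnS_gt _ (L / r).
  exists n; rewrite ltr_pdivrMr ?exprn_gt0// mulrC -ltr_pdivrMr//.
  apply: (lt_le_trans Hn); rewrite -natrX ler_nat.
  by rewrite ltnW// ltn_expl.
have LE : w n + h n = L / 2 ^+ n by rewrite /w /h /L -mulrDl.
move: (G n); rewrite /good => -[G1 G2 G3 G4 G5].
set a := (u n).1 in G1 G2 G3; set b := (u n).2 in G1 G4 G5.
have Wn := w_gt0 n; have Hn := h_gt0 n.
pose z0 : C := X +i* Y.
pose aff (z : C) : C := (f z0 - d * z0) + d * z.
pose rho (z : C) : C := f z - aff z.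
have hfn : holo_on f a (a + w n) b (b + h n) by apply: holo_on_sub hf.
have Caff : forall z : C, {for z, continuous aff}.
  move=> z; have Daff := cderD (cder_cst (f z0 - d * z0) z) (cderMl d (cder_id z)).
  exact: (cder_continuous Daff).
have Crho : cont_bd rho a (a + w n) b (b + h n).
  by move=> x y hx' hy' _; exact: (cvgCB (holo_cont hfn hx' hy') (Caff _)).
have Ef : rect f a (a + w n) b (b + h n) = rect rho a (a + w n) b (b + h n).
  have -> : rect rho a (a + w n) b (b + h n)
      = rect aff a (a + w n) b (b + h n) + rect rho a (a + w n) b (b + h n).
    by rewrite rect_affine ?add0r//; lra.
  rewrite -rectD; [|lra|lra|by move=> x y _ _ _; exact: Caff|exact: Crho].
  apply: eq_rect; [lra|lra|].
  by move=> x y _ _ _; rewrite /rho [in RHS]addrC subrK.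
have Brho : on_bd (fun z => cabs (rho z) <= e * (L / 2 ^+ n)) a (a + w n) b (b + h n).
  move=> x y /andP[xa xb] /andP[ya yb] _.
  have zz : cabs ((x +i* y : C) - z0) <= L / 2 ^+ n.
    apply: (le_trans (cabs_le_ReIm _)); rewrite -LE /z0 /=.
    have /andP[k1 k2] := X1 n; have /andP[k3 k4] := Y1 n.
    rewrite -/a -/b in k1 k2 k3 k4.
    by rewrite lerD// ler_norml; apply/andP; split; lra.
  have := D ((x +i* y : C) - z0) (le_lt_trans zz Ln); rewrite (addrC (X +i* Y)) subrK.
  have -> : rho (x +i* y) = f (x +i* y) - f (X +i* Y) - d * ((x +i* y : C) - z0).
    by rewrite /rho /aff /z0; ring.
  by move/le_trans; apply; rewrite ler_pM2l.
have := cabs_rect_le _ _ Crho Brho.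
rewrite -Ef => /(_ ltac:(lra) ltac:(lra)) H.
have : e0 / 4 ^+ n <= 4 * (e * (L / 2 ^+ n)) * (L / 2 ^+ n).
  apply: (le_trans G1); apply: (le_trans H).
  by rewrite (addrC a) addrK (addrC b) addrK LE.
have E4 : (4 : R) ^+ n = 2 ^+ n * 2 ^+ n by rewrite -exprMn -natrM.
rewrite E4.
have -> : 4 * (e * (L / 2 ^+ n)) * (L / 2 ^+ n) = (e0 / (2 ^+ n * 2 ^+ n)) / 2.
  by rewrite /e; field; rewrite expf_neq0// gt_eqF.
have P : 0 < e0 / (2 ^+ n * 2 ^+ n) by rewrite divr_gt0// mulr_gt0// exprn_gt0.
lra.
Qed.

End Bisection.

End Goursat.

(** * Cauchy's formula and winding integrals *)

Section CauchyFormula.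
Variable R : realType.
Local Notation C := (R[i]^o).
Implicit Types (f g H : C -> C).

Definition winding (z0 : C) x0 x1 y0 y1 : C := rect (fun w => (w - z0)^-1) x0 x1 y0 y1.

Lemma cder_div_sub H (z0 w d : C) : w != z0 -> cder H w d ->
  exists d', cder (fun w => (H w - H z0) / (w - z0)) w d'.
Proof.
move=> wz Hw.
have A := cderB Hw (cder_cst (H z0) w).
by eexists; exact: (cderM A (cderV_sub wz)).
Qed.

(** The difference quotient [g] of [H] at the point, completed by the derivative, is continuous, and
    holomorphic elsewhere, so its contour integral vanishes. The winding integral stays as a factor:
    it is computed exactly for centred squares and bounded below for other rectangles. *)
Lemma cauchy_formula H (a b x0 x1 y0 y1 : R) : x0 < a < x1 -> y0 < b < y1 ->
  holo_on H x0 x1 y0 y1 ->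
  rect (fun w => H w / (w - (a +i* b))) x0 x1 y0 y1
  = H (a +i* b) * winding (a +i* b) x0 x1 y0 y1.
Proof.
move=> /andP[xa ax] /andP[yb by1] HH.
pose z0 : C := a +i* b; rewrite -/z0.
have [d0 D0] : exists d, cder H z0 d by apply: HH; rewrite !ltW.
pose g (w : C) : C := if w == z0 then d0 else (H w - H z0) / (w - z0).
have gE (w : C) : w != z0 -> g w = (H w - H z0) / (w - z0) by rewrite /g => /negbTE ->.
have gder (x y : R) : x0 <= x <= x1 -> y0 <= y <= y1 -> (x +i* y : C) != z0 ->
    exists d, cder g (x +i* y) d.
  move=> hx hy hz; have [d Dd] := HH x y hx hy.
  have [d' Dd'] := cder_div_sub hz Dd; exists d'.
  have r0 : 0 < cabs ((x +i* y : C) - z0) by rewrite cabs_gt0 subr_eq0.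
  apply: (cder_near r0 _ Dd') => w wz; apply: gE.
  by apply: contraTneq wz => ->; rewrite -leNgt cabsC.
have [r r0 gb] : exists2 r : R, 0 < r & forall w : C, cabs (w - z0) < r -> cabs (g w - d0) <= 1.
  move/cderP: D0 => /(_ 1 ltr01)[r r0 Hr]; exists r => // w wr.
  have [->|wz] := eqVneq w z0; first by rewrite /g eqxx subrr cabs0.
  rewrite gE// -(@ler_pM2r _ (cabs (w - z0))) ?cabs_gt0 ?subr_eq0// -cabsM.
  have := Hr (w - z0) wr; rewrite (addrC z0) subrK.
  by rewrite mulrBl divfK// subr_eq0.
have gcont : {for z0, continuous g}.
  apply/(cvgCP (F := nbhs z0)) => e e0; apply/nbhsCP.
  have e2 : 0 < e / 2 by rewrite divr_gt0.
  move/cderP: D0 => /(_ _ e2)[s s0 Hs]; exists s => // w ws.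
  rewrite [g z0]/g eqxx.
  have [->|wz] := eqVneq w z0; first by rewrite /g eqxx subrr cabs0.
  rewrite gE// -(@ltr_pM2r _ (cabs (w - z0))) ?cabs_gt0 ?subr_eq0// -cabsM.
  have := Hs (w - z0) ws; rewrite (addrC z0) subrK.
  rewrite mulrBl divfK ?subr_eq0// => /le_lt_trans; apply.
  by rewrite ltr_pM2r ?cabs_gt0 ?subr_eq0// ltr_pdivrMr// ltr_pMr// ltr1n.
have gc : cont_rect g x0 x1 y0 y1.
  move=> x y hx hy; have [E|hz] := eqVneq (x +i* y : C) z0; first by rewrite E.
  by have [d /cder_continuous] := gder x y hx hy hz.
have xx : x0 <= x1 by lra.
have yy : y0 <= y1 by lra.
have G0 : rect g x0 x1 y0 y1 = 0.
  pose K := cabs d0 + 1.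
  have K0 : 0 < K by rewrite ltr_wpDl ?cabs_ge0.
  (* Cut out the square of half-side [t] about the point. The four surrounding rectangles vanish by
     [goursat]; the square contributes a multiple of [t], which is arbitrarily small. *)
  have small (t : R) : 0 < t -> x0 < a - t -> a + t < x1 -> y0 < b - t -> b + t < y1 ->
      t < r / 2 -> cabs (rect g x0 x1 y0 y1) <= 16 * K * t.
    move=> t0 t1 t2 t3 t4 t5.
    have csub u0 u1 v0 v1 : x0 <= u0 -> u1 <= x1 -> y0 <= v0 -> v1 <= y1 ->
        cont_rect g u0 u1 v0 v1.
      move=> h1 h2 h3 h4 x y /andP[hx hx'] /andP[hy hy'].
      by apply: gc; apply/andP; split; lra.
    have gs u0 u1 v0 v1 : x0 <= u0 -> u1 <= x1 -> y0 <= v0 -> v1 <= y1 -> u0 < u1 -> v0 < v1 ->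
        ~~ (u0 <= a <= u1) || ~~ (v0 <= b <= v1) -> rect g u0 u1 v0 v1 = 0.
      move=> h1 h2 h3 h4 h5 h6 h7; apply: goursat => // x y hx hy.
      apply: gder.
      - by case/andP: hx => hx hx'; apply/andP; split; lra.
      - by case/andP: hy => hy hy'; apply/andP; split; lra.
      by apply/eqP => -[E1 E2]; move: h7; rewrite -E1 -E2 hx hy.
    rewrite (@rect_splitx _ g x0 x1 y0 y1 (a - t)); [|lra|lra|lra|exact: gc].
    rewrite [rect g (a - t) _ _ _](@rect_splitx _ g _ _ _ _ (a + t)); [|lra|lra|lra|apply: csub; lra].
    rewrite (gs x0 (a - t)); [|lra|lra|lra|lra|lra|lra|by apply/orP; left; apply/negP => /andP[]; lra].
    rewrite (gs (a + t) x1); [|lra|lra|lra|lra|lra|lra|by apply/orP; left; apply/negP => /andP[]; lra].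
    rewrite add0r addr0.
    rewrite (@rect_splity _ g _ _ y0 y1 (b - t)); [|lra|lra|lra|apply: csub; lra].
    rewrite [rect g _ _ (b - t) _](@rect_splity _ g _ _ _ _ (b + t)); [|lra|lra|lra|apply: csub; lra].
    rewrite (gs _ _ y0 (b - t)); [|lra|lra|lra|lra|lra|lra|by apply/orP; right; apply/negP => /andP[]; lra].
    rewrite (gs _ _ (b + t) y1); [|lra|lra|lra|lra|lra|lra|by apply/orP; right; apply/negP => /andP[]; lra].
    rewrite add0r addr0.
    have B : on_bd (fun z => cabs (g z) <= K) (a - t) (a + t) (b - t) (b + t).
      move=> x y /andP[hx hx'] /andP[hy hy'] _.
      have : cabs ((x +i* y : C) - z0) < r.
        apply: (le_lt_trans (cabs_le_ReIm _)) => /=.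
        have h1 : `|x - a| <= t by rewrite ler_norml; apply/andP; split; lra.
        have h2 : `|y - b| <= t by rewrite ler_norml; apply/andP; split; lra.
        lra.
      move=> /gb hg; have := cabs_ge_sub (g (x +i* y)) d0; rewrite /K; lra.
    have Cb : cont_bd g (a - t) (a + t) (b - t) (b + t).
      by apply: cont_rect_bd; apply: csub; lra.
    have xx' : a - t <= a + t by lra.
    have yy' : b - t <= b + t by lra.
    apply: (le_trans (cabs_rect_le xx' yy' Cb B)).
    have -> : a + t - (a - t) + (b + t - (b - t)) = 4 * t by ring.
    by rewrite mulrA; lra.
  apply/eqP; rewrite -cabs_eq0; apply/eqP/le_anti/andP; split; last exact: cabs_ge0.
  apply/ler_addgt0Pr => e e0; rewrite add0r.
  pose t := Num.min (Num.min ((a - x0) / 2) ((x1 - a) / 2))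
     (Num.min (Num.min ((b - y0) / 2) ((y1 - b) / 2)) (Num.min (r / 4) (e / (16 * K)))).
  have K16 : 0 < 16 * K by rewrite mulr_gt0.
  have t0 : 0 < t by rewrite !lt_min !divr_gt0//; lra.
  have [h1 h2 h3 h4 [h5 h6]] : [/\ t <= (a - x0) / 2, t <= (x1 - a) / 2, t <= (b - y0) / 2,
      t <= (y1 - b) / 2 & t <= r / 4 /\ t <= e / (16 * K)].
    by rewrite /t !ge_min !lexx ?orbT.
  rewrite ler_pdivlMr// mulrC in h6.
  by apply: (le_trans (small t _ _ _ _ _ _)) => //; lra.
have off : on_bd (fun w => w != z0) x0 x1 y0 y1.
  move=> x y hx hy bd; apply/eqP => -[E1 E2].
  by move: bd; rewrite E1 E2 (gt_eqF xa) (lt_eqF ax) (gt_eqF yb) (lt_eqF by1).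
have Cinv : cont_bd (fun w : C => (w - z0)^-1) x0 x1 y0 y1.
  by move=> x y hx hy bd; exact: (cder_continuous (cderV_sub (off x y hx hy bd))).
have Cinv' : cont_bd (fun w : C => H z0 * (w - z0)^-1) x0 x1 y0 y1.
  move=> x y hx hy bd.
  exact: (cder_continuous (cderMl (H z0) (cderV_sub (off x y hx hy bd)))).
rewrite /winding -(rectZ _ xx yy Cinv).
transitivity (rect g x0 x1 y0 y1 + rect (fun w => H z0 * (w - z0)^-1) x0 x1 y0 y1); last first.
  by rewrite G0 add0r.
rewrite -(rectD xx yy (cont_rect_bd gc) Cinv').
apply: (eq_rect xx yy) => x y hx hy bd.
by rewrite (gE _ (off x y hx hy bd)) mulrBl subrK.
Qed.

Lemma ReV_sub (x y a b : R) : complex.Re (((x +i* y : C) - (a +i* b))^-1)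
  = (x - a) / ((x - a) ^+ 2 + (y - b) ^+ 2).
Proof. by []. Qed.

Lemma ImV_sub (x y a b : R) : complex.Im (((x +i* y : C) - (a +i* b))^-1)
  = (b - y) / ((x - a) ^+ 2 + (y - b) ^+ 2).
Proof. by rewrite -[b - y]opprB mulNr. Qed.

Lemma cont_ratio (k a c : R) : c != 0 ->
  forall x, {for x, continuous (fun x => k / ((x - a) ^+ 2 + c ^+ 2))}.
Proof.
move=> c0 x; apply: cvgM; first exact: cvg_cst.
apply: cvgV; first by rewrite gt_eqF// ltr_wpDl ?sqr_ge0// exprn_even_gt0.
apply: cvgD; last exact: cvg_cst.
exact: (cvgM (cvgB cvg_id (cvg_cst a)) (cvgB cvg_id (cvg_cst a))).
Qed.

Lemma Rint_ratioN (k a c u v : R) : c != 0 ->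
  \int[@lebesgue_measure R]_(x in `[u, v]) (- k / ((x - a) ^+ 2 + c ^+ 2))
  = - \int[@lebesgue_measure R]_(x in `[u, v]) (k / ((x - a) ^+ 2 + c ^+ 2)).
Proof.
move=> c0.
have I := integrable_cont (fun (x : R) (_ : u <= x <= v) => @cont_ratio k a c c0 x).
rewrite -[RHS]mulN1r; transitivity (\int[@lebesgue_measure R]_(x in `[u, v])
  (-1 * (k / ((x - a) ^+ 2 + c ^+ 2)))); last by rewrite (@RintegralZl _ _ _ _ _ _ (-1)).
by apply: eq_Rintegral => x _; rewrite mulN1r mulNr.
Qed.

Lemma Im_winding (a b x0 x1 y0 y1 : R) : x0 < a -> y1 > b ->
  complex.Im (winding (a +i* b) x0 x1 y0 y1)
  = \int[@lebesgue_measure R]_(x in `[x0, x1]) ((b - y0) / ((x - a) ^+ 2 + (y0 - b) ^+ 2))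
  + \int[@lebesgue_measure R]_(x in `[x0, x1]) ((y1 - b) / ((x - a) ^+ 2 + (y1 - b) ^+ 2))
  + (\int[@lebesgue_measure R]_(y in `[y0, y1]) ((x1 - a) / ((y - b) ^+ 2 + (x1 - a) ^+ 2))
  + \int[@lebesgue_measure R]_(y in `[y0, y1]) ((a - x0) / ((y - b) ^+ 2 + (x0 - a) ^+ 2))).
Proof.
move=> xa yb.
rewrite /winding /rect ImD ImM !ImD !ImN ReD ReN.
have -> : complex.Re ('i : C) = 0 by [].
have -> : complex.Im ('i : C) = 1 by [].
rewrite mul0r add0r mul1r.
have c1 : y1 - b != 0 by rewrite subr_eq0 gt_eqF.
have c2 : x0 - a != 0 by rewrite subr_eq0 lt_eqF.
have := @Rint_ratioN (b - y1) a _ x0 x1 c1; rewrite opprB => ->.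
have := @Rint_ratioN (x0 - a) b _ y0 y1 c2; rewrite opprB => ->.
congr (_ - _ + (_ - _)); apply: eq_Rintegral => t _; rewrite ?ImV_sub ?ReV_sub //.
- by rewrite [(x1 - a) ^+ 2 + _]addrC.
- by rewrite [(x0 - a) ^+ 2 + _]addrC.
Qed.

(** The integrand is at least t / (2 T^2) on an interval of length at least 2 t. *)
Lemma Rint_ratio_ge (k a c u v t T : R) : u <= v -> t <= k -> 0 < t -> 0 < c ^+ 2 <= T ^+ 2 ->
  2 * t <= v - u -> 0 < T -> a - T <= u -> v <= a + T ->
  t ^+ 2 / T ^+ 2 <= \int[@lebesgue_measure R]_(x in `[u, v]) (k / ((x - a) ^+ 2 + c ^+ 2)).
Proof.
move=> uv tk t0 /andP[c0 cT] uvt T0 aT vT.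
apply: (@le_trans _ _ (t / (2 * T ^+ 2) * (v - u))).
  have -> : t ^+ 2 / T ^+ 2 = t / (2 * T ^+ 2) * (2 * t) by field; rewrite gt_eqF.
  by rewrite ler_wpM2l// divr_ge0 ?mulr_ge0 ?sqr_ge0// ltW.
have c00 : c != 0 by apply: contraTneq c0 => ->; rewrite expr0n ltxx.
rewrite -Rint_cst//; apply: le_Rintegral => //.
- by apply: integrable_cont => x _; exact: cst_continuous.
- by apply: integrable_cont => x _; exact: cont_ratio.
move=> x /=; rewrite in_itv /= => /andP[ux xv].
have xT : (x - a) ^+ 2 <= T ^+ 2.
  rewrite -[(x - a) ^+ 2]real_normK ?num_real// lerXn2r ?nnegrE ?normr_ge0 ?(ltW T0)//.
  by rewrite ler_norml; apply/andP; split; lra.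
have P : 0 < (x - a) ^+ 2 + c ^+ 2 by rewrite ltr_wpDl ?sqr_ge0.
apply: ler_pM => //; [exact: ltW|by rewrite invr_ge0 mulr_ge0// sqr_ge0|].
rewrite lef_pV2 ?posrE// ?mulr_gt0 ?exprn_gt0//; lra.
Qed.

(** All four sides contribute positively to the imaginary part. A crude lower bound is enough to
    solve Cauchy's formula for the value at a point that is not the centre of the rectangle. *)
Lemma Im_winding_ge (a b x0 x1 y0 y1 t T : R) : 0 < t ->
  x0 <= a - t -> a + t <= x1 -> y0 <= b - t -> b + t <= y1 ->
  a - T <= x0 -> x1 <= a + T -> b - T <= y0 -> y1 <= b + T ->
  4 * (t ^+ 2 / T ^+ 2) <= complex.Im (winding (a +i* b) x0 x1 y0 y1).
Proof.
move=> t0 h1 h2 h3 h4 h5 h6 h7 h8.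
rewrite Im_winding; [|lra|lra].
have T0 : 0 < T by lra.
have sq (c : R) : t <= `|c| -> `|c| <= T -> 0 < c ^+ 2 <= T ^+ 2.
  move=> tc cT; rewrite -[c ^+ 2]real_normK ?num_real// exprn_gt0 ?(lt_le_trans t0)//=.
  by rewrite lerXn2r// nnegrE// ltW.
have A1 : t ^+ 2 / T ^+ 2 <= \int[@lebesgue_measure R]_(x in `[x0, x1])
    ((b - y0) / ((x - a) ^+ 2 + (y0 - b) ^+ 2)).
  apply: Rint_ratio_ge; try lra.
  by apply: sq; rewrite ler0_norm; lra.
have A2 : t ^+ 2 / T ^+ 2 <= \int[@lebesgue_measure R]_(x in `[x0, x1])
    ((y1 - b) / ((x - a) ^+ 2 + (y1 - b) ^+ 2)).
  apply: Rint_ratio_ge; try lra.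
  by apply: sq; rewrite ger0_norm; lra.
have A3 : t ^+ 2 / T ^+ 2 <= \int[@lebesgue_measure R]_(y in `[y0, y1])
    ((x1 - a) / ((y - b) ^+ 2 + (x1 - a) ^+ 2)).
  apply: Rint_ratio_ge; try lra.
  by apply: sq; rewrite ger0_norm; lra.
have A4 : t ^+ 2 / T ^+ 2 <= \int[@lebesgue_measure R]_(y in `[y0, y1])
    ((a - x0) / ((y - b) ^+ 2 + (x0 - a) ^+ 2)).
  apply: Rint_ratio_ge; try lra.
  by apply: sq; rewrite ler0_norm; lra.
have -> : 4 * (t ^+ 2 / T ^+ 2)
  = t ^+ 2 / T ^+ 2 + t ^+ 2 / T ^+ 2 + (t ^+ 2 / T ^+ 2 + t ^+ 2 / T ^+ 2) by ring.
by rewrite !lerD.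
Qed.

Lemma Rint_atan (a t : R) : 0 < t ->
  \int[@lebesgue_measure R]_(x in `[a - t, a + t]) (t / ((x - a) ^+ 2 + t ^+ 2)) = pi / 2.
Proof.
move=> t0; have tn : t != 0 by rewrite gt_eqF.
have ab : a - t < a + t by lra.
have HD x : is_derive x (1 : R) (fun x => atan ((x - a) / t)) (t / ((x - a) ^+ 2 + t ^+ 2)).
  have D : is_derive x (1 : R) (fun x => (x - a) / t) (t^-1).
    apply: (@rder_quadratic _ _ _ _ 0) => // h; rewrite mul0r normr_le0.
    by apply/eqP; field.
  have := @is_derive1_comp R atan (fun x => (x - a) / t) x _ _ (is_derive1_atan _) D.
  suff -> : (1 + ((x - a) / t) ^+ 2)^-1 * t^-1 = t / ((x - a) ^+ 2 + t ^+ 2) by [].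
  have P : 0 < (x - a) ^+ 2 + t ^+ 2 by rewrite ltr_wpDl ?sqr_ge0// exprn_gt0.
  have E : 1 + ((x - a) / t) ^+ 2 = ((x - a) ^+ 2 + t ^+ 2) / t ^+ 2 by field.
  by rewrite E; field; rewrite tn gt_eqF.
rewrite (Rint_FTC ab HD (@cont_ratio t a t tn)).
have -> : (a + t - a) / t = 1 by field.
have -> : (a - t - a) / t = - 1 by field.
by rewrite atanN atan1; field.
Qed.

(** Each side is seen from the centre under a right angle and adds 2 arctan 1 = pi / 2 to the
    imaginary part; the real contributions of opposite sides cancel. *)
Lemma winding_square (a b t : R) : 0 < t ->
  winding (a +i* b) (a - t) (a + t) (b - t) (b + t) = 'i * (2 * pi)%:C.
Proof.
move=> t0; apply: eq_complexP; last first.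
  rewrite Im_winding; [|lra|lra].
  have -> : b - (b - t) = t by ring.
  have -> : b - t - b = - t by ring.
  have -> : b + t - b = t by ring.
  have -> : a - (a - t) = t by ring.
  have -> : a - t - a = - t by ring.
  have -> : a + t - a = t by ring.
  by rewrite sqrrN !Rint_atan// ImM /= mul0r add0r mul1r; field.
rewrite /winding /rect ReD ReM !ReD !ReN ImD ImN.
have -> : complex.Re ('i : C) = 0 by [].
have -> : complex.Im ('i : C) = 1 by [].
rewrite ReM /= mul0r mulr0 subr0 mul0r mul1r sub0r.
rewrite -[RHS](subrr 0); congr (_ - _); apply/eqP; rewrite subr_eq0; apply/eqP.
- apply: eq_Rintegral => x _.
  apply: etrans (ReV_sub x (b - t) a b) _; apply: etrans _ (esym (ReV_sub x (b + t) a b)).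
  congr (_ / (_ + _)).
  have -> : b - t - b = - t by ring.
  have -> : b + t - b = t by ring.
  by rewrite sqrrN.
- apply: eq_Rintegral => x _.
  apply: etrans (ImV_sub (a + t) x a b) _; apply: etrans _ (esym (ImV_sub (a - t) x a b)).
  congr (_ / (_ + _)).
  have -> : a - t - a = - t by ring.
  have -> : a + t - a = t by ring.
  by rewrite sqrrN.
Qed.

End CauchyFormula.

#[global] Existing Instance summability.totally_filter.

(** * Finite partial sums, unordered sums and products *)

Section FiniteSums.
Variable R : realType.
Local Notation C := (R[i]^o).
Variable T : choiceType.
Implicit Types (S : set T) (g : T -> R) (a : T -> C) (F : {fset T}).

Definition psum S g F : R := \sum_(l <- F | l \in S) g l.

Definition csum S a F : C := \sum_(l <- F | l \in S) a l.

Lemma psum_ge0 S g F : (forall l, S l -> 0 <= g l) -> 0 <= psum S g F.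
Proof. by move=> g0; apply: sumr_ge0 => l /set_mem; exact: g0. Qed.

Lemma psum_fsetI S g F : psum S g F = \sum_(l \in [set` F] `&` S) g l.
Proof.
by rewrite /psum big_mkcond /= fsbig_mkcondr /= fsbig_finite//= set_fsetK.
Qed.

(** The bridge between sums in the extended reals and uniform bounds on finite real sums;
    summability is handled in the latter form. *)
Lemma esum_le_psum S g (V : R) : (forall l, S l -> 0 <= g l) ->
  (\esum_(l in S) (g l)%:E <= V%:E)%E <-> forall F, psum S g F <= V.
Proof.
move=> g0; split.
- move=> H F; rewrite -lee_fin; apply: le_trans H; rewrite psum_fsetI.
  have fin : finite_set ([set` F] `&` S) by apply: finite_setIl; exact: finite_fset.
  by apply: esum_ge; exists ([set` F] `&` S); [split|rewrite fsumEFin].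
- move=> H; apply: ge_ereal_sup => _ [X [finX XS] <-].
  rewrite fsumEFin// lee_fin.
  apply: le_trans (H (fset_set X)); rewrite psum_fsetI fset_setK//.
  by rewrite (setIidl XS).
Qed.

Lemma big_fset_split (A : Type) (idx : A) (op : Monoid.com_law idx) (F0 F : {fset T})
    (P : pred T) (G : T -> A) : (F0 `<=` F)%fset ->
  \big[op/idx]_(l <- F | P l) G l
  = op (\big[op/idx]_(l <- F0 | P l) G l) (\big[op/idx]_(l <- (F `\` F0)%fset | P l) G l).
Proof.
move=> F0F; rewrite (bigID (fun l => l \in F0)) /=; congr (op _ _).
- rewrite big_fset_condE [RHS]big_fset_condE; congr (bigop _ _ _).
  congr enum_fset; apply/fsetP => x; rewrite !inE /=.
  case xF0 : (x \in F0); last by rewrite !andbF.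
  by rewrite (fsubsetP F0F _ xF0) andbT.
- rewrite big_fset_condE [RHS]big_fset_condE; congr (bigop _ _ _).
  congr enum_fset; apply/fsetP => x; rewrite !inE /=.
  by case: (x \in F); rewrite ?andbF //= andbT andbC.
Qed.

Lemma psum_split S g F0 F : (F0 `<=` F)%fset ->
  psum S g F = psum S g F0 + psum S g (F `\` F0)%fset.
Proof. by move=> F0F; rewrite /psum (big_fset_split _ _ _ F0F). Qed.

Lemma csum_split S a F0 F : (F0 `<=` F)%fset ->
  csum S a F = csum S a F0 + csum S a (F `\` F0)%fset.
Proof. by move=> F0F; rewrite /csum (big_fset_split _ _ _ F0F). Qed.

Lemma psum_tail S g (V : R) : (forall l, S l -> 0 <= g l) -> (forall F, psum S g F <= V) ->
  forall e : R, 0 < e -> exists F0 : {fset T}, forall F : {fset T},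
    (forall x, x \in F -> x \notin F0) -> psum S g F < e.
Proof.
move=> g0 gV e e0.
have hs : has_sup [set psum S g F | F in [set: {fset T}]].
  split; first by exists (psum S g fset0); exists fset0.
  by exists V => _ [F _ <-].
have [_ [F0 _ <-] HF0] := sup_adherent e0 hs.
exists F0 => F dis.
have : psum S g (F0 `|` F)%fset <= sup [set psum S g F | F in [set: {fset T}]].
  by apply: ub_le_sup; [case: hs|exists (F0 `|` F)%fset].
rewrite (psum_split _ _ (fsubsetUl F0 F)).
have -> : ((F0 `|` F) `\` F0 = F)%fset.
  apply/fsetP => x; rewrite !inE; case xF : (x \in F); last by rewrite orbF andNb.
  by rewrite orbT andbT dis.
lra.
Qed.

Lemma near_totally (P : {fset T} -> Prop) :
  (\forall F \near summability.totally, P F) <->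
  exists F0 : {fset T}, forall F, (F0 `<=` F)%fset -> P F.
Proof.
split; first by move=> [F0 _ H]; exists F0.
by move=> [F0 H]; exists F0.
Qed.

Lemma le_psum S g g' F : (forall l, S l -> g l <= g' l) -> psum S g F <= psum S g' F.
Proof. by move=> H; apply: ler_sum => l /set_mem; exact: H. Qed.

Lemma psumD S g g' F : psum S (fun l => g l + g' l) F = psum S g F + psum S g' F.
Proof. exact: big_split. Qed.

Lemma psumZ S (k : R) g F : psum S (fun l => k * g l) F = k * psum S g F.
Proof. by rewrite /psum mulr_sumr. Qed.

Lemma cabs_csum S a F : cabs (csum S a F) <= psum S (fun l => cabs (a l)) F.
Proof. exact: cabs_sum. Qed.

Lemma csum_cvg S a (V : R) : (forall F, psum S (fun l => cabs (a l)) F <= V) ->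
  exists2 L : C, csum S a @ summability.totally --> L & cabs L <= V.
Proof.
move=> H.
have [L HL] : exists L : C, csum S a @ summability.totally --> L.
  apply: cauchy_cvgC => e e0.
  have [F0 HF0] := psum_tail (fun l _ => cabs_ge0 (a l)) H e0.
  exists (csum S a F0); apply/near_totally; exists F0 => F F0F.
  rewrite (csum_split _ _ F0F) addrC addKr.
  apply: le_lt_trans (cabs_csum _ _ _) _; apply: HF0 => x.
  by rewrite inE => /andP[].
exists L => //; apply: (cvgC_le HL); apply/near_totally; exists fset0 => F _.
exact: le_trans (cabs_csum _ _ _) (H F).
Qed.

Lemma expRB1_le (x : R) : 0 <= x <= 2^-1 -> expR x - 1 <= 2 * x.
Proof.
move=> /andP[x0 x2].
have := expR_ge1Dx (- x); rewrite expRN => H.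
have E0 := expR_gt0 x.
have : (1 - x) * expR x <= 1 by rewrite -ler_pdivlMr// mul1r.
nra.
Qed.

Lemma cabs_prod1_le (I : Type) (r : seq I) (P : pred I) (u : I -> C) :
  cabs (\prod_(i <- r | P i) (1 + u i)) <= expR (\sum_(i <- r | P i) cabs (u i)).
Proof.
elim/big_rec2: _ => [|i x y _ H]; first by rewrite cabs1 expR0.
rewrite cabsM expRD; apply: ler_pM; rewrite ?cabs_ge0//.
by apply: (le_trans (cabsD _ _)); rewrite cabs1 expR_ge1Dx.
Qed.

Lemma cabs_prod1B1 (I : Type) (r : seq I) (P : pred I) (u : I -> C) :
  cabs (\prod_(i <- r | P i) (1 + u i) - 1) <= expR (\sum_(i <- r | P i) cabs (u i)) - 1.
Proof.
elim/big_rec2: _ => [|i x y _ H]; first by rewrite subrr cabs0 expR0 subrr.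
have -> : (1 + u i) * y - 1 = (y - 1) * (1 + u i) + u i by ring.
apply: (le_trans (cabsD _ _)); rewrite cabsM expRD.
have h1 : cabs (1 + u i) <= 1 + cabs (u i) by rewrite (le_trans (cabsD _ _))// cabs1.
have h2 := expR_ge1Dx (cabs (u i)).
have h3 : cabs (y - 1) * cabs (1 + u i) <= (expR x - 1) * (1 + cabs (u i)).
  by apply: ler_pM; rewrite ?cabs_ge0.
have h4 : expR x * (1 + cabs (u i)) <= expR x * expR (cabs (u i)).
  by rewrite ler_wpM2l// expR_ge0.
rewrite mulrC; lra.
Qed.

Definition cprod S a F : C := \prod_(l <- F | l \in S) a l.

Lemma cprod_cvg S (u : T -> C) (V : R) : (forall F, psum S (fun l => cabs (u l)) F <= V) ->
  exists L : C, cprod S (fun l => 1 + u l) @ summability.totally --> L.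
Proof.
move=> H; apply: cauchy_cvgC => e e0.
(* The cap 1/2 allows exp x - 1 <= 2 x for the tail; the second bound absorbs the factor exp V that
   controls the partial product. *)
pose e1 := Num.min (2^-1) (e / (2 * (expR V + 1))).
have P0 : 0 < 2 * (expR V + 1) by rewrite mulr_gt0// addr_gt0// expR_gt0.
have e10 : 0 < e1 by rewrite lt_min invr_gt0 ltr0n divr_gt0.
have [F0 HF0] := psum_tail (fun l _ => cabs_ge0 (u l)) H e10.
exists (cprod S (fun l => 1 + u l) F0); apply/near_totally; exists F0 => F F0F.
rewrite /cprod (big_fset_split _ _ _ F0F) /=.
set A := \prod_(l <- F0 | _) _; set B := \prod_(l <- _ | _) _.
have -> : A * B - A = A * (B - 1) by ring.
rewrite cabsM.
have hA : cabs A <= expR V by apply: le_trans (cabs_prod1_le _ _ _) _; rewrite ler_expR; exact: H.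
pose x := psum S (fun l => cabs (u l)) (F `\` F0)%fset.
have xe : x < e1 by apply: HF0 => y; rewrite inE => /andP[].
have x0 : 0 <= x by apply: psum_ge0 => l _; exact: cabs_ge0.
have hB : cabs (B - 1) <= 2 * x.
  apply: le_trans (cabs_prod1B1 _ _ _) _; apply: expRB1_le; rewrite x0 /=.
  by rewrite ltW// (lt_le_trans xe)// /e1 ge_min lexx.
have xe' : x * (2 * (expR V + 1)) < e.
  rewrite -ltr_pdivlMr//; apply: (lt_le_trans xe).
  by rewrite /e1 ge_min lexx orbT.
have EV := expR_gt0 V.
have : cabs A * cabs (B - 1) <= expR V * (2 * x) by apply: ler_pM; rewrite ?cabs_ge0.
move/le_lt_trans; apply; lra.
Qed.

End FiniteSums.

(** * The square lattice and the summable kernel |l|^-3 *)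

Section Lattice.
Variable R : realType.
Local Notation C := (R[i]^o).
Local Notation L := (@Lambda R).

Definition st : R := Num.sqrt (pi / 2).

Definition lam (p : int * int) : C := (st%:C : C) * (p.1%:~R +i* p.2%:~R : C).

Lemma st_sqr : st ^+ 2 = pi / 2.
Proof. by rewrite sqr_sqrtr// divr_ge0// pi_ge0. Qed.

Lemma st_gt0 : 0 < st.
Proof. by rewrite sqrtr_gt0 divr_gt0// pi_gt0. Qed.

Lemma Lambda_lam p : L (lam p).
Proof. by exists p.1, p.2. Qed.

Lemma LambdaE l : L l -> exists p, l = lam p.
Proof. by move=> [m [n ->]]; exists (m, n). Qed.

Lemma lamE p : lam p = (st * p.1%:~R) +i* (st * p.2%:~R).
Proof. by rewrite /lam; simpc. Qed.

Lemma lamD p q : lam (p.1 + q.1, p.2 + q.2) = lam p + lam q.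
Proof. by rewrite !lamE /=; simpc; rewrite !rmorphD /= !mulrDr. Qed.

Lemma lamN p : lam (- p.1, - p.2) = - lam p.
Proof. by rewrite !lamE /=; simpc; rewrite !rmorphN /= !mulrN. Qed.

Lemma lam_rot p : lam (- p.2, p.1) = 'i * lam p.
Proof. by rewrite !lamE /=; simpc; rewrite rmorphN /= mulrN. Qed.

Lemma lam00 : lam (0, 0) = 0.
Proof. by rewrite lamE /= !mulr0. Qed.

Lemma lam_inj : injective lam.
Proof.
have s0 : st != 0 by rewrite gt_eqF// st_gt0.
move=> [m n] [m' n']; rewrite !lamE /= => -[/(mulfI s0) /intr_inj -> /(mulfI s0) /intr_inj ->].
by [].
Qed.

Lemma Lambda_add l l' : L l -> L l' -> L (l + l').
Proof. by move=> /LambdaE[p ->] /LambdaE[q ->]; rewrite -lamD; exact: Lambda_lam. Qed.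

Lemma Lambda_opp l : L l -> L (- l).
Proof. by move=> /LambdaE[p ->]; rewrite -lamN; exact: Lambda_lam. Qed.

Lemma Lambda_sub l l' : L l -> L l' -> L (l - l').
Proof. by move=> hl hl'; apply: Lambda_add => //; exact: Lambda_opp. Qed.

Lemma Lambda0 : L 0.
Proof. by rewrite -lam00; exact: Lambda_lam. Qed.

Lemma Lambda_st : L (st%:C).
Proof.
suff -> : st%:C = lam (1, 0) by exact: Lambda_lam.
by rewrite lamE /= mulr1 mulr0.
Qed.

Lemma cabs_lam p : cabs (lam p) ^+ 2 = st ^+ 2 * (p.1%:~R ^+ 2 + p.2%:~R ^+ 2).
Proof. by rewrite cabs_sqr lamE /= !exprMn mulrDr. Qed.

Lemma sqr_int_ge1 (m : int) : m != 0 -> 1 <= (m%:~R : R) ^+ 2.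
Proof.
move=> m0; rewrite -rmorphXn /= -[1]/(1%:~R) ler_int.
by rewrite -gtz0_ge1 exprn_even_gt0.
Qed.

Lemma cabs_lam_ge p : p != (0, 0) -> st <= cabs (lam p).
Proof.
move=> p0.
rewrite -(@ler_pXn2r _ 2) ?nnegrE ?cabs_ge0 ?(ltW st_gt0)// cabs_lam.
rewrite ler_pMr ?exprn_gt0 ?st_gt0//.
case: p p0 => m n /=; have [->|m0] := eqVneq m 0.
  rewrite xpair_eqE eqxx /= => n0.
  by rewrite (le_trans (sqr_int_ge1 n0))// lerDr sqr_ge0.
by move=> _; rewrite (le_trans (sqr_int_ge1 m0))// lerDl sqr_ge0.
Qed.

Lemma Lambda_ge l : L l -> l != 0 -> st <= cabs l.
Proof.
move=> /LambdaE[p ->] p0; apply: cabs_lam_ge.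
by apply: contraNneq p0 => ->; rewrite lam00.
Qed.

(** Dominates every cubic remainder met below. The value 1 at the origin makes a convolution with
    [kern] dominate the sequence itself as well. *)
Definition kern (l : C) : R := if l == 0 then 1 else (cabs l ^+ 3)^-1.

Lemma kern_ge0 l : 0 <= kern l.
Proof. by rewrite /kern; case: ifP => // _; rewrite invr_ge0 exprn_ge0// cabs_ge0. Qed.

Lemma kernN l : kern (- l) = kern l.
Proof. by rewrite /kern oppr_eq0 cabsN. Qed.

(** This is (n + 1)^(-3/2). Up to a constant, |m + i n|^-3 lies below the product of two such
    weights, so the planar sum splits into two linear ones. *)
Definition w32 (n : nat) : R := (n.+1%:R * Num.sqrt n.+1%:R)^-1.

Lemma w32_ge0 n : 0 <= w32 n.
Proof. by rewrite invr_ge0 mulr_ge0 ?sqrtr_ge0. Qed.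

(** Comparison with the integral of x^(-3/2): each term is at most the increment of -2 / sqrt x. *)
Lemma sum_w32 n : \sum_(i < n.+1) w32 i <= 3 - 2 / Num.sqrt n.+1%:R.
Proof.
elim: n => [|n IH].
  by rewrite big_ord_recl big_ord0 addr0 /w32 sqrtr1 mulr1 invr1; lra.
rewrite big_ord_recr /=; apply: (le_trans (lerD IH (lexx _))).
rewrite /w32.
have a0 : 0 < Num.sqrt (n.+1%:R : R) by rewrite sqrtr_gt0.
have b0 : 0 < Num.sqrt (n.+2%:R : R) by rewrite sqrtr_gt0.
have Ea : Num.sqrt (n.+1%:R : R) ^+ 2 = n.+1%:R by rewrite sqr_sqrtr.
have Eb : Num.sqrt (n.+2%:R : R) ^+ 2 = n.+2%:R by rewrite sqr_sqrtr.
set a := Num.sqrt _ in a0 Ea *; set b := Num.sqrt _ in b0 Eb *.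
rewrite -Eb.
have ab : b ^+ 2 = a ^+ 2 + 1 by rewrite Ea Eb natr1.
have aleb : a <= b.
  by rewrite -(@ler_pXn2r _ 2 isT a b) ?nnegrE ?(ltW a0) ?(ltW b0)// ab lerDl.
have -> : 3 - 2 / a + (b ^+ 2 * b)^-1 = 3 - 2 / b - (2 * (b - a) / (a * b) - (b ^+ 3)^-1).
  by field; rewrite !gt_eqF.
rewrite gerBl subr_ge0.
have E : b - a = (a + b)^-1.
  apply: (@mulIf _ (a + b)); first by rewrite gt_eqF// addr_gt0.
  by rewrite mulVf ?gt_eqF ?addr_gt0// (addrC a) -subr_sqr ab; ring.
rewrite E.
have -> : 2 * (a + b)^-1 / (a * b) = 2 / ((a + b) * (a * b)) by rewrite -mulrA -invfM.
rewrite -[leLHS]mul1r.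
rewrite ler_pdivrMr ?exprn_gt0// mulrAC.
rewrite ler_pdivlMr; last by rewrite !mulr_gt0// addr_gt0.
rewrite mul1r; have : a * a <= b * b by apply: ler_pM => //; exact: ltW.
have : a * b <= b * b by rewrite ler_wpM2r// ltW.
have -> : b ^+ 3 = b * (b * b) by rewrite !exprS expr0 mulr1.
nra.
Qed.

Lemma psum_w32 (F : {fset nat}) : psum setT w32 F <= 3.
Proof.
rewrite /psum (eq_bigl xpredT); last by move=> i; rewrite in_setT.
have [n Hn] : exists n, [set` F] `<=` `I_n.
  exists (\max_(i <- F) i).+1 => i /= iF; rewrite /mkset ltnS.
  by rewrite (big_rem i)//= leq_maxl.
have P i : xpredT i -> (0 <= (w32 i)%:E)%E by rewrite lee_fin w32_ge0.
have := @lee_sum_fset_nat R _ F n xpredT P Hn; rewrite !sumEFin lee_fin => /le_trans; apply.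
case: n {Hn} => [|n]; first by rewrite big_nil.
rewrite big_mkord; apply: (le_trans (sum_w32 n)).
by rewrite gerBl divr_ge0// sqrtr_ge0.
Qed.

Lemma esum_w32_int : (\esum_(m in [set: int]) (w32 `|m|%N)%:E <= 6%:E)%E.
Proof.
rewrite (esumID (range Posz)); last by move=> i _; rewrite lee_fin w32_ge0.
have -> : (6 : R) = 3 + 3 by ring.
rewrite EFinD; apply: leeD.
- rewrite setTI esum_image; last by move=> x y _ _ [].
  apply: (esum_le_psum (S := setT) (g := w32) _ _).2 => [n _|]; [exact: w32_ge0|exact: psum_w32].
- have -> : setT `&` ~` range Posz = range Negz.
    apply/seteqP; split => [[n|n] /= []|x [n _ <-]] //.
    + by move=> _ []; exists n.
    + by move=> _ _; exists n.
    + by split => // -[].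
  rewrite esum_image; last by move=> x y _ _ [].
  apply: (@le_trans _ _ (\esum_(n in [set: nat]) (w32 n)%:E)%E).
    apply: le_esum => n _; rewrite lee_fin /w32 NegzE abszN absz_nat.
    rewrite lef_pV2 ?posrE ?mulr_gt0 ?sqrtr_gt0//.
    by apply: ler_pM; rewrite ?sqrtr_ge0// ?ler_nat// ler_sqrt ?ler_nat.
  apply: (esum_le_psum (S := setT) (g := w32) _ _).2 => [n _|]; [exact: w32_ge0|exact: psum_w32].
Qed.

Lemma esum_pair (f : int -> int -> R) (a : R) : 0 <= a -> (forall m n, 0 <= f m n) ->
  (forall m n, f m n <= a * (w32 `|m|%N * w32 `|n|%N)) ->
  (\esum_(p in [set: int * int]) (f p.1 p.2)%:E <= (a * 36)%:E)%E.
Proof.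
move=> a0 f0 fa.
have -> : [set: int * int] = setT `*`` (fun=> setT).
  by apply/seteqP; split.
rewrite -(@esum_esum _ _ _ setT (fun=> setT) (fun m n => (f m n)%:E)); last first.
  by move=> i j _ _; rewrite lee_fin.
have H m : (\esum_(n in [set: int]) (f m n)%:E <= (a * 6 * w32 `|m|%N)%:E)%E.
  apply: (esum_le_psum _ _).2 => // F.
  apply: (@le_trans _ _ (psum setT (fun n : int => a * w32 `|m|%N * w32 `|n|%N) F)).
    by apply: le_psum => n _; rewrite -mulrA.
  rewrite psumZ [leRHS]mulrAC ler_wpM2l ?mulr_ge0 ?w32_ge0//.
  apply: ((esum_le_psum (S := setT) (g := fun n : int => w32 `|n|%N) 6 _).1 esum_w32_int) => n _.
  exact: w32_ge0.
apply: (@le_trans _ _ (\esum_(m in [set: int]) (a * 6 * w32 `|m|%N)%:E)%E).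
  by apply: le_esum => m _; exact: H.
have a6 : 0 <= a * 6 by rewrite mulr_ge0.
apply: (esum_le_psum _ _).2 => [m _|F]; first by rewrite mulr_ge0 ?w32_ge0.
have -> : a * 36 = a * 6 * 6 by ring.
rewrite psumZ ler_wpM2l//.
apply: ((esum_le_psum (S := setT) (g := fun n : int => w32 `|n|%N) 6 _).1 esum_w32_int) => n _.
exact: w32_ge0.
Qed.

Lemma kern_lam_le p :
  kern (lam p) <= (1 + (2 / st) ^+ 3) * (w32 `|p.1|%N * w32 `|p.2|%N).
Proof.
have s0 := st_gt0.
have c0 : 0 <= (2 / st) ^+ 3 by rewrite exprn_ge0// divr_ge0// ltW.
case: p => m n /=; have [[-> ->]|p0] := eqVneq (m, n) (0, 0).
  rewrite lam00 /kern eqxx /w32 absz0 sqrtr1 !mulr1 invr1 mulr1; lra.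
have l0 := cabs_lam_ge p0.
have lp : 0 < cabs (lam (m, n)) by exact: lt_le_trans l0.
rewrite /kern -cabs_eq0 gt_eqF//.
pose X : R := `|m|%N.+1%:R; pose Y : R := `|n|%N.+1%:R.
have X0 : 0 < X by rewrite ltr0n. have Y0 : 0 < Y by rewrite ltr0n.
pose q := Num.sqrt X * Num.sqrt Y.
have q0 : 0 < q by rewrite mulr_gt0// sqrtr_gt0.
have Em : (m%:~R : R) ^+ 2 = (X - 1) ^+ 2.
  rewrite /X -natr1 addrK natr_absz intr_norm real_normK// num_real.
have En : (n%:~R : R) ^+ 2 = (Y - 1) ^+ 2.
  rewrite /Y -natr1 addrK natr_absz intr_norm real_normK// num_real.
have S1 : 1 <= (m%:~R : R) ^+ 2 + n%:~R ^+ 2.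
  have : st ^+ 2 <= cabs (lam (m, n)) ^+ 2 by rewrite lerXn2r// nnegrE ?cabs_ge0// ltW.
  by rewrite cabs_lam ler_pMr// exprn_gt0.
(* The shift by one in [X] and [Y] is affordable because m^2 + n^2 >= 1 away from the origin; it
   follows that |lam| >= (st / 2) sqrt(X Y). *)
have XY : X * Y <= 4 * ((m%:~R : R) ^+ 2 + n%:~R ^+ 2).
  rewrite Em En in S1 *.
  have := sqr_ge0 (X - 2); have := sqr_ge0 (Y - 2); have := sqr_ge0 (X - Y).
  rewrite !expr2 in S1 *; lra.
have Q : st / 2 * q <= cabs (lam (m, n)).
  have sq0 : 0 <= st / 2 * q by rewrite mulr_ge0 ?divr_ge0 ?(ltW s0) ?(ltW q0).
  rewrite -(@ler_pXn2r _ 2 isT) ?nnegrE ?cabs_ge0//.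
  have -> : (st / 2 * q) ^+ 2 = st ^+ 2 * (X * Y / 4).
    rewrite exprMn /q [(Num.sqrt X * _) ^+ 2]exprMn.
    rewrite [Num.sqrt X ^+ 2]sqr_sqrtr ?(ltW X0)// [Num.sqrt Y ^+ 2]sqr_sqrtr ?(ltW Y0)//.
    by field.
  rewrite cabs_lam ler_wpM2l ?sqr_ge0//=; lra.
have Q3 : (st / 2 * q) ^+ 3 <= cabs (lam (m, n)) ^+ 3.
  by rewrite lerXn2r// ?nnegrE ?cabs_ge0// ?mulr_ge0 ?divr_ge0// ?(ltW s0) ?(ltW q0).
have Eq : w32 `|m|%N * w32 `|n|%N = q ^- 3.
  rewrite /w32 -/X -/Y -invfM; congr (_^-1).
  rewrite -{1}[X]sqr_sqrtr ?(ltW X0)// -{1}[Y]sqr_sqrtr ?(ltW Y0)// /q.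
  by ring.
rewrite Eq; apply: (@le_trans _ _ ((2 / st) ^+ 3 * q ^- 3)); last first.
  by rewrite ler_wpM2r ?invr_ge0 ?exprn_ge0 ?(ltW q0)// lerDr.
have -> : (2 / st) ^+ 3 * q ^- 3 = ((st / 2 * q) ^+ 3)^-1.
  by field; rewrite !gt_eqF.
have P1 : 0 < (st / 2 * q) ^+ 3 by rewrite exprn_gt0// mulr_gt0// divr_gt0.
have P2 : 0 < cabs (lam (m, n)) ^+ 3 by rewrite exprn_gt0.
by rewrite lef_pV2 ?posrE.
Qed.

Lemma Lambda_image : L = lam @` setT.
Proof.
apply/seteqP; split => [l /LambdaE[p ->]|_ [p _ <-]]; [by exists p|exact: Lambda_lam].
Qed.

Definition Kk : R := (1 + (2 / st) ^+ 3) * 36.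

Lemma Kk_ge0 : 0 <= Kk.
Proof. by rewrite !mulr_ge0// addr_ge0// exprn_ge0// divr_ge0// ltW// st_gt0. Qed.

Lemma psum_kern F : psum L kern F <= Kk.
Proof.
apply: ((esum_le_psum (S := L) (g := kern) Kk _).1 _ F) => [l _|]; first exact: kern_ge0.
rewrite Lambda_image esum_image; last by move=> x y _ _ /lam_inj.
have a0 : 0 <= 1 + (2 / st) ^+ 3 by rewrite addr_ge0// exprn_ge0// divr_ge0// ltW// st_gt0.
have := @esum_pair (fun m n => kern (lam (m, n))) _ a0 (fun m n => kern_ge0 _)
  (fun m n => kern_lam_le (m, n)).
apply: le_trans; rewrite le_eqVlt; apply/orP; left; apply/eqP.
by apply: eq_esum => -[m n].
Qed.

Lemma psum_kern_shift l' F : L l' -> psum L (fun l => kern (l - l')) F <= Kk.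
Proof.
move=> Ll'; apply: le_trans (psum_kern [fset l - l' | l in F]%fset).
rewrite /psum big_mkcond [leRHS]big_mkcond /=.
rewrite big_imfset /=; last by move=> x y _ _ /addIr.
rewrite le_eqVlt; apply/orP; left; apply/eqP/eq_bigr => l _.
suff -> : (l - l' \in L) = (l \in L) by [].
apply/idP/idP => /set_mem h; apply/mem_set; last exact: Lambda_sub.
by rewrite -(subrK l' l); exact: Lambda_add.
Qed.

End Lattice.

(** * Second-order remainders of finite products *)

Section ProductRemainder.
Variable R : realType.
Local Notation C := (R[i]^o).
Variables (I : Type) (f : I -> C -> C) (df : I -> C) (c : I -> R) (z : C).

Fixpoint dprod (r : seq I) : C :=
  if r is i :: s then f i z * dprod s + df i * \prod_(j <- s) f j z else 0.

Lemma prod_lip (r : seq I) (h : C) : (forall i, 0 <= c i) ->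
  (forall i, cabs (f i z - 1) <= c i) -> (forall i, cabs (f i (z + h) - 1) <= c i) ->
  (forall i, cabs (f i (z + h) - f i z) <= c i * cabs h) ->
  let V := \sum_(i <- r) c i in
  cabs (\prod_(i <- r) f i (z + h) - \prod_(i <- r) f i z) <= V * expR V * cabs h.
Proof.
move=> c0 fz fzh fl /=.
have B (s : seq I) : cabs (\prod_(i <- s) f i z) <= expR (\sum_(i <- s) c i).
  have -> : \prod_(i <- s) f i z = \prod_(i <- s) (1 + (f i z - 1)).
    by apply: eq_bigr => i _; rewrite addrC subrK.
  by apply: (le_trans (cabs_prod1_le _ _ _)); rewrite ler_expR; apply: ler_sum.
elim: r => [|i s IH]; first by rewrite !big_nil subrr cabs0 mul0r mul0r.
rewrite !big_cons; set V := \sum_(j <- s) c j in IH *.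
set P := \prod_(j <- s) f j (z + h) in IH *; set Q := \prod_(j <- s) f j z in IH *.
have -> : f i (z + h) * P - f i z * Q = f i (z + h) * (P - Q) + (f i (z + h) - f i z) * Q by ring.
have V0 : 0 <= V by apply: sumr_ge0.
have h0 := cabs_ge0 h; have ci := c0 i.
have F1 : cabs (f i (z + h)) <= expR (c i).
  have -> : f i (z + h) = 1 + (f i (z + h) - 1) by ring.
  by apply: (le_trans (cabsD _ _)); rewrite cabs1 (le_trans _ (expR_ge1Dx _))// lerD2l.
apply: (le_trans (cabsD _ _)); rewrite !cabsM.
have A1 : cabs (f i (z + h)) * cabs (P - Q) <= expR (c i) * (V * expR V * cabs h).
  by apply: ler_pM; rewrite ?cabs_ge0.
have A2 : cabs (f i (z + h) - f i z) * cabs Q <= c i * cabs h * (expR V * expR (c i)).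
  apply: ler_pM; rewrite ?cabs_ge0//; apply: (le_trans (B s)).
  by rewrite ler_peMr ?expR_ge0// -expR0 ler_expR.
rewrite expRD; lra.
Qed.

(** Induction along the Leibniz rule [dprod]. The constant depends on the factors only through the
    sum [V], so it passes to infinite products by [cder_limit]. *)
Lemma prod_rem (r : seq I) (h : C) : (forall i, 0 <= c i) ->
  (forall i, cabs (f i z - 1) <= c i) -> (forall i, cabs (f i (z + h) - 1) <= c i) ->
  (forall i, cabs (f i (z + h) - f i z) <= c i * cabs h) ->
  (forall i, cabs (f i (z + h) - f i z - df i * h) <= c i * cabs h ^+ 2) ->
  let V := \sum_(i <- r) c i in
  cabs (\prod_(i <- r) f i (z + h) - \prod_(i <- r) f i z - dprod r * h)
  <= (V + V ^+ 2) * expR V * cabs h ^+ 2.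
Proof.
move=> c0 fz fzh fl fr /=.
have B (s : seq I) : cabs (\prod_(i <- s) f i z) <= expR (\sum_(i <- s) c i).
  have -> : \prod_(i <- s) f i z = \prod_(i <- s) (1 + (f i z - 1)).
    by apply: eq_bigr => i _; rewrite addrC subrK.
  by apply: (le_trans (cabs_prod1_le _ _ _)); rewrite ler_expR; apply: ler_sum.
elim: r => [|i s IH].
  by rewrite !big_nil /= subrr sub0r mul0r oppr0 cabs0 expr0n addr0 mul0r mul0r.
have LP := prod_lip s c0 fz fzh fl; rewrite /= in LP.
rewrite !big_cons /=; set V := \sum_(j <- s) c j in IH LP *.
set P := \prod_(j <- s) f j (z + h) in IH LP *; set Q := \prod_(j <- s) f j z in IH LP *.
have -> : f i (z + h) * P - f i z * Q - (f i z * dprod s + df i * Q) * h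
  = f i z * (P - Q - dprod s * h) + (f i (z + h) - f i z - df i * h) * Q
    + (f i (z + h) - f i z) * (P - Q) by ring.
have V0 : 0 <= V by apply: sumr_ge0.
have h0 := cabs_ge0 h; have ci := c0 i; have hh : 0 <= cabs h ^+ 2 by rewrite sqr_ge0.
have F1 : cabs (f i z) <= expR (c i).
  have -> : f i z = 1 + (f i z - 1) by ring.
  by apply: (le_trans (cabsD _ _)); rewrite cabs1 (le_trans _ (expR_ge1Dx _))// lerD2l.
have E1 : 1 <= expR (c i) by rewrite -expR0 ler_expR.
have EV := expR_ge0 V.
have A1 : cabs (f i z) * cabs (P - Q - dprod s * h)
    <= expR (c i) * ((V + V ^+ 2) * expR V * cabs h ^+ 2).
  by apply: ler_pM; rewrite ?cabs_ge0.
have A2 : cabs (f i (z + h) - f i z - df i * h) * cabs Q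
    <= c i * cabs h ^+ 2 * (expR V * expR (c i)).
  apply: ler_pM; rewrite ?cabs_ge0//; apply: (le_trans (B s)).
  by rewrite ler_peMr ?expR_ge0.
have A3 : cabs (f i (z + h) - f i z) * cabs (P - Q)
    <= c i * cabs h * (V * (expR V * expR (c i)) * cabs h).
  apply: ler_pM; rewrite ?cabs_ge0//; apply: (le_trans LP).
  by rewrite ler_wpM2r// ler_wpM2l// ler_peMr.
apply: (le_trans (cabsD _ _)); rewrite [cabs ((f i (z + h) - f i z) * _)]cabsM.
apply: (le_trans (lerD (cabsD _ _) (lexx _))); rewrite !cabsM.
apply: (le_trans (lerD (lerD A1 A2) A3)); rewrite expRD.
rewrite -subr_ge0.
have -> : (c i + V + (c i + V) ^+ 2) * (expR (c i) * expR V) * cabs h ^+ 2 -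
  (expR (c i) * ((V + V ^+ 2) * expR V * cabs h ^+ 2) +
   c i * cabs h ^+ 2 * (expR V * expR (c i)) +
   c i * cabs h * (V * (expR V * expR (c i)) * cabs h))
  = (c i ^+ 2 + c i * V) * (expR (c i) * expR V) * cabs h ^+ 2 by ring.
by rewrite !mulr_ge0// ?addr_ge0 ?mulr_ge0 ?sqr_ge0 ?expR_ge0.
Qed.

Lemma cabs_prod_ge (r : seq I) (x : I -> C) :
  1 - \sum_(i <- r) cabs (x i) <= cabs (\prod_(i <- r) (1 - x i)).
Proof.
elim: r => [|i s IH]; first by rewrite !big_nil subr0 cabs1.
rewrite !big_cons cabsM; set S := \sum_(j <- s) _ in IH *; set P := cabs (\prod_(j <- s) _) in IH *.
have S0 : 0 <= S by apply: sumr_ge0 => j _; exact: cabs_ge0.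
have P0 : 0 <= P by exact: cabs_ge0.
have H := cabs_ge_sub 1 (x i); rewrite cabs1 in H.
have X0 := cabs_ge0 (x i); have Y0 := cabs_ge0 (1 - x i).
have [x1|x1] := leP (cabs (x i)) 1; last first.
  by apply: (@le_trans _ _ 0); [lra|rewrite mulr_ge0].
have : (1 - cabs (x i)) * P <= cabs (1 - x i) * P by rewrite ler_wpM2r.
have : (1 - cabs (x i)) * (1 - S) <= (1 - cabs (x i)) * P by rewrite ler_wpM2l// subr_ge0.
have : 0 <= cabs (x i) * S by rewrite mulr_ge0.
lra.
Qed.

End ProductRemainder.

(** * Boxes of lattice indices under quarter turns *)

Section Boxes.

(** Multiplication by i, read on indices. *)
Definition rotp (p : int * int) : int * int := (- p.2, p.1).

(** A fundamental domain for quarter turns of the nonzero indices of the box: first coordinate in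
    1..N, second in 0..N. *)
Definition quad (N : nat) : seq (int * int) :=
  [seq (Posz m.+1, Posz n) | m <- iota 0%N N, n <- iota 0%N N.+1].

Definition box (N : nat) : seq (int * int) :=
  [seq (Posz i - Posz N, Posz j - Posz N) | i <- iota 0%N (N + N)%N.+1, j <- iota 0%N (N + N)%N.+1].

Definition quad4 (N : nat) : seq (int * int) :=
  quad N ++ map rotp (quad N) ++ map (rotp \o rotp) (quad N)
  ++ map (rotp \o rotp \o rotp) (quad N).

Lemma mem_box N p : (p \in box N) = (`|p.1| <= N)%N && (`|p.2| <= N)%N.
Proof.
case: p => m n; apply/allpairsP/idP => [[[i j] [iN jN [-> ->]]]|H].
  by rewrite !mem_iota /= in iN jN *; lia.
exists (absz (m + Posz N)%R, absz (n + Posz N)%R); rewrite !mem_iota /=.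
move: H => /= /andP[mN nN]; split; try lia.
by congr (_, _); lia.
Qed.

Lemma mem_quad N p : (p \in quad N) = (0 < p.1) && (p.1 <= Posz N) && (0 <= p.2) && (p.2 <= Posz N).
Proof.
case: p => m n; apply/allpairsP/idP => [[[i j] [iN jN [-> ->]]]|H].
  by rewrite !mem_iota /= in iN jN *; lia.
exists ((absz m).-1, absz n); rewrite !mem_iota /=.
move: H => /= H; split; try lia.
by congr (_, _); lia.
Qed.

Lemma box_uniq N : uniq (box N).
Proof.
apply: allpairs_uniq; rewrite ?iota_uniq// => -[i j] [i' j'] _ _ /= [H1 H2].
by congr (_, _); lia.
Qed.

Lemma perm_box N : perm_eq (box N) ((0, 0) :: quad4 N).
Proof.
have sub : {subset box N <= (0, 0) :: quad4 N}.
  move=> [m n]; rewrite mem_box inE /quad4 !mem_cat /= => /andP[mN nN].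
  have R1 q : (q \in map rotp (quad N)) = ((q.2, - q.1) \in quad N).
    have -> : q = rotp (q.2, - q.1) by case: q => a b; rewrite /rotp /= opprK.
    by rewrite mem_map ?/rotp /= ?opprK // => -[a b] [a' b'] [/oppr_inj -> ->].
  have R2 q : (q \in map (rotp \o rotp) (quad N)) = ((- q.1, - q.2) \in quad N).
    have -> : q = (rotp \o rotp) (- q.1, - q.2) by case: q => a b; rewrite /rotp /= !opprK.
    by rewrite mem_map ?/rotp /= ?opprK // => -[a b] [a' b'] [/oppr_inj -> /oppr_inj ->].
  have R3 q : (q \in map (rotp \o rotp \o rotp) (quad N)) = ((- q.2, q.1) \in quad N).
    have -> : q = (rotp \o rotp \o rotp) (- q.2, q.1) by case: q => a b; rewrite /rotp /= !opprK.
    by rewrite mem_map ?/rotp /= ?opprK // => -[a b] [a' b'] /= [/oppr_inj/oppr_inj -> /oppr_inj ->].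
  rewrite R1 R2 R3 !mem_quad xpair_eqE /=; lia.
(* Inclusion becomes equality by counting: (2N + 1)^2 = 1 + 4 N (N + 1). Uniqueness on the right
   comes for free. *)
have sz : (size ((0%R, 0%R) :: quad4 N) <= size (box N))%N.
  have s1 : size (box N) = ((N + N).+1 * (N + N).+1)%N by rewrite /box size_allpairs !size_iota.
  have s2 : size (quad N) = (N * N.+1)%N by rewrite /quad size_allpairs !size_iota.
  have s3 : size ((0%R, 0%R) :: quad4 N) = (size (quad4 N)).+1 by [].
  rewrite s1 s3 /quad4 !size_cat !size_map s2; nia.
have [_ E] := uniq_min_size (box_uniq N) sub sz.
have szE : size (box N) = size ((0%R, 0%R) :: quad4 N).
  by apply/eqP; rewrite eqn_leq sz uniq_leq_size ?box_uniq.
have U : uniq ((0%R, 0%R) :: quad4 N) by rewrite -(eq_uniq szE E) box_uniq.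
exact: (uniq_perm (box_uniq N) U E).
Qed.

Lemma big_box (A : Type) (idx : A) (op : Monoid.com_law idx) N (G : int * int -> A) :
  \big[op/idx]_(p <- box N) G p = op (G (0, 0)) (\big[op/idx]_(p <- quad4 N) G p).
Proof. by rewrite (perm_big _ (perm_box N)) big_cons. Qed.

Lemma big_quad4 (A : Type) (idx : A) (op : Monoid.com_law idx) N (G : int * int -> A) :
  \big[op/idx]_(p <- quad4 N) G p = \big[op/idx]_(p <- quad N)
    op (op (G p) (G (rotp p))) (op (G (rotp (rotp p))) (G (rotp (rotp (rotp p))))).
Proof. by rewrite /quad4 !big_cat !big_map /= !big_split /= !Monoid.mulmA. Qed.

Variable R : realType.

Lemma sum_inv_sqr N : \sum_(i < N) ((i.+1%:R : R) ^+ 2)^-1 <= 2.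
Proof.
case: N => [|N]; first by rewrite big_ord0.
suff H : \sum_(i < N.+1) ((i.+1%:R : R) ^+ 2)^-1 <= 2 - N.+1%:R^-1.
  by apply: (le_trans H); rewrite gerBl invr_ge0.
elim: N => [|N IH]; first by rewrite big_ord_recl big_ord0 expr1n invr1; lra.
rewrite big_ord_recr /=; apply: (le_trans (lerD IH (lexx _))).
have a0 : 0 < (N.+1%:R : R) by rewrite ltr0n.
rewrite -[N.+2%:R]natr1; set a := N.+1%:R in a0 *.
rewrite -subr_ge0.
have -> : 2 - (a + 1)^-1 - (2 - a^-1 + ((a + 1) ^+ 2)^-1) = (a * (a + 1) ^+ 2)^-1.
  by field; rewrite !gt_eqF// addr_gt0.
by rewrite invr_ge0 mulr_ge0 ?sqr_ge0 ?ltW.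
Qed.

(** For n >= 1 use (m^2 + n^2)^2 >= 4 m^2 n^2. Together with the term n = 0 the row of m sums to at
    most (3/2) m^-2, and the sum of m^-2 is at most 2. *)
Lemma sum_quad N :
  \sum_(p <- quad N) (((p.1%:~R : R) ^+ 2 + p.2%:~R ^+ 2) ^+ 2)^-1 <= 3.
Proof.
rewrite big_allpairs_dep /=.
have inner m : \sum_(n <- iota 0%N N.+1) ((((Posz m.+1)%:~R : R) ^+ 2 + (Posz n)%:~R ^+ 2) ^+ 2)^-1
    <= 3 / 2 * ((m.+1%:R : R) ^+ 2)^-1.
  have X1 : 1 <= (m.+1%:R : R) by rewrite ler1n.
  rewrite (_ : iota 0%N N.+1 = index_iota 0%N N.+1); last by rewrite /index_iota subn0.
  rewrite big_mkord big_ord_recl /= expr0n addr0; set X : R := m.+1%:R in X1 *.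
  have X0 : 0 < X by exact: lt_le_trans X1.
  have X2 : 0 < X ^+ 2 by rewrite exprn_gt0.
  have XX : 1 <= X ^+ 2 by rewrite -[leLHS](expr1n _ 2) lerXn2r// nnegrE ?ler01 ?ltW.
  have H0 : ((X ^+ 2) ^+ 2)^-1 <= (X ^+ 2)^-1.
    by rewrite lef_pV2 ?posrE ?exprn_gt0// [leRHS]expr2 ler_peMl// ltW.
  have H1 : \sum_(i < N) ((X ^+ 2 + (Posz (bump 0 i))%:~R ^+ 2) ^+ 2)^-1
      <= (4 * X ^+ 2)^-1 * \sum_(i < N) ((i.+1%:R : R) ^+ 2)^-1.
    rewrite mulr_sumr; apply: ler_sum => i _.
    have -> : ((Posz (bump 0 i))%:~R : R) = i.+1%:R by [].
    have Y0 : 0 < (i.+1%:R : R) by rewrite ltr0n.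
    set Y := i.+1%:R in Y0 *.
    rewrite -invfM lef_pV2 ?posrE; last 2 first.
    - by rewrite exprn_gt0// addr_gt0// exprn_gt0.
    - by rewrite !mulr_gt0// exprn_gt0.
    rewrite -subr_ge0.
    have -> : (X ^+ 2 + Y ^+ 2) ^+ 2 - 4 * X ^+ 2 * Y ^+ 2 = (X ^+ 2 - Y ^+ 2) ^+ 2 by ring.
    by rewrite sqr_ge0.
  apply: (le_trans (lerD H0 H1)).
  have H2 : (4 * X ^+ 2)^-1 * \sum_(i < N) ((i.+1%:R : R) ^+ 2)^-1 <= (4 * X ^+ 2)^-1 * 2.
    by rewrite ler_wpM2l ?sum_inv_sqr// invr_ge0 mulr_ge0 ?sqr_ge0.
  apply: (le_trans (lerD (lexx _) H2)).
  rewrite le_eqVlt; apply/orP; left; apply/eqP; field.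
  by rewrite gt_eqF.
apply: (@le_trans _ _ (\sum_(m <- iota 0%N N) (3 / 2 * ((m.+1%:R : R) ^+ 2)^-1))).
  by apply: ler_sum => m _; exact: inner.
rewrite -mulr_sumr (_ : iota 0%N N = index_iota 0%N N); last by rewrite /index_iota subn0.
rewrite big_mkord; have := sum_inv_sqr N; lra.
Qed.

End Boxes.

#[global] Arguments box : simpl never.
#[global] Arguments quad : simpl never.
#[global] Arguments quad4 : simpl never.

(** * The sigma product by orbits of quarter turns *)

Section SigmaProduct.
Variable R : realType.
Local Notation C := (R[i]^o).
Local Notation L := (@Lambda R).
Local Notation st := (@st R).
Local Notation lam := (@lam R).

Definition vq (p : int * int) : C := ((lam p) ^+ 4)^-1.

Definition Tn (N : nat) (z : C) : C := \prod_(p <- quad N) (1 - vq p * z ^+ 4).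

Definition wfac (l z : C) : C :=
  (1 - z / l) * cexp (z / l + 2^-1 * (z ^+ 2 / l ^+ 2)).

(** The quotient sigma(z) / z, continued by 1 at the origin. *)
Definition psig (z : C) : C := uprod (L `\ 0) (fun l => wfac l z).

Lemma sigmaE z : sigma z = z * psig z.
Proof. by []. Qed.

Lemma sum_vq N : \sum_(p <- quad N) cabs (vq p) <= 3 / st ^+ 4.
Proof.
have s0 := @st_gt0 R.
have E p : cabs (vq p) = (st ^+ 4)^-1 * (((p.1%:~R : R) ^+ 2 + p.2%:~R ^+ 2) ^+ 2)^-1.
  rewrite /vq cabsV cabsX -invfM; congr (_^-1).
  have -> : cabs (lam p) ^+ 4 = (cabs (lam p) ^+ 2) ^+ 2 by rewrite -exprM.
  by rewrite cabs_lam exprMn -exprM.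
rewrite (eq_bigr _ (fun p _ => E p)) -mulr_sumr mulrC ler_wpM2r ?sum_quad//.
by rewrite invr_ge0 exprn_ge0// ltW.
Qed.

Lemma i_sqr : ('i : C) * 'i = -1.
Proof. by rewrite -expr2 sqr_i. Qed.

Lemma lam_neq0 p : p != (0, 0) -> lam p != 0.
Proof. by move=> p0; rewrite -cabs_gt0 (lt_le_trans (@st_gt0 R))// cabs_lam_ge. Qed.

(** Over an orbit l, i l, -l, -i l the linear exponents cancel since 1/l is multiplied by the fourth
    roots of unity, and the quadratic ones since their squares alternate in sign. Only the
    polynomial factors remain. *)
Lemma wfac4 p z : p != (0, 0) ->
  wfac (lam p) z * wfac (lam (rotp p)) z *
  (wfac (lam (rotp (rotp p))) z * wfac (lam (rotp (rotp (rotp p)))) z)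
  = 1 - vq p * z ^+ 4.
Proof.
move=> /lam_neq0 l0; rewrite /wfac /vq !lam_rot.
set l := lam p in l0 *.
have i0 : ('i : C) != 0 by rewrite -cabs_gt0 cabs_i.
have iV : ('i : C)^-1 = - 'i.
  by apply: (mulIf i0); rewrite mulVf// mulNr i_sqr opprK.
have E1 : z / ('i * l) = - 'i * (z / l) by rewrite invfM iV mulrCA.
have E2 : z / ('i * ('i * l)) = - (z / l).
  by rewrite mulrA i_sqr mulN1r invrN mulrN.
have E3 : z / ('i * ('i * ('i * l))) = 'i * (z / l).
  by rewrite mulrA i_sqr mulN1r invrN mulrN E1 mulNr opprK.
have D (w : C) : z ^+ 2 / w ^+ 2 = (z / w) ^+ 2 by rewrite expr_div_n.
rewrite !D E1 E2 E3; set x := z / l.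
have Ex : l ^- 4 * z ^+ 4 = x ^+ 4 by rewrite /x expr_div_n mulrC.
rewrite Ex.
set a1 := x + _; set a2 := - 'i * x + _; set a3 := - x + _; set a4 := 'i * x + _.
have Es : a1 + a2 + (a3 + a4) = 0.
  have -> : a1 + a2 + (a3 + a4) = x ^+ 2 * 2^-1 * (2 + 2 * ('i * 'i)).
    by rewrite /a1 /a2 /a3 /a4; ring.
  by rewrite i_sqr mulrN1 subrr mulr0.
have Ec : cexp a1 * cexp a2 * (cexp a3 * cexp a4) = 1.
  by rewrite -!cexpD Es cexp0.
transitivity ((1 - x) * (1 - - 'i * x) * ((1 - - x) * (1 - 'i * x))
   * (cexp a1 * cexp a2 * (cexp a3 * cexp a4))); first by ring.
rewrite Ec mulr1.
transitivity ((1 - x ^+ 2) * (1 - ('i * 'i) * x ^+ 2)); first by ring.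
by rewrite i_sqr; ring.
Qed.

Definition boxF (N : nat) : {fset C} := [fset l in map lam (box N)]%fset.

Lemma perm_boxF N : perm_eq (boxF N) (map lam (box N)).
Proof.
apply: uniq_perm; first exact: fset_uniq.
by rewrite map_inj_uniq ?box_uniq//; exact: lam_inj.
by move=> x; rewrite /boxF !inE.
Qed.

Lemma lam_in_boxF N p : (lam p \in boxF N) = (p \in box N).
Proof. by rewrite (perm_mem (perm_boxF N)) mem_map//; exact: lam_inj. Qed.

Lemma cprod_boxF N z : cprod (L `\ 0) (fun l => wfac l z) (boxF N) = Tn N z.
Proof.
rewrite /cprod (perm_big _ (perm_boxF N)) big_map big_mkcond /= big_box.
have -> : (lam (0, 0) \in L `\ 0) = false.
  by apply/negP => /set_mem [_]; apply; rewrite lam00.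
rewrite /= mul1r big_quad4 /Tn big_seq [RHS]big_seq; apply: eq_bigr => p.
rewrite mem_quad => /andP[/andP[/andP[p1 _] _] _].
have inL q : q != (0, 0) -> (lam q \in L `\ 0).
  by move=> q0; apply/mem_set; split; [exact: Lambda_lam|exact/eqP/lam_neq0].
case: p p1 => m n /= m0.
have m0' : m != 0 by rewrite gt_eqF.
rewrite !inL ?wfac4// ?/rotp /= ?xpair_eqE ?oppr_eq0 ?(negbTE m0') ?andbF//.
Qed.

(** A primary factor of order two differs from 1 by O(|z / l|^3), so [kern] controls the convergence
    of the unordered product. *)
Lemma wfac_kern z : exists2 M : R, 0 <= M &
  forall l, (L `\ 0) l -> cabs (wfac l z - 1) <= M * kern l.
Proof.
pose x := cabs z / st.
have x0 : 0 <= x by rewrite divr_ge0 ?cabs_ge0 ?ltW ?st_gt0.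
pose E := expR (x + 2^-1 * x ^+ 2).
have E0 : 0 < E by exact: expR_gt0.
exists (2 * cabs z ^+ 3 * E); first by rewrite !mulr_ge0 ?exprn_ge0 ?cabs_ge0 ?ltW.
move=> l [Ll /eqP l0].
have lst := Lambda_ge Ll l0.
have lp : 0 < cabs l by rewrite cabs_gt0.
rewrite /wfac -expr_div_n.
apply: (le_trans (cabs_weierstrass_factor _)).
have zl : cabs (z / l) = cabs z / cabs l by rewrite cabsM cabsV.
have zx : cabs (z / l) <= x.
  by rewrite zl /x ler_wpM2l ?cabs_ge0// lef_pV2 ?posrE ?st_gt0.
rewrite /kern (negbTE l0).
have -> : 2 * (cabs (z / l) ^+ 2 * expR (cabs (z / l) + 2^-1 * cabs (z / l) ^+ 2)) * cabs (z / l)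
  = 2 * cabs (z / l) ^+ 3 * expR (cabs (z / l) + 2^-1 * cabs (z / l) ^+ 2) by ring.
have -> : 2 * cabs z ^+ 3 * E / cabs l ^+ 3 = 2 * cabs (z / l) ^+ 3 * E.
  by rewrite zl expr_div_n; field; rewrite gt_eqF.
rewrite ler_wpM2l ?mulr_ge0 ?exprn_ge0 ?cabs_ge0// ler_expR lerD// ler_wpM2l//.
by rewrite lerXn2r// nnegrE cabs_ge0.
Qed.

Lemma psum_setD0 (g : C -> R) F : (forall l, L l -> 0 <= g l) ->
  psum (L `\ 0) g F <= psum L g F.
Proof.
move=> g0; rewrite /psum big_mkcond [leRHS]big_mkcond; apply: ler_sum => l _.
case: ifPn => [/set_mem [Ll _]|_]; first by rewrite mem_set.
by case: ifPn => // /set_mem; exact: g0.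
Qed.

Lemma cvgC_unique (T : Type) (F : set_system T) {FF : ProperFilter F} (f : T -> C) (a b : C) :
  f @ F --> a -> f @ F --> b -> a = b.
Proof.
move=> fa fb; rewrite -(cvg_lim (@norm_hausdorff _ _) fa).
exact: (cvg_lim (@norm_hausdorff _ _) fb).
Qed.

Lemma psig_ucvg z : cprod (L `\ 0) (fun l => wfac l z) @ summability.totally --> psig z.
Proof.
have [M M0 HM] := wfac_kern z.
have B F : psum (L `\ 0) (fun l => cabs (wfac l z - 1)) F <= M * @Kk R.
  apply: (le_trans (le_psum _ HM)); rewrite psumZ ler_wpM2l//.
  by apply: (le_trans (psum_setD0 _ _)) => [l _|]; [exact: kern_ge0|exact: psum_kern].
have [l Hl] := cprod_cvg B.
have E : (fun l => 1 + (wfac l z - 1)) = (fun l => wfac l z).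
  by apply/funext => w; rewrite addrC subrK.
rewrite E in Hl.
suff -> : psig z = l by exact: Hl.
exact: (cvg_lim (@norm_hausdorff _ _) Hl).
Qed.

Lemma boxF_cofinal (F : {fset C}) : exists N0, forall N, (N0 <= N)%N ->
  forall l, l \in F -> L l -> l \in boxF N.
Proof.
have /choice[nb Hnb] : forall l : C, exists n0, L l -> forall N, (n0 <= N)%N -> l \in boxF N.
  move=> l; have [Ll|nL] := pselect (L l); last by exists 0%N.
  have [p Ep] := LambdaE Ll.
  exists (maxn (absz p.1) (absz p.2)) => _ N; rewrite geq_max => pN.
  by rewrite Ep lam_in_boxF mem_box.
exists (\max_(l <- F) nb l) => N HN l lF Ll; apply: Hnb => //.
by apply: leq_trans HN; rewrite (big_rem l lF) /= leq_maxl.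
Qed.

(** Boxes eventually contain any finite set of lattice points, so the limit along the net of finite
    sets is also the limit along boxes, where orbits are complete. *)
Lemma Tn_cvg z : (fun N => Tn N z) @ \oo --> psig z.
Proof.
apply/cvgCP => e e0.
move/cvgCP: (@psig_ucvg z) => /(_ _ e0) /near_totally [F0 HF0].
have [N0 HN0] := boxF_cofinal F0.
exists N0 => // N /= N0N.
have := HF0 (F0 `|` boxF N)%fset (fsubsetUl _ _).
suff -> : cprod (L `\ 0) (fun l => wfac l z) (F0 `|` boxF N)%fset = Tn N z by [].
rewrite -cprod_boxF; move: (boxF N) (HN0 N N0N) => B HB.
rewrite /cprod big_fset_condE [RHS]big_fset_condE; congr (bigop _ _ _).
congr enum_fset; apply/fsetP => l; rewrite !inE /=.
case lL : (l \in L `\ 0); last by rewrite !andbF.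
rewrite !andbT; case lF : (l \in F0) => //=.
by apply/esym/HB => //; move/set_mem: lL => [].
Qed.

Lemma cabs_nat n : cabs (n%:R : C) = n%:R.
Proof.
have -> : (n%:R : C) = (n%:R : R)%:C by rewrite rmorph_nat.
by rewrite cabs_real ger0_norm.
Qed.

Let rho4 (z h : C) : (z + h) ^+ 4 - z ^+ 4 = h * (4 * z ^+ 3 + h * (6 * z ^+ 2 + 4 * z * h + h ^+ 2)).
Proof. ring. Qed.

Lemma psig_der z : exists d, cder psig z d.
Proof.
pose r := cabs z + 1.
have r1 : 1 <= r by rewrite lerDr cabs_ge0.
have z0 := cabs_ge0 z.
(* 15 = 4 + 11 bounds 4 z^3 + h (6 z^2 + 4 z h + h^2) for |h| < 1, the powers of r >= 1 being
   increasing. *)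
pose k := 15 * r ^+ 4.
have r0 : 0 <= r by lra.
have k0 : 0 <= k by rewrite mulr_ge0 ?exprn_ge0.
pose V := k * (3 / st ^+ 4).
have s4 : 0 <= 3 / st ^+ 4 by rewrite divr_ge0 ?exprn_ge0// ltW ?st_gt0.
have V0 : 0 <= V by rewrite mulr_ge0.
have P2 : r <= r ^+ 2 by rewrite expr2 ler_peMr.
have P3 : r ^+ 2 <= r ^+ 3 by rewrite [leRHS]exprS ler_peMl ?exprn_ge0.
have P4 : r ^+ 3 <= r ^+ 4 by rewrite [leRHS]exprS ler_peMl ?exprn_ge0.
pose f (p : int * int) (w : C) : C := 1 - vq p * w ^+ 4.
pose df (p : int * int) : C := - vq p * (4 * z ^+ 3).
pose c (p : int * int) : R := k * cabs (vq p).
have c0 p : 0 <= c p by rewrite mulr_ge0 ?cabs_ge0.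
have n4 := cabs_nat 4; have n6 := cabs_nat 6.
have zr : cabs z <= r by rewrite lerDl.
have pw (w : C) n : cabs w <= r -> cabs w ^+ n <= r ^+ n.
  by move=> wr; rewrite lerXn2r// nnegrE ?cabs_ge0.
have B1 (w : C) : cabs w <= r -> forall p, cabs (f p w - 1) <= c p.
  move=> wr p; have -> : f p w - 1 = - (vq p * w ^+ 4) by rewrite /f; ring.
  rewrite cabsN cabsM cabsX mulrC /c ler_wpM2r ?cabs_ge0//.
  by apply: (le_trans (pw _ _ wr)); rewrite /k ler_peMl ?exprn_ge0// ler1n.
apply: (@cder_limit R nat \oo _ (fun N => Tn N) (fun N => dprod f df z (quad N)) psig z 1
   ((V + V ^+ 2) * expR V)) => //.
- by rewrite mulr_ge0 ?expR_ge0 ?addr_ge0 ?sqr_ge0.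
- by move=> h _; exact: (@Tn_cvg _).
move=> h h1; near=> N.
have hr : cabs (z + h) <= r by rewrite (le_trans (cabsD _ _))// lerD2l ltW.
have h0 := cabs_ge0 h.
have Q : cabs (6 * z ^+ 2 + 4 * z * h + h ^+ 2) <= 11 * r ^+ 2.
  apply: (le_trans (cabsD _ _)); apply: (le_trans (lerD (cabsD _ _) (lexx _))).
  rewrite [cabs (6 * _)]cabsM [cabs (4 * z * h)]cabsM [cabs (4 * z)]cabsM n4 n6 !cabsX.
  have H1 : cabs z ^+ 2 <= r ^+ 2 by exact: pw.
  have H2 : cabs h ^+ 2 <= 1 by rewrite expr_le1// ltW.
  have H3 : cabs z * cabs h <= r * 1 by apply: ler_pM => //; rewrite ltW.
  lra.
have Q0 := cabs_ge0 (6 * z ^+ 2 + 4 * z * h + h ^+ 2).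
have Q3 : cabs (z ^+ 3) <= r ^+ 3 by rewrite cabsX; exact: pw.
have S1 p : cabs (f p (z + h) - f p z) <= c p * cabs h.
  have -> : f p (z + h) - f p z
    = - (vq p * (h * (4 * z ^+ 3 + h * (6 * z ^+ 2 + 4 * z * h + h ^+ 2)))).
    by rewrite -rho4 /f; ring.
  have -> : c p * cabs h = cabs (vq p) * (k * cabs h) by rewrite /c; ring.
  rewrite cabsN cabsM [cabs (h * _)]cabsM ler_wpM2l ?cabs_ge0// [leLHS]mulrC ler_wpM2r//.
  apply: (le_trans (cabsD _ _)); rewrite [cabs (4 * _)]cabsM [cabs (h * _)]cabsM n4.
  have : cabs h * cabs (6 * z ^+ 2 + 4 * z * h + h ^+ 2) <= 1 * (11 * r ^+ 2).
    by apply: ler_pM => //; exact: ltW.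
  rewrite /k; lra.
have S2 p : cabs (f p (z + h) - f p z - df p * h) <= c p * cabs h ^+ 2.
  have -> : f p (z + h) - f p z - df p * h
    = - (vq p * (h ^+ 2 * (6 * z ^+ 2 + 4 * z * h + h ^+ 2))).
    by rewrite /f /df; ring.
  have -> : c p * cabs h ^+ 2 = cabs (vq p) * (k * cabs h ^+ 2) by rewrite /c; ring.
  rewrite cabsN cabsM [cabs (h ^+ 2 * _)]cabsM cabsX ler_wpM2l ?cabs_ge0// [leLHS]mulrC.
  rewrite ler_wpM2r ?sqr_ge0//; apply: (le_trans Q); rewrite /k; lra.
have := @prod_rem R _ f df c z (quad N) h c0 (B1 z zr) (B1 _ hr) S1 S2 => /=.
rewrite -/(Tn N (z + h)) -/(Tn N z) => /le_trans; apply.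
rewrite ler_wpM2r ?sqr_ge0//.
have W0 : 0 <= \sum_(p <- quad N) c p by apply: sumr_ge0.
have WV : \sum_(p <- quad N) c p <= V by rewrite -mulr_sumr ler_wpM2l// sum_vq.
apply: ler_pM; rewrite ?expR_ge0 ?ler_expR ?addr_ge0 ?sqr_ge0//.
by rewrite lerD// lerXn2r// nnegrE.
Unshelve. all: by end_near. Qed.

(** On the closed cell |z|^4 <= st^4 / 4, so the terms z^4 / l^4 sum to at most 3/4 in modulus.
    Hence the centre is the only zero of sigma in a cell. *)
Lemma psig_ge z : 2 * cabs z ^+ 2 <= st ^+ 2 -> 4^-1 <= cabs (psig z).
Proof.
move=> hz; have s0 := @st_gt0 R.
have C1 : (fun N => cabs (Tn N z)) @ \oo --> cabs (psig z) by exact: (cvg_cabs (@Tn_cvg z)).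
have H : \forall N \near \oo, 4^-1 <= cabs (Tn N z); last exact: (cvgr_to_ge C1 H).
exists 0%N => // N _ /=.
have S : \sum_(p <- quad N) cabs (vq p * z ^+ 4) <= 3 / 4.
  have -> : \sum_(p <- quad N) cabs (vq p * z ^+ 4) = cabs z ^+ 4 * \sum_(p <- quad N) cabs (vq p).
    by rewrite mulr_sumr; apply: eq_bigr => p _; rewrite cabsM cabsX mulrC.
  have Z4 : cabs z ^+ 4 <= st ^+ 4 / 4.
    have -> : cabs z ^+ 4 = (2 * cabs z ^+ 2) ^+ 2 / 4 by field.
    rewrite ler_wpM2r// -[4%N]/(2 * 2)%N exprM lerXn2r// nnegrE ?sqr_ge0//.
    by rewrite mulr_ge0 ?sqr_ge0.
  have := @ler_pM R (cabs z ^+ 4) (st ^+ 4 / 4) (\sum_(p <- quad N) cabs (vq p)) (3 / st ^+ 4).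
  have -> : st ^+ 4 / 4 * (3 / st ^+ 4) = 3 / 4 by field; rewrite gt_eqF.
  apply; rewrite ?exprn_ge0 ?cabs_ge0 ?sum_vq//.
  by apply: sumr_ge0 => p _; exact: cabs_ge0.
have := cabs_prod_ge (quad N) (fun p => vq p * z ^+ 4); rewrite -/(Tn N z); lra.
Qed.

Lemma psig_le z : cabs z <= st -> cabs (psig z) <= expR 3.
Proof.
move=> hz; have s0 := @st_gt0 R.
apply: (cvgC_le (@Tn_cvg z)); exists 0%N => // N _ /=.
have -> : Tn N z = \prod_(p <- quad N) (1 + - (vq p * z ^+ 4)) by [].
apply: (le_trans (cabs_prod1_le _ _ _)); rewrite ler_expR.
have -> : \sum_(p <- quad N) cabs (- (vq p * z ^+ 4)) = cabs z ^+ 4 * \sum_(p <- quad N) cabs (vq p).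
  by rewrite mulr_sumr; apply: eq_bigr => p _; rewrite cabsN cabsM cabsX mulrC.
have Z4 : cabs z ^+ 4 <= st ^+ 4 by rewrite lerXn2r// nnegrE ?cabs_ge0 ?ltW.
have := @ler_pM R (cabs z ^+ 4) (st ^+ 4) (\sum_(p <- quad N) cabs (vq p)) (3 / st ^+ 4).
have -> : st ^+ 4 * (3 / st ^+ 4) = 3 by field; rewrite gt_eqF.
apply; rewrite ?exprn_ge0 ?cabs_ge0 ?sum_vq//.
by apply: sumr_ge0 => p _; exact: cabs_ge0.
Qed.

Lemma psig0 : psig 0 = 1.
Proof.
have H := @Tn_cvg 0.
have E : (fun N => Tn N 0) = (fun=> 1).
  by apply/funext => N; rewrite /Tn big1// => p _; rewrite expr0n mulr0 subr0.
rewrite E in H.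
have H1 : (fun _ : nat => (1 : C)) @ \oo --> (1 : C) by exact: cvg_cst.
exact: (cvgC_unique H H1).
Qed.

Lemma psig_i z : psig ('i * z) = psig z.
Proof.
have H := @Tn_cvg ('i * z).
have E : (fun N => Tn N ('i * z)) = (fun N => Tn N z).
  apply/funext => N; apply: eq_bigr => p _.
  have -> : ('i * z) ^+ 4 = ('i * 'i) ^+ 2 * z ^+ 4 by ring.
  by rewrite i_sqr sqrrN expr1n mul1r.
rewrite E in H.
exact: (cvgC_unique H (@Tn_cvg z)).
Qed.

End SigmaProduct.

(** * Shifting box products: the quotient of two columns *)

Section QuasiPeriod.
Variable R : realType.
Local Notation C := (R[i]^o).
Local Notation L := (@Lambda R).
Local Notation st := (@st R).
Local Notation lam := (@lam R).

Lemma cvg_invn (x : nat -> C) (l : C) (K : R) (N0 : nat) :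
  (forall N, (N0 <= N)%N -> (0 < N)%N -> cabs (x N - l) <= K / N%:R) -> x @ \oo --> l.
Proof.
move=> H; apply/cvgCP => e e0.
pose K' := `|K| + 1.
have K'0 : 0 < K' by rewrite ltr_wpDl.
exists (maxn N0 (Num.truncn (K' / e)).+1) => // N /=; rewrite geq_max => /andP[N1 N2].
have NP : (0 < N)%N by exact: leq_trans N2.
apply: (le_lt_trans (H N N1 NP)).
rewrite ltr_pdivrMr ?ltr0n// mulrC -ltr_pdivrMr//.
have h1 : K' / e < N%:R by apply: (lt_le_trans (truncnS_gt _)); rewrite ler_nat.
apply: le_lt_trans h1; rewrite ler_pM2r ?invr_gt0// /K'.
by rewrite (le_trans (ler_norm K))// lerDl.
Qed.

Lemma cvgC_comp (T : Type) (F : set_system T) {FF : Filter F} (g : C -> C) (f : T -> C) (a : C) :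
  {for a, continuous g} -> f @ F --> a -> (fun x => g (f x)) @ F --> g a.
Proof.
move=> /(cvgCP (F := nbhs a)) ga /cvgCP fa; apply/cvgCP => e /ga /nbhsCP[d d0 H].
by move: (fa d d0); apply: filterS => x /H.
Qed.

Lemma atan_lip (x y : R) : x <= y -> 0 <= atan y - atan x <= y - x.
Proof.
move=> xy.
have [c cI ->] := @MVT_segment R (@atan R) (fun x => (1 + x ^+ 2)^-1) x y xy
   (fun c _ => is_derive1_atan c) (continuous_subspaceT (@continuous_atan R)).
have c1 : 1 <= 1 + c ^+ 2 by rewrite lerDl sqr_ge0.
have c2 : 0 < 1 + c ^+ 2 by exact: lt_le_trans c1.
rewrite mulr_ge0 ?invr_ge0 ?subr_ge0 ?(ltW c2)//=.
by rewrite ler_piMl ?subr_ge0// invf_le1.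
Qed.

(** By the mean value theorem the increment of arctan is 1/N times 1/(1 + t^2) at an intermediate t,
    and 1/(1 + t^2) is 1-Lipschitz. *)
Lemma atan_step (N : nat) (x : R) : (0 < N)%N ->
  `|N%:R / (N%:R ^+ 2 + x ^+ 2) - (atan ((x + 1) / N%:R) - atan (x / N%:R))| <= N%:R ^- 2.
Proof.
move=> N0; have n0 : 0 < (N%:R : R) by rewrite ltr0n.
set n : R := N%:R in n0 *.
have xy : x / n <= (x + 1) / n by rewrite ler_pM2r ?invr_gt0// lerDl.
have [c cI ->] := @MVT_segment R (@atan R) (fun x => (1 + x ^+ 2)^-1) (x / n) ((x + 1) / n) xy
   (fun c _ => is_derive1_atan c) (continuous_subspaceT (@continuous_atan R)).
have -> : (x + 1) / n - x / n = n^-1 by field; rewrite gt_eqF.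
set d := x / n in cI *.
have -> : n / (n ^+ 2 + x ^+ 2) = (1 + d ^+ 2)^-1 * n^-1.
  by rewrite /d; field; rewrite !gt_eqF// ltr_wpDr ?sqr_ge0// exprn_gt0.
have nV : 0 < n^-1 by rewrite invr_gt0.
rewrite -mulrBl normrM (gtr0_norm nV).
rewrite expr2 invfM ler_pM2r ?invr_gt0//.
have cd : `|d - c| <= n^-1.
  move: cI; rewrite in_itv /= => /andP[c1 c2].
  have -> : n^-1 = (x + 1) / n - d by rewrite /d; field; rewrite gt_eqF.
  by rewrite ler_norml; apply/andP; split; lra.
apply: le_trans cd.
have C0 : 0 < 1 + c ^+ 2 by rewrite ltr_wpDr ?sqr_ge0.
have D0 : 0 < 1 + d ^+ 2 by rewrite ltr_wpDr ?sqr_ge0.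
have -> : (1 + d ^+ 2)^-1 - (1 + c ^+ 2)^-1 = (c - d) * ((c + d) / ((1 + d ^+ 2) * (1 + c ^+ 2))).
  by field; rewrite !gt_eqF.
rewrite normrM distrC ler_piMr// normrM normfV (gtr0_norm (mulr_gt0 D0 C0)).
rewrite ler_pdivrMr ?mulr_gt0// mul1r.
have h1 := sqr_ge0 (c - 1); have h2 := sqr_ge0 (c + 1).
have h3 := sqr_ge0 (d - 1); have h4 := sqr_ge0 (d + 1).
have h5 : 0 <= c ^+ 2 * d ^+ 2 by rewrite mulr_ge0 ?sqr_ge0.
rewrite sqrrB1 in h1; rewrite sqrrD1 in h2; rewrite sqrrB1 in h3; rewrite sqrrD1 in h4.
rewrite ler_norml mulrDl mul1r mulrDr mulr1 [d ^+ 2 * _]mulrC; have h6 := sqr_ge0 c; have h7 := sqr_ge0 d; apply/andP; split; lra.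
Qed.

(** A Riemann sum of 1/(1 + t^2) over [-1, 1]. The 2N + 1 steps, each with error N^-2, cost at most
    3/N, and the last node overshoots 1 by 1/N. *)
Lemma riemann_atan (N : nat) : (0 < N)%N ->
  `|\sum_(j < (N + N).+1) (N%:R / (N%:R ^+ 2 + (j%:R - N%:R) ^+ 2)) - pi / 2| <= 4 / N%:R :> R.
Proof.
move=> N0; have n0 : 0 < (N%:R : R) by rewrite ltr0n.
pose g (j : nat) : R := atan ((j%:R - N%:R) / N%:R).
have T : \sum_(j < (N + N).+1) (g j.+1 - g j) = g (N + N).+1 - g 0.
  by rewrite -(big_mkord predT (fun j => g j.+1 - g j)) telescope_sumr.
have E0 : g 0 = - (pi / 4).
  by rewrite /g sub0r mulNr divff ?gt_eqF// atanN atan1.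
have E1 : `|g (N + N).+1 - pi / 4| <= N%:R^-1.
  rewrite /g -atan1; have -> : ((N + N).+1%:R - N%:R) / N%:R = 1 + N%:R^-1 :> R.
    by rewrite -natr1 natrD; field; rewrite gt_eqF.
  have le1 : 1 <= 1 + N%:R^-1 :> R by rewrite lerDl invr_ge0 ltW.
  have /andP[h1 h2] := atan_lip le1.
  by rewrite ger0_norm//; lra.
have S : `|\sum_(j < (N + N).+1) (N%:R / (N%:R ^+ 2 + (j%:R - N%:R) ^+ 2)) -
    \sum_(j < (N + N).+1) (g j.+1 - g j)| <= (N + N).+1%:R * N%:R ^- 2 :> R.
  rewrite -sumrB; apply: (le_trans (ler_norm_sum _ _ _)).
  apply: (@le_trans _ _ (\sum_(j < (N + N).+1) (N%:R ^- 2))).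
    apply: ler_sum => j _; rewrite /g.
    have -> : (j.+1%:R - N%:R : R) = (j%:R - N%:R) + 1 by rewrite -natr1; ring.
    exact: atan_step.
  by rewrite sumr_const card_ord mulr_natl.
rewrite T E0 in S.
have B : (N + N).+1%:R * N%:R ^- 2 <= 3 / N%:R :> R.
  have -> : 3 / N%:R = (3 * N%:R) * N%:R ^- 2 :> R by field; rewrite gt_eqF.
  rewrite ler_pM2r ?invr_gt0 ?exprn_gt0// -natrM ler_nat; lia.
have -> : \sum_(j < (N + N).+1) (N%:R / (N%:R ^+ 2 + (j%:R - N%:R) ^+ 2)) - pi / 2
  = (\sum_(j < (N + N).+1) (N%:R / (N%:R ^+ 2 + (j%:R - N%:R) ^+ 2))
     - (g (N + N).+1 - - (pi / 4))) + (g (N + N).+1 - pi / 4) :> R by field.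
apply: (le_trans (ler_normD _ _)).
have -> : 4 / N%:R = 3 / N%:R + N%:R^-1 :> R by field; rewrite gt_eqF.
by apply: lerD => //; exact: le_trans B.
Qed.

Definition boxP (N : nat) (z : C) : C := \prod_(p <- box N) (z - lam p).

Lemma boxPE N z : boxP N z = \prod_(p <- quad N) (- (lam p) ^+ 4) * (z * Tn N z).
Proof.
rewrite /boxP big_box big_quad4 /= lam00 subr0 mulrCA; congr (_ * _).
rewrite /Tn -big_split /= big_seq [RHS]big_seq; apply: eq_bigr => p.
rewrite mem_quad => /andP[/andP[/andP[p1 _] _] _].
have l0 : lam p != 0.
  by apply: lam_neq0; case: p p1 => m n /= m0; rewrite xpair_eqE (gt_eqF m0).
rewrite !lam_rot; set l := lam p in l0 *.
have -> : - l ^+ 4 * (1 - @vq R p * z ^+ 4) = z ^+ 4 - l ^+ 4.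
  by rewrite /vq -/l mulrBr mulr1 mulrA mulNr divff ?expf_neq0//; ring.
transitivity ((z - l) * (z - 'i * l) * ((z + l) * (z + 'i * l))).
  congr (_ * _ * (_ * _)).
    by rewrite mulrA i_sqr mulN1r opprK.
  by rewrite (mulrA 'i 'i l) i_sqr mulN1r mulrN opprK.
transitivity ((z ^+ 2 - l ^+ 2) * (z ^+ 2 - ('i * 'i) * l ^+ 2)); first by ring.
by rewrite i_sqr; ring.
Qed.

Lemma quad_prod_neq0 N : \prod_(p <- quad N) (- (lam p) ^+ 4) != 0.
Proof.
rewrite prodf_seq_neq0; apply/allP => p; rewrite mem_quad => /andP[/andP[/andP[p1 _] _] _].
rewrite /= oppr_eq0 expf_neq0// lam_neq0//.
by case: p p1 => m n /= m0; rewrite xpair_eqE (gt_eqF m0).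
Qed.

Definition colP (N : nat) (z : C) : C :=
  \prod_(j < (N + N).+1) (z - lam (0, Posz j - Posz N)).

Lemma boxP_col N z :
  boxP N z = \prod_(i < (N + N).+1) colP N (z - lam (Posz i - Posz N, 0)).
Proof.
have E k : iota 0%N k = index_iota 0 k by rewrite /index_iota subn0.
rewrite /boxP /box big_allpairs_dep !E big_mkord; apply: eq_bigr => i _; rewrite /colP big_mkord.
apply: eq_bigr => j _; rewrite -addrA -opprD -lamD /=; congr (_ - lam (_, _)); by rewrite ?addr0 ?add0r.
Qed.

Lemma lam_st (m : int) : lam (m, 0) = (st * m%:~R)%:C.
Proof. by rewrite lamE /= mulr0. Qed.

(** The shifted and the original box share all columns but one; completing each by its missing
    column gives the same product of 2N + 2 columns. *)
Lemma boxP_shift N z :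
  boxP N (z + (st%:C : C)) * colP N (z - ((st * N%:R)%:C : C))
  = boxP N z * colP N (z + ((st * N.+1%:R)%:C : C)).
Proof.
pose b (i : nat) : C := colP N (z - lam (Posz i - 1 - Posz N, 0)).
have E1 : boxP N (z + (st%:C : C)) = \prod_(i < (N + N).+1) b i.
  rewrite boxP_col; apply: eq_bigr => i _; congr (colP N _).
  rewrite !lam_st addrAC -addrA; congr (_ + _).
  rewrite -rmorphN -rmorphD -rmorphN /=; congr (_%:C).
  by rewrite !rmorphB /=; ring.
have E2 : boxP N z = \prod_(i < (N + N).+1) b i.+1.
  rewrite boxP_col; apply: eq_bigr => i _; congr (colP N (_ - lam (_, _))); lia.
have E3 : colP N (z - ((st * N%:R)%:C : C)) = b (N + N).+1.
  rewrite /b lam_st; congr (colP N (_ - (_ * _)%:C)).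
  have -> : Posz (N + N).+1 - 1 - Posz N = Posz N by lia.
  by [].
have E4 : colP N (z + ((st * N.+1%:R)%:C : C)) = b 0%N.
  rewrite /b lam_st; congr (colP N (_ + _)).
  have -> : Posz 0 - 1 - Posz N = - (Posz N.+1) by lia.
  by rewrite rmorphN /= mulrN rmorphN opprK.
rewrite E1 E2 E3 E4.
rewrite -(big_mkord predT (fun i => b i)) -(big_mkord predT (fun i => b i.+1)) /=.
by rewrite -big_nat_recr//= big_nat_recl//= mulrC.
Qed.

Lemma colPN N z : colP N (- z) = - colP N z.
Proof.
rewrite /colP (reindex_inj rev_ord_inj) /=.
have -> : \prod_(j < (N + N).+1) (- z - lam (0, Posz ((N + N).+1 - j.+1)%N - Posz N))
    = \prod_(j < (N + N).+1) (- (z - lam (0, Posz j - Posz N))).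
  apply: eq_bigr => j _; rewrite opprB [RHS]addrC; congr (_ + _).
  rewrite -lamN /=; have := ltn_ord j => jN.
  by congr (lam (_, _)); lia.
rewrite prodrN card_ord -signr_odd /= oddD addbb /= expr1 mulN1r.
by [].
Qed.

(** The leading constants of [boxPE] cancel in [boxP_shift]. The minus sign comes from reflecting a
    column with the odd number 2N + 1 of factors, and z + st (N + 1) minus a column point equals D j
    + (2 z + st). *)
Lemma colP_ratio N z : (forall j : nat, cabs z < st * N%:R) ->
  let D (j : nat) : C := ((st * N%:R)%:C : C) - z - lam (0, Posz j - Posz N) in
  (z + (st%:C : C)) * Tn N (z + (st%:C : C))
  = - (z * Tn N z * \prod_(j < (N + N).+1) (1 + (2 * z + (st%:C : C)) / D j)).
Proof.
move=> /(_ 0%N) zN D.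
have D0 j : D j != 0.
  apply/eqP => /(congr1 (fun w : C => complex.Re w)).
  rewrite /D lamE !ReD !ReN /= mulr0 subr0 => /eqP; rewrite subr_eq0 => /eqP E.
  by move: zN; rewrite E ltNge => /negP; apply; rewrite (le_trans (ler_norm _))// ler_Re.
have A0 : colP N (((st * N%:R)%:C : C) - z) != 0.
  by rewrite /colP prodf_seq_neq0; apply/allP => j _; exact: D0.
have := boxP_shift N z; rewrite !boxPE.
have -> : z - ((st * N%:R)%:C : C) = - (((st * N%:R)%:C : C) - z) by rewrite opprB.
rewrite colPN -!mulrA => /(mulfI (quad_prod_neq0 N)).
have -> : colP N (z + ((st * N.+1%:R)%:C : C))
   = colP N (((st * N%:R)%:C : C) - z) * \prod_(j < (N + N).+1) (1 + (2 * z + (st%:C : C)) / D j).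
  rewrite /colP -big_split /=; apply: eq_bigr => j _; rewrite -/(D j).
  rewrite mulrDr mulr1 mulrCA divff ?D0// mulr1 /D.
  rewrite -[N.+1%:R]natr1 mulrDr mulr1 [((_ + _)%:C)]rmorphD /=.
  ring.
set Q := \prod_(j < _) _; set A := colP N _ in A0 *.
move=> H; apply: (mulIf A0); apply: oppr_inj.
transitivity ((z + (st%:C : C)) * (Tn N (z + (st%:C : C)) * - A)); first by ring.
by rewrite H; ring.
Qed.

Section ColumnLimit.
Variable z : C.
Let y : C := 2 * z + (st%:C : C).
Let D N (j : nat) : C := ((st * N%:R)%:C : C) - z - lam (0, Posz j - Posz N).
Let E N (j : nat) : C := ((st * N%:R)%:C : C) - lam (0, Posz j - Posz N).
Let N0 : nat := (Num.truncn (2 * cabs z / st)).+1.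

Let zN0 N : (N0 <= N)%N -> 2 * cabs z < st * N%:R.
Proof.
move=> NN; rewrite [ltRHS]mulrC -ltr_pdivrMr ?st_gt0//.
by apply: (lt_le_trans (truncnS_gt _)); rewrite ler_nat.
Qed.

Let E_ge N j : st * N%:R <= cabs (E N j).
Proof.
apply: le_trans (ler_Re _); rewrite /E lamE ReD ReN /= mulr0 subr0.
by rewrite ger0_norm// mulr_ge0// ltW// st_gt0.
Qed.

Let D_ge N j : (N0 <= N)%N -> st * N%:R / 2 <= cabs (D N j).
Proof.
move=> /zN0 zN; have := cabs_ge_sub (E N j) z; have := E_ge N j.
have -> : E N j - z = D N j by rewrite /E /D; ring.
lra.
Qed.

(** Imaginary parts cancel under j -> 2N - j; the real parts form the arctan Riemann sum divided by
    [st]. *)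
Let sumE N : (0 < N)%N -> cabs (\sum_(j < (N + N).+1) (E N j)^-1 - (st^-1 * (pi / 2))%:C)
  <= 4 / st / N%:R.
Proof.
move=> N0'; have s0 := @st_gt0 R.
have n0 : 0 < (N%:R : R) by rewrite ltr0n.
have EV j : (E N j)^-1 = (st^-1 * (N%:R / (N%:R ^+ 2 + (j%:R - N%:R) ^+ 2)))
    +i* (st^-1 * ((j%:R - N%:R) / (N%:R ^+ 2 + (j%:R - N%:R) ^+ 2))).
  have -> : E N j = (st * N%:R) +i* (st * (N%:R - j%:R)).
    rewrite /E lamE; apply: eq_complexP; rewrite ?ReD ?ImD ?ReN ?ImN /= ?mulr0 ?subr0 ?sub0r//.
    by rewrite -mulrN rmorphB /= opprB.
  have P : 0 < N%:R ^+ 2 + (j%:R - N%:R) ^+ 2 :> R by rewrite ltr_wpDr ?sqr_ge0// exprn_gt0.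
  have P' : N%:R ^+ 2 + (j%:R - N%:R) ^+ 2 != 0 :> R by rewrite gt_eqF.
  have Q : (st * N%:R) ^+ 2 + (st * (N%:R - j%:R)) ^+ 2 = st ^+ 2 * (N%:R ^+ 2 + (j%:R - N%:R) ^+ 2) by ring.
  apply: eq_complexP => /=; rewrite Q; field; by rewrite P' gt_eqF.
have Im0 : \sum_(j < (N + N).+1) ((j%:R - N%:R) / (N%:R ^+ 2 + (j%:R - N%:R) ^+ 2)) = 0 :> R.
  set S := \sum_(j < _) _.
  have H : S = - S.
    rewrite /S {1}(reindex_inj rev_ord_inj) -sumrN /=; apply: eq_bigr => j _.
    have -> : ((N + N).+1 - j.+1)%N%:R - N%:R = - (j%:R - N%:R) :> R.
      have jN := ltn_ord j; rewrite subSS natrB; last by rewrite -ltnS.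
      by rewrite natrD; ring.
    by rewrite sqrrN mulNr.
  by apply/eqP; rewrite -[_ == _](mulrn_eq0 S 2) mulr2n {1}H addNr eqxx.
have -> : \sum_(j < (N + N).+1) (E N j)^-1 - (st^-1 * (pi / 2))%:C
  = (st^-1 * (\sum_(j < (N + N).+1) (N%:R / (N%:R ^+ 2 + (j%:R - N%:R) ^+ 2)) - pi / 2))%:C.
  apply: eq_complexP; rewrite ?ReD ?ImD ?ReN ?ImN ?Re_sum ?Im_sum /=.
  - rewrite (eq_bigr _ (fun (j : 'I_(N + N).+1) _ => congr1 (@complex.Re R) (EV j))) /= -mulr_sumr.
    by rewrite mulrBr.
  - rewrite (eq_bigr _ (fun (j : 'I_(N + N).+1) _ => congr1 (@complex.Im R) (EV j))) /= -mulr_sumr.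
    by rewrite Im0 mulr0 subrr.
rewrite cabs_real normrM gtr0_norm ?invr_gt0//.
have -> : 4 / st / N%:R = st^-1 * (4 / N%:R) by ring.
by rewrite ler_pM2l ?invr_gt0// riemann_atan.
Qed.

(** Passing from [E] to [D] moves each of the 2N + 1 terms by |z| / (|D| |E|) = O(N^-2). *)
Let sumD : (fun N => \sum_(j < (N + N).+1) (D N j)^-1) @ \oo --> ((st^-1 * (pi / 2))%:C : C).
Proof.
have s0 := @st_gt0 R.
apply: (@cvg_invn _ _ (4 / st + 6 * cabs z / st ^+ 2) N0) => N NN NP.
have n0 : 0 < (N%:R : R) by rewrite ltr0n.
have sn : 0 < st * N%:R by rewrite mulr_gt0.
have -> : \sum_(j < (N + N).+1) (D N j)^-1 - (st^-1 * (pi / 2))%:C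
  = \sum_(j < (N + N).+1) ((D N j)^-1 - (E N j)^-1)
    + (\sum_(j < (N + N).+1) (E N j)^-1 - (st^-1 * (pi / 2))%:C).
  by rewrite sumrB; ring.
apply: (le_trans (cabsD _ _)); rewrite [leRHS]mulrDl [leRHS]addrC lerD ?sumE//.
apply: (le_trans (cabs_sum _ _ _)).
apply: (@le_trans _ _ (\sum_(j < (N + N).+1) (2 * cabs z / (st * N%:R) ^+ 2))).
  apply: ler_sum => j _.
  have DD := D_ge j NN; have EE := E_ge N j.
  have D0 : 0 < cabs (D N j) by apply: lt_le_trans DD; rewrite divr_gt0.
  have E0 : 0 < cabs (E N j) by apply: lt_le_trans EE.
  have -> : (D N j)^-1 - (E N j)^-1 = z * ((D N j)^-1 * (E N j)^-1).
    have -> : z = E N j - D N j by rewrite /E /D; ring.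
    by field; rewrite -!cabs_gt0 D0 E0.
  rewrite !cabsM !cabsV.
  have -> : 2 * cabs z / (st * N%:R) ^+ 2 = cabs z * ((st * N%:R / 2)^-1 * (st * N%:R)^-1).
    by field; rewrite !gt_eqF.
  rewrite ler_wpM2l ?cabs_ge0//; apply: ler_pM; rewrite ?invr_ge0 ?cabs_ge0// lef_pV2 ?posrE//.
  by rewrite divr_gt0.
rewrite sumr_const card_ord -[leLHS]mulr_natl.
have -> : 6 * cabs z / st ^+ 2 / N%:R = (3 * N%:R) * (2 * cabs z / (st * N%:R) ^+ 2).
  by field; rewrite !gt_eqF.
have P0 : 0 <= 2 * cabs z / (st * N%:R) ^+ 2 by rewrite divr_ge0 ?sqr_ge0// mulr_ge0 ?cabs_ge0.
apply: (ler_wpM2r P0).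
by rewrite -natrM ler_nat; lia.
Qed.

(** Each xi = y / D is O(1/N). Write 1 + xi as the primary factor at -xi times exp(xi - xi^2 / 2):
    the primary factors multiply to 1 in the limit, the squares sum to 0, and the sum of the xi
    tends to st y because st^-1 (pi / 2) = st. *)
Lemma column_limit : (fun N => \prod_(j < (N + N).+1) (1 + y / D N j)) @ \oo
  --> cexp ((st%:C : C) * y).
Proof.
have s0 := @st_gt0 R.
pose K := 2 * cabs y / st.
have K0 : 0 <= K by rewrite divr_ge0 ?mulr_ge0 ?cabs_ge0// ltW.
have xiB N j : (N0 <= N)%N -> (0 < N)%N -> cabs (y / D N j) <= K / N%:R.
  move=> NN NP; have n0 : 0 < (N%:R : R) by rewrite ltr0n.
  have DD := D_ge j NN.
  have P : 0 < st * N%:R / 2 by rewrite divr_gt0// mulr_gt0.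
  rewrite cabsM cabsV; have -> : K / N%:R = cabs y * (st * N%:R / 2)^-1.
    by rewrite /K; field; rewrite !gt_eqF.
  by rewrite ler_wpM2l ?cabs_ge0// lef_pV2 ?posrE// (lt_le_trans P).
have C1 : (fun N => \sum_(j < (N + N).+1) (y / D N j)) @ \oo --> (st%:C : C) * y.
  have -> : (fun N => \sum_(j < (N + N).+1) (y / D N j))
     = (fun N => y * \sum_(j < (N + N).+1) (D N j)^-1).
    by apply/funext => N; rewrite mulr_sumr.
  have -> : (st%:C : C) * y = y * ((st^-1 * (pi / 2))%:C : C).
    rewrite mulrC; congr (_ * _%:C); rewrite -(st_sqr R) expr2 mulKf// gt_eqF//.
  exact: (cvgCMl sumD).
have C2 : (fun N => \sum_(j < (N + N).+1) (2^-1 * (- (y / D N j)) ^+ 2)) @ \oo --> (0 : C).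
  apply: (@cvg_invn _ _ (3 * K ^+ 2) N0) => N NN NP; rewrite subr0.
  have n0 : 0 < (N%:R : R) by rewrite ltr0n.
  apply: (le_trans (cabs_sum _ _ _)).
  apply: (@le_trans _ _ (\sum_(j < (N + N).+1) ((K / N%:R) ^+ 2))).
    apply: ler_sum => j _; rewrite cabsM cabsX cabsN cabsV (cabs_nat R 2).
    have Q : cabs (y / D N j) ^+ 2 <= (K / N%:R) ^+ 2.
      by rewrite lerXn2r ?nnegrE ?cabs_ge0 ?xiB// divr_ge0.
    have := sqr_ge0 (cabs (y / D N j)); lra.
  rewrite sumr_const card_ord -[leLHS]mulr_natl.
  have -> : 3 * K ^+ 2 / N%:R = (3 * N%:R) * (K / N%:R) ^+ 2 by field; rewrite gt_eqF.
  apply: (ler_wpM2r (sqr_ge0 _)).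
  by rewrite -natrM ler_nat; lia.
have C3 : (fun N => \prod_(j < (N + N).+1) ((1 - - (y / D N j))
     * cexp (- (y / D N j) + 2^-1 * (- (y / D N j)) ^+ 2))) @ \oo --> (1 : C).
  pose M := 2 * K ^+ 3 * expR (K + 2^-1 * K ^+ 2).
  have M0 : 0 <= M by rewrite /M; apply: mulr_ge0; [apply: mulr_ge0 => //; exact: exprn_ge0|exact: expR_ge0].
  apply: (@cvg_invn _ _ (2 * (3 * M)) (maxn N0 (Num.truncn (6 * M)).+1)) => N.
  rewrite geq_max => /andP[NN N1] NP.
  have n0 : 0 < (N%:R : R) by rewrite ltr0n.
  have n1 : 1 <= (N%:R : R) by rewrite ler1n.
  have -> : \prod_(j < (N + N).+1) ((1 - - (y / D N j))
     * cexp (- (y / D N j) + 2^-1 * (- (y / D N j)) ^+ 2))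
    = \prod_(j < (N + N).+1) (1 + ((1 - - (y / D N j))
     * cexp (- (y / D N j) + 2^-1 * (- (y / D N j)) ^+ 2) - 1)).
    by apply: eq_bigr => j _; rewrite [RHS]addrC subrK.
  apply: (le_trans (cabs_prod1B1 _ _ _)).
  set W := \sum_(j < _) _.
  have W0 : 0 <= W by apply: sumr_ge0 => j _; exact: cabs_ge0.
  have WM : W <= 3 * M / N%:R.
    apply: (@le_trans _ _ (\sum_(j < (N + N).+1) (M * N%:R ^- 2))).
      apply: ler_sum => j _; apply: (le_trans (cabs_weierstrass_factor _)); rewrite cabsN.
      set x := cabs _.
      have x0 : 0 <= x by exact: cabs_ge0.
      have xK : x <= K / N%:R by exact: xiB.
      have KN : K / N%:R <= K by rewrite ler_pdivrMr// ler_peMr.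
      have xK' : x <= K by exact: le_trans KN.
      have X3 : x ^+ 3 <= (K / N%:R) ^+ 3 by rewrite lerXn2r// nnegrE// divr_ge0.
      have X3' : (K / N%:R) ^+ 3 <= K ^+ 3 * N%:R ^- 2.
        rewrite expr_div_n ler_wpM2l ?exprn_ge0// lef_pV2 ?posrE ?exprn_gt0//.
        by rewrite [leRHS]exprS ler_peMl// exprn_ge0.
      have EE : expR (x + 2^-1 * x ^+ 2) <= expR (K + 2^-1 * K ^+ 2).
        by rewrite ler_expR lerD// ler_wpM2l// lerXn2r// nnegrE.
      have -> : 2 * (x ^+ 2 * expR (x + 2^-1 * x ^+ 2)) * x
        = 2 * (x ^+ 3 * expR (x + 2^-1 * x ^+ 2)) by ring.
      have -> : M / N%:R ^+ 2 = 2 * ((K ^+ 3 * N%:R ^- 2) * expR (K + 2^-1 * K ^+ 2)).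
        by rewrite /M; ring.
      rewrite ler_wpM2l//; apply: ler_pM; rewrite ?exprn_ge0 ?expR_ge0//.
      exact: le_trans X3'.
    rewrite sumr_const card_ord -[leLHS]mulr_natl.
    have -> : 3 * M / N%:R = (3 * N%:R) * (M * N%:R ^- 2) by field; rewrite gt_eqF.
    have P0 : 0 <= M * N%:R ^- 2 by rewrite mulr_ge0// invr_ge0 exprn_ge0.
    apply: (ler_wpM2r P0).
    by rewrite -natrM ler_nat; lia.
  apply: (le_trans (expRB1_le _)); last by rewrite -[leRHS]mulrA ler_wpM2l.
  rewrite W0 /=; apply: (le_trans WM); rewrite ler_pdivrMr//.
  have : 6 * M < N%:R by apply: (lt_le_trans (truncnS_gt _)); rewrite ler_nat.
  lra.
have C4 : (fun N => cexp (\sum_(j < (N + N).+1) (y / D N j)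
    - \sum_(j < (N + N).+1) (2^-1 * (- (y / D N j)) ^+ 2))) @ \oo --> cexp ((st%:C : C) * y).
  have C0 : {for (st%:C : C) * y, continuous (@cexp R)} by exact: cder_continuous (cder_cexp _).
  have C12 : (fun N => \sum_(j < (N + N).+1) (y / D N j)
    - \sum_(j < (N + N).+1) (2^-1 * (- (y / D N j)) ^+ 2)) @ \oo --> (st%:C : C) * y.
    by rewrite -[_ * y]subr0; exact: (cvgCB C1 C2).
  exact: (cvgC_comp C0 C12).
have -> : (fun N => \prod_(j < (N + N).+1) (1 + y / D N j)) = (fun N =>
    \prod_(j < (N + N).+1) ((1 - - (y / D N j))
     * cexp (- (y / D N j) + 2^-1 * (- (y / D N j)) ^+ 2))
   * cexp (\sum_(j < (N + N).+1) (y / D N j)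
    - \sum_(j < (N + N).+1) (2^-1 * (- (y / D N j)) ^+ 2))).
  apply/funext => N; rewrite -sumrB cexp_sum -big_split /=; apply: eq_bigr => j _.
  rewrite -mulrA -cexpD opprK.
  have -> : - (y / D N j) + 2^-1 * (- (y / D N j)) ^+ 2
    + (y / D N j - 2^-1 * (- (y / D N j)) ^+ 2) = 0 by ring.
  by rewrite cexp0 mulr1.
by rewrite -[cexp (_ * y)]mul1r; exact: (cvgCM C3 C4).
Qed.

End ColumnLimit.

End QuasiPeriod.

(** * Quasi-periodicity of sigma *)

Section SigmaShift.
Variable R : realType.
Local Notation C := (R[i]^o).
Local Notation L := (@Lambda R).
Local Notation st := (@st R).
Local Notation lam := (@lam R).
Local Notation sigma := (@sigma R).

Lemma sigma_st (z : C) :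
  sigma (z + (st%:C : C)) = - (sigma z * cexp ((st%:C : C) * (2 * z + (st%:C : C)))).
Proof.
have F1 : (fun N => (z + (st%:C : C)) * Tn N (z + (st%:C : C))) @ \oo --> sigma (z + (st%:C : C)).
  by rewrite sigmaE; exact: (cvgCMl (@Tn_cvg _ _)).
have F2 : (fun N => - (z * Tn N z * \prod_(j < (N + N).+1) (1 + (2 * z + (st%:C : C))
    / (((st * N%:R)%:C : C) - z - lam (0, Posz j - Posz N))))) @ \oo
    --> - (sigma z * cexp ((st%:C : C) * (2 * z + (st%:C : C)))).
  by rewrite sigmaE; exact: (cvgN (cvgCM (cvgCMl (@Tn_cvg _ z)) (@column_limit _ z))).
apply: (cvgC_unique F1).
apply/cvgCP => e e0; move/cvgCP: F2 => /(_ _ e0) [N1 _ H].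
exists (maxn N1 (Num.truncn (cabs z / st)).+1) => // N /=; rewrite geq_max => /andP[NN N2].
rewrite colP_ratio; first exact: H.
move=> _; rewrite [ltRHS]mulrC -ltr_pdivrMr ?st_gt0//.
by apply: (lt_le_trans (truncnS_gt _)); rewrite ler_nat.
Qed.

Lemma sigma_i (z : C) : sigma ('i * z) = 'i * sigma z.
Proof. by rewrite !sigmaE psig_i mulrA. Qed.

(** By [cabs_sqrD] the exponent is exactly the one for which |sigma(z)| exp(-|z|^2) has period l.
    The phase [e] is left unspecified, as only its modulus matters. *)
Definition quasi_period (l : C) := exists2 e : C, cabs e = 1 &
  forall z : C, sigma (z + l) = e * cexp (2 * l^*%C * z + ((cabs l ^+ 2)%:C : C)) * sigma z.

Lemma quasi_period_st : quasi_period (st%:C).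
Proof.
exists (-1); first by rewrite cabsN cabs1.
move=> z; rewrite sigma_st mulN1r mulNr mulrC; congr (- (cexp _ * _)).
rewrite conjc_real cabs_real gtr0_norm ?st_gt0// rmorphXn /=; ring.
Qed.

Lemma quasi_periodD (l m : C) : quasi_period l -> quasi_period m -> quasi_period (l + m).
Proof.
move=> [e e1 He] [d d1 Hd].
(* The mismatch of exponents; it is purely imaginary since |l + m|^2 = |l|^2 + |m|^2 + 2 Re(conj(m)
   l), so it only changes the phase. *)
pose t : C := 2 * m^*%C * l + ((cabs l ^+ 2 + cabs m ^+ 2)%:C : C) - ((cabs (l + m) ^+ 2)%:C : C).
exists (e * d * cexp t).
  rewrite [cabs (e * d * _)]cabsM [cabs (e * d)]cabsM e1 d1 !mul1r cabs_cexp.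
  suff -> : complex.Re t = 0 by rewrite expR0.
  rewrite /t !ReD ReN [complex.Re (2 * m^*%C * l)]ReM.
  case: l {He t} => a b; case: m {Hd} => a' b'; rewrite /= !cabs_sqr /=.
  by simpc; rewrite /=; ring.
move=> z; rewrite addrA Hd He.
set A := 2 * m^*%C * _ + _; set B := 2 * l^*%C * _ + _; set D := 2 * _ * z + _.
transitivity (e * d * (cexp A * cexp B) * sigma z); first by ring.
transitivity (e * d * (cexp t * cexp D) * sigma z); last by ring.
rewrite -!cexpD; congr (_ * cexp _ * _).
by rewrite /A /B /D /t !rmorphD /=; ring.
Qed.

Lemma quasi_period_i (l : C) : quasi_period l -> quasi_period ('i * l).
Proof.
move=> [e e1 He]; exists e => // z.
have Ez : z = 'i * (- 'i * z) by rewrite mulrA mulrN i_sqr opprK mul1r.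
have Hz : z + 'i * l = 'i * (- 'i * z + l) by rewrite mulrDr -Ez.
have Sz : sigma z = 'i * sigma (- 'i * z) by rewrite -sigma_i -Ez.
rewrite Hz Sz sigma_i He cabsM cabs_i mul1r.
have -> : ('i * l)^*%C = - 'i * l^*%C by case: (l) => a b; simpc.
have -> : 2 * l^*%C * (- 'i * z) = 2 * (- 'i * l^*%C) * z by ring.
ring.
Qed.

Lemma quasi_period_Lambda (l : C) : L l -> quasi_period l.
Proof.
move=> /LambdaE[[m n] ->].
have P0 : quasi_period 0.
  exists 1 => [|z]; first by rewrite cabs1.
  by rewrite addr0 rmorph0 mulr0 mul0r cabs0 expr0n add0r cexp0 !mul1r.
have Pn k x : quasi_period x -> quasi_period (x *+ k).
  by move=> Px; elim: k => [|k IH]; rewrite ?mulr0n// mulrS; exact: quasi_periodD.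
(* Quarter turns give st, i st, -st and -i st, hence generators with both signs, and from them all
   integer combinations. *)
have S1 := quasi_period_st; have S2 := quasi_period_i S1; have S3 := quasi_period_i S2.
have S4 := quasi_period_i S3.
have Z (x : C) : quasi_period x -> quasi_period (- x) -> forall k : int, quasi_period (x *~ k).
  by move=> P1 P2 [k|k]; rewrite ?pmulrn ?NegzE ?mulrNz -?mulNrn; exact: Pn.
have E3 : 'i * ('i * (st%:C : C)) = - (st%:C : C) by rewrite mulrA i_sqr mulN1r.
have E4 : 'i * ('i * ('i * (st%:C : C))) = - ('i * (st%:C : C)) by rewrite mulrA i_sqr mulN1r.
rewrite E3 in S3; rewrite E4 in S4.
have -> : lam (m, n) = (st%:C : C) *~ m + ('i * (st%:C : C)) *~ n.
  have intC (k : int) : (k%:~R : C) = ((k%:~R : R)%:C : C) by rewrite rmorph_int.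
  rewrite -[(st%:C : C) *~ m]mulrzr -[('i * _) *~ n]mulrzr !intC lamE.
  by apply: eq_complexP; rewrite ?(ReD, ImD, ReM, ImM) /=; ring.
by apply: quasi_periodD; exact: Z.
Qed.

Lemma cabs_sqrD (l z : C) :
  cabs (l + z) ^+ 2 = complex.Re (2 * l^*%C * z) + cabs l ^+ 2 + cabs z ^+ 2.
Proof. by case: l => a b; case: z => x y; rewrite !cabs_sqr; simpc; rewrite /=; ring. Qed.

Lemma cder_exp_lin (a z : C) : cder (fun w => cexp (a * w)) z (cexp (a * z) * a).
Proof. by have := cder_cexp_comp (cderMl a (cder_id z)); rewrite mulr1. Qed.

(** Quasi-periodicity transports sigma(w) = w psig(w) from the origin to l, which exhibits the
    simple zero at l together with the modulus of the derivative. *)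
Lemma sigma_shift_ex (l : C) : L l -> exists s : C,
  [/\ cder sigma l s, cabs s = expR (cabs l ^+ 2) &
      forall w : C, sigma (l + w) = s * (cexp (2 * l^*%C * w) * (w * psig w))].
Proof.
move=> /quasi_period_Lambda[e e1 He].
pose s : C := e * cexp ((cabs l ^+ 2)%:C).
have Hs w : sigma (l + w) = s * (cexp (2 * l^*%C * w) * (w * psig w)).
  rewrite addrC He cexpD sigmaE /s; ring.
exists s; split => //; last by rewrite cabsM e1 mul1r cabs_cexp.
have [d Dd] := psig_der (0 : C).
have D1 := cderMl s (cderM (cder_exp_lin (2 * l^*%C) 0) (cderM (cder_id (0 : C)) Dd)).
have D2 : cder (fun w => w - l) l 1 by exact: cder_sub_cst.
rewrite mulr0 cexp0 !mul0r !mul1r psig0 !mulr1 !add0r addr0 mulr1 in D1.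
rewrite -(subrr l) in D1.
have := cder_comp D2 D1; rewrite mulr1.
suff -> : (fun w => s * (cexp (2 * l^*%C * (w - l)) * ((w - l) * psig (w - l)))) = sigma by [].
by apply/funext => w; rewrite -Hs addrC subrK.
Qed.

Lemma sigma_shift (l w : C) : L l ->
  sigma (l + w) = derive1 sigma l * (cexp (2 * l^*%C * w) * (w * psig w)).
Proof. by move=> /sigma_shift_ex[s [/cder_derive1 -> _ ->]]. Qed.

Lemma cabs_dsigma (l : C) : L l -> cabs (derive1 sigma l) = expR (cabs l ^+ 2).
Proof. by move=> /sigma_shift_ex[s [/cder_derive1 -> -> _]]. Qed.

Lemma dsigma_neq0 (l : C) : L l -> derive1 sigma l != 0.
Proof. by move=> Ll; rewrite -cabs_gt0 cabs_dsigma// expR_gt0. Qed.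

Lemma dsigma0 : derive1 sigma (0 : C) = 1.
Proof.
have [d Dd] := psig_der (0 : C).
have := cderM (cder_id (0 : C)) Dd; rewrite mul0r add0r psig0 mulr1.
by move/cder_derive1.
Qed.

End SigmaShift.

(** * Principal values along discs *)

Section PrincipalValue.
Variable R : realType.
Local Notation C := (R[i]^o).
Local Notation L := (@Lambda R).
Local Notation st := (@st R).
Local Notation lam := (@lam R).

Definition disc (r : R) : {fset C} := fset_set (L `&` [set l | cabs l < r]).

Lemma finite_disc (r : R) : finite_set (L `&` [set l | cabs l < r]).
Proof.
have s0 := @st_gt0 R.
apply: (@sub_finite_set _ _ [set` boxF R (Num.truncn (r / st)).+1]); last exact: finite_fset.
move=> l [/LambdaE[p ->] /= lr]; rewrite lam_in_boxF mem_box.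
have B (m : int) : `|st * m%:~R| <= cabs (lam p) -> (absz m <= (Num.truncn (r / st)).+1)%N.
  move=> H; rewrite -(@ler_nat R); apply: (@le_trans _ _ (r / st)); last first.
    by apply: ltW; exact: truncnS_gt.
  rewrite ler_pdivlMr// natr_absz intr_norm mulrC.
  by apply: (le_trans _ (ltW lr)); rewrite normrM (gtr0_norm s0) in H.
rewrite !B//.
- by have := ler_Im (lam p); rewrite {1}lamE.
- by have := ler_Re (lam p); rewrite {1}lamE.
Qed.

Lemma in_disc r l : (l \in disc r) = (l \in L) && (cabs l < r).
Proof.
rewrite /disc in_fset_set; last exact: finite_disc.
rewrite in_setI; congr (_ && _).
by apply/idP/idP => [/set_mem|h]; [|exact: mem_set].
Qed.

(** The index set is always the whole disc; omitted lattice points are encoded by summands vanishing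
    there. *)
Definition dsum (g : C -> C) (r : R) : C := \sum_(l <- disc r) g l.

Lemma csum_disc S g r : S `<=` L -> (forall l, L l -> ~ S l -> g l = 0) ->
  csum S g (disc r) = dsum g r.
Proof.
move=> SL H; rewrite /csum /dsum big_mkcond; apply: eq_big_seq => l.
rewrite in_disc => /andP[/set_mem Ll _]; case: ifPn => // /negP nS.
by rewrite H// => Sl; apply: nS; exact: mem_set.
Qed.

Lemma pv_partialE S g r : S `<=` L -> pv_partial S g r = csum S g (disc r).
Proof.
move=> SL; have fin : finite_set (S `&` [set l | cabs l < r]).
  by apply: sub_finite_set (finite_disc r); apply: setSI.
rewrite /pv_partial fsbig_finite//= /csum [RHS]big_fset_condE; congr (bigop _ _ _).
congr enum_fset; apply/fsetP => l; rewrite in_fset_set// !inE /= in_disc in_setI.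
case lS : (l \in S) => /=; last by rewrite andbF.
have lL : l \in L by apply/mem_set/SL/set_mem.
rewrite andbT lL /=; by apply/idP/idP => [/set_mem|h]; [|exact: mem_set].
Qed.

Lemma dsumD g h r : dsum (fun l => g l + h l) r = dsum g r + dsum h r.
Proof. exact: big_split. Qed.

Lemma dsumB g h r : dsum (fun l => g l - h l) r = dsum g r - dsum h r.
Proof. by rewrite /dsum sumrB. Qed.

Lemma dsumZ k g r : dsum (fun l => k * g l) r = k * dsum g r.
Proof. by rewrite /dsum mulr_sumr. Qed.

Lemma eq_dsum g h r : (forall l, L l -> g l = h l) -> dsum g r = dsum h r.
Proof. by move=> H; apply: eq_big_seq => l; rewrite in_disc => /andP[/set_mem /H]. Qed.

Lemma cabs_dsum_le g r (V : R) : (forall F, psum L (fun l => cabs (g l)) F <= V) ->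
  cabs (dsum g r) <= V.
Proof.
move=> H; rewrite -(@csum_disc L)//.
exact: le_trans (cabs_csum _ _ _) (H _).
Qed.

(** Discs eventually swallow any finite set, so unordered convergence implies convergence of the
    principal value, with the same limit. *)
Lemma csum_dsum_cvg (S : set C) (g : C -> C) (l : C) : S `<=` L -> csum S g @ summability.totally --> l ->
  (fun r => csum S g (disc r)) @ +oo --> l.
Proof.
move=> SL /cvgCP H; apply/cvgCP => e /H /near_totally[F0 HF0].
pose M := \sum_(l <- F0) cabs l.
have MF x : x \in F0 -> cabs x <= M.
  by move=> xF; rewrite /M (big_rem x xF) /= lerDl; apply: sumr_ge0 => y _; exact: cabs_ge0.
exists M; split; first exact: num_real.
move=> r Mr; have := HF0 (F0 `|` disc r)%fset (fsubsetUl _ _).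
suff -> : csum S g (F0 `|` disc r)%fset = csum S g (disc r) by [].
rewrite /csum big_fset_condE [RHS]big_fset_condE; congr (bigop _ _ _).
congr enum_fset; apply/fsetP => x; rewrite !inE /=.
case xS : (x \in S); last by rewrite !andbF.
rewrite !andbT; case xF : (x \in F0) => //=.
have xL : x \in L by apply/mem_set/SL/set_mem.
by rewrite in_disc xL (le_lt_trans (MF x xF)).
Qed.

Lemma abs_dsum_cvg g (V : R) : (forall F, psum L (fun l => cabs (g l)) F <= V) ->
  exists2 l : C, dsum g @ +oo --> l & cabs l <= V.
Proof.
move=> H; have [l Hl lV] := csum_cvg H; exists l => //.
have -> : dsum g = (fun r => csum L g (disc r)) by apply/funext => r; rewrite csum_disc.
exact: csum_dsum_cvg.
Qed.

(** * Discrete Hilbert transforms and Beurling sums *)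

Section Cauchy.
Variables (a : C -> C) (gam : R -> C) (Lm : C -> C) (Mb : R).
Hypothesis aMb : forall l, L l -> cabs (a l) <= Mb.
Hypothesis Lm_cvg : forall l', L l' ->
  (fun r => dsum (fun l => a l / (l - l')) r - gam r) @ +oo --> Lm l'.

Let b (l : C) : R := cabs (a l) + cabs (Lm l).
(** [Lm] is the Hilbert transform of [a], renormalised by a quantity [gam] that does not depend on
    l': zero for finite p, the sum of a_l / l for p infinite. The single number [V] controls all
    that happens in the cell of l'. *)
Definition majorizes (l' : C) (V : R) :=
  forall F, psum L (fun l => kern (l - l') * b l) F <= V.

Let b_ge0 l : 0 <= b l.
Proof. by rewrite addr_ge0// cabs_ge0. Qed.

Let Mb_ge0 : 0 <= Mb.
Proof. by apply: le_trans (aMb (Lambda0 R)); exact: cabs_ge0. Qed.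

Lemma majorizes_point l' l V : majorizes l' V -> L l -> kern (l - l') * b l <= V.
Proof.
move=> H Ll; have := H [fset l]%fset; rewrite /psum big_mkcond big_seq_fset1.
by rewrite mem_set.
Qed.

Lemma majorizes_kern l' V (e : C -> C) (K : R) : L l' -> 0 <= K -> majorizes l' V ->
  (forall x, L x -> cabs (e x) <= K * kern x) ->
  forall F, psum L (fun l => cabs (a l * e (l - l'))) F <= K * V.
Proof.
move=> Ll' K0 HV He F.
apply: (@le_trans _ _ (psum L (fun l => K * (kern (l - l') * b l)) F)).
  apply: le_psum => l Ll; rewrite cabsM mulrC mulrA.
  apply: ler_pM; rewrite ?cabs_ge0//; first by apply: He; exact: Lambda_sub.
  by rewrite lerDl cabs_ge0.
by rewrite psumZ ler_wpM2l.
Qed.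

(** Boundedness of [a] alone gives absolute convergence; [majorizes_kern] supplies the quantitative
    bound at l' separately. *)
Lemma bounded_kern l' (e : C -> C) (K : R) : L l' -> 0 <= K ->
  (forall x, L x -> cabs (e x) <= K * kern x) ->
  forall F, psum L (fun l => cabs (a l * e (l - l'))) F <= K * Mb * @Kk R.
Proof.
move=> Ll' K0 He F.
apply: (@le_trans _ _ (psum L (fun l => K * Mb * kern (l - l')) F)).
  apply: le_psum => l Ll; rewrite cabsM mulrC mulrAC.
  by apply: ler_pM; rewrite ?cabs_ge0 ?aMb//; apply: He; exact: Lambda_sub.
by rewrite psumZ ler_wpM2l ?mulr_ge0// psum_kern_shift.
Qed.

(* Every kernel below is a sum over all lattice points: thanks to [0^-1 = 0] the
   singular terms vanish by themselves. *)
Let s : C := (st%:C : C).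

Let s_neq0 : s != 0.
Proof. by rewrite -cabs_gt0 cabs_real normr_gt0 gt_eqF// st_gt0. Qed.

Let cabs_s : cabs s = st.
Proof. by rewrite cabs_real gtr0_norm// st_gt0. Qed.

Let Ls : L s. Proof. exact: Lambda_st. Qed.

(** The defect between 1/x^2 and the central difference of 1/x with step s, times 2 s. Away from 0,
    s, -s it equals -2 s^3 / (x^2 (x - s)(x + s)), hence is O(|x|^-3). *)
Let e2 (x : C) : C := 2 * s / x ^+ 2 - (x - s)^-1 + (x + s)^-1.

Definition K2 : R := 2 / st + 3 * st ^+ 2.

Lemma K2_ge0 : 0 <= K2.
Proof.
have s0 := @st_gt0 R.
by rewrite addr_ge0//; [rewrite divr_ge0// ltW | rewrite mulr_ge0// sqr_ge0].
Qed.

Let e2_kern x : L x -> cabs (e2 x) <= K2 * kern x.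
Proof.
move=> Lx; have s0 := @st_gt0 R.
have sq : 0 < st ^+ 2 by rewrite exprn_gt0.
have sV : 0 < st^-1 by rewrite invr_gt0.
have s2 : s + s != 0.
  by rewrite -cabs_gt0 -mulr2n -mulr_natl cabsM cabs_nat cabs_s mulr_gt0.
have [->|x0] := eqVneq x 0.
  rewrite /kern eqxx mulr1 /e2 expr0n invr0 mulr0 !add0r invrN opprK.
  apply: (le_trans (cabsD _ _)); rewrite cabsV cabs_s /K2.
  lra.
have kx : kern x = (cabs x ^+ 3)^-1 by rewrite /kern (negbTE x0).
have [xs|xs] := eqVneq x s.
  rewrite kx xs cabs_s /e2 subrr invr0 subr0.
  have -> : 2 * s / s ^+ 2 + (s + s)^-1 = (2 + 2^-1) * s^-1.
    by field; rewrite s_neq0 -mulr2n mulrn_eq0.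
  rewrite cabsM cabsV cabs_s.
  have h5 : cabs (2 + 2^-1 : C) <= 3.
    apply: (le_trans (cabsD _ _)); rewrite cabsV (cabs_nat R 2); lra.
  have -> : K2 / st ^+ 3 = 2 / st ^+ 4 + 3 / st by rewrite /K2; field; rewrite gt_eqF.
  have : cabs (2 + 2^-1 : C) * st^-1 <= 3 * st^-1 by rewrite ler_wpM2r// ltW.
  have : 0 <= 2 / st ^+ 4 by rewrite divr_ge0// exprn_ge0// ltW.
  lra.
have [xs'|xs'] := eqVneq x (- s).
  rewrite kx xs' cabsN cabs_s /e2 addNr invr0 addr0 sqrrN.
  have -> : 2 * s / s ^+ 2 - (- s - s)^-1 = (2 + 2^-1) * s^-1.
    by rewrite -opprD invrN opprK; field; rewrite s_neq0 -mulr2n mulrn_eq0.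
  rewrite cabsM cabsV cabs_s.
  have h5 : cabs (2 + 2^-1 : C) <= 3.
    apply: (le_trans (cabsD _ _)); rewrite cabsV (cabs_nat R 2); lra.
  have -> : K2 / st ^+ 3 = 2 / st ^+ 4 + 3 / st by rewrite /K2; field; rewrite gt_eqF.
  have : cabs (2 + 2^-1 : C) * st^-1 <= 3 * st^-1 by rewrite ler_wpM2r// ltW.
  have : 0 <= 2 / st ^+ 4 by rewrite divr_ge0// exprn_ge0// ltW.
  lra.
have p0 : x - s != 0 by rewrite subr_eq0.
have m0 : x + s != 0 by rewrite -[s]opprK subr_eq0.
have -> : e2 x = - (2 * s ^+ 3) * (x ^+ 2 * ((x - s) * (x + s)))^-1.
  by rewrite /e2; field; rewrite x0 p0 m0.
have Lp := Lambda_ge (Lambda_sub Lx Ls) p0; have Lq := Lambda_ge (Lambda_add Lx Ls) m0.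
have X0 : 0 < cabs x by rewrite cabs_gt0.
(* The moduli of x - s and x + s add up to at least 2 |x|, so the larger is at least |x|, while the
   smaller is at least [st]. *)
have pq : st * cabs x <= cabs ((x - s) * (x + s)).
  rewrite cabsM.
  have : 2 * cabs x <= cabs (x - s) + cabs (x + s).
    apply: le_trans (cabsD _ _).
    have -> : x - s + (x + s) = 2 * x by ring.
    by rewrite cabsM cabs_nat.
  set P := cabs (x - s) in Lp *; set Q := cabs (x + s) in Lq *.
  move=> PQ; have [PQ'|PQ'] := leP P Q.
    by apply: ler_pM; rewrite ?cabs_ge0 ?(ltW s0)//; lra.
  by rewrite mulrC; apply: ler_pM; rewrite ?cabs_ge0 ?(ltW s0)//; lra.
rewrite cabsM cabsN [cabs (2 * _)]cabsM cabs_nat cabsX cabs_s cabsV [cabs (x ^+ 2 * _)]cabsM cabsX.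
apply: (@le_trans _ _ (2 * st ^+ 3 * (cabs x ^+ 2 * (st * cabs x))^-1)).
  rewrite ler_wpM2l ?mulr_ge0 ?exprn_ge0 ?(ltW s0)//.
  rewrite lef_pV2 ?posrE; last 2 first.
  - by rewrite mulr_gt0 ?exprn_gt0// (lt_le_trans _ pq)// mulr_gt0.
  - by rewrite mulr_gt0 ?exprn_gt0// mulr_gt0.
  by rewrite ler_wpM2l// exprn_ge0// ltW.
have -> : 2 * st ^+ 3 * (cabs x ^+ 2 * (st * cabs x))^-1 = 2 * st ^+ 2 / cabs x ^+ 3.
  by field; rewrite !gt_eqF.
rewrite kx ler_wpM2r ?invr_ge0 ?exprn_ge0 ?(ltW X0)//.
have V0 : 0 <= 2 / st by rewrite divr_ge0// ltW.
rewrite /K2; have := ltW sq; lra.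
Qed.

Definition KB : R := (2 * st ^+ 3 + K2) / (2 * st).

Lemma KB_ge0 : 0 <= KB.
Proof.
have s0 := @st_gt0 R.
apply: divr_ge0; last by rewrite mulr_ge0// ltW.
by rewrite addr_ge0 ?K2_ge0// mulr_ge0// exprn_ge0// ltW.
Qed.

(** Through [e2] the Beurling sum is a central difference of [Lm], in which [gam] cancels, plus an
    absolutely convergent sum. The neighbours enter the bound with weight kern = st^-3, whence the
    st^3 in [KB]. *)
Lemma beurling_cvg l' : L l' -> exists2 B : C,
  (fun r => dsum (fun l => a l / (l - l') ^+ 2) r) @ +oo --> B &
  forall V, majorizes l' V -> cabs B <= KB * V.
Proof.
move=> Ll'; have s0 := @st_gt0 R.
have [E HE _] := abs_dsum_cvg (bounded_kern Ll' K2_ge0 e2_kern).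
have Lp := Lambda_add Ll' Ls; have Lm' := Lambda_sub Ll' Ls.
pose B : C := (2 * s)^-1 * (Lm (l' + s) - Lm (l' - s) + E).
have s2 : 2 * s != 0 by rewrite mulf_neq0// pnatr_eq0.
exists B.
  have -> : (fun r => dsum (fun l => a l / (l - l') ^+ 2) r) = (fun r => (2 * s)^-1 *
      ((dsum (fun l => a l / (l - (l' + s))) r - gam r)
       - (dsum (fun l => a l / (l - (l' - s))) r - gam r)
       + dsum (fun l => a l * e2 (l - l')) r)).
    apply/funext => r; apply: (mulfI s2); rewrite mulrA divff// mul1r.
    have -> : 2 * s * dsum (fun l => a l / (l - l') ^+ 2) r
       = dsum (fun l => 2 * s * (a l / (l - l') ^+ 2)) r by rewrite dsumZ.
    have -> : forall X Y G Z : C, X - G - (Y - G) + Z = X - Y + Z by move=> *; ring.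
    rewrite -dsumB -dsumD; apply: eq_dsum => l _; rewrite /e2.
    have -> : l - (l' + s) = l - l' - s by ring.
    have -> : l - (l' - s) = l - l' + s by ring.
    by ring.
  exact: (cvgCMl (cvgCD (cvgCB (Lm_cvg Lp) (Lm_cvg Lm')) HE)).
move=> V HV.
have [E' HE' EV] := abs_dsum_cvg (majorizes_kern Ll' K2_ge0 HV e2_kern).
have EE : E = E' by exact: (cvgC_unique HE HE').
have pt x : L (l' + x) -> cabs x = st -> cabs (Lm (l' + x)) <= st ^+ 3 * V.
  move=> Lx xs; have := majorizes_point HV Lx; rewrite (addrC l') addrK /kern.
  have x0 : x != 0 by rewrite -cabs_gt0 xs.
  rewrite (negbTE x0) xs mulrC ler_pdivrMr ?exprn_gt0// mulrC.
  by apply: le_trans; rewrite /b addrC lerDr cabs_ge0.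
have H1 := pt s Lp cabs_s.
have H2 : cabs (Lm (l' - s)) <= st ^+ 3 * V by apply: pt; rewrite ?cabsN.
rewrite /B cabsM cabsV [cabs (2 * s)]cabsM cabs_nat cabs_s /KB mulrAC mulrC.
rewrite ler_pM2r ?invr_gt0 ?mulr_gt0//.
apply: (le_trans (cabsD _ _)); apply: (le_trans (lerD (cabsB _ _) (lexx _))).
rewrite EE mulrDl; lra.
Qed.

End Cauchy.

End PrincipalValue.

(** * Construction of the interpolating function *)

Section Interpolation.
Variable R : realType.
Local Notation C := (R[i]^o).
Local Notation L := (@Lambda R).
Local Notation st := (@st R).
Local Notation lam := (@lam R).
Local Notation sigma := (@sigma R).
Local Notation psig := (@psig R).

Lemma nearest_lambda (z : C) : exists2 l : C, L l &
  [/\ - (st / 2) <= complex.Re (z - l), complex.Re (z - l) < st / 2,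
      - (st / 2) <= complex.Im (z - l) & complex.Im (z - l) < st / 2].
Proof.
have s0 := @st_gt0 R.
have H (t : R) : exists m : int, - (st / 2) <= t - st * m%:~R < st / 2.
  exists (Num.floor (t / st + 2^-1)).
  have := floor_le_tmp (t / st + 2^-1); have := floorD1_gt (t / st + 2^-1).
  rewrite intrD; set k := _%:~R; move=> h1 h2.
  have E : t = st * (t / st) by rewrite mulrC divfK// gt_eqF.
  apply/andP; split; rewrite {1}E; nra.
have [m /andP[m1 m2]] := H (complex.Re z); have [n /andP[n1 n2]] := H (complex.Im z).
exists (lam (m, n)); first exact: Lambda_lam.
by rewrite ReD ReN ImD ImN lamE.
Qed.

Lemma cell_sqr (w : C) : - (st / 2) <= complex.Re w -> complex.Re w <= st / 2 ->
  - (st / 2) <= complex.Im w -> complex.Im w <= st / 2 -> 2 * cabs w ^+ 2 <= st ^+ 2.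
Proof. by case: w => x y /= *; rewrite cabs_sqr /=; nra. Qed.

Lemma cell_lt (w : C) (t : R) : 0 < t -> 1 < 2 * t ^+ 2 -> 2 * cabs w ^+ 2 <= st ^+ 2 ->
  cabs w < t * st.
Proof.
move=> t0 t2 H; have s0 := @st_gt0 R; have := cabs_ge0 w.
rewrite ltNge => w0; apply/negP => tw.
have : (t * st) ^+ 2 <= cabs w ^+ 2 by rewrite ler_sqr ?nnegrE// mulr_ge0// ltW.
have : 0 < st ^+ 2 by rewrite exprn_gt0.
rewrite exprMn; nra.
Qed.

Lemma Lambda_sep l (w : C) : L l -> L (l + w) -> cabs w < st -> w = 0.
Proof.
move=> Ll Lw ws; have := Lambda_sub Lw Ll; rewrite addrAC subrr add0r => L0.
by apply/eqP/negPn/negP => /(Lambda_ge L0); rewrite leNgt ws.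
Qed.

(** Nonzero lattice points satisfy |x| >= st. Three nested radii are in use: a cell has circumradius
    st / sqrt 2, derivatives are taken within (3/4) st, and sums are controlled up to (4/5) st. *)
Lemma lattice_gap (x w : C) : L x -> x != 0 -> cabs w <= 4 / 5 * st ->
  cabs x / 5 <= cabs (x - w).
Proof.
move=> Lx x0 ws; have := Lambda_ge Lx x0; have := cabs_ge_sub x w; lra.
Qed.

Lemma lattice_gapV (x w : C) : L x -> x != 0 -> cabs w <= 4 / 5 * st ->
  cabs (x - w)^-1 <= 5 * (cabs x)^-1.
Proof.
move=> Lx x0 ws; have h := lattice_gap Lx x0 ws.
have X0 : 0 < cabs x by rewrite cabs_gt0.
have -> : 5 * (cabs x)^-1 = (cabs x / 5)^-1 by rewrite invfM invrK mulrC.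
rewrite cabsV lef_pV2 ?posrE// ?(lt_le_trans _ h)// divr_gt0//.
Qed.

Lemma lt34_le45 (w : C) : cabs w < 3 / 4 * st -> cabs w <= 4 / 5 * st.
Proof.
move=> ws; apply: (le_trans (ltW ws)); rewrite ler_wpM2r ?(ltW (@st_gt0 R))//; lra.
Qed.

Section Germ.
Variables (a : C -> C) (gam : R -> C) (Lm : C -> C) (Mb : R).
Hypothesis aMb : forall l, L l -> cabs (a l) <= Mb.
Hypothesis Lm_cvg : forall l', L l' ->
  (fun r => dsum (fun l => a l / (l - l')) r - gam r) @ +oo --> Lm l'.

(** The remainder of 1/(x - w) after the linear term in w, divided by w^2. It vanishes at x = 0 by
    the convention on inverses. *)
Let rho (w x : C) : C := (x ^+ 2)^-1 * (x - w)^-1.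

Let rho_kern (w x : C) : cabs w <= 4 / 5 * st -> L x -> cabs (rho w x) <= 5 * kern x.
Proof.
move=> ws Lx; rewrite /kern; have [->|x0] := eqVneq x 0.
  by rewrite /rho expr0n invr0 mul0r cabs0 mulr1.
have h := lattice_gapV Lx x0 ws.
have -> : 5 * (cabs x ^+ 3)^-1 = (cabs x ^+ 2)^-1 * (5 * (cabs x)^-1).
  by field; rewrite cabs_eq0.
by rewrite cabsM cabsV cabsX ler_wpM2l// invr_ge0 exprn_ge0// cabs_ge0.
Qed.

(** The remainder is h^2 times x^-2 and three inverse gaps, each at most 5 / |x|; two of the five
    powers of 1/|x| are given away as st^-2. It feeds [cder_limit]. *)
Let rem_kern (w h x : C) : cabs w <= 4 / 5 * st -> cabs (w + h) <= 4 / 5 * st -> L x ->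
  cabs (rho (w + h) x - rho w x - (x ^+ 2)^-1 * (x - w) ^- 2 * h)
    <= cabs h ^+ 2 * (125 / st ^+ 2 * kern x).
Proof.
move=> ws hs Lx; have s0 := @st_gt0 R.
rewrite /kern; have [->|x0] := eqVneq x 0.
  rewrite /rho expr0n invr0 !mul0r !subr0 cabs0 mulr1 mulr_ge0 ?sqr_ge0//.
  by rewrite divr_ge0// exprn_ge0// ltW.
have g1 := lattice_gapV Lx x0 ws; have g2 := lattice_gapV Lx x0 hs.
have X0 : 0 < cabs x by rewrite cabs_gt0.
have nz v : cabs v <= 4 / 5 * st -> x - v != 0.
  move=> vs; rewrite -cabs_gt0 (lt_le_trans _ (lattice_gap Lx x0 vs))// divr_gt0//.
have -> : rho (w + h) x - rho w x - (x ^+ 2)^-1 * (x - w) ^- 2 * h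
    = h ^+ 2 * ((x ^+ 2)^-1 * ((x - w)^-1 * (x - w)^-1 * (x - (w + h))^-1)).
  by rewrite /rho; field; rewrite x0 !nz//.
rewrite cabsM cabsX ler_wpM2l ?sqr_ge0//.
rewrite [cabs (_ * _)]cabsM cabsV cabsX.
set u := (cabs x)^-1 in g1 g2.
have u0 : 0 <= u by rewrite invr_ge0 ltW.
have us : u <= st^-1 by rewrite lef_pV2 ?posrE//; exact: Lambda_ge.
apply: (@le_trans _ _ (u ^+ 2 * ((5 * u) * (5 * u) * (5 * u)))).
  rewrite exprVn ler_wpM2l ?invr_ge0 ?sqr_ge0//.
  rewrite !cabsM; apply: ler_pM; rewrite ?mulr_ge0 ?cabs_ge0//.
  by apply: ler_pM; rewrite ?cabs_ge0.
have -> : u ^+ 2 * (5 * u * (5 * u) * (5 * u)) = 125 * u ^+ 2 * u ^+ 3 by ring.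
rewrite -!exprVn -/u ler_wpM2r ?exprn_ge0// ler_wpM2l//.
by rewrite ler_sqr ?nnegrE// (le_trans u0).
Qed.

Lemma germ_expansion (w x : C) : L x -> cabs w <= 4 / 5 * st ->
  (if x == 0 then 0 else (x - w)^-1) = x^-1 + w * (x ^+ 2)^-1 + w ^+ 2 * rho w x.
Proof.
move=> Lx ws; case: (eqVneq x 0) => [->|x0].
  by rewrite /rho expr0n invr0 mul0r !mulr0 !addr0.
have X0 : 0 < cabs x by rewrite cabs_gt0.
have xw : x - w != 0.
  by rewrite -cabs_gt0 (lt_le_trans _ (lattice_gap Lx x0 ws))// divr_gt0.
by rewrite /rho; field; rewrite x0 xw.
Qed.

Definition KG : R := st * (1 + st * KB R + st ^+ 2 * 5).

Lemma KG_ge0 : 0 <= KG.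
Proof.
have s0 := ltW (@st_gt0 R); have kb := @KB_ge0 R.
by rewrite mulr_ge0// !addr_ge0// mulr_ge0// exprn_ge0.
Qed.

(** The Cauchy sum with its pole at l' removed is Lm l' + w B + w^2 S(w), where B is the Beurling
    sum and S the absolutely convergent sum of [rho]. Each coefficient is bounded by a multiple of
    [V]. *)
Lemma germ l' : L l' -> exists G : C -> C,
  [/\ forall w, cabs w <= 4 / 5 * st ->
        (fun r => dsum (fun l => if l == l' then 0 else a l / (l - (l' + w))) r - gam r)
          @ +oo --> G w,
      forall w, cabs w < 3 / 4 * st -> exists d, cder G w d &
      forall w V, cabs w < 3 / 4 * st -> majorizes a Lm l' V -> cabs (w * G w) <= KG * V].
Proof.
move=> Ll'; have s0 := @st_gt0 R.
have [B HB BV] := beurling_cvg aMb Lm_cvg Ll'.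
have Sex (w : C) : exists S : C, cabs w <= 4 / 5 * st ->
    (fun r => dsum (fun l => a l * rho w (l - l')) r) @ +oo --> S.
  have [ws|ws] := pselect (cabs w <= 4 / 5 * st); last first.
    exists 0 => w45; case: (ws w45).
  have k5 : (0 : R) <= 5 by [].
  have [S HS _] := abs_dsum_cvg (bounded_kern aMb Ll' k5 (fun x Lx => rho_kern ws Lx)).
  by exists S.
have [S HS] := choice Sex.
exists (fun w => Lm l' + w * B + w ^+ 2 * S w); split.
- move=> w ws.
  have -> : (fun r => dsum (fun l => if l == l' then 0 else a l / (l - (l' + w))) r - gam r)
     = (fun r => (dsum (fun l => a l / (l - l')) r - gam r)
        + w * dsum (fun l => a l / (l - l') ^+ 2) r
        + w ^+ 2 * dsum (fun l => a l * rho w (l - l')) r).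
    apply/funext => r; have -> : forall X Y Z G : C, X - G + Y + Z = X + Y + Z - G by move=> *; ring.
    rewrite -!dsumZ -!dsumD.
    congr (_ - gam r); apply: eq_dsum => l Ll.
    have := germ_expansion (Lambda_sub Ll Ll') ws; rewrite subr_eq0 opprD addrA => E.
    transitivity (a l * (if l == l' then 0 else (l - l' - w)^-1)).
      by case: eqP => _; rewrite ?mulr0.
    by rewrite E; ring.
  exact: (cvgCD (cvgCD (Lm_cvg Ll') (cvgCMl HB)) (cvgCMl (HS w ws))).
- move=> w ws; have w45 := lt34_le45 ws.
  have [dS HdS] : exists d, cder S w d.
    apply: (@cder_limit R R +oo _ (fun r w => dsum (fun l => a l * rho w (l - l')) r)
       (fun r => dsum (fun l => a l * (((l - l') ^+ 2)^-1 * (l - l' - w) ^- 2)) r)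
       S w (3 / 4 * st - cabs w) (125 / st ^+ 2 * Mb * @Kk R)).
    + by rewrite subr_gt0.
    + rewrite mulr_ge0 ?Kk_ge0// mulr_ge0//; first by rewrite divr_ge0// sqr_ge0.
      exact: (le_trans (cabs_ge0 _) (aMb (@Lambda0 R))).
    + move=> h hh; apply: HS; apply: lt34_le45; apply: (le_lt_trans (cabsD _ _)); lra.
    move=> h hh; have wh : cabs (w + h) <= 4 / 5 * st.
      by apply: lt34_le45; apply: (le_lt_trans (cabsD _ _)); lra.
    apply: nearW => r; rewrite -dsumB [_ * h]mulrC -dsumZ -dsumB.
    have K0 : 0 <= cabs h ^+ 2 * (125 / st ^+ 2) by rewrite mulr_ge0 ?divr_ge0 ?sqr_ge0.
    have H := bounded_kern aMb (e := fun x => rho (w + h) x - rho w x - (x ^+ 2)^-1 * (x - w) ^- 2 * h) Ll' K0.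
    have {}H : forall F, psum L (fun l => cabs (a l * (rho (w + h) (l - l') - rho w (l - l')
        - ((l - l') ^+ 2)^-1 * (l - l' - w) ^- 2 * h))) F
        <= 125 / st ^+ 2 * Mb * @Kk R * cabs h ^+ 2.
      move=> F; have -> : 125 / st ^+ 2 * Mb * @Kk R * cabs h ^+ 2
        = cabs h ^+ 2 * (125 / st ^+ 2) * Mb * @Kk R by ring.
      by apply: H => x Lx; rewrite -[leRHS]mulrA; exact: rem_kern.
    apply: le_trans (cabs_dsum_le _ H); rewrite le_eqVlt; apply/orP; left; apply/eqP.
    by congr cabs; apply: eq_dsum => l _; ring.
  have D := cderD (cderD (cder_cst (Lm l') w) (cderM (cder_id w) (cder_cst B w)))
     (cderM (cderX 2 (cder_id w)) HdS).
  by eexists; exact: D.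
- move=> w V ws HV.
  have k5 : (0 : R) <= 5 by [].
  have w45 := lt34_le45 ws.
  have [S' HS' SV] := abs_dsum_cvg (majorizes_kern Ll' k5 HV (fun x Lx => rho_kern w45 Lx)).
  have ES : S w = S' by exact: (cvgC_unique (HS w w45) HS').
  rewrite ES; have bV : cabs (Lm l') <= V.
    have := majorizes_point HV Ll'; rewrite subrr /kern eqxx mul1r; apply: le_trans.
    by rewrite lerDr cabs_ge0.
  have ws' : cabs w <= st by have := cabs_ge0 w; lra.
  have V0 : 0 <= V by apply: le_trans bV; exact: cabs_ge0.
  have -> : KG * V = st * (V + st * (KB R * V) + st ^+ 2 * (5 * V)) by rewrite /KG; ring.
  rewrite cabsM; apply: ler_pM; rewrite ?cabs_ge0//.
  apply: (le_trans (cabsD _ _)); apply: lerD; last first.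
    rewrite cabsM cabsX; apply: ler_pM; rewrite ?sqr_ge0 ?cabs_ge0//.
    by rewrite ler_sqr ?nnegrE ?cabs_ge0// ltW.
  apply: (le_trans (cabsD _ _)); apply: lerD => //.
  by rewrite cabsM; apply: ler_pM; rewrite ?cabs_ge0// BV.
Qed.

(** Lagrange interpolation: off the lattice f is -sigma times the renormalised Cauchy sum. Near l'
    the simple zero of sigma cancels the pole, and the weight exp(-|z|^2) cancels the growth of
    sigma, so the bound is uniform over cells apart from [V]. *)
Lemma interpolation : exists f : C -> C,
  [/\ entire f, forall l, L l -> f l = derive1 sigma l * a l &
      forall l' w V, L l' -> 2 * cabs w ^+ 2 <= st ^+ 2 -> majorizes a Lm l' V ->
        cabs (f (l' + w)) * expR (- cabs (l' + w) ^+ 2) <= expR 3 * (1 + KG) * V].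
Proof.
have s0 := @st_gt0 R.
pose g z r := dsum (fun l => a l / (l - z)) r - gam r.
(* Values are fixed pointwise before the limits are known to exist; [germ] then shows that off the
   lattice they do exist. *)
have Yex z : exists yz : C, (L z -> yz = derive1 sigma z * a z) /\
    (forall v, ~ L z -> g z @ +oo --> v -> yz = - sigma z * v).
  have [Lz|nLz] := pselect (L z).
    by exists (derive1 sigma z * a z); split=> // v nLz; case: (nLz Lz).
  have [[v Hv]|nv] := pselect (exists v : C, g z @ +oo --> v).
    exists (- sigma z * v); split=> [Lz|u _ Hu]; first by case: (nLz Lz).
    by rewrite (cvgC_unique Hv Hu).
  exists 0; split=> [Lz|v _ Hv]; first by case: (nLz Lz).
  by case: nv; exists v.
have [y Hy] := choice Yex.
(* The regular form of sigma(l' + w) (a l' / w - G w), by the factorisation of sigma at l'. *)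
pose loc l' (G : C -> C) w :=
  derive1 sigma l' * (cexp (2 * l'^*%C * w) * (psig w * (a l' - w * G w))).
have H l' : L l' -> exists G : C -> C,
  [/\ forall w, cabs w <= 4 / 5 * st -> y (l' + w) = loc l' G w,
      forall w, cabs w < 3 / 4 * st -> exists d, cder (loc l' G) w d &
      forall w V, cabs w < 3 / 4 * st -> majorizes a Lm l' V -> cabs (w * G w) <= KG * V].
  move=> Ll'; have [G [G1 G2 G3]] := germ Ll'.
  exists G; split => //.
    move=> w ws; have ws1 : cabs w < st by lra.
    have [->|w0] := eqVneq w 0.
      by rewrite addr0 (Hy l').1// /loc mulr0 cexp0 psig0 mul0r subr0 !mul1r.
    have nL : ~ L (l' + w).
      by move=> /(Lambda_sep Ll') /(_ ws1) w00; rewrite w00 eqxx in w0.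
    rewrite ((Hy (l' + w)).2 (- (a l' / w) + G w))//.
      by rewrite sigma_shift// /loc; field.
    have C1 : (fun r => - (a l' / w) +
      (dsum (fun l => if l == l' then 0 else a l / (l - (l' + w))) r - gam r)) @ +oo
      --> - (a l' / w) + G w.
      by exact: (cvgCD (cvg_cst _) (G1 w ws)).
    apply: cvg_trans C1; apply: near_eq_cvg.
    exists (cabs l'); split; first exact: num_real.
    move=> r lr; symmetry; rewrite /g addrA; congr (_ - gam r).
    have l'r : l' \in disc r by rewrite in_disc mem_set.
    have S1 (h : C -> C) : dsum h r = h l' + \sum_(i <- disc r | i != l') h i.
      by rewrite /dsum (bigD1_seq l') ?fset_uniq.
    rewrite !S1 eqxx add0r.
    congr (_ + _); last by apply: eq_bigr => i /negbTE ->.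
    by rewrite opprD addrA subrr add0r invrN mulrN.
  move=> w ws; have [d Dd] := G2 w ws; have [p Dp] := psig_der w.
  have D := cderMl (derive1 sigma l') (cderM (cder_exp_lin (2 * l'^*%C) w)
    (cderM Dp (cderB (cder_cst (a l') w) (cderM (cder_id w) Dd)))).
  by eexists; exact: D.
exists y; split.
- move=> z; have [l' Ll' [c1 c2 c3 c4]] := nearest_lambda z.
  have [G [G1 G2 _]] := H l' Ll'.
  have ws : cabs (z - l') < 3 / 4 * st.
    apply: cell_lt; [lra|lra|apply: cell_sqr => //; exact: ltW].
  have [d Dd] := G2 _ ws.
  have D2 := cder_comp (cder_sub_cst l' z) Dd.
  apply: cder_derivable.
  apply: (@cder_near R y (fun w => loc l' G (w - l')) z _ (3 / 4 * st - cabs (z - l')) _ _ D2).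
    by rewrite subr_gt0.
  move=> v /= hv; rewrite -G1; first by rewrite addrC subrK.
  apply: lt34_le45; have -> : v - l' = (v - z) + (z - l') by ring.
  by apply: (le_lt_trans (cabsD _ _)); lra.
- by move=> l Ll; rewrite (Hy l).1.
- move=> l' w V Ll' hw HV; have [G [G1 _ G3]] := H l' Ll'.
  have ws : cabs w < 3 / 4 * st by apply: cell_lt => //; lra.
  rewrite G1; last exact: lt34_le45.
  have aV : cabs (a l') <= V.
    have := majorizes_point HV Ll'; rewrite subrr /kern eqxx mul1r; apply: le_trans.
    by rewrite lerDl cabs_ge0.
  have V0 : 0 <= V by apply: le_trans aV; exact: cabs_ge0.
  have hG := G3 w V ws HV.
  rewrite /loc cabsM cabs_dsigma// cabsM cabs_cexp cabs_sqrD.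
  have -> : forall A B P Q : R, expR A * (expR B * P) * expR (- (B + A + Q)) = P * expR (- Q).
    move=> A B P Q; rewrite !opprD !expRD !expRN.
    by field; rewrite !gt_eqF ?expR_gt0.
  rewrite cabsM -mulrA -mulrA.
  have ws' : cabs w <= st by have := cabs_ge0 w; lra.
  apply: ler_pM; rewrite ?mulr_ge0 ?cabs_ge0 ?expR_ge0//; first exact: psig_le.
  rewrite -[leRHS]mulr1; apply: ler_pM; rewrite ?cabs_ge0 ?expR_ge0//.
    by apply: (le_trans (cabsB _ _)); rewrite mulrDl mul1r lerD.
  by rewrite -expR0 ler_expR oppr_le0 sqr_ge0.
Qed.

End Germ.
End Interpolation.

(** * Convolution with the kernel on l^p *)

Section Convolution.
Variable R : realType.
Local Notation C := (R[i]^o).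
Local Notation L := (@Lambda R).
Local Notation st := (@st R).
Local Notation Kk := (@Kk R).

(** Either x <= A, or x / A >= 1 is below its p-th power. With a well chosen level [A] this stands
    in for Hölder's inequality. *)
Lemma le_powR_split (A x p : R) : 0 < A -> 0 <= x -> 1 <= p ->
  x <= A + A * (A `^ p)^-1 * x `^ p.
Proof.
move=> A0 x0 p1; have Ap : 0 < A `^ p by rewrite powR_gt0.
have [xA|Ax] := leP x A.
  by rewrite -[leLHS]addr0 lerD// mulr_ge0 ?powR_ge0// mulr_ge0 ?ltW// invr_gt0.
have q1 : 1 <= x / A by rewrite ler_pdivlMr// mul1r ltW.
have -> : A * (A `^ p)^-1 * x `^ p = A * (x / A) `^ p.
  rewrite powRM ?invr_ge0 ?(ltW A0)// -[A^-1]powR_inv1 ?(ltW A0)// -powRrM mulN1r powRN.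
  by ring.
have := le1r_powR q1 p1; rewrite -(ler_pM2l A0) [leLHS]mulrC divfK ?gt_eqF//; lra.
Qed.

Let Kk_gt0 : 0 < Kk.
Proof.
have s0 := @st_gt0 R.
by rewrite mulr_gt0// ltr_pwDl// exprn_ge0// divr_ge0// ltW.
Qed.

(** Young's inequality for a summable kernel: split x at a level depending on l', then sum the
    convolution of the p-th powers by Tonelli. *)
Lemma kern_convolution (x : C -> R) (p M : R) : 1 <= p -> (forall l, 0 <= x l) ->
  (forall F, psum L (fun l => x l `^ p) F <= M) ->
  exists V : C -> R, [/\ forall l', 0 <= V l',
    forall l', L l' -> forall F, psum L (fun l => kern (l - l') * x l) F <= V l' &
    exists M', forall F, psum L (fun l' => V l' `^ p) F <= M'].
Proof.
move=> p1 x0 HM; have p0 : 0 < p by exact: lt_le_trans p1.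
have M0 : 0 <= M by have := HM fset0; rewrite /psum big_mkcond big_seq_fset0.
pose w l' l := kern (l - l') * x l `^ p.
have w0 l' l : 0 <= w l' l by rewrite mulr_ge0 ?kern_ge0 ?powR_ge0.
pose E l' := (\esum_(l in L) (w l' l)%:E)%E.
(* Exchange of summations; evenness of [kern] makes the sum over l' a translate of the kernel
   sum. *)
have sumE (G : {fset C}) : (\sum_(l' <- G | l' \in L) E l' <= (Kk * M)%:E)%E.
  rewrite -esum_sum; last by move=> i j _ _; rewrite lee_fin.
  under eq_esum do rewrite sumEFin.
  apply/esum_le_psum => [l _|F]; first exact: sumr_ge0.
  apply: (@le_trans _ _ (psum L (fun l => Kk * x l `^ p) F)).
    apply: le_psum => l Ll; rewrite -mulr_suml ler_wpM2r ?powR_ge0//.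
    apply: le_trans (psum_kern_shift G Ll); apply: le_psum => l' _.
    by rewrite -kernN opprB.
  by rewrite psumZ ler_wpM2l ?(ltW Kk_gt0).
have E0 l' : (0 <= E l')%E by apply: esum_ge0 => l _; rewrite lee_fin.
have Efin l' : L l' -> E l' \is a fin_num.
  move=> Ll'; rewrite ge0_fin_numE//; apply: (@le_lt_trans _ _ (Kk * M)%:E); last exact: ltry.
  by have := sumE [fset l']%fset; rewrite big_mkcond big_seq_fset1 mem_set.
pose W l' := fine (E l').
have W0 l' : 0 <= W l' by exact: fine_ge0.
have WE l' F : L l' -> psum L (w l') F <= W l'.
  by move=> Ll'; apply: (esum_le_psum _ _).1 => //; rewrite fineK// Efin.
(* The level that balances the two terms of the split: each becomes Kk A, whence the bound 2 Kk
   A. *)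
pose A l' := (W l' / Kk) `^ p^-1.
have Ap l' : A l' `^ p = W l' / Kk.
  by rewrite /A -powRrM mulVf ?gt_eqF// powRr1// divr_ge0// ltW.
exists (fun l' => 2 * Kk * A l'); split.
- by move=> l'; rewrite mulr_ge0 ?powR_ge0// mulr_ge0// (ltW Kk_gt0).
- move=> l' Ll' F.
  have Hs (B : R) : 0 < B -> psum L (fun l => kern (l - l') * x l) F
      <= Kk * B + B * (B `^ p)^-1 * W l'.
    move=> B0; apply: (@le_trans _ _ (psum L (fun l => B * kern (l - l')
        + B * (B `^ p)^-1 * w l' l) F)).
      apply: le_psum => l Ll.
      have -> : B * kern (l - l') + B * (B `^ p)^-1 * w l' l
        = kern (l - l') * (B + B * (B `^ p)^-1 * x l `^ p) by rewrite /w; ring.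
      by rewrite ler_wpM2l ?kern_ge0// le_powR_split.
    rewrite psumD !psumZ; apply: lerD.
      by rewrite mulrC ler_wpM2r ?(ltW B0)// psum_kern_shift.
    by rewrite ler_wpM2l ?WE// mulr_ge0 ?(ltW B0)// invr_ge0 powR_ge0.
  have [A0|A0] := ltP 0 (A l').
    apply: (le_trans (Hs _ A0)); rewrite Ap.
    have W1 : W l' != 0.
      by apply: contraTneq A0 => W00; rewrite /A W00 mul0r powR0 ?invr_eq0 ?gt_eqF// ltxx.
    rewrite le_eqVlt; apply/orP; left; apply/eqP; field.
    by rewrite W1 gt_eqF.
  have A00 : A l' = 0 by apply/eqP; rewrite eq_le A0 powR_ge0.
  have W1 : W l' = 0.
    by have := Ap l'; rewrite A00 powR0 ?gt_eqF// => /esym/eqP; rewrite mulf_eq0 invr_eq0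
      (gt_eqF Kk_gt0) orbF => /eqP.
  (* Here W l' = 0, and splitting at arbitrarily small positive levels shows that the convolution
     vanishes. *)
  rewrite A00 mulr0; apply/ler_addgt0Pr => e e0; rewrite add0r.
  have eK : 0 < e / Kk by rewrite divr_gt0.
  apply: (le_trans (Hs _ eK)).
  by rewrite W1 mulr0 addr0 mulrC divfK ?gt_eqF.
exists ((2 * Kk) `^ p * (M)) => F.
apply: (@le_trans _ _ (psum L (fun l' => (2 * Kk) `^ p * Kk^-1 * W l') F)).
  apply: le_psum => l' _; rewrite powRM ?powR_ge0//; last by rewrite mulr_ge0// (ltW Kk_gt0).
  by rewrite Ap [W l' / _]mulrC mulrA.
rewrite psumZ -mulrA ler_wpM2l ?powR_ge0// mulrC ler_pdivrMr// mulrC.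
rewrite -lee_fin; apply: le_trans (sumE F); rewrite /psum -sumEFin.
by apply: lee_sum => l /set_mem Ll; rewrite fineK// Efin.
Qed.

End Convolution.

(** * Integration over the cells of the lattice *)

Section PlaneIntegral.
Variable R : realType.
Local Notation C := (R[i]^o).
Local Notation L := (@Lambda R).
Local Notation st := (@st R).
Local Notation lam := (@lam R).
Local Notation mu := (@lebesgue_measure R).
Local Notation mu2 := (@lebesgue_measure R \x @lebesgue_measure R)%E.

(* Rational boxes generate the topology of the plane; the library has no Borel
   structure on [R * R]. *)
Lemma measurable_lsc2 (g : R * R -> R) :
  (forall x y e, 0 < e -> exists2 d : R, 0 < d & forall x' y',
     `|x' - x| < d -> `|y' - y| < d -> g (x, y) - e < g (x', y')) ->
  measurable_fun [set: R * R] g.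
Proof.
move=> H; apply: (measurability _ (RGenOInfty.measurableE R)).
move=> /= _ [_ [a ->]] <-; rewrite setTI; set A := _ @^-1` _.
pose box (q : (rat * rat) * (rat * rat)) : set (R * R) :=
  `]ratr q.1.1, ratr q.1.2[%classic `*` `]ratr q.2.1, ratr q.2.2[%classic.
have -> : A = \bigcup_q (if `[< box q `<=` A >] then box q else set0).
  apply/seteqP; split => [[x y]|[x y] [q _]]; last first.
    by case: ifPn => // /asboolP bA /bA.
  rewrite /A /= in_itv /= andbT => Axy.
  have e0 : 0 < g (x, y) - a by rewrite subr_gt0.
  have [d d0 Hd] := H x y _ e0.
  have d1 (t : R) : t - d < t by rewrite ltrBlDr ltrDl.
  have d2 (t : R) : t < t + d by rewrite ltrDl.
  have [q1 /itvP h1] := rat_in_itvoo (d1 x); have [q2 /itvP h2] := rat_in_itvoo (d2 x).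
  have [q3 /itvP h3] := rat_in_itvoo (d1 y); have [q4 /itvP h4] := rat_in_itvoo (d2 y).
  have B : box ((q1, q2), (q3, q4)) `<=` A.
    move=> [x' y'] [] /=; rewrite !in_itv /= => /andP[a1 a2] /andP[a3 a4].
    rewrite /A /= in_itv /= andbT.
    have := Hd x' y'; have -> : g (x, y) - (g (x, y) - a) = a by ring.
    apply; rewrite ltr_norml; apply/andP; split.
    - by rewrite ltrBrDl (le_lt_trans _ a1)// ltW// h1.
    - by rewrite ltrBlDl (lt_le_trans a2)// ltW// h2.
    - by rewrite ltrBrDl (le_lt_trans _ a3)// ltW// h3.
    - by rewrite ltrBlDl (lt_le_trans a4)// ltW// h4.
  exists ((q1, q2), (q3, q4)) => //; rewrite asboolT//.
  by split; rewrite /= in_itv /=; [rewrite h1 h2 | rewrite h3 h4].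
apply: countable_bigcupT_measurable => [|q]; first exact: countableP.
by case: ifP => _; [apply: measurableX; exact: measurable_itv | exact: measurable0].
Qed.

(** Half-open, so that the cells partition the plane. *)
Definition cell (p : int * int) : set (R * R) :=
  `[st * p.1%:~R - st / 2, st * p.1%:~R + st / 2[%classic `*`
  `[st * p.2%:~R - st / 2, st * p.2%:~R + st / 2[%classic.

Lemma measurable_cell p : measurable (cell p).
Proof. by apply: measurableX; exact: measurable_itv. Qed.

Lemma mu_cell p : mu2 (cell p) = (st ^+ 2)%:E.
Proof.
have s0 := @st_gt0 R.
rewrite product_measure1E; [|exact: measurable_itv|exact: measurable_itv].
rewrite /= !lebesgue_measure_itv /= !lte_fin.
have -> (t : R) : t - st / 2 < t + st / 2 by lra.
have -> (t : R) : t - st / 2 < t + st / 2 by lra.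
by rewrite -!EFinD -EFinM; congr EFin; field.
Qed.

Lemma cell_cover z : exists p, cell p z.
Proof.
case: z => x y; have [l /LambdaE[p ->]] := nearest_lambda (x +i* y : C).
rewrite lamE /= => -[h1 h2 h3 h4]; exists p.
by split; rewrite /= in_itv /=; apply/andP; split; lra.
Qed.

Lemma cell_inj p q z : cell p z -> cell q z -> p = q.
Proof.
have s0 := @st_gt0 R.
have U (m n : int) (t : R) : st * m%:~R - st / 2 <= t < st * m%:~R + st / 2 ->
  st * n%:~R - st / 2 <= t < st * n%:~R + st / 2 -> m = n.
  move=> /andP[m1 m2] /andP[n1 n2].
  have A : st * (m - n)%:~R < st * 1 by rewrite intrB; lra.
  have B : st * (n - m)%:~R < st * 1 by rewrite intrB; lra.
  by rewrite !ltr_pM2l// -[1]/(1%:~R) !ltr_int in A B; lia.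
case: p q z => m n [m' n'] [x y] [/= h1 h2] [/= h3 h4].
by rewrite !in_itv /= in h1 h2 h3 h4; rewrite (U _ _ _ h1 h3) (U _ _ _ h2 h4).
Qed.

Lemma integral_cells (g : R * R -> \bar R) : measurable_fun [set: R * R] g ->
  (forall z, (0 <= g z)%E) ->
  (\int[mu2]_z g z = \esum_(p in [set: int * int]) \int[mu2]_(z in cell p) g z)%E.
Proof.
move=> mg g0.
(* Countable additivity is stated for sequences: cells are listed by the code of their index, and
   numbers coding no index give the empty set. *)
pose F n := if @pickle_inv (int * int)%type n is Some p then cell p else set0.
have FE (p : int * int) : F (choice.pickle p) = cell p by rewrite /F pickleK_inv.
have mF n : measurable (F n).
  by rewrite /F; case: (@pickle_inv (int * int)%type n) => [p|]; [exact: measurable_cell|exact: measurable0].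
have UF : \bigcup_n F n = setT.
  apply/seteqP; split => // z _; have [p pz] := cell_cover z.
  by exists (choice.pickle p); [exact: I | rewrite FE; exact: pz].
have := @ge0_integral_bigcup _ _ R mu2 F g mF; rewrite /= UF => ->//; last first.
  apply/trivIsetP => i j _ _ /eqP ij; apply/seteqP; split => // z; rewrite /F.
  case Ei : (@pickle_inv (int * int)%type i) => [p|]; case Ej : (@pickle_inv (int * int)%type j) => [q|] [] // pz qz.
  apply: ij; have := @pickle_invK (int * int)%type i; rewrite Ei /= => <-.
  by have := @pickle_invK (int * int)%type j; rewrite Ej /= => <-; rewrite (cell_inj pz qz).
have I0 n : (0 <= \int[mu2]_(z in F n) g z)%E by apply: integral_ge0.
rewrite nneseries_esumT//.
have -> : (\esum_(p in [set: int * int]) \int[mu2]_(z in cell p) g z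
  = \esum_(n in choice.pickle @` [set: int * int]) \int[mu2]_(z in F n) g z)%E.
  rewrite esum_image; last by move=> x y _ _; exact: (pcan_inj (@pickleK_inv (int * int)%type)).
  by apply: eq_esum => p _; rewrite FE.
rewrite [RHS]esum_mkcond; apply: eq_esum => n _.
case: ifPn => // /negP nn; rewrite /F; case E : (@pickle_inv (int * int)%type n) => [p|]; last first.
  by rewrite integral_set0.
exfalso; apply: nn; apply/mem_set; exists p => //.
by have := @pickle_invK (int * int)%type n; rewrite E.
Qed.

End PlaneIntegral.

(** * The Gaussian weight and the Fock norms *)

Section FockWeight.
Variable R : realType.
Local Notation C := (R[i]^o).
Local Notation L := (@Lambda R).
Local Notation st := (@st R).
Local Notation lam := (@lam R).
Local Notation mu := (@lebesgue_measure R).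
Local Notation mu2 := (@lebesgue_measure R \x @lebesgue_measure R)%E.

Definition FF (f : C -> C) (z : C) : R := cabs (f z) * expR (- cabs z ^+ 2).

Lemma FF_ge0 f z : 0 <= FF f z.
Proof. by rewrite mulr_ge0 ?cabs_ge0 ?expR_ge0. Qed.

Lemma FF_continuous f z : entire f -> {for z, continuous (FF f)}.
Proof.
move=> /(_ z) /derivable_cder[d /cder_continuous fz].
have C1 : cabs (f w) @[w --> z] --> cabs (f z) by exact: cvg_cabs fz.
have C2 : cabs w @[w --> z] --> cabs z by apply: (@cvg_cabs R C (nbhs z) _ (fun w => w) z); exact: cvg_id.
have C3 : expR (- cabs w ^+ 2) @[w --> z] --> expR (- cabs z ^+ 2).
  have C4 : - cabs w ^+ 2 @[w --> z] --> - cabs z ^+ 2.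
    by exact: (cvgN (cvgM C2 C2)).
  exact: (cvg_comp (fun w : C => - cabs w ^+ 2) expR C4 (@continuous_expR R _)).
exact: cvgM C1 C3.
Qed.

Lemma powR_FF p f z : 0 < p ->
  FF f z `^ p = cabs (f z) `^ p * expR (- (p * cabs z ^+ 2)).
Proof.
move=> p0; rewrite powRM ?cabs_ge0 ?expR_ge0// -expRM.
by congr (_ * expR _); rewrite mulNr mulrC.
Qed.

Lemma measurable_FF f : entire f ->
  measurable_fun [set: R * R] (fun w => FF f (w.1 +i* w.2)).
Proof.
move=> ef; apply: measurable_lsc2 => x y e e0.
have := @FF_continuous f (x +i* y) ef.
move=> /cvgrPdist_lt /(_ e e0) /(nbhsCP (x +i* y : C)) [d d0 H].
exists (d / 2); first by rewrite divr_gt0.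
move=> x' y' hx hy.
have := H (x' +i* y'); have E : (x' +i* y' : C) - (x +i* y) = (x' - x) +i* (y' - y).
  by apply: eq_complexP; rewrite ?(ReD, ImD, ReN, ImN).
rewrite E => /(_ _) => /= H'; have {}H' : `|FF f (x +i* y) - FF f (x' +i* y')| < e.
  apply: H'; apply: (le_lt_trans (cabs_le_ReIm _)) => /=; lra.
by move: H'; rewrite ltr_norml => /andP[_]; lra.
Qed.

Lemma measurable_FFp p f : entire f ->
  measurable_fun [set: R * R] (fun w => (FF f (w.1 +i* w.2) `^ p)%:E).
Proof.
move=> ef; apply/measurable_EFinP.
exact: (measurableT_comp (@measurable_powR R p) (measurable_FF ef)).
Qed.

Lemma fockE p f : 0 < p -> fock p f <-> entire f /\
  (\int[mu2]_w (FF f (w.1 +i* w.2) `^ p)%:E < +oo)%E.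
Proof.
move=> p0; rewrite /fock.
have -> : (fun w : R * R => (cabs (f (w.1 +i* w.2)) `^ p
        * expR (- (p * cabs (w.1 +i* w.2 : C) ^+ 2)))%:E)
  = (fun w => (FF f (w.1 +i* w.2) `^ p)%:E).
  by apply/funext => w; rewrite powR_FF.
by [].
Qed.

Lemma cellP p (w : R * R) : cell p w -> exists2 v : C,
  w.1 +i* w.2 = lam p + v & 2 * cabs v ^+ 2 <= st ^+ 2.
Proof.
case: w => x y [] /=; rewrite !in_itv /= => /andP[h1 h2] /andP[h3 h4].
exists ((x +i* y) - lam p); first by rewrite addrC subrK.
by apply: cell_sqr; rewrite ?(ReD, ImD, ReN, ImN) lamE /=; lra.
Qed.

Lemma fock_of_bound p f (V : C -> R) (M : R) : 0 < p -> entire f ->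
  (forall l w, L l -> 2 * cabs w ^+ 2 <= st ^+ 2 -> FF f (l + w) <= V l) ->
  (forall F, psum L (fun l => V l `^ p) F <= M) -> fock p f.
Proof.
move=> p0 ef HV HM; apply/fockE => //; split => //.
rewrite integral_cells; [|exact: measurable_FFp|by move=> z; rewrite lee_fin powR_ge0].
apply: (@le_lt_trans _ _ (st ^+ 2 * M)%:E); last exact: ltry.
apply: (@le_trans _ _ (\esum_(l in L) (st ^+ 2 * V l `^ p)%:E)%E); last first.
  apply/esum_le_psum => [l _|F]; first by rewrite mulr_ge0 ?sqr_ge0 ?powR_ge0.
  by rewrite psumZ ler_wpM2l ?sqr_ge0.
rewrite Lambda_image esum_image; last by move=> x y _ _ /lam_inj.
apply: le_esum => q _.
apply: (@le_trans _ _ (\int[mu2]_(w in cell q) (V (lam q) `^ p)%:E)%E).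
  apply: ge0_le_integral => //.
  - exact: measurable_cell.
  - by move=> w _; rewrite lee_fin powR_ge0.
  - by apply: measurable_funTS; exact: measurable_FFp.
  move=> w /cellP[v -> hv]; rewrite lee_fin; apply: ge0_ler_powR.
  - exact: ltW.
  - by rewrite nnegrE FF_ge0.
  - by rewrite nnegrE (le_trans (FF_ge0 f (lam q + v)))// HV//; exact: Lambda_lam.
  by apply: HV => //; exact: Lambda_lam.
rewrite integral_cst; last exact: measurable_cell.
by rewrite [X in (_ * X)%E](@mu_cell R q) muleC -EFinM.
Qed.

End FockWeight.

(** * A local mean value inequality *)

Section LocalMean.
Variable R : realType.
Local Notation C := (R[i]^o).
Local Notation st := (@st R).
Local Notation mu := (@lebesgue_measure R).
Local Notation mu2 := (@lebesgue_measure R \x @lebesgue_measure R)%E.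

(** Otherwise the integral over [u, v] alone would reach [I]. *)
Lemma good_point (Fn : R -> \bar R) (I u v : R) : measurable_fun [set: R] Fn ->
  (forall x, (0 <= Fn x)%E) -> (\int[mu]_x Fn x < I%:E)%E -> u < v ->
  exists2 x, u <= x <= v & (Fn x <= (I / (v - u))%:E)%E.
Proof.
move=> mF F0 HI uv; apply: contrapT => nex.
have I0 : 0 < I by rewrite -lte_fin; apply: le_lt_trans HI; exact: integral_ge0.
have vu : 0 < v - u by rewrite subr_gt0.
have : (I%:E <= \int[mu]_x Fn x)%E; last by rewrite leNgt HI.
apply: (@le_trans _ _ (\int[mu]_(x in `[u, v]) Fn x)%E); last first.
  by apply: ge0_subset_integral => //; exact: measurable_itv.
have -> : I%:E = (\int[mu]_(x in `[u, v]) (I / (v - u))%:E)%E.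
  rewrite integral_cst /=; last exact: measurable_itv.
  rewrite lebesgue_measure_itv /= lte_fin uv.
  by rewrite -EFinD -EFinM divfK// gt_eqF.
apply: ge0_le_integral => //.
- by move=> x _; rewrite lee_fin divr_ge0 ?ltW.
- exact: measurable_funTS.
- move=> x; rewrite /= in_itv /= => ux; apply/ltW; rewrite ltNge; apply/negP => Fx.
  by apply: nex; exists x.
Qed.

Lemma cabs_cint_weight (phi : R -> C) (psi : R -> R) (s t K J : R) :
  cont_on phi s t -> (forall x, s <= x <= t -> {for x, continuous psi}) -> 0 <= K ->
  (forall x, s <= x <= t -> cabs (phi x) <= K * psi x) ->
  \int[mu]_(x in `[s, t]) psi x <= J -> cabs (cint phi s t) <= 2 * (K * J).
Proof.
move=> Hphi Hpsi K0 H HJ; apply: (le_trans (cabs_cint Hphi)).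
rewrite ler_wpM2l//; apply: (@le_trans _ _ (K * \int[mu]_(x in `[s, t]) psi x)).
  rewrite -RintegralZl//; last exact: integrable_cont.
  apply: le_Rintegral => //; first exact: (integrable_cont (cont_on_cabs Hphi)).
  apply: (@integrable_cont R (fun x => K * psi x)) => x hx.
  by apply: cvgM; [exact: cvg_cst | exact: Hpsi].
by rewrite ler_wpM2l.
Qed.

Definition csq (z : C) : set (R * R) :=
  `[complex.Re z - st / 2, complex.Re z + st / 2]%classic `*`
  `[complex.Im z - st / 2, complex.Im z + st / 2]%classic.

Lemma measurable_csq z : measurable (csq z).
Proof. by apply: measurableX; exact: measurable_itv. Qed.

Section Lines.
Variables (f : C -> C) (z0 : C) (I : R).
Hypothesis ef : entire f.
Hypothesis HI : (\int[mu2]_(w in csq z0) (FF f (w.1 +i* w.2))%:E < I%:E)%E.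
Let a := complex.Re z0.
Let b := complex.Im z0.
Let H := (fun w : R * R => (FF f (w.1 +i* w.2))%:E) \_ (csq z0).

Let mFF : measurable_fun [set: R * R] (fun w => (FF f (w.1 +i* w.2))%:E).
Proof. by apply/measurable_EFinP; exact: measurable_FF. Qed.

Let mH : measurable_fun [set: R * R] H.
Proof.
apply/(measurable_restrictT _ (measurable_csq z0)).
exact: measurable_funTS.
Qed.

Let H0 w : (0 <= H w)%E.
Proof. by rewrite /H patchE; case: ifP => // _; rewrite lee_fin FF_ge0. Qed.

Let HI' : (\int[mu2]_w H w < I%:E)%E.
Proof. by rewrite /H -integral_mkcond. Qed.

(** Tonelli's theorem and [good_point] pick a vertical line carrying no more than the average;
    [good_y] does the same for horizontal lines. *)
Lemma good_x u v : u < v -> a - st / 2 <= u -> v <= a + st / 2 ->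
  exists2 x, u <= x <= v & forall y0 y1, b - st / 2 <= y0 -> y1 <= b + st / 2 ->
    \int[mu]_(y in `[y0, y1]) FF f (x +i* y) <= I / (v - u).
Proof.
move=> uv au va.
have [|||x hx Hx] := @good_point (fubini_F mu H) I u v _ _ _ uv.
- exact: measurable_fun_fubini_tonelli_F.
- by move=> x; apply: integral_ge0.
- by rewrite -fubini_tonelli1.
exists x => // y0 y1 hy0 hy1.
have X : (\int[mu]_(y in `[y0, y1]) (FF f (x +i* y))%:E <= (I / (v - u))%:E)%E.
  apply: le_trans Hx; rewrite /fubini_F [leLHS]integral_mkcond; apply: ge0_le_integral => //.
  - by move=> y _; rewrite patchE; case: ifP => // _; rewrite lee_fin FF_ge0.
  - apply/(measurable_restrictT _ (measurable_itv _)); apply: measurable_funTS.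
    exact: (measurableT_comp mFF (pair1_measurable x)).
  - exact: (measurableT_comp mH (pair1_measurable x)).
  move=> y _; rewrite patchE; case: ifPn => //; rewrite inE /= in_itv /= => /andP[y0y yy1].
  rewrite /H patchE ifT// inE; split; rewrite /= in_itv /= -/a -/b.
    by case/andP: hx => h1 h2; rewrite (le_trans au h1) (le_trans h2 va).
  by rewrite (le_trans hy0 y0y) (le_trans yy1 hy1).
rewrite /Rintegral -lee_fin fineK// ge0_fin_numE ?(le_lt_trans X) ?ltry//.
by apply: integral_ge0 => y _; rewrite lee_fin FF_ge0.
Qed.

Lemma good_y u v : u < v -> b - st / 2 <= u -> v <= b + st / 2 ->
  exists2 y, u <= y <= v & forall x0 x1, a - st / 2 <= x0 -> x1 <= a + st / 2 ->
    \int[mu]_(x in `[x0, x1]) FF f (x +i* y) <= I / (v - u).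
Proof.
move=> uv bu vb.
have [|||y hy Hy] := @good_point (fubini_G mu H) I u v _ _ _ uv.
- exact: measurable_fun_fubini_tonelli_G.
- by move=> y; apply: integral_ge0.
- by rewrite -fubini_tonelli2.
exists y => // x0 x1 hx0 hx1.
have X : (\int[mu]_(x in `[x0, x1]) (FF f (x +i* y))%:E <= (I / (v - u))%:E)%E.
  apply: le_trans Hy; rewrite /fubini_G [leLHS]integral_mkcond; apply: ge0_le_integral => //.
  - by move=> x _; rewrite patchE; case: ifP => // _; rewrite lee_fin FF_ge0.
  - apply/(measurable_restrictT _ (measurable_itv _)); apply: measurable_funTS.
    exact: (measurableT_comp mFF (pair2_measurable y)).
  - exact: (measurableT_comp mH (pair2_measurable y)).
  move=> x _; rewrite patchE; case: ifPn => //; rewrite inE /= in_itv /= => /andP[x0x xx1].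
  rewrite /H patchE ifT// inE; split; rewrite /= in_itv /= -/a -/b.
    by rewrite (le_trans hx0 x0x) (le_trans xx1 hx1).
  by case/andP: hy => h1 h2; rewrite (le_trans bu h1) (le_trans h2 vb).
rewrite /Rintegral -lee_fin fineK// ge0_fin_numE ?(le_lt_trans X) ?ltry//.
by apply: integral_ge0 => x _; rewrite lee_fin FF_ge0.
Qed.

Let KW : R := 4 / st * expR (st ^+ 2 / 2 + cabs z0 ^+ 2).

(** The holomorphic twist has modulus exp(|z0|^2 + |w - z0|^2 - |w|^2), so near z0 |g| is comparable
    to the weighted modulus [FF f] times exp(|z0|^2). *)
Let g (w : C) : C := f w * cexp (- (2 * z0^*%C) * (w - z0)).

Let g_der w : exists d, cder g w d.
Proof.
have [d Dd] : exists d, cder f w d by apply: derivable_cder; exact: ef.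
have D := cderM Dd (cder_cexp_comp (cderMl (- (2 * z0^*%C)) (cder_sub_cst z0 w))).
by eexists; exact: D.
Qed.

Let gz0 : g z0 = f z0.
Proof. by rewrite /g subrr mulr0 cexp0 mulr1. Qed.

Let g_le (w : C) : `|complex.Re (w - z0)| <= st / 2 -> `|complex.Im (w - z0)| <= st / 2 ->
  st / 4 <= cabs (w - z0) -> cabs (g w / (w - z0)) <= KW * FF f w.
Proof.
move=> hr hi hw; have s0 := @st_gt0 R.
have c0 : 0 < cabs (w - z0) by rewrite (lt_le_trans _ hw)// divr_gt0.
have E : expR (- complex.Re (2 * z0^*%C * (w - z0)))
   = expR (cabs z0 ^+ 2 + cabs (w - z0) ^+ 2) * expR (- cabs w ^+ 2).
  rewrite -expRD; congr expR.
  have := cabs_sqrD z0 (w - z0); rewrite [z0 + _]addrC subrK => ->; ring.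
rewrite cabsM cabsV /g cabsM cabs_cexp mulNr ReN E.
have h2 : cabs (w - z0) ^+ 2 <= st ^+ 2 / 2.
  rewrite cabs_sqr; move: hr hi; rewrite !ler_norml => /andP[r1 r2] /andP[i1 i2]; nra.
have -> : cabs (f w) * (expR (cabs z0 ^+ 2 + cabs (w - z0) ^+ 2) * expR (- cabs w ^+ 2))
    / cabs (w - z0)
  = (cabs (w - z0))^-1 * expR (cabs z0 ^+ 2 + cabs (w - z0) ^+ 2) * FF f w.
  by rewrite /FF; ring.
rewrite ler_wpM2r ?FF_ge0// /KW; apply: ler_pM; rewrite ?invr_ge0 ?cabs_ge0 ?expR_ge0//.
  have -> : 4 / st = (st / 4)^-1 by rewrite invfM invrK mulrC.
  by rewrite lef_pV2 ?posrE// divr_gt0.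
by rewrite ler_expR addrC lerD2r.
Qed.

(** Cauchy's formula for [g] on a rectangle with good sides. The constant is 4 sides, times 2 from
    [cabs_cint], times 4 / st for 1 / |w - z0|, times 4 / st for the choice of each line. *)
Lemma local_mean : FF f z0 <= 128 / st ^+ 2 * expR (st ^+ 2 / 2) * I.
Proof.
have s0 := @st_gt0 R; have q0 : 0 < st / 4 by rewrite divr_gt0.
have I0 : 0 <= I.
  rewrite -lee_fin; apply: (le_trans _ (ltW HI)).
  by apply: integral_ge0 => w _; rewrite lee_fin FF_ge0.
(* Every side is sought at distance between st / 4 and st / 2 from z0: off the pole, yet inside the
   square. *)
have [x0 /andP[x0l x0r] Hx0] : exists2 x, a - st / 2 <= x <= a - st / 4 & forall y0 y1, b - st / 2 <= y0 -> y1 <= b + st / 2 ->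
    \int[mu]_(y in `[y0, y1]) FF f (x +i* y) <= 4 / st * I.
  have -> : 4 / st * I = I / ((a - st / 4) - (a - st / 2)).
    have -> : (a - st / 4) - (a - st / 2) = st / 4 by field.
    by field; rewrite gt_eqF.
  by apply: good_x; lra.
have [x1 /andP[x1l x1r] Hx1] : exists2 x, a + st / 4 <= x <= a + st / 2 & forall y0 y1, b - st / 2 <= y0 -> y1 <= b + st / 2 ->
    \int[mu]_(y in `[y0, y1]) FF f (x +i* y) <= 4 / st * I.
  have -> : 4 / st * I = I / ((a + st / 2) - (a + st / 4)).
    have -> : (a + st / 2) - (a + st / 4) = st / 4 by field.
    by field; rewrite gt_eqF.
  by apply: good_x; lra.
have [y0 /andP[y0l y0r] Hy0] : exists2 y, b - st / 2 <= y <= b - st / 4 & forall x0 x1, a - st / 2 <= x0 -> x1 <= a + st / 2 ->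
    \int[mu]_(x in `[x0, x1]) FF f (x +i* y) <= 4 / st * I.
  have -> : 4 / st * I = I / ((b - st / 4) - (b - st / 2)).
    have -> : (b - st / 4) - (b - st / 2) = st / 4 by field.
    by field; rewrite gt_eqF.
  by apply: good_y; lra.
have [y1 /andP[y1l y1r] Hy1] : exists2 y, b + st / 4 <= y <= b + st / 2 & forall x0 x1, a - st / 2 <= x0 -> x1 <= a + st / 2 ->
    \int[mu]_(x in `[x0, x1]) FF f (x +i* y) <= 4 / st * I.
  have -> : 4 / st * I = I / ((b + st / 2) - (b + st / 4)).
    have -> : (b + st / 2) - (b + st / 4) = st / 4 by field.
    by field; rewrite gt_eqF.
  by apply: good_y; lra.
have Ez : z0 = a +i* b by rewrite /a /b; case: (z0).
have CF : rect (fun w => g w / (w - z0)) x0 x1 y0 y1 = f z0 * winding z0 x0 x1 y0 y1.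
  rewrite -gz0 Ez; apply: cauchy_formula; [lra|lra|].
  by move=> x y _ _; exact: g_der.
(* With t = st / 4 and T = st / 2 the lower bound 4 t^2 / T^2 is exactly 1. *)
have W1 : 1 <= cabs (winding z0 x0 x1 y0 y1).
  apply: le_trans (ler_Im _); apply: le_trans (ler_norm _).
  have := @Im_winding_ge R a b x0 x1 y0 y1 (st / 4) (st / 2) q0; rewrite -Ez.
  have -> : 4 * ((st / 4) ^+ 2 / (st / 2) ^+ 2) = 1 :> R by field; rewrite gt_eqF.
  by apply; lra.
have KW0 : 0 <= KW by rewrite mulr_ge0 ?expR_ge0// divr_ge0// ltW.
have sub (x y : R) : (x +i* y : C) - z0 = (x - a) +i* (y - b).
  by rewrite Ez; apply: eq_complexP; rewrite ?(ReD, ImD, ReN, ImN).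
have V (x : R) : st / 4 <= `|x - a| -> `|x - a| <= st / 2 ->
    (forall y0 y1, b - st / 2 <= y0 -> y1 <= b + st / 2 ->
    \int[mu]_(y in `[y0, y1]) FF f (x +i* y) <= 4 / st * I) ->
    cabs (vint (fun w => g w / (w - z0)) x y0 y1) <= 2 * (KW * (4 / st * I)).
  move=> hx1 hx2 HJ.
  apply: (@cabs_cint_weight _ (fun y => FF f (x +i* y))) => //.
  - move=> y hy; apply: (@cont_v R (fun w => g w / (w - z0))).
    have [d Dd] := g_der (x +i* y).
    have xz : (x +i* y : C) != z0.
      by rewrite -subr_eq0 sub -cabs_gt0; apply: lt_le_trans (ler_Re _) => /=; lra.
    exact: cder_continuous (cderM Dd (cderV_sub xz)).
  - move=> y hy; apply: (@continuous_comp _ _ _ (fun y => x +i* y : C) (FF f)).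
      exact: (cvg_ReIm (cvg_cst x) cvg_id).
    exact: FF_continuous.
  - move=> y /andP[hy1 hy2]; apply: g_le; rewrite sub //=.
      by rewrite ler_norml; apply/andP; split; lra.
    by apply: le_trans (ler_Re _).
  - by apply: HJ; lra.
have Hh (y : R) : st / 4 <= `|y - b| -> `|y - b| <= st / 2 ->
    (forall x0 x1, a - st / 2 <= x0 -> x1 <= a + st / 2 ->
    \int[mu]_(x in `[x0, x1]) FF f (x +i* y) <= 4 / st * I) ->
    cabs (hint (fun w => g w / (w - z0)) y x0 x1) <= 2 * (KW * (4 / st * I)).
  move=> hy1 hy2 HJ.
  apply: (@cabs_cint_weight _ (fun x => FF f (x +i* y))) => //.
  - move=> x hx; apply: (@cont_h R (fun w => g w / (w - z0))).
    have [d Dd] := g_der (x +i* y).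
    have xz : (x +i* y : C) != z0.
      by rewrite -subr_eq0 sub -cabs_gt0; apply: lt_le_trans (ler_Im _) => /=; lra.
    exact: cder_continuous (cderM Dd (cderV_sub xz)).
  - move=> x hx; apply: (@continuous_comp _ _ _ (fun x => x +i* y : C) (FF f)).
      exact: (cvg_ReIm cvg_id (cvg_cst y)).
    exact: FF_continuous.
  - move=> x /andP[hx1 hx2]; apply: g_le; rewrite sub //=.
      by rewrite ler_norml; apply/andP; split; lra.
    by apply: le_trans (ler_Im _).
  - by apply: HJ; lra.
have nm (x c : R) : st / 4 <= x - c -> x - c <= st / 2 -> st / 4 <= `|x - c| /\ `|x - c| <= st / 2.
  by move=> h1 h2; rewrite ger0_norm//; lra.
have nm' (x c : R) : st / 4 <= c - x -> c - x <= st / 2 -> st / 4 <= `|x - c| /\ `|x - c| <= st / 2.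
  by move=> h1 h2; rewrite distrC; exact: nm.
have [Vx0a Vx0b] := nm' x0 a ltac:(lra) ltac:(lra).
have [Vx1a Vx1b] := nm x1 a ltac:(lra) ltac:(lra).
have [Vy0a Vy0b] := nm' y0 b ltac:(lra) ltac:(lra).
have [Vy1a Vy1b] := nm y1 b ltac:(lra) ltac:(lra).
have B1 := V _ Vx0a Vx0b Hx0; have B2 := V _ Vx1a Vx1b Hx1.
have B3 := Hh _ Vy0a Vy0b Hy0; have B4 := Hh _ Vy1a Vy1b Hy1.
have B : cabs (rect (fun w => g w / (w - z0)) x0 x1 y0 y1) <= 4 * (2 * (KW * (4 / st * I))).
  rewrite /rect; apply: (le_trans (cabsD _ _)).
  rewrite [cabs ('i * _)]cabsM cabs_i mul1r.
  have := cabsB (hint (fun w => g w / (w - z0)) y0 x0 x1) (hint (fun w => g w / (w - z0)) y1 x0 x1).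
  have := cabsB (vint (fun w => g w / (w - z0)) x1 y0 y1) (vint (fun w => g w / (w - z0)) x0 y0 y1).
  lra.
have fB : cabs (f z0) <= 4 * (2 * (KW * (4 / st * I))).
  apply: le_trans B; rewrite CF cabsM -[leLHS]mulr1.
  by rewrite ler_wpM2l// cabs_ge0.
rewrite /FF; apply: (@le_trans _ _ (4 * (2 * (KW * (4 / st * I))) * expR (- cabs z0 ^+ 2))).
  by rewrite ler_wpM2r ?expR_ge0.
rewrite /KW expRD expRN le_eqVlt; apply/orP; left; apply/eqP; field.
by rewrite !gt_eqF ?expR_gt0.
Qed.

End Lines.
End LocalMean.

(** * An l^p sequence bounding a Fock function on cells *)

Section FockBound.
Variable R : realType.
Local Notation C := (R[i]^o).
Local Notation L := (@Lambda R).
Local Notation st := (@st R).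
Local Notation lam := (@lam R).
Local Notation mu := (@lebesgue_measure R).
Local Notation mu2 := (@lebesgue_measure R \x @lebesgue_measure R)%E.

Let hsq (l : C) : set (R * R) :=
  `[complex.Re l - st / 2, complex.Re l + st / 2[%classic `*`
  `[complex.Im l - st / 2, complex.Im l + st / 2[%classic.

Let cellE q : cell q = hsq (lam q).
Proof. by rewrite /hsq lamE. Qed.

Lemma mu_csq (z : C) : mu2 (csq z) = (st ^+ 2)%:E.
Proof.
have s0 := @st_gt0 R.
rewrite product_measure1E; [|exact: measurable_itv|exact: measurable_itv].
rewrite /= !lebesgue_measure_itv /= !lte_fin.
have E (t : R) : t - st / 2 < t + st / 2 by lra.
by rewrite !E -!EFinD -EFinM; congr EFin; field.
Qed.

Definition KN : R := 1 + (3 * st) ^+ 3.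

Lemma kern_gt0 (x : C) : 0 < kern x.
Proof.
by rewrite /kern; case: eqVneq => // x0; rewrite invr_gt0 exprn_gt0// cabs_gt0.
Qed.

Lemma kern_ge (x : C) : cabs x <= 3 * st -> 1 <= KN * kern x.
Proof.
move=> hx; have s0 := @st_gt0 R; have s3 : 0 <= (3 * st) ^+ 3 by rewrite exprn_ge0// mulr_ge0// ltW.
rewrite /kern; case: eqVneq => x0; first by rewrite mulr1 /KN; lra.
rewrite ler_pdivlMr ?exprn_gt0 ?cabs_gt0// mul1r.
apply: (@le_trans _ _ ((3 * st) ^+ 3)); last by rewrite /KN; lra.
by apply: lerXn2r; rewrite // nnegrE ?cabs_ge0// mulr_ge0// ltW.
Qed.

Section Fixed.
Variables (p : R) (f : C -> C).
Hypothesis p1 : 1 <= p.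
Hypothesis fp : fock p f.

Let p0 : 0 < p.
Proof. exact: lt_le_trans p1. Qed.

Let ef : entire f.
Proof. by case: fp. Qed.

Let G (w : R * R) : \bar R := (FF f (w.1 +i* w.2) `^ p)%:E.

Let mG : measurable_fun [set: R * R] G.
Proof. exact: measurable_FFp. Qed.

Let G0 w : (0 <= G w)%E.
Proof. by rewrite lee_fin powR_ge0. Qed.

Let Gfin : (\int[mu2]_w G w < +oo)%E.
Proof. by have [] := (fockE f p0).1 fp. Qed.

Let T : R := fine (\int[mu2]_w G w)%E.

Let TE : T%:E = (\int[mu2]_w G w)%E.
Proof. by rewrite /T fineK// ge0_fin_numE//; exact: integral_ge0. Qed.

Let q (l : C) : R := fine (\int[mu2]_(w in hsq l) G w)%E.

Let qE l : (q l)%:E = (\int[mu2]_(w in hsq l) G w)%E.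
Proof.
rewrite /q fineK// ge0_fin_numE; last exact: integral_ge0.
apply: le_lt_trans Gfin; apply: ge0_subset_integral => //.
by apply: measurableX; exact: measurable_itv.
Qed.

Let q0 l : 0 <= q l.
Proof. by rewrite -lee_fin qE; exact: integral_ge0. Qed.

Let psum_q F : psum L q F <= T.
Proof.
apply: (esum_le_psum _ _).1 => //.
rewrite TE integral_cells// Lambda_image esum_image; last by move=> x y _ _ /lam_inj.
by apply: le_esum => r _; rewrite qE cellE.
Qed.

(** The summand [kern l] keeps the later convolution strictly positive, so that its p-th root can
    serve as a splitting level. *)
Let x (l : C) : R := kern l + q l.

Let x0 l : 0 <= x l.
Proof. by rewrite addr_ge0 ?kern_ge0. Qed.

(** A square of side [st] centred in the cell of l' meets only cells with centre within 3 st of l',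
    where [kern] is bounded below by 1 / KN. *)
Let integral_csq (l' w : C) (V : R) : L l' ->
  `|complex.Re w| <= st / 2 -> `|complex.Im w| <= st / 2 ->
  (forall F, psum L (fun l => kern (l - l') * x l) F <= V) ->
  (\int[mu2]_(z in csq (l' + w)%R) G z <= (KN * V)%:E)%E.
Proof.
move=> Ll' hr hi HV; have s0 := @st_gt0 R.
have K0 : 0 <= KN by rewrite addr_ge0// exprn_ge0// mulr_ge0// ltW.
have small (v : C) : 2 * cabs v ^+ 2 <= st ^+ 2 -> cabs v < st.
  by move=> hv; rewrite -[st]mul1r; apply: cell_lt => //; lra.
rewrite integral_mkcond integral_cells; last 2 first.
- by apply/(measurable_restrictT _ (measurable_csq _)); exact: measurable_funTS.
- by move=> z; rewrite patchE; case: ifP.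
apply: (@le_trans _ _ (\esum_(l in L) (KN * (kern (l - l') * x l))%:E)%E); last first.
  apply/esum_le_psum => [l _|F]; first by rewrite !mulr_ge0 ?kern_ge0.
  by rewrite psumZ ler_wpM2l.
rewrite Lambda_image esum_image; last by move=> ? ? _ _ /lam_inj.
apply: le_esum => r _.
have [[z [z1 z2]]|nz] := pselect (exists z, cell r z /\ csq (l' + w) z); last first.
  rewrite (eq_integral (fun=> 0%E)).
    by rewrite integral0 lee_fin !mulr_ge0 ?kern_ge0.
  move=> z; rewrite inE => zr; rewrite patchE ifF//.
  by apply/negP; rewrite inE => zc; apply: nz; exists z.
apply: (@le_trans _ _ (q (lam r))%:E).
  rewrite qE cellE; apply: ge0_le_integral => //.
  - by apply: measurableX; exact: measurable_itv.
  - by move=> y _; rewrite patchE; case: ifP.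
  - apply: measurable_funTS.
    by apply/(measurable_restrictT _ (measurable_csq _)); exact: measurable_funTS.
  - exact: measurable_funTS.
  - by move=> y _; rewrite patchE; case: ifP.
rewrite lee_fin mulrA; apply: (@le_trans _ _ (1 * x (lam r))).
  by rewrite mul1r /x lerDr kern_ge0.
rewrite ler_wpM2r//; apply: kern_ge.
have [v Ev hv] := cellP z1.
have hu : 2 * cabs ((z.1 +i* z.2) - (l' + w)) ^+ 2 <= st ^+ 2.
  case: z {z1 Ev} z2 => zx zy [] /=; rewrite !in_itv /= => /andP[a1 a2] /andP[a3 a4].
  by apply: cell_sqr; rewrite ?(ReD, ImD, ReN, ImN) /=; move: a1 a2 a3 a4; rewrite !(ReD, ImD); lra.
have hw : 2 * cabs w ^+ 2 <= st ^+ 2.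
  by move: hr hi; rewrite !ler_norml => /andP[? ?] /andP[? ?]; exact: cell_sqr.
have -> : lam r - l' = ((z.1 +i* z.2) - (l' + w)) - v + w by rewrite Ev; ring.
apply: (le_trans (cabsD _ _)); apply: (le_trans (lerD (cabsB _ _) (lexx _))).
have := small _ hu; have := small _ hv; have := small _ hw; lra.
Qed.

(** [local_mean] bounds the weighted modulus by its integral over a square. Splitting at the level A
    = V^(1/p), where V dominates the integral of the p-th power, makes both parts of order A, and V
    is summable over the lattice. *)
Lemma fock_bound : exists b : C -> R, [/\ forall l, 0 <= b l,
  forall l w, L l -> `|complex.Re w| <= st / 2 -> `|complex.Im w| <= st / 2 ->
    FF f (l + w) <= b l &
  exists M, forall F, psum L (fun l => b l `^ p) F <= M].
Proof.
have s0 := @st_gt0 R.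
have HM F : psum L (fun l => x l `^ 1) F <= @Kk R + T.
  apply: (@le_trans _ _ (psum L (fun l => kern l + q l) F)).
    by apply: le_psum => l _; rewrite powRr1.
  by rewrite psumD lerD// psum_kern.
have [V [V0 HV [M' HM']]] := kern_convolution (lexx 1) x0 HM.
have K0 : 0 <= KN by rewrite addr_ge0// exprn_ge0// mulr_ge0// ltW.
(* The area of the square accounts for st^2, the p-th power for KN; the extra 1 makes the inequality
   strict, as [local_mean] requires. *)
pose K := 128 / st ^+ 2 * expR (st ^+ 2 / 2) * (st ^+ 2 + KN + 1).
have K'0 : 0 <= K.
  rewrite mulr_ge0//; first by rewrite mulr_ge0 ?expR_ge0// divr_ge0// sqr_ge0.
  by rewrite addr_ge0// addr_ge0// sqr_ge0.
exists (fun l => K * V l `^ p^-1); split.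
- by move=> l; rewrite mulr_ge0 ?powR_ge0.
- move=> l w Ll hr hi; pose A := V l `^ p^-1.
  have Vp : 0 < V l.
    apply: lt_le_trans (kern_gt0 l) _.
    have := HV l Ll [fset l]%fset; rewrite /psum big_mkcond big_seq_fset1 mem_set//.
    by rewrite subrr {1}/kern eqxx mul1r /x; apply: le_trans; rewrite lerDl.
  have A0 : 0 < A by exact: powR_gt0.
  have Ap : A `^ p = V l by rewrite /A -powRrM mulVf ?gt_eqF// powRr1.
  have -> : K * V l `^ p^-1 = 128 / st ^+ 2 * expR (st ^+ 2 / 2) * ((st ^+ 2 + KN + 1) * A).
    by rewrite /K -mulrA.
  apply: local_mean => //.
  apply: (@le_lt_trans _ _ (\int[mu2]_(z in csq (l + w)%R) (A%:E + (A * (A `^ p)^-1)%R%:E * G z))%E).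
    apply: ge0_le_integral => //.
    - exact: measurable_csq.
    - by move=> z _; rewrite lee_fin FF_ge0.
    - by apply/measurable_EFinP; apply: measurable_funTS; exact: measurable_FF.
    - apply: emeasurable_funD => //; apply: measurable_funeM; exact: measurable_funTS.
    - by move=> z _; rewrite -EFinM -EFinD lee_fin; apply: le_powR_split; rewrite ?FF_ge0.
  have k0 : 0 <= A * (A `^ p)^-1 by rewrite mulr_ge0 ?(ltW A0)// invr_ge0 powR_ge0.
  rewrite ge0_integralD//; last 4 first.
  - exact: measurable_csq.
  - by move=> z _; rewrite lee_fin ltW.
  - by move=> z _; rewrite mule_ge0// lee_fin.
  - by apply: measurable_funeM; exact: measurable_funTS.
  rewrite ge0_integralZl//; last 2 first.
  - exact: measurable_csq.
  - exact: measurable_funTS.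
  rewrite integral_cst; last exact: measurable_csq.
  rewrite [X in (_ * X + _)%E](@mu_csq (l + w)).
  have H := integral_csq Ll hr hi (HV l Ll).
  apply: (@le_lt_trans _ _ (A%:E * (st ^+ 2)%R%:E + (A * (A `^ p)^-1)%R%:E * (KN * V l)%R%:E)%E).
    by rewrite leeD2l// lee_wpmul2l// lee_fin.
  rewrite -!EFinM -EFinD lte_fin Ap.
  have -> : A / V l * (KN * V l) = A * KN by field; rewrite gt_eqF.
  have -> : (st ^+ 2 + KN + 1) * A = A * st ^+ 2 + A * KN + A by ring.
  by rewrite ltrDl.
- exists (K `^ p * M') => F.
  apply: (@le_trans _ _ (psum L (fun l => K `^ p * V l `^ 1) F)); last first.
    by rewrite psumZ ler_wpM2l ?powR_ge0.
  apply: le_psum => l _; rewrite powRM ?powR_ge0// -powRrM mulVf ?gt_eqF//.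
Qed.

End Fixed.
End FockBound.

(** * Telescoping contour integrals over a disc of cells *)

Section Telescope.
Variable R : realType.
Local Notation C := (R[i]^o).
Local Notation L := (@Lambda R).
Local Notation st := (@st R).
Local Notation lam := (@lam R).
Local Notation disc := (@disc R).

Definition outer (r : R) (d : C) : seq C := [seq l <- disc r | l + d \notin disc r].

Lemma sum_telescope r (d : C) (g : C -> C) :
  \sum_(l <- disc r) (g l - g (l + d))
  = \sum_(l <- outer r (- d)) g l - \sum_(l <- outer r d) g (l + d).
Proof.
rewrite sumrB /outer !big_filter.
rewrite (bigID (fun l => l - d \in disc r)) /= [X in _ - X](bigID (fun l => l + d \in disc r)) /=.
suff -> : \sum_(l <- disc r | l - d \in disc r) g l
  = \sum_(l <- disc r | l + d \in disc r) g (l + d) by ring.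
rewrite -big_filter -[RHS]big_filter -[RHS](big_map (fun l => l + d) xpredT g).
apply: perm_big; apply: uniq_perm.
- by rewrite filter_uniq ?fset_uniq.
- by rewrite map_inj_uniq ?filter_uniq ?fset_uniq//; exact: addIr.
move=> l; rewrite mem_filter; apply/idP/mapP => [/andP[h1 h2]|[x + ->]].
  by exists (l - d); rewrite ?mem_filter subrK ?h2.
by rewrite mem_filter addrK => /andP[-> ->].
Qed.

Lemma outerP r d l : l \in outer r d -> L (l + d) ->
  [/\ L l, cabs l < r & r <= cabs (l + d)].
Proof.
rewrite mem_filter => /andP[h]; rewrite in_disc => /andP[/set_mem Ll lr] Ld.
by split => //; move: h; rewrite in_disc mem_set//= -leNgt.
Qed.

(** [u] is the coordinate along [d], [v] the transverse one. By convexity of the disc a line in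
    direction [d] has at most one lattice point from which the step leaves the disc, so outer points
    are counted by their values of [v]. *)
Let size_outer_aux r (d : C) (u v : C -> R) : L d ->
  (forall l, L l -> exists m n : int, u l = st * m%:~R /\ v l = st * n%:~R) ->
  (forall l, cabs l ^+ 2 = u l ^+ 2 + v l ^+ 2) ->
  (forall l, u (l + d) = u l + st) -> (forall l, v (l + d) = v l) ->
  (forall l l', u l = u l' -> v l = v l' -> l = l') ->
  (size (outer r d) <= (2 * (Num.truncn (r / st)).+1).+1)%N.
Proof.
move=> Ld Huv Hc Hu Hv inj; have s0 := @st_gt0 R.
set N := (Num.truncn (r / st)).+1.
rewrite -(size_map v) -(size_iota 0 (2 * N).+1).
rewrite -(size_map (fun k : nat => st * (k%:R - N%:R) : R) (iota 0 _)).
have outP l : l \in outer r d -> [/\ L l, cabs l < r & r <= cabs (l + d)].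
  move=> lo; apply: outerP => //; apply: Lambda_add => //.
  by move: lo; rewrite mem_filter => /andP[_]; rewrite in_disc => /andP[/set_mem].
apply: uniq_leq_size.
  rewrite map_inj_in_uniq ?filter_uniq ?fset_uniq// => x y hx hy vxy.
  have [Lx xr xd] := outP x hx; have [Ly yr yd] := outP y hy.
  have lt x' y' : L x' -> L y' -> cabs x' < r -> cabs y' < r -> r <= cabs (x' + d) ->
      v x' = v y' -> ~ u x' < u y'.
    move=> Lx' Ly' x'r y'r x'd v' u'.
    have us : u x' + st <= u y'.
      have [m [n [Em _]]] := Huv x' Lx'; have [m' [n' [Em' _]]] := Huv y' Ly'.
      move: u'; rewrite Em Em' ltr_pM2l// ltr_int => mm.
      by rewrite -[X in _ + X]mulr1 -mulrDr ler_pM2l// -[1]/(1%:~R) -intrD ler_int; lia.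
    have sqlt z z' : cabs z < r -> r <= cabs z' -> u z ^+ 2 + v z ^+ 2 < u z' ^+ 2 + v z' ^+ 2.
      move=> h1 h2; rewrite -!Hc ltr_sqr ?nnegrE ?cabs_ge0//.
      exact: lt_le_trans h1 h2.
    have A1 := sqlt _ _ x'r x'd; have A2 := sqlt _ _ y'r x'd.
    rewrite Hu Hv v' in A1 A2; move: A1 A2 us; rewrite !ltrD2r.
    move: (u x') (u y') => X Y A1 A2 us; have [h|h] := leP 0 (X + st).
      by move: A2; apply/negP; rewrite -leNgt ler_sqr ?nnegrE// (le_trans h).
    by move: A1; apply/negP; rewrite -leNgt; nra.
  apply: inj => //; apply/eqP; rewrite eq_le !leNgt; apply/andP; split; apply/negP.
    by apply: lt => //; rewrite vxy.
  exact: lt.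
move=> y /mapP[l lo ->]; have [Ll lr _] := outP l lo.
have [m [n [_ En]]] := Huv l Ll.
have vN : `|v l| <= st * N%:R.
  have vc : `|v l| <= cabs l.
    rewrite -ler_sqr ?nnegrE ?cabs_ge0// real_normK ?num_real// Hc.
    by rewrite lerDr sqr_ge0.
  apply: (le_trans vc); apply: (le_trans (ltW lr)).
  by rewrite mulrC -ler_pdivrMr//; apply/ltW; exact: truncnS_gt.
have nN : (`|n| <= N%:Z)%R.
  by move: vN; rewrite En normrM (gtr0_norm s0) ler_pM2l// -intr_norm -[N%:R]/(N%:Z%:~R) ler_int.
apply/mapP; exists (absz (n + N%:Z)).
  by rewrite mem_iota; move: nN; clear; lia.
rewrite En; congr (_ * _).
have -> : (absz (n + N%:Z))%:R = (n + N%:Z)%:~R :> R.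
  by rewrite natr_absz ger0_norm//; move: nN; clear; lia.
by rewrite intrD addrK.
Qed.

Definition dirs : seq C := [:: (st%:C : C); - (st%:C : C); 'i * (st%:C : C); - ('i * (st%:C : C))].

Lemma dirs_L d : d \in dirs -> L d.
Proof.
have Ls := @Lambda_st R.
have Li : L ('i * (st%:C : C)).
  have -> : 'i * (st%:C : C) = lam (0, 1).
    by rewrite lamE; apply: eq_complexP; rewrite ?(ReM, ImM) /=; ring.
  exact: Lambda_lam.
by rewrite !inE => /or4P[] /eqP ->//; exact: Lambda_opp.
Qed.

Lemma cabs_dirs d : d \in dirs -> cabs d = st.
Proof.
have s0 := @st_gt0 R.
have Es : cabs (st%:C : C) = st by rewrite cabs_real gtr0_norm.
by rewrite !inE => /or4P[] /eqP ->; rewrite ?cabsN ?cabsM ?cabs_i ?Es ?mul1r.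
Qed.

Lemma size_outer r d : d \in dirs -> (size (outer r d) <= (2 * (Num.truncn (r / st)).+1).+1)%N.
Proof.
move=> dd; have Ld := dirs_L dd.
have co l : L l -> exists m n : int, complex.Re l = st * m%:~R /\ complex.Im l = st * n%:~R.
  by move=> /LambdaE[[m n] ->]; exists m, n; rewrite lamE.
have coN (t : R) (n : int) : t = st * n%:~R -> - t = st * (- n)%:~R.
  by move=> ->; rewrite intrN mulrN.
move: dd; rewrite !inE => /or4P[] /eqP E; rewrite E in Ld *.
- apply: (@size_outer_aux r _ (fun l => complex.Re l) (fun l => complex.Im l)) => //.
  + by move=> l; rewrite cabs_sqr.
  + by move=> l; rewrite ReD.
  + by move=> l; rewrite ImD /= addr0.
  + by move=> l l'; exact: eq_complexP.
- apply: (@size_outer_aux r _ (fun l => - complex.Re l) (fun l => complex.Im l)) => //.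
  + by move=> l /co[m [n [/coN h1 h2]]]; exists (- m), n.
  + by move=> l; rewrite cabs_sqr sqrrN.
  + by move=> l; rewrite ReD ReN /=; ring.
  + by move=> l; rewrite ImD ImN /= oppr0 addr0.
  + by move=> l l' /oppr_inj; exact: eq_complexP.
- apply: (@size_outer_aux r _ (fun l => complex.Im l) (fun l => complex.Re l)) => //.
  + by move=> l /co[m [n [h1 h2]]]; exists n, m.
  + by move=> l; rewrite cabs_sqr addrC.
  + by move=> l; rewrite ImD ImM /=; ring.
  + by move=> l; rewrite ReD ReM /=; ring.
  + by move=> l l' h1 h2; exact: eq_complexP.
- apply: (@size_outer_aux r _ (fun l => - complex.Im l) (fun l => complex.Re l)) => //.
  + by move=> l /co[m [n [h1 /coN h2]]]; exists (- n), m.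
  + by move=> l; rewrite cabs_sqr sqrrN addrC.
  + by move=> l; rewrite ImD ImN ImM /=; ring.
  + by move=> l; rewrite ReD ReN ReM /=; ring.
  + by move=> l l' /oppr_inj h1 h2; exact: eq_complexP.
Qed.

Definition rectQ (psi : C -> C) (l : C) : C :=
  rect psi (complex.Re l - st / 2) (complex.Re l + st / 2)
           (complex.Im l - st / 2) (complex.Im l + st / 2).

(* The closed cell around [l], and its boundary. *)
Definition on_cell_bd (w : C) :=
  [/\ `|complex.Re w| <= st / 2, `|complex.Im w| <= st / 2 &
      st / 2 <= Num.max `|complex.Re w| `|complex.Im w|].

(** An edge shared by two cells of the disc is run through in both directions. What survives are
    edges of cells with a neighbour outside, and those cells have centres with modulus at least r -
    st. *)
Lemma rect_telescope (psi : C -> C) (M : C -> R) (r : R) :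
  (forall l w, L l -> on_cell_bd w -> {for (l + w), continuous psi}) ->
  (forall l w, L l -> cabs l < r -> r - st <= cabs l -> on_cell_bd w -> cabs (psi (l + w)) <= M l) ->
  cabs (\sum_(l <- disc r) rectQ psi l)
    <= \sum_(d <- dirs) \sum_(l <- outer r d) 2 * M l * st.
Proof.
move=> Hc HM; have s0 := @st_gt0 R.
pose hb l := hint psi (complex.Im l - st / 2) (complex.Re l - st / 2) (complex.Re l + st / 2).
pose vl l := vint psi (complex.Re l - st / 2) (complex.Im l - st / 2) (complex.Im l + st / 2).
pose s : C := (st%:C : C).
have E1 l : rectQ psi l = (hb l - hb (l + 'i * s)) - 'i * (vl l - vl (l + s)).
  rewrite /rectQ /rect /hb /vl /s !ReD !ImD ReM ImM /=.
  rewrite !mul0r !mulr0 !mul1r subrr !addr0 !add0r.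
  have -> (t : R) : t + st - st / 2 = t + st / 2 by field.
  have -> (t : R) : t + st - st / 2 = t + st / 2 by field.
  ring.
under eq_bigr do rewrite E1.
rewrite sumrB -mulr_sumr !sum_telescope.
have le0 (t : R) : t <= st / 2 -> - (st / 2) <= t -> `|t| <= st / 2.
  by move=> h1 h2; rewrite ler_norml h2.
have s20 : 0 <= st / 2 by rewrite divr_ge0// ltW.
have Ns : `|- (st / 2)| = st / 2 by rewrite normrN ger0_norm.
have Ps : `|st / 2| = st / 2 by rewrite ger0_norm.
have Hb l (e : R) : L l -> cabs l < r -> r - st <= cabs l -> `|e| = st / 2 ->
    cabs (hint psi (complex.Im l + e) (complex.Re l - st / 2) (complex.Re l + st / 2))
      <= 2 * M l * st.
  move=> Ll lr rl es.
  have P x : complex.Re l - st / 2 <= x <= complex.Re l + st / 2 ->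
      on_cell_bd ((x - complex.Re l) +i* e) /\
      x +i* (complex.Im l + e) = l + ((x - complex.Re l) +i* e).
    move=> /andP[h1 h2]; split; last by apply: eq_complexP; rewrite ?(ReD, ImD) /=; ring.
    by split => /=; rewrite ?es ?le_max ?lexx ?orbT//; apply: le0; lra.
  have -> : 2 * M l * st = 2 * M l * (complex.Re l + st / 2 - (complex.Re l - st / 2)) by field.
  apply: cabs_cint_le; first lra.
    by move=> x /P[B E]; apply: cont_h; rewrite E; exact: Hc.
  by move=> x /P[B ->]; exact: HM.
have Vb l (e : R) : L l -> cabs l < r -> r - st <= cabs l -> `|e| = st / 2 ->
    cabs (vint psi (complex.Re l + e) (complex.Im l - st / 2) (complex.Im l + st / 2))
      <= 2 * M l * st.
  move=> Ll lr rl es.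
  have P x : complex.Im l - st / 2 <= x <= complex.Im l + st / 2 ->
      on_cell_bd (e +i* (x - complex.Im l)) /\
      (complex.Re l + e) +i* x = l + (e +i* (x - complex.Im l)).
    move=> /andP[h1 h2]; split; last by apply: eq_complexP; rewrite ?(ReD, ImD) /=; ring.
    by split => /=; rewrite ?es ?le_max ?lexx ?orbT//; apply: le0; lra.
  have -> : 2 * M l * st = 2 * M l * (complex.Im l + st / 2 - (complex.Im l - st / 2)) by field.
  apply: cabs_cint_le; first lra.
    by move=> x /P[B E]; apply: cont_v; rewrite E; exact: Hc.
  by move=> x /P[B ->]; exact: HM.
have out (d : C) (g : C -> C) : d \in dirs ->
    (forall l, L l -> cabs l < r -> r - st <= cabs l -> cabs (g l) <= 2 * M l * st) ->
    cabs (\sum_(l <- outer r d) g l) <= \sum_(l <- outer r d) 2 * M l * st.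
  move=> dd Hg; apply: (le_trans (cabs_sum _ _ _)); rewrite big_seq [leRHS]big_seq.
  apply: ler_sum => l lo; have Ll : L l.
    by move: lo; rewrite mem_filter => /andP[_]; rewrite in_disc => /andP[/set_mem].
  have [_ lr ld] := outerP lo (Lambda_add Ll (dirs_L dd)).
  apply: Hg => //; have := cabsD l d; rewrite (cabs_dirs dd); lra.
have mem1 : s \in dirs by rewrite !inE eqxx.
have mem2 : - s \in dirs by rewrite !inE eqxx orbT.
have mem3 : 'i * s \in dirs by rewrite !inE eqxx !orbT.
have mem4 : - ('i * s) \in dirs by rewrite !inE eqxx !orbT.
have B1 := out _ vl mem2 (fun l h1 h2 h3 => Vb l (- (st / 2)) h1 h2 h3 Ns).
have B2 : cabs (\sum_(l <- outer r s) vl (l + s)) <= \sum_(l <- outer r s) 2 * M l * st.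
  apply: (out _ (fun l => vl (l + s)) mem1) => l h1 h2 h3.
  have := Vb l (st / 2) h1 h2 h3 Ps; rewrite /vl /s !ReD !ImD /= !addr0.
  by have -> : complex.Re l + st - st / 2 = complex.Re l + st / 2 by field.
have B3 := out _ hb mem4 (fun l h1 h2 h3 => Hb l (- (st / 2)) h1 h2 h3 Ns).
have B4 : cabs (\sum_(l <- outer r ('i * s)) hb (l + 'i * s))
    <= \sum_(l <- outer r ('i * s)) 2 * M l * st.
  apply: (out _ (fun l => hb (l + 'i * s)) mem3) => l h1 h2 h3.
  have := Hb l (st / 2) h1 h2 h3 Ps; rewrite /hb /s !ReD !ImD ReM ImM /=.
  rewrite !mul0r !mulr0 !mul1r subrr !addr0 !add0r.
  by have -> : complex.Im l + st - st / 2 = complex.Im l + st / 2 by field.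
rewrite /dirs !big_cons big_nil addr0 -/s.
apply: (le_trans (cabsB _ _)); rewrite cabsM cabs_i mul1r.
apply: (le_trans (lerD (cabsB _ _) (cabsB _ _))); lra.
Qed.

End Telescope.

(** * Residue calculus for f / sigma *)

Section Contour.
Variable R : realType.
Local Notation C := (R[i]^o).
Local Notation L := (@Lambda R).
Local Notation st := (@st R).
Local Notation sigma := (@sigma R).
Local Notation psig := (@psig R).
Variables (f : C -> C) (b : C -> R).
Hypothesis ef : entire f.
Hypothesis b0 : forall l, 0 <= b l.
Hypothesis Hb : forall l w, L l -> `|complex.Re w| <= st / 2 -> `|complex.Im w| <= st / 2 ->
  FF f (l + w) <= b l.

Let a (l : C) : C := f l / derive1 sigma l.

Lemma cell_sqr_norm (w : C) : `|complex.Re w| <= st / 2 -> `|complex.Im w| <= st / 2 ->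
  2 * cabs w ^+ 2 <= st ^+ 2.
Proof. by rewrite !ler_norml => /andP[? ?] /andP[? ?]; exact: cell_sqr. Qed.

Lemma cabs_interp_coeff l : L l -> cabs (a l) <= b l.
Proof.
move=> Ll; have s20 : `|0 : R| <= st / 2 by rewrite normr0 divr_ge0// ltW// st_gt0.
have := Hb (w := 0) Ll s20 s20; rewrite addr0; apply: le_trans.
by rewrite /a /FF cabsM cabsV cabs_dsigma// expRN.
Qed.

Lemma cell_bd_ge (w : C) : on_cell_bd w -> st / 2 <= cabs w.
Proof. by case=> _ _ /le_trans; apply; rewrite ge_max ler_Re ler_Im. Qed.

Let psig_neq0 (w : C) : 2 * cabs w ^+ 2 <= st ^+ 2 -> psig w != 0.
Proof. by move=> /psig_ge h; rewrite -cabs_gt0 (lt_le_trans _ h). Qed.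

Lemma sigma_neq0 l w : L l -> 2 * cabs w ^+ 2 <= st ^+ 2 -> w != 0 -> sigma (l + w) != 0.
Proof.
move=> Ll hw w0; rewrite sigma_shift//; apply: mulf_neq0; first exact: dsigma_neq0.
by apply: mulf_neq0; [exact: cexp_neq0 | apply: mulf_neq0 => //; exact: psig_neq0].
Qed.

(** On the boundary of a cell |w| >= st / 2, |psig w| >= 1/4 and |w|^2 <= st^2 / 2; this constant is
    the resulting bound for the inverse of the periodic function |sigma(z)| exp(-|z|^2). *)
Definition Kphi : R := 8 / st * expR (st ^+ 2 / 2).

Lemma Kphi_ge0 : 0 <= Kphi.
Proof. by rewrite mulr_ge0 ?expR_ge0// divr_ge0// ltW// st_gt0. Qed.

Lemma cabs_quotient_le l w : L l -> on_cell_bd w ->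
  cabs (f (l + w) / sigma (l + w)) <= Kphi * b l.
Proof.
move=> Ll hw; have s0 := @st_gt0 R; have [hr hi _] := hw.
have c2 := cell_sqr_norm hr hi; have wg := cell_bd_ge hw.
have Hf := Hb Ll hr hi.
have w0 : 0 < cabs w by rewrite (lt_le_trans _ wg)// divr_gt0.
have p0 := psig_ge c2.
have E : cabs (sigma (l + w)) = expR (cabs (l + w) ^+ 2) * (expR (- cabs w ^+ 2) * (cabs w * cabs (psig w))).
  rewrite sigma_shift// cabsM cabs_dsigma// cabsM cabs_cexp cabsM [LHS]mulrA [RHS]mulrA -!expRD.
  by congr (expR _ * _); rewrite cabs_sqrD; ring.
have -> : cabs (f (l + w) / sigma (l + w))
   = FF f (l + w) * (expR (- cabs w ^+ 2) * (cabs w * cabs (psig w)))^-1.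
  rewrite cabsM cabsV E /FF !expRN; field.
  by rewrite !gt_eqF ?expR_gt0// (lt_le_trans _ p0).
rewrite mulrC; apply: ler_pM => //.
- by rewrite invr_ge0 !mulr_ge0 ?expR_ge0 ?cabs_ge0.
- exact: FF_ge0.
have -> : Kphi = (expR (- (st ^+ 2 / 2)) * (st / 2 * 4^-1))^-1.
  by rewrite /Kphi expRN; field; rewrite !gt_eqF ?expR_gt0.
rewrite lef_pV2 ?posrE ?mulr_gt0 ?expR_gt0 ?divr_gt0// ?(lt_le_trans _ p0)//.
apply: ler_pM; rewrite ?expR_ge0 ?mulr_ge0 ?divr_ge0 ?(ltW s0)//.
  by rewrite ler_expR lerN2 ler_pdivlMr// mulrC.
by apply: ler_pM; rewrite ?divr_ge0 ?(ltW s0).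
Qed.

Section Kernel.
Variables (k : C -> C) (E : seq C).
Hypothesis uE : uniq E.
Hypothesis EL : forall l, l \in E -> L l.
Hypothesis kE : forall l w, L l -> l \notin E ->
  `|complex.Re w| <= st / 2 -> `|complex.Im w| <= st / 2 -> exists d, cder k (l + w) d.
Hypothesis kbd : forall l w, L l -> on_cell_bd w -> exists d, cder k (l + w) d.

Let psi (w : C) : C := f w / sigma w * k w.

Let fder w : exists d, cder f w d.
Proof. by apply: derivable_cder; exact: ef. Qed.

Lemma sigma_der w : exists d, cder sigma w d.
Proof.
have [d Dd] := psig_der w; exists (w * d + psig w * 1).
suff -> : sigma = (fun w => w * psig w) by exact: (cderM (cder_id w) Dd).
by apply/funext => z; rewrite sigmaE.
Qed.

Let psi_cont l w : L l -> on_cell_bd w -> {for (l + w), continuous psi}.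
Proof.
move=> Ll hw; have s0 := @st_gt0 R; have [hr hi _] := hw.
have w0 : w != 0 by rewrite -cabs_gt0 (lt_le_trans _ (cell_bd_ge hw))// divr_gt0.
have [d1 D1] := fder (l + w); have [d2 D2] := sigma_der (l + w).
have [d3 D3] := kbd Ll hw.
have n0 := sigma_neq0 Ll (cell_sqr_norm hr hi) w0.
exact: cder_continuous (cderM (cderM D1 (cderV n0 D2)) D3).
Qed.

(** Off the list [E] of possible poles of [k], the integrand is H(v) / (v - l) with H holomorphic on
    the cell and H(l) = a l k(l); Cauchy's formula on a centred square gives the residue. *)
Lemma rectQ_residue l : L l -> l \notin E ->
  rectQ psi l = 'i * (2 * pi)%:C * (a l * k l).
Proof.
move=> Ll lE; have s0 := @st_gt0 R; have s20 : 0 < st / 2 by rewrite divr_gt0.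
pose H (v : C) : C := f v * k v / (derive1 sigma l * (cexp (2 * l^*%C * (v - l)) * psig (v - l))).
have El : l = complex.Re l +i* complex.Im l by case: (l).
have inc x y : complex.Re l - st / 2 <= x <= complex.Re l + st / 2 ->
    complex.Im l - st / 2 <= y <= complex.Im l + st / 2 ->
    `|complex.Re ((x +i* y) - l)| <= st / 2 /\ `|complex.Im ((x +i* y) - l)| <= st / 2.
  move=> /andP[h1 h2] /andP[h3 h4]; rewrite ReD ReN ImD ImN /= !ler_norml.
  by split; apply/andP; split; lra.
have den v : 2 * cabs (v - l) ^+ 2 <= st ^+ 2 ->
    derive1 sigma l * (cexp (2 * l^*%C * (v - l)) * psig (v - l)) != 0.
  move=> hv; apply: mulf_neq0; first exact: dsigma_neq0.
  by apply: mulf_neq0; [exact: cexp_neq0 | exact: psig_neq0].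
have HH : holo_on H (complex.Re l - st / 2) (complex.Re l + st / 2)
    (complex.Im l - st / 2) (complex.Im l + st / 2).
  move=> x y hx hy; have [h1 h2] := inc x y hx hy.
  set v : C := x +i* y in h1 h2 *.
  have [d1 D1] := fder v.
  have [d2 D2] : exists d, cder k v d by have := kE Ll lE h1 h2; rewrite addrC subrK.
  have [d3 D3] := psig_der (v - l).
  have D4 := cder_comp (cder_sub_cst l v) D3.
  have D5 := cder_cexp_comp (cderMl (2 * l^*%C) (cder_sub_cst l v)).
  have D6 := cderMl (derive1 sigma l) (cderM D5 D4).
  have D7 := @cderV R (fun w => derive1 sigma l * (cexp (2 * l^*%C * (w - l)) * psig (w - l)))
    v _ (den v (cell_sqr_norm h1 h2)) D6.
  by eexists; exact: (cderM (cderM D1 D2) D7).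
have := @cauchy_formula R H (complex.Re l) (complex.Im l) (complex.Re l - st / 2) (complex.Re l + st / 2)
    (complex.Im l - st / 2) (complex.Im l + st / 2).
have Ra (t : R) : t - st / 2 < t < t + st / 2 by apply/andP; split; lra.
rewrite -El => /(_ (Ra _) (Ra _) HH) CF.
have W := winding_square (complex.Re l) (complex.Im l) s20; rewrite -El in W.
rewrite W in CF.
rewrite /rectQ (@eq_rect _ _ (fun w => H w / (w - l))).
- rewrite CF.
  rewrite /H subrr mulr0 cexp0 psig0 !mul1r mulr1 /a; ring.
- lra.
- lra.
move=> x y hx hy _; have [h1 h2] := inc x y hx hy.
set v : C := x +i* y in h1 h2 *.
have Es : sigma v = derive1 sigma l * (cexp (2 * l^*%C * (v - l)) * psig (v - l)) * (v - l).
  by rewrite -{1}[v](subrK l) [_ + l]addrC sigma_shift//; ring.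
by rewrite /psi /H Es invfM; ring.
Qed.

Lemma cabs_rectQ_le l (K : R) : L l -> 0 <= K ->
  (forall w, on_cell_bd w -> cabs (k (l + w)) <= K) ->
  cabs (rectQ psi l) <= 8 * st * Kphi * K * b l.
Proof.
move=> Ll K0 HK; have s0 := @st_gt0 R.
have -> : 8 * st * Kphi * K * b l = 4 * (Kphi * b l * K) *
    (complex.Re l + st / 2 - (complex.Re l - st / 2) + (complex.Im l + st / 2 - (complex.Im l - st / 2))).
  by field.
have bd x y : complex.Re l - st / 2 <= x <= complex.Re l + st / 2 ->
    complex.Im l - st / 2 <= y <= complex.Im l + st / 2 ->
    [|| x == complex.Re l - st / 2, x == complex.Re l + st / 2,
      y == complex.Im l - st / 2 | y == complex.Im l + st / 2] ->
    on_cell_bd ((x +i* y) - l).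
  move=> /andP[h1 h2] /andP[h3 h4] h; rewrite /on_cell_bd !(ReD, ReN, ImD, ImN) /=.
  split; rewrite ?ler_norml ?le_max; first by apply/andP; split; lra.
    by apply/andP; split; lra.
  by case/or4P: h => /eqP ->; apply/orP; [left|left|right|right];
    rewrite ler_normr; apply/orP; (try by left; lra); right; lra.
apply: cabs_rect_le; [lra|lra| |].
  by move=> x y hx hy; rewrite -!orbA => h; have := psi_cont Ll (bd _ _ hx hy h); rewrite addrC subrK.
move=> x y hx hy; rewrite -!orbA => h; have B := bd _ _ hx hy h.
have := cabs_quotient_le Ll B; have := HK _ B; rewrite [l + _]addrC subrK => h1 h2.
by rewrite /psi cabsM; apply: ler_pM; rewrite ?cabs_ge0.
Qed.

Variable kap : R -> R.
Hypothesis kap_bound : exists r0, forall r l w, r0 <= r -> L l -> cabs l < r ->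
  r - st <= cabs l -> on_cell_bd w -> cabs (k (l + w)) <= kap r.
Hypothesis kap_small : forall e : R, 0 < e -> exists r0, forall r, r0 <= r ->
  0 <= kap r /\ kap r * (\sum_(d <- @dirs R) \sum_(l <- outer r d) b l) <= e.

(** The residue theorem on the growing union of cells centred in a disc. The total contour integral
    is at most [kap r], the size of [k] near the rim, times the mass of [b] on the rim, and this
    tends to 0; the cells of [E] are moved to the other side. *)
Lemma contour_limit :
  (fun r => dsum (fun l => if l \in E then 0 else a l * k l) r) @ +oo -->
  - (('i * (2 * pi)%:C)^-1 * \sum_(l <- E) rectQ psi l).
Proof.
have s0 := @st_gt0 R; have [r0 H0] := kap_bound.
apply/cvgCP => e e0.
have K0 : 0 < 2 * Kphi * st + 1.
  by rewrite ltr_wpDl// mulr_ge0 ?(ltW s0)// mulr_ge0 ?Kphi_ge0.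
have [r1 H1] := kap_small (divr_gt0 e0 K0).
pose M := \sum_(l <- E) cabs l.
have ME x : x \in E -> cabs x <= M.
  by move=> xE; rewrite /M (big_rem x xE) /= lerDl; apply: sumr_ge0 => y _; exact: cabs_ge0.
exists (Num.max M (Num.max r0 r1)); split; first exact: num_real.
move=> r; rewrite !gt_max => /and3P[Mr r0r r1r].
have [k0 k1] := H1 r (ltW r1r).
set kp : C := 'i * (2 * pi)%:C.
have kpE : cabs kp = 2 * pi.
  by rewrite /kp cabsM cabs_i mul1r cabs_real ger0_norm// mulr_ge0// pi_ge0.
have kp1 : 1 <= cabs kp by rewrite kpE; have := pi_ge2 R; lra.
have kp0 : kp != 0 by rewrite -cabs_gt0 (lt_le_trans _ kp1).
have S : \sum_(l <- disc r) rectQ psi l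
  = kp * dsum (fun l => if l \in E then 0 else a l * k l) r + \sum_(l <- E) rectQ psi l.
  rewrite (bigID (fun l => l \in E)) /= addrC; congr (_ + _).
    rewrite /dsum mulr_sumr big_mkcond; apply: eq_big_seq => l.
    rewrite in_disc => /andP[/set_mem Ll _]; case: ifPn => lE.
      by rewrite rectQ_residue// (negbTE lE).
    by move: lE; rewrite negbK => ->; rewrite mulr0.
  rewrite -big_filter; apply: perm_big; apply: uniq_perm => //.
    by rewrite filter_uniq ?fset_uniq.
  move=> l; rewrite mem_filter in_disc; apply/andP/idP => [[]//|lE].
  by split => //; rewrite mem_set ?(le_lt_trans (ME l lE))//; exact: EL.
have -> : dsum (fun l => if l \in E then 0 else a l * k l) r - - (kp^-1 * \sum_(l <- E) rectQ psi l)
  = kp^-1 * \sum_(l <- disc r) rectQ psi l.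
  by rewrite S mulrDr mulrA mulVf// mul1r opprK.
have T : cabs (\sum_(l <- disc r) rectQ psi l)
   <= \sum_(d <- @dirs R) \sum_(l <- outer r d) 2 * (Kphi * b l * kap r) * st.
  apply: rect_telescope => [l w Ll hw|l w Ll lr rl hw]; first exact: psi_cont.
  rewrite /psi cabsM; apply: ler_pM; rewrite ?cabs_ge0//.
    exact: cabs_quotient_le.
  by apply: H0 => //; exact: ltW.
have T2 : \sum_(d <- @dirs R) \sum_(l <- outer r d) 2 * (Kphi * b l * kap r) * st
   = 2 * Kphi * st * (kap r * \sum_(d <- @dirs R) \sum_(l <- outer r d) b l).
  rewrite !mulr_sumr; apply: eq_bigr => d _; rewrite !mulr_sumr; apply: eq_bigr => l _; ring.
rewrite cabsM cabsV.
apply: (@le_lt_trans _ _ (cabs (\sum_(l <- disc r) rectQ psi l))).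
  by rewrite -[leRHS]mul1r ler_wpM2r ?cabs_ge0// invf_le1// (lt_le_trans _ kp1).
apply: (le_lt_trans T); rewrite T2.
apply: (@le_lt_trans _ _ (2 * Kphi * st * (e / (2 * Kphi * st + 1)))).
  by rewrite ler_wpM2l// mulr_ge0 ?(ltW s0)// mulr_ge0 ?Kphi_ge0.
rewrite mulrA ltr_pdivrMr// mulrC ltr_pM2l// ltrDl//.
Qed.

End Kernel.
End Contour.

(** * Hilbert transforms of the values of a Fock function *)

Section CauchySums.
Variable R : realType.
Local Notation C := (R[i]^o).
Local Notation L := (@Lambda R).
Local Notation st := (@st R).
Local Notation sigma := (@sigma R).

Lemma on_cell_bd_lt (w : C) : on_cell_bd w -> cabs w < 3 / 4 * st.
Proof. by case=> h1 h2 _; apply: cell_lt; [lra|lra|exact: cell_sqr_norm]. Qed.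

Lemma lattice_off (x w : C) : L x -> on_cell_bd w -> st / 4 <= cabs (x + w).
Proof.
move=> Lx hw; have s0 := @st_gt0 R; have h := cell_bd_ge hw; have h' := on_cell_bd_lt hw.
have [->|x0] := eqVneq x 0; first by rewrite add0r; lra.
have := Lambda_ge Lx x0; have := cabs_ge_sub x (- w); rewrite opprK cabsN; lra.
Qed.

Lemma lattice_off_cell (x w : C) : L x -> x != 0 -> `|complex.Re w| <= st / 2 ->
  `|complex.Im w| <= st / 2 -> x + w != 0.
Proof.
move=> Lx x0 hr hi; have s0 := @st_gt0 R.
have h' : cabs w < 3 / 4 * st by apply: cell_lt; [lra|lra|exact: cell_sqr_norm].
rewrite -cabs_gt0.
have := Lambda_ge Lx x0; have := cabs_ge_sub x (- w); rewrite opprK cabsN; lra.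
Qed.

Lemma far_cell (r : R) (l l' w : C) : 4 * st + 2 * cabs l' <= r -> r - st <= cabs l ->
  on_cell_bd w -> r / 2 <= cabs (l + w - l').
Proof.
move=> h1 h2 hw; have h' := on_cell_bd_lt hw; have s0 := @st_gt0 R.
have := cabs_ge_sub (l + w) l'; have := cabs_ge_sub l (- w); rewrite opprK cabsN.
lra.
Qed.

(** With inverse of 0 equal to 0, the difference of the two full sums has the terms -a(l') / l' at
    l' and -a(0) / l' at 0, which the sum omitting both points lacks. *)
Lemma dsum_kernel_diff (a : C -> C) (l' : C) (r : R) : L l' -> l' != 0 -> cabs l' < r ->
  dsum (fun l => if l \in [:: l'; 0] then 0 else a l * ((l - l')^-1 - l^-1)) r - (a l' + a 0) / l'
  = dsum (fun l => a l / (l - l')) r - dsum (fun l => a l / l) r.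
Proof.
move=> Ll' l'0 lr; have r0 : 0 < r by apply: le_lt_trans lr; exact: cabs_ge0.
have L0 := @Lambda0 R.
have S1 (h : C -> C) : dsum h r = h l' + h 0 + \sum_(i <- disc r | (i != l') && (i != 0)) h i.
  have i1 : l' \in disc r by rewrite in_disc mem_set.
  have i2 : 0 \in disc r by rewrite in_disc mem_set// cabs0.
  rewrite /dsum (bigD1_seq l') ?fset_uniq//= -big_filter (bigD1_seq 0) /=; last 2 first.
  - by rewrite mem_filter i2 eq_sym l'0.
  - by rewrite filter_uniq// fset_uniq.
  rewrite addrA big_filter_cond; congr (_ + _); apply: eq_bigl => i; exact: andbC.
have Er : \sum_(i <- disc r | (i != l') && (i != 0)) (if i \in [:: l'; 0] then 0 else a i * ((i - l')^-1 - i^-1))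
    = \sum_(i <- disc r | (i != l') && (i != 0)) (a i / (i - l') - a i / i).
  apply: eq_bigr => i /andP[il' i0]; rewrite !inE (negbTE il') (negbTE i0) /=.
  by rewrite mulrBr.
have T (g1 g2 : C -> C) (x y S : C) : g1 l' = 0 -> g1 0 = 0 ->
    g2 l' = - (x / l') -> g2 0 = - (y / l') ->
    g1 l' + g1 0 + S - (x + y) / l' = g2 l' + g2 0 + S.
  by move=> -> -> -> ->; ring.
rewrite -dsumB (S1 (fun l => if l \in [:: l'; 0] then 0 else a l * ((l - l')^-1 - l^-1))) Er.
rewrite (S1 (fun l => a l / (l - l') - a l / l)).
apply: (T (fun l => if l \in [:: l'; 0] then 0 else a l * ((l - l')^-1 - l^-1))
  (fun l => a l / (l - l') - a l / l) (a l') (a 0)).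
- by rewrite inE eqxx.
- by rewrite !inE eqxx orbT.
- by rewrite subrr invr0 mulr0 sub0r.
- by rewrite sub0r invrN mulrN invr0 mulr0 subr0.
Qed.

Variables (f : C -> C) (b : C -> R).
Hypothesis ef : entire f.
Hypothesis b0 : forall l, 0 <= b l.
Hypothesis Hb : forall l w, L l -> `|complex.Re w| <= st / 2 -> `|complex.Im w| <= st / 2 ->
  FF f (l + w) <= b l.

Let a (l : C) : C := f l / derive1 sigma l.

Lemma cabs_two_pi_inv : cabs (('i * (2 * pi)%:C)^-1 : C) <= 1.
Proof.
have p2 := pi_ge2 R.
rewrite cabsV cabsM cabs_i mul1r cabs_real ger0_norm; last by lra.
by rewrite invf_le1; lra.
Qed.

Definition KC : R := 64 * Kphi R.

(** [contour_limit] with k(w) = 1/(w - l') turns the principal value into one integral around the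
    cell of l'. Since k decays only like 1/r, the mass of [b] on the rim has to be o(r). *)
Lemma pv_cauchy l' : L l' ->
  (forall e : R, 0 < e -> exists K, forall r d, d \in dirs R -> st <= r ->
     \sum_(l <- outer r d) b l <= e * r + K) ->
  exists2 Lm : C, (fun r => dsum (fun l => a l / (l - l')) r) @ +oo --> Lm &
    cabs Lm <= KC * b l'.
Proof.
move=> Ll' Hsub; have s0 := @st_gt0 R.
pose k (w : C) : C := (w - l')^-1.
have kder w : w != l' -> exists d, cder k w d by move=> wl; eexists; exact: cderV_sub wl.
have EL l : l \in [:: l'] -> L l by rewrite inE => /eqP ->.
have kE l w : L l -> l \notin [:: l'] -> `|complex.Re w| <= st / 2 ->
    `|complex.Im w| <= st / 2 -> exists d, cder k (l + w) d.
  rewrite inE => Ll ll' hr hi; apply: kder; rewrite -subr_eq0 addrAC.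
  by apply: lattice_off_cell => //; [exact: Lambda_sub | rewrite subr_eq0].
have kbd l w : L l -> on_cell_bd w -> exists d, cder k (l + w) d.
  move=> Ll hw; apply: kder; rewrite -subr_eq0 addrAC -cabs_gt0.
  by apply: lt_le_trans (lattice_off (Lambda_sub Ll Ll') hw); rewrite divr_gt0.
have [X HX XV] : exists2 X : C, (fun r => dsum (fun l => if l \in [:: l'] then 0 else a l * k l) r) @ +oo --> X
   & cabs X <= KC * b l'.
  exists (- (('i * (2 * pi)%:C)^-1 * \sum_(l <- [:: l']) rectQ (fun w => f w / sigma w * k w) l)).
    apply: (@contour_limit _ f b ef Hb k [:: l'] _ EL kE kbd (fun r => 2 / r)) => //.
      exists (4 * st + 2 * cabs l') => r l w hr Ll lr rl hw.
      have h := far_cell hr rl hw.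
      have r0 : 0 < r by have := cabs_ge0 l'; lra.
      rewrite /k cabsV -[2 / r]invrK lef_pV2 ?posrE ?invr_gt0 ?divr_gt0//.
        by rewrite invf_div.
      by rewrite (lt_le_trans _ h)// divr_gt0.
    (* Four directions against the decay 2 / r turn (e / 16) r into e / 2; the constant K is
       absorbed by taking r large. *)
    move=> e e0; have e16 : 0 < e / 16 by rewrite divr_gt0.
    have [K HK] := Hsub _ e16.
    exists (st + 16 * `|K| / e) => r hr.
    have sr : st <= r by apply: le_trans hr; rewrite lerDl divr_ge0 ?mulr_ge0// ltW.
    have r0 : 0 < r by exact: lt_le_trans sr.
    split; first by rewrite divr_ge0// ltW.
    have S : \sum_(d <- dirs R) \sum_(l <- outer r d) b l <= 4 * (e / 16 * r + K).
      have : \sum_(d <- dirs R) \sum_(l <- outer r d) b l <= \sum_(d <- dirs R) (e / 16 * r + K).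
        by rewrite big_seq [leRHS]big_seq; apply: ler_sum => d dd; exact: HK.
      by rewrite /dirs !big_cons !big_nil; lra.
    apply: (@le_trans _ _ (2 / r * (4 * (e / 16 * r + K)))).
      by rewrite ler_wpM2l// divr_ge0// ltW.
    have -> : 2 / r * (4 * (e / 16 * r + K)) = e / 2 + 8 * K / r by field; rewrite gt_eqF.
    have : 8 * K / r <= e / 2.
      rewrite ler_pdivrMr//; have := ler_norm K.
      have : 16 * `|K| <= e * r.
        rewrite [e * r]mulrC -ler_pdivrMr//; apply: le_trans hr.
        by rewrite lerDr ltW.
      lra.
    lra.
  rewrite cabsN cabsM big_cons big_nil addr0 -[leRHS]mul1r.
  apply: ler_pM; rewrite ?cabs_ge0 ?cabs_two_pi_inv//.
  have K4 : 0 <= 4 / st by rewrite divr_ge0// ltW.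
  have := @cabs_rectQ_le _ f b ef Hb k kbd l' (4 / st) Ll' K4.
  have -> : 8 * st * Kphi R * (4 / st) = 32 * Kphi R by field; rewrite gt_eqF.
  have KK : 32 * Kphi R * b l' <= KC * b l'.
    by rewrite /KC ler_wpM2r// ler_wpM2r ?Kphi_ge0//; lra.
  move=> H; apply: le_trans KK; apply: H => w hw; rewrite /k cabsV.
  have h := lattice_off (Lambda_sub Ll' Ll') hw.
  have -> : 4 / st = (st / 4)^-1 by rewrite invf_div.
  rewrite [l' + w - l']addrAC lef_pV2 ?posrE ?divr_gt0// (lt_le_trans _ h)// divr_gt0//.
exists X => //.
have -> : (fun r => dsum (fun l => a l / (l - l')) r)
  = (fun r => dsum (fun l => if l \in [:: l'] then 0 else a l * k l) r); last by [].
apply/funext => r; apply: eq_dsum => l _; rewrite inE /k.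
by case: eqP => // ->; rewrite subrr invr0 mulr0.
Qed.

(** For merely bounded [b] the rim has mass O(r), so the kernel 1/(w - l') - 1/w, of size O(r^-2),
    is used. Its poles at l' and 0 give two local integrals with a bound independent of l'. *)
Lemma pv_cauchy_diff (B : R) : (forall l, b l <= B) -> exists K, forall l', L l' ->
  exists2 Lm : C, (fun r => dsum (fun l => a l / (l - l')) r - dsum (fun l => a l / l) r) @ +oo --> Lm &
    cabs Lm <= K.
Proof.
move=> bB; have s0 := @st_gt0 R.
have B0 : 0 <= B by exact: le_trans (b0 0) (bB 0).
exists (2 * (64 * Kphi R * B) + 2 * B / st) => l' Ll'.
have Kp := Kphi_ge0 R.
have KK0 : 0 <= 2 * (64 * Kphi R * B) + 2 * B / st.
  by rewrite addr_ge0// ?mulr_ge0// ?invr_ge0 ?(ltW s0).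
have [->|l'0] := eqVneq l' 0.
  exists 0; last by rewrite cabs0.
  have -> : (fun r => dsum (fun l => a l / (l - 0)) r - dsum (fun l => a l / l) r) = (fun=> 0).
    by apply/funext => r; apply/eqP; rewrite subr_eq0; apply/eqP/eq_dsum => l _; rewrite subr0.
  exact: cvg_cst.
have L0 := @Lambda0 R.
pose k (w : C) : C := (w - l')^-1 - w^-1.
have kder w : w != l' -> w != 0 -> exists d, cder k w d.
  by move=> wl w0; eexists; exact: (cderB (cderV_sub wl) (cder_inv w0)).
have EL l : l \in [:: l'; 0] -> L l by rewrite !inE => /orP[] /eqP ->.
have kE l w : L l -> l \notin [:: l'; 0] -> `|complex.Re w| <= st / 2 ->
    `|complex.Im w| <= st / 2 -> exists d, cder k (l + w) d.
  rewrite !inE negb_or => Ll /andP[ll' l0] hr hi.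
  apply: kder; last by apply: lattice_off_cell.
  rewrite -subr_eq0 addrAC.
  by apply: lattice_off_cell => //; [exact: Lambda_sub | rewrite subr_eq0].
have off l w : L l -> on_cell_bd w -> 0 < cabs (l + w).
  by move=> Ll hw; apply: lt_le_trans (lattice_off Ll hw); rewrite divr_gt0.
have kbd l w : L l -> on_cell_bd w -> exists d, cder k (l + w) d.
  move=> Ll hw; apply: kder; last by rewrite -cabs_gt0 off.
  by rewrite -subr_eq0 addrAC -cabs_gt0 off//; exact: Lambda_sub.
have uE : uniq [:: l'; 0] by rewrite /= inE l'0.
pose X := - (('i * (2 * pi)%:C)^-1 * \sum_(l <- [:: l'; 0]) rectQ (fun w => f w / sigma w * k w) l).
have HX : (fun r => dsum (fun l => if l \in [:: l'; 0] then 0 else a l * k l) r) @ +oo --> X.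
  apply: (@contour_limit _ f b ef Hb k [:: l'; 0] uE EL kE kbd (fun r => 4 * cabs l' / r ^+ 2)) => //.
    exists (4 * st + 2 * cabs l') => r l w hr Ll lr rl hw.
    have h := far_cell hr rl hw; have c0 := cabs_ge0 l'.
    have r0 : 0 < r by lra.
    have h0 : r / 2 <= cabs (l + w).
      have := @far_cell r l 0 w; rewrite subr0 cabs0; apply => //; lra.
    have r2 : 0 < r / 2 by rewrite divr_gt0.
    have n1 : l + w != 0 by rewrite -cabs_gt0 (lt_le_trans _ h0).
    have n2 : l + w - l' != 0 by rewrite -cabs_gt0 (lt_le_trans _ h).
    have -> : k (l + w) = l' * ((l + w - l')^-1 * (l + w)^-1).
      by rewrite /k; field; rewrite n1 n2.
    have -> : 4 * cabs l' / r ^+ 2 = cabs l' * ((r / 2)^-1 * (r / 2)^-1) by field; rewrite gt_eqF.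
    rewrite cabsM ler_wpM2l// cabsM !cabsV.
    by apply: ler_pM; rewrite ?invr_ge0 ?cabs_ge0// lef_pV2 ?posrE// (lt_le_trans r2).
  move=> e e0; exists (st + 80 * cabs l' * B / (st * e)) => r hr.
  have c0 := cabs_ge0 l'.
  have sr : st <= r by apply: le_trans hr; rewrite lerDl divr_ge0 ?mulr_ge0// ltW.
  have r0 : 0 < r by exact: lt_le_trans sr.
  split; first by rewrite divr_ge0 ?sqr_ge0// mulr_ge0.
  (* There are at most 2 (r / st + 1) + 1 outer points, hence at most 5 r / st once r >= st. *)
  have o d : d \in dirs R -> \sum_(l <- outer r d) b l <= B * (5 * (r / st)).
    move=> dd; apply: (@le_trans _ _ (\sum_(l <- outer r d) B)); first exact: ler_sum.
    rewrite big_const_seq count_predT iter_addr_0 -[B *+ _]mulr_natr ler_wpM2l//.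
    apply: (@le_trans _ _ ((2 * (Num.truncn (r / st)).+1).+1)%:R).
      by rewrite ler_nat; exact: size_outer.
    have rs : 1 <= r / st by rewrite ler_pdivlMr// mul1r.
    have tr : (Num.truncn (r / st))%:R <= r / st.
      have q0 : 0 <= r / st by rewrite divr_ge0 ?ltW.
      by have /andP[] := truncn_itv q0.
    by rewrite -addn1 natrD natrM -addn1 natrD; lra.
  have S : \sum_(d <- dirs R) \sum_(l <- outer r d) b l <= 4 * (B * (5 * (r / st))).
    have : \sum_(d <- dirs R) \sum_(l <- outer r d) b l <= \sum_(d <- dirs R) (B * (5 * (r / st))).
      by rewrite big_seq [leRHS]big_seq; apply: ler_sum => d dd; exact: o.
    by rewrite /dirs !big_cons !big_nil; lra.
  apply: (@le_trans _ _ (4 * cabs l' / r ^+ 2 * (4 * (B * (5 * (r / st)))))).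
    by rewrite ler_wpM2l// divr_ge0 ?sqr_ge0// mulr_ge0.
  have -> : 4 * cabs l' / r ^+ 2 * (4 * (B * (5 * (r / st)))) = 80 * cabs l' * B / st / r.
    by field; rewrite !gt_eqF.
  rewrite ler_pdivrMr// [e * r]mulrC -ler_pdivrMr//; apply: le_trans hr.
  by rewrite -[leLHS]mulrA -invfM lerDr ltW.
have XV : cabs X <= 2 * (64 * Kphi R * B).
  rewrite /X cabsN cabsM -[leRHS]mul1r; apply: ler_pM; rewrite ?cabs_ge0 ?cabs_two_pi_inv//.
  rewrite big_cons big_seq1; apply: (le_trans (cabsD _ _)).
  have J l : L l -> cabs (rectQ (fun w => f w / sigma w * k w) l) <= 64 * Kphi R * B.
    move=> Ll; have K8 : 0 <= 8 / st by rewrite divr_ge0// ltW.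
    have := @cabs_rectQ_le _ f b ef Hb k kbd l (8 / st) Ll K8.
    have -> : 8 * st * Kphi R * (8 / st) = 64 * Kphi R by field; rewrite gt_eqF.
    move=> H; have KK : 64 * Kphi R * b l <= 64 * Kphi R * B by rewrite ler_wpM2l ?bB// mulr_ge0.
    apply: le_trans KK; apply: H => w hw; rewrite /k; apply: (le_trans (cabsB _ _)).
    rewrite !cabsV.
    have i4 x : L x -> (cabs (x + w))^-1 <= 4 / st.
      move=> Lx; have -> : 4 / st = (st / 4)^-1 by rewrite invf_div.
      by rewrite lef_pV2 ?posrE ?divr_gt0 ?off//; exact: lattice_off.
    have := i4 l Ll; have := i4 (l - l') (Lambda_sub Ll Ll'); rewrite addrAC.
    have -> : 8 / st = 4 / st + 4 / st by field; rewrite gt_eqF.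
    lra.
  have -> : 2 * (64 * Kphi R * B) = 64 * Kphi R * B + 64 * Kphi R * B by ring.
  exact: lerD (J l' Ll') (J 0 L0).
exists (X - (a l' + a 0) / l').
  have D : (fun r => dsum (fun l => if l \in [:: l'; 0] then 0 else a l * k l) r - (a l' + a 0) / l') @ +oo
      --> X - (a l' + a 0) / l' by exact: (cvgCB HX (cvg_cst _)).
  apply: cvg_trans D; apply: near_eq_cvg.
  exists (cabs l'); split; first exact: num_real.
  by move=> r lr; exact: (dsum_kernel_diff a Ll' l'0 lr).
apply: (le_trans (cabsB _ _)); apply: lerD => //.
rewrite cabsM cabsV; apply: ler_pM; rewrite ?invr_ge0 ?cabs_ge0//.
  apply: (le_trans (cabsD _ _)).
  have -> : 2 * B = B + B by ring.
  apply: lerD.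
    exact: (le_trans (cabs_interp_coeff Hb Ll') (bB l')).
  exact: (le_trans (cabs_interp_coeff Hb L0) (bB 0)).
by rewrite lef_pV2 ?posrE ?cabs_gt0//; exact: Lambda_ge.
Qed.

End CauchySums.

(** * Fock membership and l^p conditions for finite p *)

Section Assembly.
Variable R : realType.
Local Notation C := (R[i]^o).
Local Notation L := (@Lambda R).
Local Notation st := (@st R).
Local Notation sigma := (@sigma R).

Lemma esum_lty_psum (S : set C) (g : C -> R) : (forall l, S l -> 0 <= g l) ->
  (\esum_(l in S) (g l)%:E < +oo)%E <-> exists M, forall F, psum S g F <= M.
Proof.
move=> g0; split=> [H|[M HM]].
  have fin : (\esum_(l in S) (g l)%:E)%E \is a fin_num.
    by rewrite ge0_fin_numE//; apply: esum_ge0 => l Sl; rewrite lee_fin g0.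
  by exists (fine (\esum_(l in S) (g l)%:E)%E); apply/esum_le_psum => //; rewrite fineK.
by apply: le_lt_trans (ltry M); apply/esum_le_psum.
Qed.

Lemma ereal_sup_lty (D : set C) (g : C -> R) :
  (ereal_sup [set (g x)%:E | x in D] < +oo)%E <-> exists B, forall x, D x -> g x <= B.
Proof.
split=> [H|[B HB]]; last first.
  by apply: le_lt_trans (ltry B); apply: ge_ereal_sup => _ [x Dx <-]; rewrite lee_fin HB.
have U x : D x -> ((g x)%:E <= ereal_sup [set (g x)%:E | x in D])%E.
  by move=> Dx; apply: ereal_sup_ubound; exists x.
move: U H; case: (ereal_sup _) => [B|//|] U _.
  by exists B => x /U; rewrite lee_fin.
by exists 0 => x /U.
Qed.

Lemma le_psum_sub (S S' : set C) (g : C -> R) F : S `<=` S' ->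
  (forall l, S' l -> 0 <= g l) -> psum S g F <= psum S' g F.
Proof.
move=> SS g0; rewrite /psum big_mkcond [leRHS]big_mkcond; apply: ler_sum => l _.
case: ifPn => lS; first by rewrite mem_set//; apply: SS; exact/set_mem.
by case: ifPn => // /set_mem /g0.
Qed.

Lemma LambdaD_sub (l' : C) : LambdaD l' `<=` L.
Proof. by move=> l []. Qed.

Lemma csum_LambdaD (g : C -> C) (l' : C) r : g l' = 0 ->
  csum (LambdaD l') g (disc r) = dsum g r.
Proof.
move=> g0; apply: csum_disc; first exact: LambdaD_sub.
move=> l Ll nl; have [->//|ll'] := eqVneq l l'.
by case: nl; split => //= E; rewrite E eqxx in ll'.
Qed.

Lemma pvsum_eq (g : C -> C) (l' X : C) : g l' = 0 -> dsum g @ +oo --> X ->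
  pv_cvg (LambdaD l') g /\ pvsum (LambdaD l') g = X.
Proof.
move=> g0 H; have E : pv_partial (LambdaD l') g = dsum g.
  apply/funext => r; by rewrite (pv_partialE _ _ (@LambdaD_sub l')) csum_LambdaD.
split; first by rewrite /pv_cvg E; apply/cvg_ex; exists X.
by rewrite /pvsum E; exact: (cvg_lim (@norm_hausdorff _ _) H).
Qed.

Lemma pv_cvg_dsum (g : C -> C) (l' : C) : g l' = 0 -> pv_cvg (LambdaD l') g ->
  dsum g @ +oo --> pvsum (LambdaD l') g.
Proof.
move=> g0; have E : pv_partial (LambdaD l') g = dsum g.
  apply/funext => r; by rewrite (pv_partialE _ _ (@LambdaD_sub l')) csum_LambdaD.
by rewrite /pv_cvg /pvsum E.
Qed.

Lemma usum_eq (S : set C) (g : C -> C) (X : C) : csum S g @ summability.totally --> X ->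
  usum_cvg S g /\ usum S g = X.
Proof.
move=> H; split; first by apply/cvg_ex; exists X.
exact: (cvg_lim (@norm_hausdorff _ _) H).
Qed.

Lemma usum_dsum (g : C -> C) (l' : C) : g l' = 0 -> usum_cvg (LambdaD l') g ->
  dsum g @ +oo --> usum (LambdaD l') g.
Proof.
move=> g0 H; have := csum_dsum_cvg (@LambdaD_sub l') (H : csum _ g @ summability.totally --> _).
have -> : (fun r => csum (LambdaD l') g (disc r)) = dsum g; last by [].
by apply/funext => r; exact: csum_LambdaD.
Qed.

Variable c : C -> C.
Let a (l : C) : C := c l / derive1 sigma l.

Let term1 (l l' : C) : c l / (derive1 sigma l * (l - l')) = a l / (l - l').
Proof. by rewrite invfM mulrA. Qed.

Let term2 (l l' : C) : c l / (derive1 sigma l * (l - l') ^+ 2) = a l / (l - l') ^+ 2.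
Proof. by rewrite invfM mulrA. Qed.

Lemma cabs_coeff l : L l -> cabs (c l / derive1 sigma l) = FF c l.
Proof. by move=> Ll; rewrite cabsM cabsV cabs_dsigma// /FF expRN. Qed.

(** With no renormalisation ([gam] zero), [interpolation] bounds f on cells by the kernel
    convolution of |a| + |Lm|, which [kern_convolution] keeps in l^p. *)
Lemma fock_sufficient (p : R) (Lm : C -> C) : 1 <= p ->
  (exists M, forall F, psum L (fun l => FF c l `^ p) F <= M) ->
  (forall l', L l' -> dsum (fun l => a l / (l - l')) @ +oo --> Lm l') ->
  (exists M, forall F, psum L (fun l => cabs (Lm l) `^ p) F <= M) ->
  exists f, fock p f /\ forall l, L l -> f l = c l.
Proof.
move=> p1 [M1 HM1] HL [M2 HM2]; have p0 : 0 < p by exact: lt_le_trans p1.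
have Ha1 F : psum L (fun l => cabs (a l) `^ p) F <= M1.
  apply: le_trans (HM1 F); apply: le_psum => l Ll; by rewrite cabs_coeff.
have le1p x : 0 <= x -> x <= 1 + x `^ p.
  move=> x0; have := le_powR_split (ltr01 : 0 < 1 :> R) x0 p1.
  by rewrite powR1 invr1 !mul1r.
have aMb l : L l -> cabs (a l) <= 1 + M1.
  move=> Ll; apply: (le_trans (le1p _ (cabs_ge0 _))); rewrite lerD2l.
  by have := Ha1 [fset l]%fset; rewrite /psum big_mkcond big_seq_fset1 mem_set.
have Lm_cvg l' : L l' -> (fun r => dsum (fun l => a l / (l - l')) r - (fun=> 0 : C) r) @ +oo --> Lm l'.
  move=> Ll'; have -> : (fun r => dsum (fun l => a l / (l - l')) r - (fun=> 0 : C) r) = dsum (fun l => a l / (l - l')).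
    by apply/funext => r; rewrite subr0.
  exact: HL.
pose x l := cabs (a l) + cabs (Lm l).
have x0 l : 0 <= x l by rewrite addr_ge0 ?cabs_ge0.
have Hx F : psum L (fun l => x l `^ p) F <= 2 `^ p * (M1 + M2).
  apply: (@le_trans _ _ (psum L (fun l => 2 `^ p * (cabs (a l) `^ p + cabs (Lm l) `^ p)) F)).
    apply: le_psum => l _; rewrite /x.
    have P0 u : 0 <= u `^ p by exact: powR_ge0.
    have mono u v : 0 <= u -> u <= v -> u `^ p <= v `^ p.
      by move=> u0 uv; apply: ge0_ler_powR; rewrite ?nnegrE ?(ltW p0)// (le_trans u0).
    have S u v : 0 <= u -> 0 <= v -> u <= v -> (u + v) `^ p <= 2 `^ p * v `^ p.
      by move=> u0 v0 uv; rewrite -powRM//; apply: mono; [rewrite addr_ge0 | lra].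
    have [h|/ltW h] := leP (cabs (a l)) (cabs (Lm l)).
      apply: (le_trans (S _ _ (cabs_ge0 _) (cabs_ge0 _) h)).
      by rewrite ler_wpM2l ?powR_ge0// lerDr.
    rewrite addrC; apply: (le_trans (S _ _ (cabs_ge0 _) (cabs_ge0 _) h)).
    by rewrite ler_wpM2l ?powR_ge0// lerDl.
  by rewrite psumZ psumD ler_wpM2l ?powR_ge0// lerD.
have [V [V0 HV [M' HM']]] := kern_convolution p1 x0 Hx.
have [f [ef fi fb]] := interpolation aMb Lm_cvg.
pose K := expR 3 * (1 + KG R).
have K0 : 0 <= K by rewrite mulr_ge0 ?expR_ge0// addr_ge0// KG_ge0.
exists f; split; last by move=> l Ll; rewrite fi// mulrC divfK// dsigma_neq0.
apply: (@fock_of_bound _ _ _ (fun l => K * V l) (K `^ p * M')) => //.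
  by move=> l w Ll hw; apply: fb => //; exact: HV.
move=> F; apply: (@le_trans _ _ (psum L (fun l => K `^ p * V l `^ p) F)).
  by apply: le_psum => l _; rewrite powRM.
by rewrite psumZ ler_wpM2l ?powR_ge0.
Qed.

Lemma fock_necessary (p : R) (f : C -> C) : 1 <= p -> fock p f -> (forall l, L l -> f l = c l) ->
  exists (b : C -> R) (Lm : C -> C),
  [/\ forall l, 0 <= b l,
      exists M, forall F, psum L (fun l => b l `^ p) F <= M,
      forall l, L l -> cabs (a l) <= b l,
      forall l', L l' -> dsum (fun l => a l / (l - l')) @ +oo --> Lm l' &
      forall l', L l' -> cabs (Lm l') <= KC R * b l'].
Proof.
move=> p1 fp fc; have p0 : 0 < p by exact: lt_le_trans p1.
have ef : entire f by case: fp.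
have s0 := @st_gt0 R.
have [b [b0 Hb [M HM]]] := fock_bound p1 fp.
have afa l : L l -> f l / derive1 sigma l = a l by move=> Ll; rewrite /a fc.
(* The rim has at most 5 r / st outer points, so splitting [b] at the level A = e st / 5 costs e r;
   the p-th powers add a constant. *)
have sub (e : R) : 0 < e -> exists K, forall r d, d \in dirs R -> st <= r ->
     \sum_(l <- outer r d) b l <= e * r + K.
  move=> e0; pose A := e * st / 5; have A0 : 0 < A by rewrite divr_gt0// mulr_gt0.
  exists (A * (A `^ p)^-1 * M) => r d dd sr; have r0 : 0 < r by exact: lt_le_trans sr.
  apply: (@le_trans _ _ (\sum_(l <- outer r d) (A + A * (A `^ p)^-1 * b l `^ p))).
    by apply: ler_sum => l _; exact: le_powR_split.
  rewrite big_split /=; apply: lerD.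
    rewrite big_const_seq count_predT iter_addr_0 -[A *+ _]mulr_natr.
    have sz : (size (outer r d))%:R <= 5 * (r / st).
      apply: (@le_trans _ _ ((2 * (Num.truncn (r / st)).+1).+1)%:R).
        by rewrite ler_nat; exact: size_outer.
      have rs : 1 <= r / st by rewrite ler_pdivlMr// mul1r.
      have tr : (Num.truncn (r / st))%:R <= r / st.
        have q0 : 0 <= r / st by rewrite divr_ge0 ?ltW.
        by have /andP[] := truncn_itv q0.
      by rewrite -addn1 natrD natrM -addn1 natrD; lra.
    apply: (@le_trans _ _ (A * (5 * (r / st)))); first by rewrite ler_wpM2l// ltW.
    by rewrite le_eqVlt; apply/orP; left; apply/eqP; rewrite /A; field; rewrite gt_eqF.
  rewrite -mulr_sumr; apply: ler_wpM2l.
    by rewrite mulr_ge0 ?(ltW A0)// invr_ge0 powR_ge0.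
  apply: le_trans (HM (disc r)); rewrite /psum /outer big_filter.
  rewrite big_seq_cond [leRHS]big_seq_cond big_mkcond [leRHS]big_mkcond; apply: ler_sum => l _.
  case: (boolP (l \in disc r)) => //= lr; have -> : l \in L by move: lr; rewrite in_disc => /andP[].
  by case: ifP => // _; exact: powR_ge0.
have H l' : exists X, L l' -> (dsum (fun l => a l / (l - l')) @ +oo --> X) /\ cabs X <= KC R * b l'.
  have [Ll'|nL] := pselect (L l'); last by exists 0.
  have [X HX XV] := pv_cauchy ef b0 Hb Ll' sub; exists X => _; split => //.
  suff <- : (fun r => dsum (fun l => f l / derive1 sigma l / (l - l')) r)
    = dsum (fun l => a l / (l - l')) by [].
  by apply/funext => r; apply: eq_dsum => l Ll; rewrite afa.
have [Lm HLm] := choice H.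
exists b, Lm; split => //; first by exists M.
- by move=> l Ll; rewrite -afa//; exact: cabs_interp_coeff.
- by move=> l' /HLm[].
- by move=> l' /HLm[].
Qed.

End Assembly.

(** * The three ranges of p *)

Section Main.
Variable R : realType.
Local Notation C := (R[i]^o).
Local Notation L := (@Lambda R).
Local Notation st := (@st R).
Local Notation sigma := (@sigma R).
Variable c : C -> C.
Let a (l : C) : C := c l / derive1 sigma l.

Let g1 (l' l : C) : C := c l / (derive1 sigma l * (l - l')).
Let g2 (l' l : C) : C := c l / (derive1 sigma l * (l - l') ^+ 2).

Let g1E l' : g1 l' = (fun l => a l / (l - l')).
Proof. by apply/funext => l; rewrite /g1 invfM mulrA. Qed.

Let g2E l' : g2 l' = (fun l => a l / (l - l') ^+ 2).
Proof. by apply/funext => l; rewrite /g2 invfM mulrA. Qed.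

Let g1_diag l' : g1 l' l' = 0.
Proof. by rewrite /g1 subrr mulr0 invr0 mulr0. Qed.

Let g2_diag l' : g2 l' l' = 0.
Proof. by rewrite /g2 subrr expr0n mulr0 invr0 mulr0. Qed.

Let weightE (p : R) l : 0 < p ->
  cabs (c l) `^ p * expR (- (p * cabs l ^+ 2)) = FF c l `^ p.
Proof. by move=> p0; rewrite powR_FF. Qed.

Let KC_ge0 : 0 <= KC R.
Proof. by rewrite mulr_ge0// Kphi_ge0. Qed.

Lemma interpolation_p (p : R) : 1 < p ->
  ((exists f, fock p f /\ forall l, L l -> f l = c l)
    <->
    (\esum_(l in L) (cabs (c l) `^ p * expR (- (p * cabs l ^+ 2)))%:E < +oo)%E
    /\ ((forall l', L l' -> pv_cvg (LambdaD l') (g1 l'))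
     /\ (\esum_(l' in L) (cabs (pvsum (LambdaD l') (g1 l')) `^ p)%:E < +oo)%E)).
Proof.
move=> p1; have p0 : 0 < p by exact: lt_trans p1.
have -> : (\esum_(l in L) (cabs (c l) `^ p * expR (- (p * cabs l ^+ 2)))%:E
  = \esum_(l in L) (FF c l `^ p)%:E)%E by apply: eq_esum => l _; rewrite weightE.
split=> [[f [fp fc]]|[C1 [C2 C3]]].
  have [b [Lm [b0 [M HM] ab HL HLb]]] := fock_necessary (ltW p1) fp fc.
  have pv l' : L l' -> pv_cvg (LambdaD l') (g1 l') /\ pvsum (LambdaD l') (g1 l') = Lm l'.
    by move=> Ll'; apply: pvsum_eq; [exact: g1_diag | rewrite g1E; exact: HL].
  have mono u v : 0 <= u -> u <= v -> u `^ p <= v `^ p.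
    by move=> u0 uv; apply: ge0_ler_powR; rewrite ?nnegrE ?(ltW p0)// (le_trans u0).
  split; last split.
  - apply/esum_lty_psum => [l _|]; first exact: powR_ge0.
    exists M => F; apply: le_trans (HM F); apply: le_psum => l Ll.
    by rewrite -cabs_coeff//; apply: mono; rewrite ?cabs_ge0// ab.
  - by move=> l' /pv[].
  apply/esum_lty_psum => [l _|]; first exact: powR_ge0.
  exists (KC R `^ p * M) => F.
  apply: (@le_trans _ _ (psum L (fun l => KC R `^ p * b l `^ p) F)).
    apply: le_psum => l Ll; rewrite -powRM//; apply: mono; rewrite ?cabs_ge0//.
    by rewrite (pv l Ll).2 HLb.
  by rewrite psumZ ler_wpM2l ?powR_ge0.
apply: (@fock_sufficient R c p (fun l' => pvsum (LambdaD l') (g1 l')) (ltW p1)).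
- by apply/esum_lty_psum => // l _; exact: powR_ge0.
- move=> l' Ll'; have := pv_cvg_dsum (g1_diag l') (C2 l' Ll').
  by rewrite g1E.
by apply/esum_lty_psum => // l _; exact: powR_ge0.
Qed.

(** For a Fock function [a] is summable, and nonzero lattice differences have modulus at least [st].
    The unordered sums therefore converge absolutely and agree with the principal values. The
    Beurling sums are bounded by the kernel convolution through [beurling_cvg]. *)
Lemma interpolation_1 :
  ((exists f, fock 1 f /\ forall l, L l -> f l = c l)
   <->
   [/\ (\esum_(l in L) (cabs (c l) * expR (- cabs l ^+ 2))%:E < +oo)%E,
       (forall l', L l' -> usum_cvg (LambdaD l') (g1 l'))
       /\ (\esum_(l' in L) (cabs (usum (LambdaD l') (g1 l')))%:E < +oo)%E
     & (forall l', L l' -> usum_cvg (LambdaD l') (g2 l'))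
       /\ (\esum_(l' in L) (cabs (usum (LambdaD l') (g2 l')))%:E < +oo)%E]).
Proof.
have s0 := @st_gt0 R.
split=> [[f [fp fc]]|[C1 [C2 C3] _]]; last first.
  apply: (@fock_sufficient R c 1 (fun l' => usum (LambdaD l') (g1 l')) (lexx _)).
  - apply/esum_lty_psum => [l _|]; first exact: powR_ge0.
    by under eq_esum do rewrite (powRr1 (FF_ge0 _ _)).
  - move=> l' Ll'; have := usum_dsum (g1_diag l') (C2 l' Ll').
    by rewrite g1E.
  apply/esum_lty_psum => [l _|]; first exact: powR_ge0.
  by under eq_esum do rewrite (powRr1 (cabs_ge0 _)).
have [b [Lm [b0 [M HM'] ab HL HLb]]] := fock_necessary (lexx _) fp fc.
have HM F : psum L b F <= M.
  by apply: le_trans (HM' F); apply: le_psum => l _; rewrite powRr1.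
have sum_le (k : C -> C) (K : R) l' : 0 <= K -> (forall l, L l -> cabs (k l) <= K) ->
    forall F, psum (LambdaD l') (fun l => cabs (a l * k l)) F <= K * M.
  move=> K0 Hk F; apply: (@le_trans _ _ (psum L (fun l => K * b l) F)); last first.
    by rewrite psumZ ler_wpM2l.
  apply: (@le_trans _ _ (psum L (fun l => cabs (a l * k l)) F)).
    by apply: le_psum_sub => [|l _]; [exact: LambdaD_sub | exact: cabs_ge0].
  apply: le_psum => l Ll; rewrite cabsM mulrC.
  by apply: ler_pM; rewrite ?cabs_ge0 ?Hk ?ab.
have inv_le l' l : L l' -> L l -> cabs (l - l')^-1 <= st^-1.
  move=> Ll' Ll; have [->|ll'] := eqVneq l l'.
    by rewrite subrr invr0 cabs0 invr_ge0 ltW.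
  have d0 : l - l' != 0 by rewrite subr_eq0.
  by rewrite cabsV lef_pV2 ?posrE ?cabs_gt0//; apply: Lambda_ge => //; exact: Lambda_sub.
have sV : 0 <= st^-1 by rewrite invr_ge0 ltW.
have U1 l' : L l' -> usum_cvg (LambdaD l') (g1 l') /\ usum (LambdaD l') (g1 l') = Lm l'.
  move=> Ll'; have [X HX _] := csum_cvg (sum_le (fun l => (l - l')^-1) _ l' sV (fun l => @inv_le l' l Ll')).
  have XE : X = Lm l'.
    have H := csum_dsum_cvg (@LambdaD_sub R l') HX.
    apply: (cvgC_unique H).
    suff -> : (fun r => csum (LambdaD l') (fun l => a l * (l - l')^-1) (disc r))
      = dsum (fun l => a l / (l - l')) by exact: HL.
    by apply/funext => r; apply: csum_LambdaD; rewrite subrr invr0 mulr0.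
  rewrite -XE; apply: usum_eq; rewrite g1E; exact: HX.
have U2 l' : L l' -> exists B, [/\ usum_cvg (LambdaD l') (g2 l'), usum (LambdaD l') (g2 l') = B &
    (fun r => dsum (fun l => a l / (l - l') ^+ 2) r) @ +oo --> B].
  move=> Ll'; have sq l : L l -> cabs ((l - l') ^+ 2)^-1 <= (st^-1) ^+ 2.
    by move=> Ll; rewrite -exprVn cabsX lerXn2r ?nnegrE ?cabs_ge0 ?inv_le.
  have [X HX _] := csum_cvg (sum_le (fun l => ((l - l') ^+ 2)^-1) _ l' (sqr_ge0 _) sq).
  have H := csum_dsum_cvg (@LambdaD_sub R l') HX.
  exists X; have [H1 H2] := usum_eq (HX : csum _ (fun l => a l / (l - l') ^+ 2) @ _ --> _).
  split; [by rewrite g2E|by rewrite g2E|].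
  suff <- : (fun r => csum (LambdaD l') (fun l => a l * ((l - l') ^+ 2)^-1) (disc r))
      = dsum (fun l => a l / (l - l') ^+ 2) by [].
  by apply/funext => r; apply: csum_LambdaD; rewrite subrr expr0n invr0 mulr0.
have KCb : 0 <= KC R by [].
have aMb l : L l -> cabs (a l) <= M.
  move=> Ll; apply: (le_trans (ab l Ll)).
  by have := HM [fset l]%fset; rewrite /psum big_mkcond big_seq_fset1 mem_set.
have Lm_cvg l' : L l' -> (fun r => dsum (fun l => a l / (l - l')) r - (fun=> 0 : C) r) @ +oo --> Lm l'.
  move=> Ll'; have -> : (fun r => dsum (fun l => a l / (l - l')) r - (fun=> 0 : C) r) = dsum (fun l => a l / (l - l')).
    by apply/funext => r; rewrite subr0.
  exact: HL.
pose x l := b l + KC R * b l.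
have x0 l : 0 <= x l by rewrite addr_ge0// mulr_ge0.
have Hx F : psum L (fun l => x l `^ 1) F <= M + KC R * M.
  apply: (@le_trans _ _ (psum L (fun l => b l + KC R * b l) F)).
    by apply: le_psum => l _; rewrite powRr1.
  by rewrite psumD psumZ; apply: lerD => //; rewrite ler_wpM2l.
have [V [V0 HV [M' HM1]]] := kern_convolution (lexx 1) x0 Hx.
have maj l' : L l' -> majorizes a Lm l' (V l').
  move=> Ll' F; apply: le_trans (HV l' Ll' F); apply: le_psum => l Ll.
  by rewrite ler_wpM2l ?kern_ge0// lerD// ?ab// HLb.
split.
- apply/esum_lty_psum => [l _|]; first by rewrite mulr_ge0 ?cabs_ge0 ?expR_ge0.
  exists M => F; apply: le_trans (HM F); apply: le_psum => l Ll.
  by rewrite -/(FF c l) -cabs_coeff// ab.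
- split; first by move=> l' /U1[].
  apply/esum_lty_psum => [l _|]; first exact: cabs_ge0.
  exists (KC R * M) => F; apply: (@le_trans _ _ (psum L (fun l => KC R * b l) F)).
    by apply: le_psum => l Ll; rewrite (U1 l Ll).2 HLb.
  by rewrite psumZ ler_wpM2l.
- split; first by move=> l' /U2[B []].
  apply/esum_lty_psum => [l _|]; first exact: cabs_ge0.
  exists (KB R * M') => F; apply: (@le_trans _ _ (psum L (fun l => KB R * V l `^ 1) F)).
    apply: le_psum => l Ll; have [B [_ -> HB]] := U2 l Ll.
    have [B' HB' BV] := beurling_cvg aMb Lm_cvg Ll.
    by rewrite (cvgC_unique HB HB') powRr1// BV//; exact: maj.
  by rewrite psumZ ler_wpM2l ?KB_ge0.
Qed.

Let gd (l' l : C) : C := c l / derive1 sigma l * ((l - l')^-1 - l^-1).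

Let pv_gd l' r : pv_partial (LambdaD l' `\ 0) (gd l') r
  = dsum (fun l => if l \in [:: l'; 0] then 0 else a l * ((l - l')^-1 - l^-1)) r.
Proof.
have SL : LambdaD l' `\ 0 `<=` L by move=> l [] /LambdaD_sub.
rewrite (pv_partialE _ _ SL) /csum /dsum big_mkcond; apply: eq_big_seq => l.
rewrite in_disc => /andP[/set_mem Ll _]; rewrite !inE.
have [->|ll'] := eqVneq l l'.
  by rewrite ifF//; apply/negP => /set_mem[[_ /=]].
have [->|l0] := eqVneq l 0; first by rewrite ifF//; apply/negP => /set_mem[_ /=].
by rewrite ifT//; apply/mem_set; split; [split => //; exact/eqP | exact/eqP].
Qed.

Let pv_gd_near l' : L l' -> l' != 0 -> {near +oo%R,
  (fun r => dsum (fun l => a l / (l - l')) r - dsum (fun l => a l / l) r)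
  =1 (fun r => pv_partial (LambdaD l' `\ 0) (gd l') r - (a l' + a 0) / l')}.
Proof.
move=> Ll' l'0; exists (cabs l'); split; first exact: num_real.
by move=> r lr; rewrite /= pv_gd dsum_kernel_diff.
Qed.

Let head0 l' : c 0 / (derive1 sigma 0 * l') = a 0 / l'.
Proof. by rewrite invfM mulrA. Qed.

(** Here [gam r] is the truncated sum of a_l / l. The expression in the second condition differs
    from the renormalised Hilbert transform by a l' / l' in the sense of [a] at l' divided by l',
    which is bounded; convolving a constant with [kern] gives a constant. *)
Lemma interpolation_infty :
  ((exists f, fock_infty f /\ forall l, L l -> f l = c l)
   <->
   [/\ (ereal_sup [set (cabs (c l) * expR (- cabs l ^+ 2))%:E | l in L] < +oo)%E,
       (forall l', @LambdaD R 0 l' -> pv_cvg (LambdaD l' `\ 0%R) (gd l'))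
       /\ (ereal_sup
             [set (cabs (- (c 0 / (derive1 sigma 0 * l')) + pvsum (LambdaD l' `\ 0%R) (gd l')))%:E
             | l' in @LambdaD R 0%R] < +oo)%E
     & (forall l', L l' -> pv_cvg (LambdaD l') (g2 l'))
       /\ (ereal_sup [set (cabs (pvsum (LambdaD l') (g2 l')))%:E | l' in L] < +oo)%E]).
Proof.
have s0 := @st_gt0 R; have L0 := @Lambda0 R.
pose gam r : C := dsum (fun l => a l / l) r.
have D0 l' : @LambdaD R 0 l' -> L l' /\ l' != 0 by move=> [Ll' /= /eqP].
split=> [[f [[ef fB] fc]]|[C1 [C2 C3] _]].
  have [B' HB'] := (ereal_sup_lty setT (FF f)).1 fB.
  have HB z : FF f z <= B' by exact: HB'.
  have B0 : 0 <= B' by apply: le_trans (HB 0); exact: FF_ge0.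
  pose b (l : C) := B'.
  have b0 l : 0 <= b l by [].
  have Hb l w : L l -> `|complex.Re w| <= st / 2 -> `|complex.Im w| <= st / 2 ->
    FF f (l + w) <= b l by move=> _ _ _; exact: HB.
  have [K HK] := pv_cauchy_diff ef b0 Hb (fun l => lexx _).
  have afa l : L l -> f l / derive1 sigma l = a l by move=> Ll; rewrite /a fc.
  have H l' : exists X, L l' ->
      (fun r => dsum (fun l => a l / (l - l')) r - gam r) @ +oo --> X /\ cabs X <= K.
    have [Ll'|nL] := pselect (L l'); last by exists 0.
    have [X HX XV] := HK l' Ll'; exists X => _; split => //.
    suff <- : (fun r => dsum (fun l => f l / derive1 sigma l / (l - l')) r
        - dsum (fun l => f l / derive1 sigma l / l) r)
      = (fun r => dsum (fun l => a l / (l - l')) r - gam r) by [].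
    by apply/funext => r; congr (_ - _); apply: eq_dsum => l Ll; rewrite afa.
  have [Lm HLm] := choice H.
  have aB l : L l -> cabs (a l) <= B'.
    by move=> Ll; rewrite -afa//; exact: (cabs_interp_coeff Hb).
  have pv l' : L l' -> l' != 0 ->
      pv_partial (LambdaD l' `\ 0) (gd l') @ +oo --> Lm l' + (a l' + a 0) / l'.
    move=> Ll' l'0; have [HX _] := HLm l' Ll'.
    have D : (fun r => dsum (fun l => a l / (l - l')) r - dsum (fun l => a l / l) r
        + (a l' + a 0) / l') @ +oo --> Lm l' + (a l' + a 0) / l'.
      by exact: (cvgCD HX (cvg_cst _)).
    apply: cvg_trans D; apply: near_eq_cvg.
    have := pv_gd_near Ll' l'0; apply: filterS => r /= E.
    by rewrite E subrK.
  have psq l' : L l' -> exists X, [/\ pv_cvg (LambdaD l') (g2 l'),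
      pvsum (LambdaD l') (g2 l') = X & cabs X <= KB R * ((B' + K) * @Kk R)].
    move=> Ll'; have [X HX XV] := beurling_cvg aB (fun l Ll => (HLm l Ll).1) Ll'.
    exists X; have [||H1 H2] := @pvsum_eq R (g2 l') l' X; first exact: g2_diag.
      by rewrite g2E.
    split => //; apply: XV => F.
    have BK : 0 <= B' + K.
      by rewrite addr_ge0//; apply: le_trans (cabs_ge0 _) (HLm 0 L0).2.
    apply: (@le_trans _ _ (psum L (fun l => (B' + K) * kern (l - l')) F)).
      apply: le_psum => l Ll; rewrite mulrC ler_wpM2r ?kern_ge0//.
      by apply: lerD; [exact: aB | exact: (HLm l Ll).2].
    by rewrite psumZ ler_wpM2l// psum_kern_shift.
  split.
  - apply/ereal_sup_lty; exists B' => l Ll; rewrite -(fc l Ll); exact: HB.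
  - split.
      move=> l' /D0[Ll' l'0]; apply/cvg_ex; exists (Lm l' + (a l' + a 0) / l'); exact: pv.
    apply/ereal_sup_lty; exists (K + B' / st) => l' /D0[Ll' l'0].
    have -> : pvsum (LambdaD l' `\ 0) (gd l') = Lm l' + (a l' + a 0) / l'.
      exact: (cvg_lim (@norm_hausdorff _ _) (pv l' Ll' l'0)).
    rewrite head0.
    have T (x y X : C) : - (y / l') + (X + (x + y) / l') = X + x / l' by ring.
    rewrite T.
    apply: (le_trans (cabsD _ _)); apply: lerD; first exact: (HLm l' Ll').2.
    rewrite cabsM cabsV; apply: ler_pM; rewrite ?invr_ge0 ?cabs_ge0 ?aB//.
    by rewrite lef_pV2 ?posrE ?cabs_gt0//; exact: Lambda_ge.
  - split; first by move=> l' /psq[X []].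
    apply/ereal_sup_lty; exists (KB R * ((B' + K) * @Kk R)) => l' Ll'.
    by have [X [_ -> XV]] := psq l' Ll'.
have [B HB] := (ereal_sup_lty L (FF c)).1 C1.
have [K HK] := (ereal_sup_lty _ _).1 C3.
have aB l : L l -> cabs (a l) <= B by move=> Ll; rewrite cabs_coeff// HB.
(* At the origin the renormalised sum vanishes identically. Elsewhere the last term restores the
   contribution of -1/l at l = l', which the principal value omits. *)
pose Lm l' : C := if l' == 0 then 0
  else - (c 0 / (derive1 sigma 0 * l')) + pvsum (LambdaD l' `\ 0) (gd l') - a l' / l'.
have Lm_cvg l' : L l' -> (fun r => dsum (fun l => a l / (l - l')) r - gam r) @ +oo --> Lm l'.
  move=> Ll'; rewrite /Lm; have [->|l'0] := eqVneq l' 0.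
    have -> : (fun r => dsum (fun l => a l / (l - 0)) r - gam r) = (fun=> 0).
      apply/funext => r; apply/eqP; rewrite subr_eq0; apply/eqP/eq_dsum => l _.
      by rewrite subr0.
    exact: cvg_cst.
  have HP : pv_partial (LambdaD l' `\ 0) (gd l') @ +oo --> pvsum (LambdaD l' `\ 0) (gd l').
    by apply: C2; split => //=; exact/eqP.
  rewrite head0.
  have T (x y X : C) : - (y / l') + X - x / l' = X - (x + y) / l' by ring.
  rewrite T.
  have D : (fun r => pv_partial (LambdaD l' `\ 0) (gd l') r - (a l' + a 0) / l') @ +oo
      --> pvsum (LambdaD l' `\ 0) (gd l') - (a l' + a 0) / l'.
    by exact: (cvgCB HP (cvg_cst _)).
  apply: cvg_trans D; apply: near_eq_cvg.
  by have := pv_gd_near Ll' l'0; apply: filterS => r /= ->.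
have B0 : 0 <= B by apply: le_trans (aB 0 L0); exact: cabs_ge0.
pose K' := `|K| + B / st.
have K'0 : 0 <= K' by rewrite addr_ge0// divr_ge0// ltW.
have LmK l' : L l' -> cabs (Lm l') <= K'.
  move=> Ll'; rewrite /Lm; have [_|l'0] := eqVneq l' 0; first by rewrite cabs0.
  apply: (le_trans (cabsB _ _)); apply: lerD.
    apply: le_trans (ler_norm K); apply: HK; split => //=; exact/eqP.
  rewrite cabsM cabsV; apply: ler_pM; rewrite ?invr_ge0 ?cabs_ge0 ?aB//.
  by rewrite lef_pV2 ?posrE ?cabs_gt0//; exact: Lambda_ge.
have [f [ef fi fb]] := interpolation aB Lm_cvg.
exists f; split; last by move=> l Ll; rewrite fi// mulrC divfK// dsigma_neq0.
split => //; apply/(ereal_sup_lty setT (FF f)).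
exists (expR 3 * (1 + KG R) * ((B + K') * @Kk R)) => z _.
have [l Ll [h1 h2 h3 h4]] := nearest_lambda z.
rewrite -[z](subrK l) addrC; apply: fb => //.
  by apply: cell_sqr => //; exact: ltW.
move=> F; apply: (@le_trans _ _ (psum L (fun l' => (B + K') * kern (l' - l)) F)).
  apply: le_psum => l' Ll'; rewrite mulrC ler_wpM2r ?kern_ge0//.
  by apply: lerD; [exact: aB | exact: LmK].
by rewrite psumZ ler_wpM2l ?psum_kern_shift// addr_ge0.
Qed.

End Main.

Unset Implicit Arguments.

Theorem theorem2 (R : realType) (c : Cplx R -> Cplx R) :
  ((exists f : Cplx R -> Cplx R,
      fock 1 f /\ forall l, Lambda l -> f l = c l)
   <->
   [/\ (\esum_(l in @Lambda R) (cabs (c l) * expR (- cabs l ^+ 2))%:E < +oo)%E,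
       (forall l', Lambda l' ->
          usum_cvg (LambdaD l')
            (fun l => c l / (derive1 (@sigma R) l * (l - l'))))
       /\ (\esum_(l' in @Lambda R)
             (cabs (usum (LambdaD l')
               (fun l => c l / (derive1 (@sigma R) l * (l - l')))))%:E < +oo)%E
     & (forall l', Lambda l' ->
          usum_cvg (LambdaD l')
            (fun l => c l / (derive1 (@sigma R) l * (l - l') ^+ 2)))
       /\ (\esum_(l' in @Lambda R)
             (cabs (usum (LambdaD l')
               (fun l => c l / (derive1 (@sigma R) l * (l - l') ^+ 2))))%:E
           < +oo)%E])
  /\
  (forall p : R, 1 < p ->
   ((exists f : Cplx R -> Cplx R,
       fock p f /\ forall l, Lambda l -> f l = c l)
    <->
    (\esum_(l in @Lambda R)
       (cabs (c l) `^ p * expR (- (p * cabs l ^+ 2)))%:E < +oo)%E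
    /\
    ((forall l', Lambda l' ->
        pv_cvg (LambdaD l')
          (fun l => c l / (derive1 (@sigma R) l * (l - l'))))
     /\ (\esum_(l' in @Lambda R)
           (cabs (pvsum (LambdaD l')
             (fun l => c l / (derive1 (@sigma R) l * (l - l')))) `^ p)%:E
         < +oo)%E)))
  /\
  ((exists f : Cplx R -> Cplx R,
      fock_infty f /\ forall l, Lambda l -> f l = c l)
   <->
   [/\ (ereal_sup [set (cabs (c l) * expR (- cabs l ^+ 2))%:E | l in @Lambda R]
          < +oo)%E,
       (forall l', @LambdaD R 0 l' ->
          pv_cvg (LambdaD l' `\ 0%R)
            (fun l => c l / derive1 (@sigma R) l * ((l - l')^-1 - l^-1)))
       /\ (ereal_sup
             [set (cabs (- (c 0 / (derive1 (@sigma R) 0 * l'))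
                    + pvsum (LambdaD l' `\ 0%R)
                        (fun l => c l / derive1 (@sigma R) l
                                    * ((l - l')^-1 - l^-1))))%:E
             | l' in @LambdaD R 0%R] < +oo)%E
     & (forall l', Lambda l' ->
          pv_cvg (LambdaD l')
            (fun l => c l / (derive1 (@sigma R) l * (l - l') ^+ 2)))
       /\ (ereal_sup
             [set (cabs (pvsum (LambdaD l')
                 (fun l => c l / (derive1 (@sigma R) l * (l - l') ^+ 2))))%:E
             | l' in @Lambda R] < +oo)%E]).
Proof.
split; first exact: interpolation_1.
split; last exact: interpolation_infty.
exact: interpolation_p.
Qed.
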